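(* The RelBuechi problem (defined in the context) is strongly NP-complete.
   Context: A Markov decision process (MDP) is a triple $\mathcal{M}=(S,\mathit{Act},\mathbf{P})$ with $S$ a non-empty finite set of states, $\mathit{Act}$ a non-empty finite set of actions and $\mathbf{P}:S\times\mathit{Act}\times S\to[0,1]$ such that for every $s$ the set $\mathit{Act}(s)=\{\alpha\mid \sum_{s'}\mathbf{P}(s,\alpha,s')=1\}$ of enabled actions is non-empty and $\sum_{s'}\mathbf{P}(s,\alpha,s')=0$ for $\alpha\notin\mathit{Act}(s)$. A (general) scheduler is a function $\sigma$ from finite paths of $\mathcal{M}$ to probability distributions over $\mathit{Act}$, giving probability $0$ to actions not enabled in the last state of the path (it may thus use memory and randomization). $\Pr^{\sigma}_s$ denotes the induced probability measure on infinite paths from state $s$; $\Pr^\sigma_s(\mathbf{G}\mathbf{F}\,T)$ is the probability of visiting $T\subseteq S$ infinitely often. For reals $r,r'$ and $\epsilon\ge0$: $r\approx_\epsilon r'$ iff $|r-r'|\le\epsilon$; $r\not\approx_\epsilon r'$ iff $|r-r'|>\epsilon$. RelBuechi: given an MDP $\mathcal{M}$ (rational transition probabilities), natural numbers $m,n$, rationals $q_1,\dots,q_m,q$, states $s_1,\dots,s_m$, indices $k_1,\dots,k_m$ with $\{k_1,\dots,k_m\}=\{1,\dots,n\}$, sets $T_1,\dots,T_m\subseteq S$, and $\bowtie\in\{>,\ge,\approx_\epsilon,\not\approx_\epsilon\mid\epsilon\in\mathbb{Q}_{\ge0}\}$, decide whether there exist general schedulers $\sigma_1,\dots,\sigma_n$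 with $\sum_{i=1}^m q_i\Pr^{\sigma_{k_i}}_{s_i}(\mathbf{G}\mathbf{F}\,T_i)\bowtie q$. A problem is strongly NP-hard if it is NP-hard even when all numbers in the input are encoded in unary. *)

(* Defs.v *)
From HB Require Import structures.
From mathcomp Require Import all_boot all_order all_algebra.
From mathcomp Require Import all_classical all_reals.
From mathcomp Require Import ereal topology normedtype sequences measure.

Set Implicit Arguments.
Unset Strict Implicit.
Unset Printing Implicit Defensive.

Import Order.TTheory GRing.Theory Num.Theory.

Local Open Scope classical_set_scope.
Local Open Scope ring_scope.

Record mdp (S Act : finType) := MDP {
  trans : S -> Act -> S -> rat;
  trans_ge0 : forall s a t, 0 <= trans s a t;
  trans_le1 : forall s a t, trans s a t <= 1;
  states_nonempty : exists s : S, true;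
  actions_enabled : forall s, exists a, \sum_t trans s a t == 1;
  trans_01 : forall s a, \sum_t trans s a t != 1 -> \sum_t trans s a t = 0 }.

Definition enabled (S Act : finType) (M : mdp S Act) (s : S) (a : Act) : bool :=
  \sum_t trans M s a t == 1.

(** The finite sequence s0 a0 s1 a1 ... sn is represented by
    (s0, [:: (a0, s1); ...; (a(n-1), sn)]). *)
Definition history (S Act : finType) : Type := (S * seq (Act * S))%type.

Definition last_state (S Act : finType) (h : history S Act) : S :=
  last h.1 [seq x.2 | x <- h.2].

Fixpoint is_path_from (S Act : finType) (M : mdp S Act) (s : S)
    (p : seq (Act * S)) : bool :=
  if p is (a, t) :: p' then (0 < trans M s a t) && is_path_from M t p'
  else true.

Definition finite_path (S Act : finType) (M : mdp S Act) (h : history S Act) :=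
  is_path_from M h.1 h.2.

(** Histories that are not finite paths of [M] are outside the domain of a
    scheduler: the values of [sched] there are unconstrained and irrelevant. *)
Record scheduler (R : realType) (S Act : finType) (M : mdp S Act) := Scheduler {
  sched :> history S Act -> Act -> R;
  sched_ge0 : forall h, finite_path M h -> forall a, 0 <= sched h a;
  sched_sum1 : forall h, finite_path M h -> \sum_a sched h a = 1;
  sched_enabled : forall h, finite_path M h ->
    forall a, ~~ enabled M (last_state h) a -> sched h a = 0 }.

(** [w : omega M] is the infinite sequence s0 a0 s1 a1 ... with
    [w i = (s_i, a_i)]; sequences that are not paths of [M] are included, but
    lie in cylinders of measure 0. *)
Definition omega (S Act : finType) (M : mdp S Act) : Type := nat -> S * Act.

Lemma omega_inhabited (S Act : finType) (M : mdp S Act) : exists x : S * Act, true.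
Proof.
by have [s _] := states_nonempty M; have [a _] := actions_enabled M s; exists (s, a).
Qed.

HB.instance Definition _ (S Act : finType) (M : mdp S Act) :=
  Choice.on (omega M).
HB.instance Definition _ (S Act : finType) (M : mdp S Act) :=
  isPointed.Build (omega M) (fun=> xchoose (omega_inhabited M)).

Definition prefix_of (S Act : finType) (M : mdp S Act) (w : omega M) (n : nat) :
    history S Act :=
  ((w 0%N).1, mkseq (fun i => ((w i).2, (w i.+1).1)) n).

Definition cylinder (S Act : finType) (M : mdp S Act) (w : omega M) (n : nat) :
    set (omega M) :=
  [set w' | prefix_of w' n = prefix_of w n].

Definition cylinders (S Act : finType) (M : mdp S Act) : set (set (omega M)) :=
  [set C | exists w n, C = cylinder w n].

Arguments cylinders {S Act} M _.

Notation infinite_paths M := (g_sigma_algebraType (cylinders M)).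

Definition cylinder_prob (R : realType) (S Act : finType) (M : mdp S Act)
    (sigma : scheduler R M) (s : S) (w : omega M) (n : nat) : R :=
  ((w 0%N).1 == s)%:R *
  \prod_(i < n) (sigma (prefix_of w i) (w i).2
                 * ratr (trans M (w i).1 (w i).2 (w i.+1).1)).

Definition induced (R : realType) (S Act : finType) (M : mdp S Act)
    (sigma : scheduler R M) (s : S) (P : probability (infinite_paths M) R) : Prop :=
  forall w n, P (cylinder w n) = (cylinder_prob sigma s w n)%:E.

(** Existence of the induced measure: the content of a set that is determined by
    the first [n] steps is computed by backward recursion, extended to a
    countably additive function by compactness, then to the sigma-algebra by
    Caratheodory's theorem. *)
Section induced_exists.
Context (R : realType) (S Act : finType) (M : mdp S Act).

Definition determined_at (n : nat) (A : set (omega M)) :=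
  forall w w', prefix_of w n = prefix_of w' n -> A w -> A w'.

Definition determined : set (set (omega M)) := [set A | exists n, determined_at n A].

Lemma prefix_of_le (n m : nat) (w w' : omega M) : (n <= m)%N ->
  prefix_of w m = prefix_of w' m -> prefix_of w n = prefix_of w' n.
Proof.
move=> nm [e0 em]; rewrite /prefix_of e0; congr pair.
have x0 := ((w 0%N).2, (w 0%N).1).
apply: (@eq_from_nth _ x0); first by rewrite !size_mkseq.
move=> i; rewrite size_mkseq => lin; have lim := leq_trans lin nm.
by have := congr1 (fun s => nth x0 s i) em; rewrite !nth_mkseq.
Qed.

Lemma determined_le n m A : (n <= m)%N -> determined_at n A -> determined_at m A.
Proof. by move=> nm dA w w' /(prefix_of_le nm); exact: dA. Qed.

Lemma determined0 : determined set0.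
Proof. by exists 0%N. Qed.

Lemma determined_atU n A B :
  determined_at n A -> determined_at n B -> determined_at n (A `|` B).
Proof. by move=> dA dB w w' e [/(dA _ _ e)|/(dB _ _ e)]; [left|right]. Qed.

Lemma determinedU : setU_closed determined.
Proof.
move=> A B [n dA] [m dB]; exists (maxn n m); apply: determined_atU.
  exact: determined_le (leq_maxl _ _) dA.
exact: determined_le (leq_maxr _ _) dB.
Qed.

Lemma determinedC : setC_closed determined.
Proof. by move=> A [n dA]; exists n => w w' e nA /(dA _ _ (esym e)). Qed.

Definition determined_display : measure_display. Proof. exact. Qed.
Definition omega_alg : Type := omega M.

HB.instance Definition _ := Pointed.on omega_alg.
HB.instance Definition _ := @isAlgebraOfSets.Build determined_display
  omega_alg determined determined0 determinedU determinedC.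

Variable sigma : scheduler R M.

Definition extend (h : history S Act) : omega M := fun i =>
  (nth h.1 (h.1 :: [seq x.2 | x <- h.2]) i,
   nth (xchoose (omega_inhabited M)).2 [seq x.1 | x <- h.2] i).

Lemma extendK (h : history S Act) : prefix_of (extend h) (size h.2) = h.
Proof.
case: h => s p; rewrite /prefix_of /extend /=; congr pair.
apply: (@eq_from_nth _ ((xchoose (omega_inhabited M)).2, s)).
  by rewrite size_mkseq.
move=> i; rewrite size_mkseq => li; rewrite nth_mkseq //=.
by rewrite !(nth_map ((xchoose (omega_inhabited M)).2, s)) // -surjective_pairing.
Qed.

Fixpoint weight (n : nat) (h : history S Act) (A : set (omega M)) : R :=
  if n is n'.+1 then
    \sum_a \sum_t sigma h a * ratr (trans M (last_state h) a t)
                  * weight n' (h.1, rcons h.2 (a, t)) A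
  else (extend h \in A)%:R.

Lemma finite_path_rcons (h : history S Act) a t :
  finite_path M (h.1, rcons h.2 (a, t)) =
  finite_path M h && (0 < trans M (last_state h) a t).
Proof.
case: h => s p; rewrite /finite_path /last_state /=.
by elim: p s => [|[b u] p IH] s /=; rewrite ?andbT // IH andbA.
Qed.

Lemma step_eq (h : history S Act) (F G : Act -> S -> R) :
  (forall a t, finite_path M (h.1, rcons h.2 (a, t)) -> F a t = G a t) ->
  finite_path M h ->
  \sum_a \sum_t sigma h a * ratr (trans M (last_state h) a t) * F a t =
  \sum_a \sum_t sigma h a * ratr (trans M (last_state h) a t) * G a t.
Proof.
move=> FG hp; apply: eq_bigr => a _; apply: eq_bigr => t _.
have [p0|p0] := boolP (0 < trans M (last_state h) a t).
  by rewrite FG // finite_path_rcons hp.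
have -> : trans M (last_state h) a t = 0.
  by apply: le_anti; rewrite trans_ge0 andbT leNgt.
by rewrite rmorph0 mulr0 !mul0r.
Qed.

Lemma step_sum1 (h : history S Act) : finite_path M h ->
  \sum_a \sum_t sigma h a * ratr (trans M (last_state h) a t) = 1.
Proof.
move=> hp; rewrite -(sched_sum1 sigma hp); apply: eq_bigr => a _.
rewrite -big_distrr /= -rmorph_sum /=.
have [/eqP ->|ne] := boolP (enabled M (last_state h) a).
  by rewrite rmorph1 mulr1.
by rewrite (sched_enabled sigma hp ne) mul0r.
Qed.

Lemma weight_stable n m (h : history S Act) A : finite_path M h ->
  determined_at (size h.2 + n) A -> weight (n + m) h A = weight n h A.
Proof.
elim: n h => [|n IH] h hp dA /=; last first.
  apply: step_eq => // a t hp'; apply: IH => //=.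
  by rewrite size_rcons addSnnS.
rewrite add0n addn0 in dA *; elim: m h hp dA => // m IH h hp dA /=.
have ->: \sum_a \sum_t sigma h a * ratr (trans M (last_state h) a t)
    * weight m (h.1, rcons h.2 (a, t)) A =
    \sum_a \sum_t sigma h a * ratr (trans M (last_state h) a t)
    * (extend h \in A)%:R.
  apply: step_eq => // a t hp'; rewrite IH //=; last first.
    by rewrite size_rcons; apply: determined_le dA.
  congr (nat_of_bool _)%:R.
  have e : prefix_of (extend (h.1, rcons h.2 (a, t))) (size h.2)
      = prefix_of (extend h) (size h.2).
    rewrite extendK; have := extendK (h.1, rcons h.2 (a, t)) => /=.
    rewrite size_rcons /prefix_of mkseqS => -[] /= /rcons_inj [-> _].
    by case: (h).
  by apply/idP/idP; rewrite !inE; apply: dA.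
under eq_bigr do rewrite -big_distrl.
by rewrite -big_distrl /= step_sum1 // mul1r.
Qed.

Lemma weight_ge0 n (h : history S Act) A : finite_path M h -> 0 <= weight n h A.
Proof.
elim: n h => [|n IH] h hp /=; first by rewrite ler0n.
apply: sumr_ge0 => a _; apply: sumr_ge0 => t _.
have [p0|p0] := boolP (0 < trans M (last_state h) a t).
  apply: mulr_ge0; last by apply: IH; rewrite finite_path_rcons hp.
  by apply: mulr_ge0; [exact: sched_ge0|rewrite ler0q trans_ge0].
have -> : trans M (last_state h) a t = 0.
  by apply: le_anti; rewrite trans_ge0 andbT leNgt.
by rewrite rmorph0 mulr0 !mul0r.
Qed.

Lemma weightU n (h : history S Act) A B : A `&` B = set0 ->
  weight n h (A `|` B) = weight n h A + weight n h B.
Proof.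
move=> AB; elim: n h => [|n IH] h /=.
  have := congr1 (fun X : set _ => X (extend h)) AB => /=.
  rewrite in_setU => e.
  have [] := boolP (extend h \in A); have [] := boolP (extend h \in B) => /=;
    rewrite ?inE ?addr0 ?add0r //.
  by move=> hB hA; exfalso; rewrite -[False]e.
rewrite -big_split; apply: eq_bigr => a _ /=.
by rewrite -big_split; apply: eq_bigr => t _ /=; rewrite IH mulrDr.
Qed.

Lemma weightT n (h : history S Act) : finite_path M h -> weight n h setT = 1.
Proof.
move=> hp; rewrite -(add0n n) weight_stable //= ?in_setT //.
Qed.

Lemma weight0 n (h : history S Act) : weight n h set0 = 0.
Proof.
elim: n h => [|n IH] h /=; first by rewrite in_set0.
by rewrite big1 // => a _; rewrite big1 // => t _; rewrite IH mulr0.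
Qed.

Lemma weight_cylinder_out n (h : history S Act) w m : (size h.2 + n = m)%N ->
  h <> prefix_of w (size h.2) -> weight n h (cylinder w m) = 0.
Proof.
elim: n h => [|n IH] h /=.
  rewrite addn0 => <- ne.
  by rewrite [X in nat_of_bool X]memNset // /cylinder /= extendK.
move=> e ne; rewrite big1 // => a _; rewrite big1 // => t _.
rewrite IH ?mulr0 //= size_rcons ?addSnnS // => e'.
apply: ne; move: e'; rewrite /prefix_of mkseqS => -[] /= e0 /rcons_inj [e1 _].
by rewrite -e0 -e1; case: (h).
Qed.

Lemma last_state_prefix (w : omega M) n : last_state (prefix_of w n) = (w n).1.
Proof.
rewrite /last_state /prefix_of /=.
by case: n => // n; rewrite mkseqS map_rcons last_rcons.
Qed.

Lemma weight_cylinder n m w :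
  weight n (prefix_of w m) (cylinder w (m + n)) =
  \prod_(i < n) (sigma (prefix_of w (m + i)) (w (m + i)%N).2
     * ratr (trans M (w (m + i)%N).1 (w (m + i)%N).2 (w (m + i).+1).1)).
Proof.
elim: n m => [|n IH] m /=.
  rewrite big_ord0 mem_set // addn0.
  by have := extendK (prefix_of w m); rewrite /= size_mkseq.
rewrite big_ord_recl /= addn0 (bigD1 (w m).2) //= (bigD1 (w m.+1).1) //=.
rewrite last_state_prefix [X in _ + X]big1 ?addr0; last first.
  move=> a ne; rewrite big1 // => t _.
  rewrite weight_cylinder_out ?mulr0 //= size_rcons size_mkseq ?addSnnS //.
  rewrite /prefix_of mkseqS => -[] /rcons_inj [e _].
  by rewrite e eqxx in ne.
rewrite [X in _ + X]big1 ?addr0; last first.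
  move=> t ne.
  rewrite weight_cylinder_out ?mulr0 //= size_rcons size_mkseq ?addSnnS //.
  rewrite /prefix_of mkseqS => -[] /rcons_inj [e].
  by rewrite e eqxx in ne.
have -> : ((w 0%N).1, rcons (mkseq (fun i => ((w i).2, (w i.+1).1)) m)
    ((w m).2, (w m.+1).1)) = prefix_of w m.+1.
  by rewrite /prefix_of mkseqS.
rewrite -addSnnS IH; congr (_ * _).
by apply: eq_bigr => i _; rewrite /= /bump /= add1n addSnnS.
Qed.

Variable s : S.

Definition depth (A : set (omega M)) : nat := xget 0%N [set n | determined_at n A].

Definition premeasure (A : set omega_alg) : \bar R :=
  (weight (depth A) (s, [::]) A)%:E.

Lemma premeasureE n A : determined_at n A ->
  premeasure A = (weight n (s, [::]) A)%:E.
Proof.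
move=> dA; rewrite /premeasure; congr EFin.
have dA' : determined_at (depth A) A.
  by rewrite /depth; apply: (@xgetI _ _ [set k | determined_at k A] n dA).
have [le|/ltnW le] := leqP (depth A) n.
  by rewrite -(subnKC le) weight_stable.
by rewrite -{1}(subnKC le) weight_stable.
Qed.

Lemma premeasure_ge0 A : (0 <= premeasure A)%E.
Proof. by rewrite lee_fin weight_ge0. Qed.

Lemma premeasure0 : premeasure set0 = 0.
Proof. by rewrite /premeasure weight0. Qed.

Lemma premeasureU A B : determined A -> determined B -> A `&` B = set0 ->
  premeasure (A `|` B) = (premeasure A + premeasure B)%E.
Proof.
move=> [n dA] [m dB] AB.
have {}dA := determined_le (leq_maxl n m) dA.
have {}dB := determined_le (leq_maxr n m) dB.
by rewrite (premeasureE dA) (premeasureE dB) (premeasureE (determined_atU dA dB))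
  weightU.
Qed.

Lemma omega_compact (G : (set (omega M))^nat) :
  (forall k, determined (G k)) -> (forall k, G k.+1 `<=` G k) ->
  (forall k, G k !=set0) -> exists w, forall k, G k w.
Proof.
move=> dG Gdec Gne.
have Gle k l : (k <= l)%N -> G l `<=` G k.
  by move=> /subnKC <-; elim: (l - k)%N => [|i IH] w;
    rewrite ?addn0 // addnS => /Gdec /IH.
pose good (p : seq (S * Act)) := forall k, exists2 w, G k w & mkseq w (size p) = p.
have good0 : good [::] by move=> k; have [w Gw] := Gne k; exists w.
have goodS p : good p -> exists e, good (rcons p e).
  move=> gp; apply: contrapT => /forallNP bad.
  have /choice[f fP] : forall e, exists k, forall w, G k w ->
      mkseq w (size p).+1 <> rcons p e.
    move=> e; have /existsNP[k kP] := bad e; exists k => w Gw ew.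
    by apply: kP; exists w; rewrite ?size_rcons.
  have [w Gw ew] := gp (\max_e f e).
  apply: (fP (w (size p)) w); last by rewrite mkseqS ew.
  by apply: Gle Gw; exact: leq_bigmax.
have /choice[g gP] : forall p, exists e, good p -> good (rcons p e).
  move=> p; have [gp|ngp] := pselect (good p).
    by have [e ge] := goodS p gp; exists e.
  by exists (xchoose (omega_inhabited M)).
pose pre := fix pre n := if n is n'.+1 then rcons (pre n') (g (pre n')) else [::].
have preP n : good (pre n) by elim: n => //= n; exact: gP.
have sz n : size (pre n) = n by elim: n => //= n IH; rewrite size_rcons IH.
pose w : omega M := fun i => g (pre i).
have wE n : mkseq w n = pre n by elim: n => //= n IH; rewrite mkseqS IH.
exists w => k; have [n dk] := dG k.
have [w' Gw' e] := preP n.+1 k.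
apply: dk Gw'; rewrite sz -wE in e.
have ei i : (i <= n)%N -> w' i = w i.
  move=> li; have := congr1 (fun s => nth (w 0%N) s i) e.
  by rewrite !nth_mkseq.
rewrite /prefix_of ei //; congr pair; apply/eq_in_map => i.
by rewrite mem_iota add0n => /andP[_ li]; rewrite !ei // ltnW.
Qed.

Lemma premeasure_sigma_additive : semi_sigma_additive premeasure.
Proof.
move=> F mF tF mUF.
pose U k := \big[setU/set0]_(i < k) F i.
have mU k : determined (U k).
  rewrite /U; elim/big_ind: _; [exact: determined0|exact: determinedU|].
  by move=> i _; exact: mF.
have UE k : premeasure (U k) = (\sum_(0 <= i < k) premeasure (F i))%E.
  elim: k => [|k IH]; first by rewrite /U big_ord0 big_geq // premeasure0.
  rewrite big_nat_recr //= -IH /U big_ord_recr /= premeasureU //.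
  - exact: mU.
  - exact: mF.
  - apply/seteqP; split=> // w [].
    rewrite -bigcup_mkord => -[i /= ik Fi] Fk.
    have ik0 : F i `&` F k = set0.
      by move/trivIsetP : tF; apply=> //; rewrite ltn_eqF.
    by have : (F i `&` F k) w by []; rewrite ik0.
have [K UK] : exists K, U K = \bigcup_n F n.
  apply: contrapT => /forallNP nU.
  have [||k|w wG] := @omega_compact (fun k => (\bigcup_n F n) `\` U k).
  - move=> k; rewrite setDE -[X in X `&` _]setCK -setCU.
    apply: determinedC; apply: determinedU; last exact: mU.
    exact: determinedC.
  - move=> k w [Fw nw]; split=> // Uw; apply: nw.
    by rewrite /U big_ord_recr /=; left.
  - apply/set0P/eqP; rewrite setD_eq0 => sub; apply: (nU k); apply/seteqP; split=> //.
    by rewrite /U -bigcup_mkord => w [i _ Fi]; exists i.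
  - have [[i _ Fi] _] := wG 0%N; have [_] := wG i.+1; apply.
    by rewrite /U big_ord_recr /=; right.
apply: cvg_near_cst; near=> k.
have Kk : (K <= k)%N by near: k; exact: nbhs_infty_ge.
rewrite -UE -UK; congr premeasure; apply/seteqP; split.
  by rewrite UK /U -bigcup_mkord => w [i _ Fi]; exists i.
rewrite /U -!bigcup_mkord => w [i /= li Fi]; exists i => //=.
exact: leq_trans li Kk.
Unshelve. all: by end_near. Qed.

HB.instance Definition _ := isMeasure.Build _ _ _ premeasure
  premeasure0 premeasure_ge0 premeasure_sigma_additive.

Definition extension (A : set (infinite_paths M)) : \bar R :=
  measure_extension premeasure A.

Lemma determined_cylinder w n : determined_at n (cylinder w n).
Proof. by move=> x y; rewrite /cylinder /= => ->. Qed.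

Lemma cylinders_sub (A : set (omega M)) : <<s cylinders M >> A ->
  <<s determined >> A.
Proof.
move: A; apply: smallest_sub; first exact: smallest_sigma_algebra.
move=> _ [w [n ->]]; apply: sub_sigma_algebra; exists n.
exact: determined_cylinder.
Qed.

Lemma extension_sigma_additive : semi_sigma_additive extension.
Proof.
move=> F mF tF mU; apply: (@measure_semi_sigma_additive _ _ _
  (measure_extension premeasure)) => //.
  by move=> i; exact: (cylinders_sub (mF i)).
exact: (cylinders_sub mU).
Qed.

HB.instance Definition _ := isMeasure.Build _ _ _ extension
  (measure0 (measure_extension premeasure))
  (measure_ge0 (measure_extension premeasure)) extension_sigma_additive.

Lemma extensionE A : determined A -> extension A = premeasure A.
Proof. by move=> mA; rewrite /extension /measure_extension measurable_mu_extE. Qed.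

Lemma extensionT : extension setT = 1%E.
Proof.
have dT : determined_at 0 [set: omega M] by [].
by rewrite extensionE; [rewrite (premeasureE dT) weightT|exists 0%N].
Qed.

HB.instance Definition _ := Measure_isProbability.Build _ _ _ extension extensionT.

Lemma induced_exists : exists P, induced sigma s P.
Proof.
exists extension => w n.
transitivity (premeasure (cylinder w n)).
  by apply: extensionE; exists n; exact: determined_cylinder.
rewrite (premeasureE (@determined_cylinder w n)) /cylinder_prob; congr EFin.
have [e|ne] := eqVneq (w 0%N).1 s.
  by rewrite mul1r -e -[(_, _)]/(prefix_of w 0) (weight_cylinder n 0).
rewrite mul0r weight_cylinder_out // => -[e].
by rewrite e eqxx in ne.
Qed.

End induced_exists.

Lemma induced_unique (R : realType) (S Act : finType) (M : mdp S Act)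
    (sigma : scheduler R M) (s : S) (P Q : probability (infinite_paths M) R) :
  induced sigma s P -> induced sigma s Q ->
  forall A, measurable A -> P A = Q A.
Proof.
move=> iP iQ A mA.
pose G : set (set (infinite_paths M)) := [set C | [\/ cylinders M C, C = set0 | C = setT]].
apply: (@measure_unique _ R (infinite_paths M) G (fun=> setT)) => //.
- apply/seteqP; split; apply: smallest_sub; try exact: smallest_sigma_algebra.
    by move=> C cC; apply: sub_sigma_algebra; constructor.
  move=> C [cC|->|->]; first exact: sub_sigma_algebra.
    exact: sigma_algebra0.
  exact: (@measurableT _ (infinite_paths M)).
- move=> B C [[w [n ->]]|->|->]; last by rewrite setTI.
    move=> [[x [m ->]]|->|->]; last 2 first.
    + by rewrite setI0; constructor 2.
    + by rewrite setIT; constructor; exists w, n.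
    have [[y [yw yx]]|ne] := pselect ((cylinder w n `&` cylinder x m) !=set0);
      last first.
      by constructor 2; apply/seteqP; split=> // y ?; apply: ne; exists y.
    constructor; exists y, (maxn n m); apply/seteqP; split=> z /=.
      rewrite /cylinder /= in yw yx *; move=> [zw zx].
      have [le|/ltnW le] := leqP n m; first by rewrite zx yx.
      by rewrite zw yw.
    rewrite /cylinder /= in yw yx * => e; split.
      by rewrite (prefix_of_le (leq_maxl n m) e).
    by rewrite (prefix_of_le (leq_maxr n m) e).
  by move=> _; rewrite set0I; constructor 2.
- by move=> i; constructor 3.
- exact: bigcup_const.
- move=> C [[w [n ->]]|->|->]; first exact: (etrans (iP w n) (esym (iQ w n))).
    by rewrite !measure0.
  exact: (etrans (probability_setT P) (esym (probability_setT Q))).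
- by move=> k; have /= -> := probability_setT P; rewrite ltry.
Qed.

Definition path_measure (R : realType) (S Act : finType) (M : mdp S Act)
    (sigma : scheduler R M) (s : S) : probability (infinite_paths M) R :=
  xget point (induced sigma s).

Lemma path_measureP (R : realType) (S Act : finType) (M : mdp S Act)
    (sigma : scheduler R M) (s : S) : induced sigma s (path_measure sigma s).
Proof. exact: xgetPex (induced_exists sigma s). Qed.

Definition infinitely_often (S Act : finType) (M : mdp S Act) (T : {set S}) :
    set (infinite_paths M) :=
  [set w | forall n, exists2 m, (n <= m)%N & (w m).1 \in T].

Arguments infinitely_often {S Act} M T.

Lemma measurable_infinitely_often (S Act : finType) (M : mdp S Act) (T : {set S}) :
  measurable (infinitely_often M T).
Proof.
have mT m : measurable ([set w | (w m).1 \in T] : set (infinite_paths M)).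
  pose seq_of (t : m.+1.-tuple (S * Act)) : omega M := fun i => nth (thead t) t i.
  rewrite (_ : mkset _ = \bigcup_(t in [set t | (seq_of t m).1 \in T])
    (cylinder (seq_of t) m : set (infinite_paths M))).
    apply: fin_bigcup_measurable; first exact: finite_finset.
    move=> t _; apply: (@sub_sigma_algebra _ setT (cylinders M)).
    by exists (seq_of t), m.
  apply/seteqP; split=> w /=.
    move=> wT; pose t := mktuple (fun i : 'I_m.+1 => w i).
    have tE i : (i <= m)%N -> seq_of t i = w i.
      by move=> im; rewrite /seq_of -[i]/(val (Ordinal (im : (i < m.+1)%N)))
        -tnth_nth tnth_mktuple.
    exists t; rewrite /= ?tE // /cylinder /= /prefix_of tE //.
    congr pair; apply/eq_in_map => i; rewrite mem_iota add0n => /andP[_ im].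
    by rewrite !tE // ltnW.
  move=> [t /= tT /(congr1 (@last_state _ _))].
  by rewrite !last_state_prefix => ->.
rewrite (_ : infinitely_often _ _ = \bigcap_n \bigcup_(m in [set m | (n <= m)%N])
  ([set w | (w m).1 \in T] : set (infinite_paths M))).
  apply: bigcapT_measurable => n; apply: bigcup_measurable => m _; exact: mT.
apply/seteqP; split=> w /= h n.
  by move=> _; have [m nm wm] := h n; exists m.
by have [m nm wm] := h n I; exists m.
Qed.

Definition Pr (R : realType) (S Act : finType) (M : mdp S Act)
    (sigma : scheduler R M) (s : S) (A : set (infinite_paths M)) : R :=
  fine (path_measure sigma s A).

Inductive comparison :=
  | Greater
  | GreaterEq
  | Approx (eps : rat) of 0 <= eps
  | NotApprox (eps : rat) of 0 <= eps.

Definition compare (R : realType) (c : comparison) (x y : R) : Prop :=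
  match c with
  | Greater => x > y
  | GreaterEq => x >= y
  | Approx eps _ => `|x - y| <= ratr eps
  | NotApprox eps _ => `|x - y| > ratr eps
  end.

Record relbuechi_instance := RelBuechiInstance {
  nstates : nat;
  nactions : nat;
  model : mdp 'I_nstates 'I_nactions;
  nterms : nat;
  nscheds : nat;
  coef : 'I_nterms -> rat;
  source : 'I_nterms -> 'I_nstates;
  sched_index : 'I_nterms -> 'I_nscheds;
  sched_index_surj : forall j, exists i, sched_index i = j;
  target : 'I_nterms -> {set 'I_nstates};
  cmp : comparison;
  bound : rat }.

Definition relbuechi_holds (R : realType) (I : relbuechi_instance) : Prop :=
  exists sigma : 'I_(nscheds I) -> scheduler R (model I),
    compare (cmp I)
      (\sum_(i < nterms I) ratr (coef i) *
         Pr (sigma (sched_index i)) (source i)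
            (infinitely_often (model I) (target i)))
      (ratr (bound I)).

Local Open Scope nat_scope.

Inductive direction := MoveLeft | Stay | MoveRight.

(** A tape cell is blank ([None]) or holds an input symbol, an output symbol or
    an auxiliary symbol. *)
Definition cell (A B X : finType) : Type := option (A + B + X).

(** Deterministic Turing machines with [extra_tapes + 1] two-way infinite tapes,
    input alphabet [A] and output alphabet [B]. *)
Record machine (A B : finType) := Machine {
  aux : finType;
  control : finType;
  extra_tapes : nat;
  start : control;
  halting : pred control;
  delta : control -> {ffun 'I_extra_tapes.+1 -> cell A B aux} ->
    control * ('I_extra_tapes.+1 -> cell A B aux * direction) }.

(** (cells left of the head, nearest first; scanned cell; cells right of the
    head); all cells beyond the two lists are blank. *)
Definition tape (A B X : finType) : Type :=
  (seq (cell A B X) * cell A B X * seq (cell A B X))%type.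

Definition write_move (A B X : finType) (u : tape A B X)
    (act : cell A B X * direction) : tape A B X :=
  let: (l, _, r) := u in
  let: (c, d) := act in
  match d with
  | MoveLeft => (behead l, head None l, c :: r)
  | Stay => (l, c, r)
  | MoveRight => (c :: l, head None r, behead r)
  end.

Definition configuration (A B : finType) (M : machine A B) : Type :=
  (control M * ('I_(extra_tapes M).+1 -> tape A B (aux M)))%type.

Definition step (A B : finType) (M : machine A B) (c : configuration M) :
    configuration M :=
  if halting c.1 then c else
  let: (q, acts) := delta c.1 [ffun i => (c.2 i).1.2] in
  (q, fun i => write_move (c.2 i) (acts i)).

(** The input is written on tape 0, with the head on its first symbol; the other
    tapes are blank. *)
Definition initial (A B : finType) (M : machine A B) (x : seq A) :
    configuration M :=
  let cells : seq (cell A B (aux M)) := [seq Some (inl (inl a)) | a <- x] in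
  (start M, fun i => if i == ord0 then ([::], head None cells, behead cells)
                     else ([::], None, [::])).

Fixpoint read_output (A B X : finType) (cells : seq (cell A B X)) : seq B :=
  if cells is Some (inl (inr b)) :: cells' then b :: read_output cells' else [::].

(** The output is the maximal word of output symbols that starts under the head
    of the last tape. *)
Definition output (A B : finType) (M : machine A B) (c : configuration M) : seq B :=
  let: (_, a, r) := c.2 ord_max in read_output (a :: r).

Definition poly_time (A B : finType) (f : seq A -> seq B) : Prop :=
  exists (M : machine A B) (c d : nat), forall x : seq A,
    exists2 t, t <= c * size x ^ d + c &
      let C := iter t (@step A B M) (initial M x) in
      halting C.1 /\ output C = f x.

Definition language (A : finType) := seq A -> Prop.

Definition in_P (A : finType) (L : language A) : Prop :=
  exists2 f : seq A -> seq bool, poly_time f & forall x, L x <-> f x = [:: true].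

(** The verifier reads the word [x] followed by the certificate [y], written with
    a separate copy of {0,1}. *)
Definition in_NP (A : finType) (L : language A) : Prop :=
  exists (V : language (A + bool)%type) (c d : nat), in_P V /\
    forall x, L x <->
      exists2 y : seq bool, size y <= c * size x ^ d + c &
        V ([seq inl a | a <- x] ++ [seq inr b | b <- y]).

Definition poly_reducible (A B : finType) (L : language A) (K : language B) : Prop :=
  exists2 f : seq A -> seq B, poly_time f & forall x, L x <-> K (f x).

Definition NP_hard (B : finType) (K : language B) : Prop :=
  forall (A : finType) (L : language A), in_NP L -> poly_reducible L K.

(** [entries] lists all the numbers that describe an instance, in a fixed order;
    the word of an instance is obtained by writing each of them with a chosen
    numeral system and terminating it by the separator [None]. *)
Record decision_problem := DecisionProblem {
  instance : Type;
  entries : instance -> seq nat;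
  yes : instance -> Prop }.

Definition unary (n : nat) : seq bool := nseq n true.

(** Least significant bit first, without trailing zeros; 0 is the empty word. *)
Definition binary (n : nat) : seq bool :=
  [seq odd (n %/ 2 ^ i) | i <- iota 0 (up_log 2 n.+1)].

Definition encode (numeral : nat -> seq bool) (ns : seq nat) : seq (option bool) :=
  flatten [seq rcons [seq Some b | b <- numeral n] None | n <- ns].

Definition language_of (numeral : nat -> seq bool) (Q : decision_problem) :
    language (option bool) :=
  fun w => exists2 I : instance Q, w = encode numeral (entries I) & yes I.

Definition strongly_NP_hard (Q : decision_problem) : Prop :=
  NP_hard (language_of unary Q).

Definition strongly_NP_complete (Q : decision_problem) : Prop :=
  in_NP (language_of binary Q) /\ strongly_NP_hard Q.

Definition rat_entries (x : rat) : seq nat :=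
  [:: nat_of_bool (x < 0)%R; absz (numq x); absz (denq x)].

Definition comparison_entries (c : comparison) : seq nat :=
  match c with
  | Greater => [:: 0]
  | GreaterEq => [:: 1]
  | Approx eps _ => 2 :: rat_entries eps
  | NotApprox eps _ => 3 :: rat_entries eps
  end.

Definition mdp_entries (n a : nat) (M : mdp 'I_n 'I_a) : seq nat :=
  n :: a ::
  flatten [seq flatten [seq flatten [seq rat_entries (trans M s b t) | t <- enum 'I_n]
                       | b <- enum 'I_a]
          | s <- enum 'I_n].

Definition relbuechi_entries (I : relbuechi_instance) : seq nat :=
  mdp_entries (model I) ++ [:: nterms I; nscheds I] ++
  flatten [seq rat_entries (coef i) ++ [:: val (source i); val (sched_index i)]
               ++ [seq nat_of_bool (s \in target i) | s <- enum 'I_(nstates I)]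
          | i <- enum 'I_(nterms I)] ++
  comparison_entries (cmp I) ++ rat_entries (bound I).

Definition RelBuechi (R : realType) : decision_problem :=
  DecisionProblem relbuechi_entries (relbuechi_holds R).

(* Main.v *)
(** Membership. After a shift, the payoff [sum_i q_i [GF T_i]] is a nonnegative function of the set
    of state-action pairs that occur infinitely often, and this set is almost surely an end
    component. Hence the optimal values are those of an optimal stopping problem, where stopping in
    [u] is rewarded by the best end component that contains [u]: a superharmonic majorant of the
    rewards bounds every scheduler (supermartingale argument), and a policy that reaches a stopping
    state almost surely is realized by a scheduler that then stays in the end component forever. A
    stopping policy with the largest sum of values is optimal in every state, and by Cramer's rule
    its values are rationals of polynomial bit length; so policies with rank functions, end
    components and integer multiples of the values are a certificate, checked with columnwise binary
    arithmetic. Terms with distinct schedulers or distinct source states are independent, because a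
    scheduler sees the initial state. For the approximate comparisons one bounds the payoff from
    both sides and uses that mixtures of schedulers attain every value in between.

    Hardness. The run of a verifier is described by propositional clauses (Cook-Levin). They are
    encoded with one scheduler on the complete deterministic process whose states are the literals:
    [2 GF {x, ~x} - GF {x} - GF {~x}] is at most 1, with equality when exactly one of the two
    literals recurs, and each clause [C] contributes [GF C]. The expected payoff reaches the number
    of variables and clauses only if some path attains it, and such a path is a satisfying
    assignment.

    Running times are controlled with a small language of counter programs, compiled to Turing
    machines; the class [E] of functions computed by it with polynomially bounded counters is closed
    under bounded sums, quantifiers and recursion. *)
From HB Require Import structures.
From mathcomp Require Import all_boot all_order all_algebra perm.
From mathcomp Require Import all_classical all_reals.
From mathcomp Require Import ereal topology normedtype sequences measure.
From mathcomp Require Import zify ring lra.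
Require Import Defs.

Set Implicit Arguments.
Unset Strict Implicit.
Unset Printing Implicit Defensive.

Import Order.TTheory GRing.Theory Num.Theory numFieldNormedType.Exports.

(** Membership needs only lower bounds to be checked. A certificate proves that some schedulers
    reach a value; that no schedulers do better is used only to show that every yes-instance has a
    certificate. Upper bounds in a comparison become lower bounds for the negated coefficients, so
    two certificates of the same form suffice. Two obstacles shape the rest. The measure of a
    scheduler is known through its values on cylinders, so expectations are handled as finite sums
    over histories and atoms, and statements about recurrence come from one supermartingale
    argument, [recurrence]. Moreover, the numbers of the input and of the certificate have
    polynomially many bits, while a counter is unary: numbers are compared as polynomials in 2, and
    carries are resolved only in the comparison. Divisions and Euclid's algorithm never run; their
    results are part of the certificate and are verified by multiplication. A single denominator
    [D * Z] serves all values: [D] clears the denominators of the input, [Z] is a product of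
    determinants of policies. *)

Module CounterPrograms.

Local Open Scope nat_scope.

(** * Counter programs and their flow graphs *)

Section Commands.
Variables (A B : finType).

Inductive act := Nop | Inc of nat | Dec of nat | MvL | MvR | Emit of B.
Inductive guard := NonZero of nat | Reads of pred (option A).
Inductive cmd :=
  | Do of act
  | Seq of cmd & cmd
  | If of guard & cmd & cmd
  | While of guard & cmd.

Record state := State { hpos : nat; ctr : nat -> nat; emitted : seq B }.

Definition upd (f : nat -> nat) r v : nat -> nat := fun x => if x == r then v else f x.

Definition doact (a : act) (s : state) : state :=
  match a with
  | Nop => s
  | Inc r => State (hpos s) (upd (ctr s) r (ctr s r).+1) (emitted s)
  | Dec r => State (hpos s) (upd (ctr s) r (ctr s r).-1) (emitted s)
  | MvL => State (hpos s).-1 (ctr s) (emitted s)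
  | MvR => State (hpos s).+1 (ctr s) (emitted s)
  | Emit b => State (hpos s) (ctr s) (b :: emitted s)
  end.

(** [hpos] is truncated at 0, whereas a tape head would leave the input; such a move is excluded
    instead of being modelled. *)
Definition act_ok (a : act) (s : state) := if a is MvL then 0 < hpos s else true.

Variable w : seq A.

Definition gtrue (s : state) (g : guard) : bool :=
  match g with NonZero r => 0 < ctr s r | Reads P => P (onth w (hpos s)) end.

Inductive ev : cmd -> state -> state -> nat -> Prop :=
  | ev_do a s : act_ok a s -> ev (Do a) s (doact a s) 1
  | ev_seq c1 c2 s s1 s2 n1 n2 : ev c1 s s1 n1 -> ev c2 s1 s2 n2 ->
      ev (Seq c1 c2) s s2 (n1 + n2)
  | ev_if g c1 c2 s s' n : ev (if gtrue s g then c1 else c2) s s' n ->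
      ev (If g c1 c2) s s' n.+1
  | ev_stop g c s : ~~ gtrue s g -> ev (While g c) s s 1
  | ev_loop g c s s1 s2 n1 n2 : gtrue s g -> ev c s s1 n1 ->
      ev (While g c) s1 s2 n2 -> ev (While g c) s s2 (n1 + n2).+1.

(** A flow graph with one entry, whose exit is the successor [None]. Guards enter through an
    arbitrary oracle, so the same graph is driven by a [state] and by the scanned tape cells. *)
Record frag := Frag {
  fq : finType; fe : fq; ft : fq -> (guard -> bool) -> option fq * act }.

Fixpoint frag_of (c : cmd) : frag :=
  match c with
  | Do a => @Frag unit tt (fun _ _ => (None, a))
  | Seq c1 c2 => let F1 := frag_of c1 in let F2 := frag_of c2 in
      @Frag (fq F1 + fq F2)%type (inl (fe F1)) (fun q o =>
        match q with
        | inl q => let r := ft q o in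
            (if r.1 is Some q' then Some (inl q') else Some (inr (fe F2)), r.2)
        | inr q => let r := ft q o in
            (if r.1 is Some q' then Some (inr q') else None, r.2)
        end)
  | If g c1 c2 => let F1 := frag_of c1 in let F2 := frag_of c2 in
      @Frag (option (fq F1 + fq F2)%type) None (fun q o =>
        match q with
        | None => (Some (Some (if o g then inl (fe F1) else inr (fe F2))), Nop)
        | Some (inl q) => let r := ft q o in
            (if r.1 is Some q' then Some (Some (inl q')) else None, r.2)
        | Some (inr q) => let r := ft q o in
            (if r.1 is Some q' then Some (Some (inr q')) else None, r.2)
        end)
  | While g c => let F := frag_of c in
      @Frag (option (fq F)) None (fun q o =>
        match q with
        | None => (if o g then Some (Some (fe F)) else None, Nop)
        | Some q => let r := ft q o in
            (if r.1 is Some q' then Some (Some q') else Some None, r.2)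
        end)
  end.

Inductive runs (F : frag) : fq F -> state -> state -> nat -> Prop :=
  | runs_exit q s : act_ok (ft q (gtrue s)).2 s -> (ft q (gtrue s)).1 = None ->
      runs q s (doact (ft q (gtrue s)).2 s) 1
  | runs_next q q' s s' n : act_ok (ft q (gtrue s)).2 s ->
      (ft q (gtrue s)).1 = Some q' ->
      runs q' (doact (ft q (gtrue s)).2 s) s' n -> runs q s s' n.+1.

(** Every composite command places a subgraph along [j] and redirects its exit edge to [ex]; this
    one simulation covers all composite cases of [ev_runs]. *)
Lemma runs_embed (F G : frag) (j : fq F -> fq G) (ex : option (fq G)) :
  (forall q o, ft (j q) o =
     (if (ft q o).1 is Some q' then Some (j q') else ex, (ft q o).2)) ->
  forall q s s' n, runs q s s' n ->
  if ex is Some p then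
    forall s'' m, runs p s' s'' m -> runs (j q) s s'' (n + m)
  else runs (j q) s s' n.
Proof.
move=> jP q s s' n; elim=> {q s s' n}.
  move=> q s ok e; have jq := jP q (gtrue s); rewrite e in jq.
  case: ex jq {jP} => [p|] jq.
    move=> s'' m H; rewrite add1n; apply: (@runs_next _ _ p); rewrite ?jq //.
  have -> : (ft q (gtrue s)).2 = (ft (j q) (gtrue s)).2 by rewrite jq.
  by apply: runs_exit; rewrite jq.
move=> q q' s s' n ok e _ IH; have jq := jP q (gtrue s); rewrite e in jq.
case: ex jq {jP} IH => [p|] jq IH.
  move=> s'' m H; rewrite addSn; apply: (@runs_next _ _ (j q')); rewrite ?jq //.
  exact: IH.
by apply: (@runs_next _ _ (j q')); rewrite ?jq.
Qed.

Lemma ev_runs c s s' n : ev c s s' n -> runs (fe (frag_of c)) s s' n.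
Proof.
elim=> {c s s' n}.
- by move=> a s ok; exact: (@runs_exit (frag_of (Do a)) tt).
- move=> c1 c2 s s1 s2 n1 n2 _ H1 _ H2.
  pose G := frag_of (Seq c1 c2).
  have E1 := @runs_embed _ G inl (Some (inr (fe (frag_of c2)))) (fun _ _ => erefl) _ _ _ _ H1.
  apply: E1; exact: (@runs_embed _ G inr None (fun _ _ => erefl) _ _ _ _ H2).
- move=> g c1 c2 s s' n _ H; pose G := frag_of (If g c1 c2).
  have [gt|gf] := boolP (gtrue s g); rewrite ?gt ?(negbTE gf) in H.
    apply: (@runs_next G _ (Some (inl (fe (frag_of c1))))) => //=; first by rewrite gt.
    exact: (@runs_embed _ G (fun q => Some (inl q)) None (fun _ _ => erefl) _ _ _ _ H).
  apply: (@runs_next G _ (Some (inr (fe (frag_of c2))))) => //=; first by rewrite (negbTE gf).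
  exact: (@runs_embed _ G (fun q => Some (inr q)) None (fun _ _ => erefl) _ _ _ _ H).
- move=> g c s gf; apply: (@runs_exit (frag_of (While g c)) None) => //=.
  by rewrite (negbTE gf).
- move=> g c s s1 s2 n1 n2 gt _ H1 _ H2; pose G := frag_of (While g c).
  apply: (@runs_next G _ (Some (fe (frag_of c)))) => //=; first by rewrite gt.
  exact: (@runs_embed _ G Some (Some None) (fun _ _ => erefl) _ _ _ _ H1 _ _ H2).
Qed.

Definition areg (a : act) := match a with Inc r | Dec r => r | _ => 0 end.

Fixpoint maxreg (c : cmd) : nat :=
  match c with
  | Do a => areg a
  | Seq c1 c2 | If _ c1 c2 => maxn (maxreg c1) (maxreg c2)
  | While _ c => maxreg c
  end.

Lemma ft_areg c q o : areg (ft (f := frag_of c) q o).2 <= maxreg c.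
Proof.
elim: c q o => [a|c1 I1 c2 I2|g c1 I1 c2 I2|g c I] //=.
- by move=> [q|q] o /=; [have := I1 q o|have := I2 q o]; lia.
- by move=> [[q|q]|] o //=; [have := I1 q o|have := I2 q o]; lia.
- by move=> [q|] o //=.
Qed.

End Commands.

Arguments Nop {B}. Arguments Inc {B}. Arguments Dec {B}. Arguments MvL {B}. Arguments MvR {B}.
Arguments NonZero {A}. Arguments State {B}.

(** * Compilation of counter programs to Turing machines *)

Section Simulation.
Variables (A B : finType) (c : cmd A B).
Let F := frag_of c.
Let K := (maxreg c).+1.

Let mark : cell A B unit := Some (inr tt).

(** Tape [0] holds the input, tape [r.+1] the counter [r < K], and the last of the [K.+2] tapes the
    output. *)
Definition creg (r : nat) : 'I_K.+2 := inord r.+1.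

Definition symbol (x : cell A B unit) : option A :=
  if x is Some (inl (inl a)) then Some a else None.

Definition cobs (x : 'I_K.+2 -> cell A B unit) (g : guard A) : bool :=
  match g with
  | NonZero r => (r < K) && (x (creg r) != mark)
  | Reads P => P (symbol (x ord0))
  end.

(** Emitting writes and moves left, so the output word grows to the left like the list [emitted].
    [Dec] stops at the mark, which matches the truncated predecessor. *)
Definition cact (a : act B) (x : 'I_K.+2 -> cell A B unit) (i : 'I_K.+2) :
    cell A B unit * direction :=
  match a with
  | Nop => (x i, Stay)
  | Inc r => (x i, if i == creg r then MoveRight else Stay)
  | Dec r => (x i, if (i == creg r) && (x i != mark) then MoveLeft else Stay)
  | MvL => (x i, if i == ord0 then MoveLeft else Stay)
  | MvR => (x i, if i == ord0 then MoveRight else Stay)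
  | Emit b => if i == ord_max then (Some (inl (inr b)), MoveLeft) else (x i, Stay)
  end.

(** The three states of ['I_3] write the marks at the bottom of the counters, move the output head
    right onto the first emitted symbol, and halt; hence the two steps beyond [n] in
    [ev_machine]. *)
Definition cdelta (q : 'I_3 + fq F) (x : {ffun 'I_K.+2 -> cell A B unit}) :
    ('I_3 + fq F) * ('I_K.+2 -> cell A B unit * direction) :=
  match q with
  | inl i => if val i == 0 then
      (inr (fe F), fun i => if (i == ord0) || (i == ord_max) then (x i, Stay)
                            else (mark, Stay))
      else (inl (inord 2), fun i => (x i, if i == ord_max then MoveRight else Stay))
  | inr q => let r := ft q (cobs x) in
      (if r.1 is Some q' then inr q' else inl (inord 1), cact r.2 x)
  end.

Definition cmachine : machine A B :=
  @Machine A B unit ('I_3 + fq F)%type K.+1 (inl ord0)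
    (fun q => if q is inl i then val i == 2 else false) cdelta.

Definition cellat (w : seq A) i : cell A B unit :=
  omap (fun a => inl (inl a)) (onth w i).

Definition inrep w p (u : tape A B unit) :=
  let: (l, x, r) := u in
  [/\ l = [seq cellat w i | i <- rev (iota 0 p)], x = cellat w p &
      forall j, nth None r j = cellat w (p + j).+1].

(* The value of a counter is the distance between the head and the mark at the bottom. *)
Definition ctrrep v (u : tape A B unit) :=
  let: (l, x, r) := u in
  x :: l = rcons (nseq v None) mark /\ exists k, r = nseq k None.

Definition rep w (s : state B) (t : 'I_K.+2 -> tape A B unit) :=
  [/\ inrep w (hpos s) (t ord0),
      forall r, r < K -> ctrrep (ctr s r) (t (creg r)),
      forall r, K <= r -> ctr s r = 0 &
      t ord_max = ([::], None, [seq Some (inl (inr b)) | b <- emitted s])].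

Lemma cregK r : r < K -> val (creg r) = r.+1.
Proof. by move=> h; rewrite /creg /= inordK //; lia. Qed.

Lemma creg_eq r r' : r < K -> r' < K -> (creg r == creg r') = (r == r').
Proof. by move=> h h'; rewrite -val_eqE /= !cregK. Qed.

Lemma creg_neq r : r < K -> (creg r == ord0) = false /\ (creg r == ord_max) = false.
Proof. by move=> h; rewrite -!val_eqE /= !cregK //; split=> //; lia. Qed.

Lemma ctrrep_zero v u : ctrrep v u -> (u.1.2 != mark) = (0 < v).
Proof. by case: u => [[l x] r] /= [+ _]; case: v => [|v] [-> _]. Qed.

Lemma inrep_symbol w p u : inrep w p u -> symbol u.1.2 = onth w p.
Proof. by case: u => [[l x] r] /= [_ -> _]; rewrite /cellat; case: (onth w p). Qed.

Lemma rep_obs w s t : rep w s t ->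
  cobs [ffun i => (t i).1.2] = gtrue w s.
Proof.
move=> [hi hc hz ho]; apply: boolp.funext => -[r|P] /=.
  have [rK|rK] := ltnP r K; first by rewrite ffunE (ctrrep_zero (hc _ rK)).
  by rewrite hz.
by rewrite ffunE (inrep_symbol hi).
Qed.

Lemma rev_iotaS h : rev (iota 0 h.+1) = h :: rev (iota 0 h).
Proof. by rewrite -addn1 iotaD rev_cat add0n. Qed.

Lemma write_stay (u : tape A B unit) : write_move u (u.1.2, Stay) = u.
Proof. by case: u => [[]]. Qed.

Lemma rep_act w s t a : rep w s t -> areg a < K -> act_ok a s ->
  rep w (doact a s)
    (fun i => write_move (t i) (cact a [ffun i => (t i).1.2] i)).
Proof.
case: s => h f o [/= hi hc hz ho] aK ok.
have ff i : write_move (t i) ([ffun i => (t i).1.2] i, Stay) = t i.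
  by rewrite ffunE write_stay.
case: a aK ok => [|r|r|||b] /= aK ok.
- by split=> /=; rewrite ?ff // => r rK; rewrite ff; exact: hc.
- have [r0 rm] := creg_neq aK; split=> /=.
  + by rewrite eq_sym r0 ff.
  + move=> r' rK'; rewrite creg_eq // /upd; case: eqP => [->|_]; last by rewrite ff; exact: hc.
    rewrite ffunE; move: (hc _ aK); case: (t _) => [[l x] r''] /= [e [k ->]].
    by rewrite e; split; [case: k | exists k.-1; case: k].
  + by move=> r' Kr; rewrite /upd; case: eqP => [?|_]; [lia|exact: hz].
  + by rewrite eq_sym rm ff ho.
- have [r0 rm] := creg_neq aK; split=> /=.
  + by rewrite eq_sym r0 ff.
  + move=> r' rK'; rewrite creg_eq // /upd; case: eqP => [->|_] /=; last by rewrite ff; exact: hc.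
    rewrite ffunE; have := hc _ aK; have := ctrrep_zero (hc _ aK).
    case: (t _) => [[l x] r''] /= -> [e [k ->]].
    case: (f r) e => [|v] /= e; first by split=> //; exists k.
    by case: e => -> ->; split; [case: v | exists k.+1].
  + by move=> r' Kr; rewrite /upd; case: eqP => [?|_]; [lia|exact: hz].
  + by rewrite eq_sym rm /= ff ho.
- split=> /=; rewrite ?ff //; last by move=> r rK; have [-> _] := creg_neq rK; rewrite ff; exact: hc.
  rewrite ffunE; case: h ok hi => // h _; case: (t ord0) => [[l x] r] [-> -> hr].
  rewrite rev_iotaS /=; split=> //.
  by case=> [|j] /=; rewrite ?addn0 // hr -addSnnS.
- split=> /=; rewrite ?ff //; last by move=> r rK; have [-> _] := creg_neq rK; rewrite ff; exact: hc.
  rewrite ffunE; case: (t ord0) hi => [[l x] r] [-> -> hr].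
  rewrite /write_move /inrep rev_iotaS /=; split=> //.
    by rewrite -nth0 hr addn0.
  by move=> j; rewrite nth_behead hr addnS.
- split=> //=; first by rewrite ff.
    by move=> r rK; have [_ ->] := creg_neq rK; rewrite ff; exact: hc.
  by rewrite eqxx ho.
Qed.

Lemma runs_steps w q s s' n : @runs A B w F q s s' n -> forall t, rep w s t ->
  exists2 t', rep w s' t' &
    iter n (@step A B cmachine) (inr q, t) = (inl (inord 1), t').
Proof.
elim=> {q s s' n}.
  move=> q s ok e t rt; eexists; first by apply: (rep_act rt _ ok); exact: ft_areg.
  by rewrite /= /step /= (rep_obs rt) e.
move=> q q' s s' n ok e _ IH t rt.
have [t' rt' H] := IH _ (rep_act rt (ft_areg _ _) ok).
exists t' => //; rewrite iterSr /= -H; congr iter.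
by rewrite /step /= (rep_obs rt) e.
Qed.

Lemma read_outputK (o : seq B) :
  read_output [seq Some (inl (inr b)) : cell A B unit | b <- o] = o.
Proof. by elim: o => //= b o ->. Qed.

Lemma ev_machine w s' n :
  ev w c (State 0 (fun=> 0) [::]) s' n ->
  let C := iter n.+2 (@step A B cmachine) (initial cmachine w) in
  halting C.1 /\ output C = emitted s'.
Proof.
move=> /ev_runs H; rewrite iterS iterSr.
set C1 := step (initial _ _).
have [t rt C1E] : exists2 t, rep w (State 0 (fun=> 0) [::]) t & C1 = (inr (fe F), t).
  eexists; last by rewrite /C1 /step.
  split=> /=.
  - rewrite ffunE /=; split=> //.
      by rewrite /cellat; case: (w).
    move=> j; rewrite /cellat; case: (w) => [|a w']; rewrite /= ?nth_nil //.
    by elim: w' j => [|x w' IH] [|j] //=; rewrite IH.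
  - by move=> r rK; have [-> ->] := creg_neq rK; split=> //=; exists 0.
  - by [].
  - by rewrite eqxx ffunE.
have [t' [_ _ _ ht] e] := runs_steps H rt; rewrite C1E e.
rewrite /step /= inordK //=; split; first by rewrite inordK.
rewrite /output /= eqxx ht /=.
by case: (emitted s') => //= b o; rewrite read_outputK.
Qed.
End Simulation.

End CounterPrograms.

Import CounterPrograms.

(** * Functions computable with polynomially bounded counters *)

Module Computable.

Local Open Scope nat_scope.

Section Costs.
Variables (A B : finType) (w : seq A).

Definition evle (c : cmd A B) s s' t := exists2 n, n <= t & ev w c s s' n.

Lemma evle_do a s : act_ok a s -> evle (Do A a) s (doact a s) 1.
Proof. by move=> h; exists 1 => //; constructor. Qed.

Lemma evle_seq c1 c2 s s1 s2 t1 t2 : evle c1 s s1 t1 -> evle c2 s1 s2 t2 ->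
  evle (Seq c1 c2) s s2 (t1 + t2).
Proof.
move=> [n1 le1 e1] [n2 le2 e2]; exists (n1 + n2); first exact: leq_add.
exact: ev_seq e1 e2.
Qed.

Lemma evle_if g c1 c2 s s' t : evle (if gtrue w s g then c1 else c2) s s' t ->
  evle (If g c1 c2) s s' t.+1.
Proof. by move=> [n le e]; exists n.+1 => //; constructor. Qed.

Lemma evle_eq c s s1 s2 t1 t2 : evle c s s1 t1 -> s1 = s2 -> t1 <= t2 -> evle c s s2 t2.
Proof. by move=> [n le e] <- le'; exists n => //; exact: leq_trans le le'. Qed.

(** The states are indexed by what remains in the loop counter, so an iteration leads from [st i.+1]
    to [st i]. *)
Lemma evle_count r body (st : nat -> state B) (cost : nat -> nat) N :
  (forall i, i <= N -> ctr (st i) r = i) ->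
  (forall i, i < N -> evle body (st i.+1) (st i) (cost i)) ->
  evle (While (NonZero r) body) (st N) (st 0) (1 + \sum_(0 <= i < N) (cost i).+1).
Proof.
elim: N => [|N IH] cr bd.
  by rewrite big_geq //; exists 1 => //; constructor => /=; rewrite cr.
have [n1 le1 e1] := bd N (ltnSn N).
have [n2 le2 e2] := IH (fun i h => cr i (leqW h)) (fun i h => bd i (leqW h)).
exists (n1 + n2).+1; last by apply: ev_loop e1 e2; rewrite /= cr.
by rewrite big_nat_recr //=; lia.
Qed.

End Costs.

Ltac zap Z := repeat match type of Z with
  forall r, _ -> ?g r = 0 => match goal with |- context [g ?x] =>
    rewrite (Z x ltac:(lia)) end end.

Ltac updt0 := apply: boolp.funext => ?; rewrite /upd /=; repeat (case: eqP => ?);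
  subst; try lia; auto.

Ltac updt Z := apply: boolp.funext => ?; rewrite /upd /=; repeat (case: eqP => ?);
  subst; try lia; zap Z; try lia; auto.

Definition move_reg (A B : finType) r1 r2 : cmd A B :=
  While (NonZero r1) (Seq (Do A (Dec r1)) (Do A (Inc r2))).

Definition clear_reg (A B : finType) r : cmd A B := While (NonZero r) (Do A (Dec r)).

Lemma evle_move (A B : finType) (w : seq A) r1 r2 h f (o : seq B) : r1 != r2 ->
  evle w (move_reg A B r1 r2) (State h f o)
    (State h (upd (upd f r2 (f r2 + f r1)) r1 0) o) (1 + f r1 * 3).
Proof.
move=> /eqP ne.
pose st i := State h (upd (upd f r2 (f r2 + (f r1 - i))) r1 i) o.
have := @evle_count A B w r1 (Seq (Do A (Dec r1)) (Do A (Inc r2))) st (fun=> 2) (f r1).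
rewrite sum_nat_const_nat subn0 /st subnn subn0 => H.
have -> : State h f o = State h (upd (upd f r2 (f r2 + 0)) r1 (f r1)) o.
  by congr State; updt0.
apply: H => [i _|i le]; first by rewrite /= /upd eqxx.
apply: evle_eq (evle_seq (evle_do _ _) (evle_do _ _)) _ _ => //=.
by congr State; updt0.
Qed.

Lemma evle_clear (A B : finType) (w : seq A) r h f (o : seq B) :
  evle w (clear_reg A B r) (State h f o) (State h (upd f r 0) o) (1 + f r * 2).
Proof.
pose st i := State h (upd f r i) o.
have := @evle_count A B w r (Do A (Dec r)) st (fun=> 1) (f r).
rewrite sum_nat_const_nat subn0 => H.
have -> : State h f o = st (f r) by congr State; updt0.
apply: H => [i _|i le]; first by rewrite /= /upd eqxx.
apply: evle_eq (evle_do _ _) _ _ => //=.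
by congr State; updt0.
Qed.

(** Environments in de Bruijn style: the last component is the innermost bound variable. *)
Fixpoint ctx (k : nat) : Type := if k is k'.+1 then (ctx k' * nat)%type else unit.

Fixpoint get k (m : seq nat) (f : nat -> nat) : ctx k :=
  match k with 0 => tt | k'.+1 => (get k' (behead m) f, f (head 0 m)) end.

Fixpoint csum k : ctx k -> nat :=
  match k with 0 => fun _ => 0 | k'.+1 => fun c => csum c.1 + c.2 end.

Lemma get_upd k m f r v d : size m = k -> all (ltn^~ d) m -> d <= r ->
  get k m (upd f r v) = get k m f.
Proof.
elim: k m => [|k IH] [|x m] //= [sm] /andP[xd am] dr.
by rewrite IH // /upd; case: eqP => // ?; lia.
Qed.

Section Poly.
Variable A : finType.
Implicit Types w : seq A.

Definition sz k w (c : ctx k) := (size w + csum c).+1.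

(** Polynomial in the length of the word and in the values of the variables. In the empty context
    only the length is left, and [pbd_bind] eliminates a variable whose range is bounded. *)
Definition pbd k (t : seq A -> ctx k -> nat) :=
  exists a e, forall w c, t w c <= a * sz w c ^ e.

Lemma pbd_le k (t t' : seq A -> ctx k -> nat) :
  (forall w c, t w c <= t' w c) -> pbd t' -> pbd t.
Proof. by move=> le [a [e h]]; exists a, e => w c; exact: leq_trans (le w c) (h w c). Qed.

Lemma pbd_const k n : pbd (fun w (c : ctx k) => n).
Proof. by exists n, 0 => w c; rewrite expn0 muln1. Qed.

Lemma pbd_add k (t t' : seq A -> ctx k -> nat) :
  pbd t -> pbd t' -> pbd (fun w c => t w c + t' w c).
Proof.
move=> [a [e h]] [a' [e' h']]; exists (a + a'), (e + e') => w c.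
have s0 : 0 < sz w c by [].
apply: leq_trans (leq_add (h w c) (h' w c)) _; rewrite mulnDl leq_add //;
  by rewrite leq_mul // leq_pexp2l // ?leq_addr ?leq_addl.
Qed.

Lemma pbd_mul k (t t' : seq A -> ctx k -> nat) :
  pbd t -> pbd t' -> pbd (fun w c => t w c * t' w c).
Proof.
move=> [a [e h]] [a' [e' h']]; exists (a * a'), (e + e') => w c.
by rewrite expnD mulnACA leq_mul.
Qed.

Lemma pbd_sz k : pbd (@sz k).
Proof. by exists 1, 1 => w c; rewrite mul1n expn1. Qed.

Lemma pbd_exp k (t : seq A -> ctx k -> nat) e : pbd t -> pbd (fun w c => t w c ^ e).
Proof.
move=> h; elim: e => [|e IH]; first exact: pbd_const.
by apply: pbd_le (pbd_mul h IH) => w c; rewrite expnS.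
Qed.

Lemma pbd_weak k (t : seq A -> ctx k -> nat) : pbd t ->
  @pbd k.+1 (fun w c => t w c.1).
Proof.
move=> [a [e h]]; exists a, e => w c; apply: leq_trans (h _ _) _.
by rewrite leq_mul //; case: e {h} => // e; rewrite leq_exp2r // /sz /=; lia.
Qed.

Lemma pbd_bind k (u : seq A -> ctx k.+1 -> nat) (n : seq A -> ctx k -> nat) :
  pbd u -> pbd n ->
  exists2 b, pbd b & forall w c i, i <= n w c -> u w (c, i) <= b w c.
Proof.
move=> [a [e h]] hn; exists (fun w c => a * (sz w c + n w c) ^ e).
  by apply: pbd_mul (pbd_const _ _) (pbd_exp _ (pbd_add (pbd_sz _) hn)).
move=> w c i le; apply: leq_trans (h _ _) _; rewrite leq_mul //.
by case: e {h} => // e; rewrite leq_exp2r // /sz /=; lia.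
Qed.

Lemma pbd_sum k (u : seq A -> ctx k.+1 -> nat) (n : seq A -> ctx k -> nat) :
  pbd u -> pbd n -> pbd (fun w c => \sum_(0 <= i < n w c) u w (c, i)).
Proof.
move=> hu hn; have [b hb ub] := pbd_bind hu hn.
apply: pbd_le (pbd_mul hn hb) => w c.
rewrite -[X in X * _]subn0 -sum_nat_const_nat [leqLHS]big_nat [leqRHS]big_nat.
by apply: leq_sum => i /andP[_ /ltnW]; exact: ub.
Qed.

End Poly.

Section Exprs.
Variables (A B : finType).
Implicit Types (w : seq A).

(* The arguments are in the registers [m]; the registers from [d] on are free, and the result is
   left in [d]. *)
Definition computes k (f : seq A -> ctx k -> nat) (p : seq nat -> nat -> cmd A B)
    (t : seq A -> ctx k -> nat) :=
  forall w m d g (o : seq B), size m = k -> all (ltn^~ d) m ->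
    (forall r, d <= r -> g r = 0) ->
    evle w (p m d) (State 0 g o) (State 0 (upd g d (f w (get k m g))) o)
      (t w (get k m g)).

(** Boundedness of the values is recorded along with the program because values serve as ranges of
    loops, whose cost is a sum over the range. *)
Definition E k (f : seq A -> ctx k -> nat) :=
  pbd f /\ exists p t, pbd t /\ computes f p t.

Lemma E_pbd k (f : seq A -> ctx k -> nat) : E f -> pbd f.
Proof. by case. Qed.

Lemma E_ext k (f g : seq A -> ctx k -> nat) : (forall w c, f w c = g w c) -> E f -> E g.
Proof.
by move=> fg; suff -> : f = g by []; apply: boolp.funext => w; apply: boolp.funext.
Qed.

Lemma all_lt d m r : all (ltn^~ d) m -> d <= r -> all (ltn^~ r) m.
Proof. by move=> /allP h dr; apply/allP => x /h /= lt; exact: leq_trans lt dr. Qed.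

Lemma E_one k : E (fun w (c : ctx k) => 1).
Proof.
split; first exact: pbd_const.
exists (fun m d => Do A (Inc d)), (fun _ _ => 1); split; first exact: pbd_const.
move=> w m d g o _ _ Z; apply: evle_eq (evle_do _ _) _ _ => //=.
by congr State; updt Z.
Qed.

(** Reading a counter empties it, so it is unloaded into both [d] and [d.+1] and restored from the
    latter. *)
Lemma E_var0 k : @E k.+1 (fun w c => c.2).
Proof.
have pb : @pbd A k.+1 (fun w c => c.2).
  by apply: pbd_le (pbd_sz _ _) => w c; rewrite /sz /=; lia.
split=> //; exists (fun m d => let r := head 0 m in
  Seq (While (NonZero r) (Seq (Do A (Dec r)) (Seq (Do A (Inc d)) (Do A (Inc d.+1)))))
      (move_reg A B d.+1 r)), (fun w c => 1 + c.2 * 4 + (1 + c.2 * 3)).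
split; first by do ?[exact: pbd_const|exact: pb|apply: pbd_add|apply: pbd_mul].
move=> w [|r m] d g o //= [sm] /andP[rd am] Z.
pose st i := State 0 (upd (upd (upd g d (g r - i)) d.+1 (g r - i)) r i) o.
have H := @evle_count A B w r (Seq (Do A (Dec r)) (Seq (Do A (Inc d)) (Do A (Inc d.+1))))
  st (fun=> 3) (g r).
have e : State 0 g o = st (g r) by congr State; rewrite subnn; updt Z.
rewrite e; apply: evle_seq.
  apply: evle_eq (H _ _) erefl _; last by rewrite sum_nat_const_nat subn0.
    by move=> i _; rewrite /= /upd eqxx.
  move=> i le.
  apply: evle_eq (evle_seq (evle_do _ _) (evle_seq (evle_do _ _) (evle_do _ _))) _ _ => //=.
  by congr State; updt Z.
have ne : d.+1 != r by lia.
apply: evle_eq (evle_move _ _ _ _ ne) _ _ => //=.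
  by congr State; rewrite subn0; updt Z.
by rewrite /upd; do ?case: eqP => ?; lia.
Qed.

Lemma E_weak k (f : seq A -> ctx k -> nat) : E f -> @E k.+1 (fun w c => f w c.1).
Proof.
move=> [pf [p [t [pt c]]]]; split; first exact: pbd_weak.
exists (fun m d => p (behead m) d), (fun w c => t w c.1); split; first exact: pbd_weak.
by move=> w [|r m] d g o //= [sm] /andP[_ am]; exact: c.
Qed.

Lemma E_add k (f1 f2 : seq A -> ctx k -> nat) : E f1 -> E f2 ->
  E (fun w c => f1 w c + f2 w c).
Proof.
move=> [pf1 [p1 [t1 [pt1 c1]]]] [pf2 [p2 [t2 [pt2 c2]]]].
split; first exact: pbd_add.
exists (fun m d => Seq (p1 m d) (Seq (p2 m d.+1) (move_reg A B d.+1 d))),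
  (fun w c => t1 w c + (t2 w c + (1 + f2 w c * 3))).
split; first by do ?[exact: pbd_const|assumption|apply: pbd_add|apply: pbd_mul].
move=> w m d g o sm am Z; apply: evle_seq; first exact: c1.
have Z1 r : d.+1 <= r -> upd g d (f1 w (get k m g)) r = 0.
  by move=> h; rewrite /upd; case: eqP => ?; [lia|apply: Z; lia].
have H2 := c2 w m d.+1 _ o sm (all_lt am (leqnSn _)) Z1.
rewrite (get_upd _ _ sm am) // in H2.
apply: evle_seq; first exact: H2.
have ne : d.+1 != d by lia.
apply: evle_eq (evle_move _ _ _ _ ne) _ _ => //=.
  by congr State; updt Z.
by rewrite /upd; do ?case: eqP => ?; lia.
Qed.

Lemma E_sub k (f1 f2 : seq A -> ctx k -> nat) : E f1 -> E f2 ->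
  E (fun w c => f1 w c - f2 w c).
Proof.
move=> [pf1 [p1 [t1 [pt1 c1]]]] [pf2 [p2 [t2 [pt2 c2]]]].
split; first by apply: pbd_le pf1 => w c; lia.
exists (fun m d => Seq (p1 m d) (Seq (p2 m d.+1)
    (While (NonZero d.+1) (Seq (Do A (Dec d.+1)) (Do A (Dec d)))))),
  (fun w c => t1 w c + (t2 w c + (1 + f2 w c * 3))).
split; first by do ?[exact: pbd_const|assumption|apply: pbd_add|apply: pbd_mul].
move=> w m d g o sm am Z; apply: evle_seq; first exact: c1.
set v1 := f1 w _; set v2 := f2 w _.
have Z1 r : d.+1 <= r -> upd g d v1 r = 0.
  by move=> h; rewrite /upd; case: eqP => ?; [lia|apply: Z; lia].
have H2 := c2 w m d.+1 _ o sm (all_lt am (leqnSn _)) Z1.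
rewrite (get_upd _ _ sm am) // -/v2 in H2.
apply: evle_seq; first exact: H2.
pose st i := State 0 (upd (upd g d (v1 - (v2 - i))) d.+1 i) o.
have -> : State 0 (upd (upd g d v1) d.+1 v2) o = st v2.
  by congr State; rewrite subnn subn0.
apply: evle_eq (@evle_count A B w d.+1 _ st (fun=> 2) v2 _ _) _ _ => //.
- by move=> i _; rewrite /= /upd eqxx.
- move=> i le; apply: evle_eq (evle_seq (evle_do _ _) (evle_do _ _)) _ _ => //=.
  by congr State; updt Z.
- by congr State; rewrite subn0; updt Z.
- by rewrite sum_nat_const_nat subn0.
Qed.

Lemma E_sum k (n : seq A -> ctx k -> nat) (g : seq A -> ctx k -> nat -> nat) :
  E n -> @E k.+1 (fun w c => g w c.1 c.2) ->
  E (fun w c => \sum_(0 <= i < n w c) g w c i).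
Proof.
move=> [pn [p1 [t1 [pt1 c1]]]] [pg [p2 [t2 [pt2 c2]]]].
split; first exact: (pbd_sum pg pn).
pose cost w (c : ctx k.+1) := (1 + (t2 w c + (1 + g w c.1 c.2 * 3))).+1.
(* The loop counter [d.+1] is also the bound variable of the body; as it is decremented first, the
   body sees the indices from [n - 1] down to [0]. *)
exists (fun m d => Seq (p1 m d) (Seq (move_reg A B d d.+1)
    (While (NonZero d.+1) (Seq (Do A (Dec d.+1))
       (Seq (p2 (d.+1 :: m) d.+2) (move_reg A B d.+2 d)))))),
  (fun w c => t1 w c + (1 + n w c * 3 + (1 + \sum_(0 <= i < n w c) cost w (c, i)))).
split.
  have pc : pbd cost.
    apply: (@pbd_le _ _ _ (fun w c => 1 + (1 + (t2 w c + (1 + g w c.1 c.2 * 3))))) => //.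
    by do ?[exact: pbd_const|assumption|apply: pbd_add|apply: pbd_mul].
  by do ?[exact: pbd_const|assumption|exact: (pbd_sum pc pn)|apply: pbd_add|apply: pbd_mul].
move=> w m d f o sm am Z; apply: evle_seq; first exact: c1.
set c := get k m f; set N := n w c.
have ne : d != d.+1 by lia.
have Hm := @evle_move A B w d d.+1 0 (upd f d N) o ne.
apply: evle_seq; first by apply: evle_eq Hm erefl _; rewrite /upd eqxx.
pose st i := State 0 (upd (upd f d (\sum_(i <= j < N) g w c j)) d.+1 i) o.
have -> : State 0 (upd (upd (upd f d N) d.+1 (upd f d N d.+1 + upd f d N d)) d 0) o = st N.
  by congr State; rewrite big_geq //; updt Z.
apply: evle_eq (@evle_count A B w d.+1 _ st (fun i => (cost w (c, i)).-1) N _ _) _ _ => //.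
- by move=> i _; rewrite /= /upd eqxx.
- move=> i le; apply: evle_seq; first exact: evle_do.
  pose f' := upd (upd f d (\sum_(i.+1 <= j < N) g w c j)) d.+1 i.
  have -> : doact (Dec d.+1) (st i.+1) = State 0 f' o.
    by rewrite /= /f'; congr State; updt Z.
  have Z' r : d.+2 <= r -> f' r = 0.
    by move=> h; rewrite /f' /upd; do ?case: eqP => ?; try lia; apply: Z; lia.
  have sm' : size (d.+1 :: m) = k.+1 by rewrite /= sm.
  have am' : all (ltn^~ d.+2) (d.+1 :: m) by rewrite /= ltnSn (all_lt am) //; lia.
  have := c2 w _ d.+2 f' o sm' am' Z'.
  have -> : get k.+1 (d.+1 :: m) f' = (c, i).
    rewrite /= /f' !(get_upd _ _ sm am) ?leqnSn //=.
    by rewrite /upd eqxx.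
  move=> H; apply: evle_seq; first exact: H.
  have ne' : d.+2 != d by lia.
  apply: evle_eq (evle_move _ _ _ _ ne') _ _ => //=.
    by congr State; rewrite /f' (big_ltn le); updt Z.
  by rewrite /f' /upd; do ?case: eqP => ?; lia.
- by congr State; updt Z.
Qed.

(** Iteration can leave the polynomially bounded functions, hence the bound [b] on all iterates.
    Register [d] accumulates, [d.+1] counts down and controls the loop, [d.+2] counts up and is the
    index given to [F]. *)
Lemma E_iteri k (n a : seq A -> ctx k -> nat) (F : seq A -> ctx k -> nat -> nat -> nat)
    (b : seq A -> ctx k -> nat) :
  E n -> E a -> @E k.+2 (fun w c => F w c.1.1 c.1.2 c.2) -> pbd b ->
  (forall w c j, j <= n w c -> iteri j (F w c) (a w c) <= b w c) ->
  E (fun w c => iteri (n w c) (F w c) (a w c)).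
Proof.
move=> [pn [p1 [t1 [pt1 c1]]]] [pa [p2 [t2 [pt2 c2]]]] [pF [p3 [t3 [pt3 c3]]]] pb ib.
split; first by apply: pbd_le pb => w c; exact: ib.
have [u1 pu1 h1] := pbd_bind pt3 (pbd_weak pb).
have [u pu h2] := pbd_bind pu1 pn.
pose cost w (c : ctx k) := (1 + (u w c + (1 + b w c * 2 + (1 + b w c * 3 + 1)))).
exists (fun m d => Seq (p1 m d.+1) (Seq (p2 m d.+2) (Seq (move_reg A B d.+2 d)
    (Seq (While (NonZero d.+1) (Seq (Do A (Dec d.+1))
       (Seq (p3 (d :: d.+2 :: m) d.+3) (Seq (clear_reg A B d)
          (Seq (move_reg A B d.+3 d) (Do A (Inc d.+2)))))))
     (clear_reg A B d.+2))))),
  (fun w c => t1 w c + (t2 w c + (1 + a w c * 3 + ((1 + n w c * (1 + cost w c)) +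
     (1 + n w c * 2))))).
split.
  by do ?[exact: pbd_const|assumption|apply: pbd_add|apply: pbd_mul].
move=> w m d f o sm am Z.
have H1 := c1 w m d.+1 f o sm (all_lt am (leqnSn _)) (fun r h => Z r (ltnW h)).
set c := get k m f in H1 *; set N := n w c in H1 *.
apply: evle_seq; first exact: H1.
have Z1 r : d.+2 <= r -> upd f d.+1 N r = 0.
  by move=> h; rewrite /upd; case: eqP => ?; [lia|apply: Z; lia].
have H2 := c2 w m d.+2 _ o sm (all_lt am (leqW (leqnSn _))) Z1.
rewrite (get_upd _ _ sm am) // -/c in H2.
apply: evle_seq; first exact: H2.
have ne : d.+2 != d by lia.
apply: evle_seq.
  by apply: evle_eq (evle_move _ _ _ _ ne) erefl _ => /=; rewrite /upd eqxx.
pose st i := State 0 (upd (upd (upd f d (iteri (N - i) (F w c) (a w c))) d.+1 i)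
  d.+2 (N - i)) o.
set s0 := State 0 _ o; have -> : s0 = st N.
  by rewrite /s0 /st subnn /=; congr State; updt Z.
apply: evle_seq.
  apply: evle_eq (@evle_count A B w d.+1 _ st (fun=> cost w c) N _ _) erefl _.
  - by move=> i _; rewrite /= /upd; do ?case: eqP => ?; lia.
  - move=> i le; apply: evle_seq; first exact: evle_do.
    rewrite /=; set f' := upd _ d.+1 _; set v := iteri (N - i.+1) _ _ in f' *.
    have Z' r : d.+3 <= r -> f' r = 0.
      by move=> h; rewrite /f' /upd; do ?case: eqP => ?; try lia; apply: Z; lia.
    have sm' : size (d :: d.+2 :: m) = k.+2 by rewrite /= sm.
    have am' : all (ltn^~ d.+3) (d :: d.+2 :: m).
      by rewrite /= ltnSn (all_lt am) ?andbT //; lia.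
    have := c3 w _ d.+3 f' o sm' am' Z'.
    have -> : get k.+2 (d :: d.+2 :: m) f' = (c, N - i.+1, v).
      rewrite /= /f' !(get_upd _ _ sm am); try lia.
      by rewrite /upd !eqxx; do ?case: eqP => ?; try lia.
    have vb : v <= b w c by apply: ib; rewrite -/N; lia.
    have Fv : F w c (N - i.+1) v = iteri (N - i) (F w c) (a w c).
      by have -> : N - i = (N - i.+1).+1 by lia.
    move=> /= H; apply: evle_seq.
      apply: evle_eq H erefl _.
      by apply: leq_trans (h1 w (c, N - i.+1) v vb) (h2 _ _ _ _); rewrite -/N; lia.
    rewrite /= Fv; set v' := iteri (N - i) _ _.
    have v'b : v' <= b w c by apply: ib; rewrite -/N; lia.
    apply: evle_seq.
      apply: evle_eq (evle_clear _ _ _ _ _) erefl _.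
      by rewrite /f' /upd; do ?case: eqP => ?; lia.
    have ne' : d.+3 != d by lia.
    apply: evle_seq.
      apply: evle_eq (evle_move _ _ _ _ ne') erefl _.
      by rewrite /f' /upd; do ?case: eqP => ?; lia.
    apply: evle_eq (evle_do _ _) _ _ => //=.
    by rewrite /st -/v'; congr State; rewrite /f'; updt Z.
  - by rewrite sum_nat_const_nat subn0.
apply: evle_eq (evle_clear _ _ _ _ _) _ _ => /=.
  by congr State; rewrite subn0; updt Z.
by rewrite /upd eqxx; lia.
Qed.

(** [computes] requires the head to start and end at position 0; [d.+1] records how far it has
    moved, so that it can return. *)
Lemma E_sym k (f : seq A -> ctx k -> nat) x : E f ->
  E (fun w c => onth w (f w c) == Some x : nat).
Proof.
move=> [pf [p [t [pt c]]]].
split; first by apply: (pbd_le _ (pbd_const _ _ 1)) => w c'; exact: leq_b1.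
exists (fun m d => Seq (p m d) (Seq
   (While (NonZero d) (Seq (Do A (Dec d)) (Seq (Do A MvR) (Do A (Inc d.+1)))))
   (Seq (If (Reads (fun y => y == Some x)) (Do A (Inc d)) (Do A Nop))
   (While (NonZero d.+1) (Seq (Do A (Dec d.+1)) (Do A MvL)))))),
  (fun w c => t w c + (1 + f w c * 4 + (2 + (1 + f w c * 3)))).
split; first by do ?[exact: pbd_const|assumption|apply: pbd_add|apply: pbd_mul].
move=> w m d g o sm am Z; apply: evle_seq; first exact: c.
set N := f w _.
pose st i := State (N - i) (upd (upd g d i) d.+1 (N - i)) o.
have -> : State 0 (upd g d N) o = st N by rewrite /st subnn; congr State; updt Z.
apply: evle_seq.
  apply: evle_eq (@evle_count A B w d _ st (fun=> 3) N _ _) erefl _.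
  - by move=> i _; rewrite /= /upd; do ?case: eqP => ?; lia.
  - move=> i le.
    apply: evle_eq (evle_seq (evle_do _ _) (evle_seq (evle_do _ _) (evle_do _ _))) _ _ => //=.
    by rewrite /st; congr State; [lia|updt Z].
  - by rewrite sum_nat_const_nat subn0.
pose b := onth w N == Some x.
pose st' i := State i (upd (upd g d b) d.+1 i) o.
apply: evle_seq.
  apply: (@evle_if A B w _ _ _ _ (st' N) 1); rewrite /= subn0 -/b.
  by case eb: b; apply: evle_eq (evle_do _ _) _ _ => //=; rewrite /st' /st subn0;
    congr State; updt Z; rewrite eb.
apply: evle_eq (@evle_count A B w d.+1 _ st' (fun=> 2) N _ _) _ _.
- by move=> i _; rewrite /= /upd; do ?case: eqP => ?; lia.
- move=> i le; apply: evle_eq (evle_seq (evle_do _ _) (evle_do _ _)) _ _ => //=.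
  by rewrite /st'; congr State; updt Z.
- by rewrite -/b /st'; congr State; updt Z.
- by rewrite sum_nat_const_nat subn0.
Qed.

Lemma E_len k : E (fun w (c : ctx k) => size w).
Proof.
have pf : pbd (fun w (c : ctx k) => size w).
  by apply: pbd_le (pbd_sz _ _) => w c; rewrite /sz; lia.
split=> //; exists (fun m d => Seq
  (While (Reads isSome) (Seq (Do A MvR) (Seq (Do A (Inc d)) (Do A (Inc d.+1)))))
  (While (NonZero d.+1) (Seq (Do A (Dec d.+1)) (Do A MvL)))),
  (fun w c => 1 + size w * 4 + (1 + size w * 3)).
split; first by do ?[exact: pbd_const|assumption|apply: pbd_add|apply: pbd_mul].
move=> w m d g o sm am Z; set N := size w.
pose st i := State (N - i) (upd (upd g d (N - i)) d.+1 (N - i)) o.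
have -> : State 0 g o = st N by rewrite /st subnn; congr State; updt Z.
apply: evle_seq.
  suff : forall i, i <= N -> evle w (While (Reads isSome) (Seq (Do A MvR)
      (Seq (Do A (Inc d)) (Do A (Inc d.+1))))) (st i) (st 0) (1 + i * 4) by exact.
  elim=> [|i IH] iN.
    exists 1 => //; constructor; rewrite /= subn0 onth_default //.
  have [n le e] := IH (ltnW iN).
  exists (1 + (1 + 1) + n).+1; first by lia.
  apply: (@ev_loop A B w _ _ _ (st i) _ (1 + (1 + 1)) n _ _ e).
    rewrite /=; case: (w) @N iN {st IH e} => [|x w'] N iN; first by rewrite /N in iN.
    by rewrite onthTE; lia.
  have -> : st i = doact (Inc d.+1) (doact (Inc d) (doact MvR (st i.+1))).
    by rewrite /= /st; congr State; [lia|updt Z].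
  by apply: ev_seq; [|apply: ev_seq]; apply: ev_do.
pose st' i := State i (upd (upd g d N) d.+1 i) o.
have -> : st 0 = st' N by rewrite /st /st' subn0.
apply: evle_eq (@evle_count A B w d.+1 _ st' (fun=> 2) N _ _) _ _.
- by move=> i _; rewrite /= /upd; do ?case: eqP => ?; lia.
- move=> i le; apply: evle_eq (evle_seq (evle_do _ _) (evle_do _ _)) _ _ => //=.
  by rewrite /st'; congr State; updt Z.
- by rewrite /st'; congr State; updt Z.
- by rewrite sum_nat_const_nat subn0.
Qed.

(* Words are emitted from right to left. *)
Definition P k (f : seq A -> ctx k -> seq B) :=
  exists (p : seq nat -> nat -> cmd A B) t, pbd t /\
  forall w m d g (o : seq B), size m = k -> all (ltn^~ d) m ->
    (forall r, d <= r -> g r = 0) ->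
    evle w (p m d) (State 0 g o) (State 0 g (f w (get k m g) ++ o)) (t w (get k m g)).

Lemma P_ext k (f g : seq A -> ctx k -> seq B) : (forall w c, f w c = g w c) -> P f -> P g.
Proof.
by move=> fg; suff -> : f = g by []; apply: boolp.funext => w; apply: boolp.funext.
Qed.

Lemma P_nil k : P (fun w (c : ctx k) => [::]).
Proof.
exists (fun m d => Do A Nop), (fun _ _ => 1); split; first exact: pbd_const.
by move=> w m d g o _ _ _; exact: evle_do.
Qed.

Lemma P_emit k b : P (fun w (c : ctx k) => [:: b]).
Proof.
exists (fun m d => Do A (Emit b)), (fun _ _ => 1); split; first exact: pbd_const.
by move=> w m d g o _ _ _; exact: evle_do.
Qed.

Lemma P_cat k (f1 f2 : seq A -> ctx k -> seq B) : P f1 -> P f2 ->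
  P (fun w c => f1 w c ++ f2 w c).
Proof.
move=> [p1 [t1 [pt1 h1]]] [p2 [t2 [pt2 h2]]].
exists (fun m d => Seq (p2 m d) (p1 m d)), (fun w c => t2 w c + t1 w c).
split; first exact: pbd_add.
move=> w m d g o sm am Z; rewrite -catA.
by apply: evle_seq; [exact: h2|exact: h1].
Qed.

(** Counting down produces the pieces in the order that emission from right to left requires. *)
Lemma P_for k (n : seq A -> ctx k -> nat) (f : seq A -> ctx k -> nat -> seq B) :
  E n -> @P k.+1 (fun w c => f w c.1 c.2) ->
  P (fun w c => flatten [seq f w c i | i <- iota 0 (n w c)]).
Proof.
move=> [pn [p1 [t1 [pt1 c1]]]] [p2 [t2 [pt2 h2]]].
pose cost w (c : ctx k.+1) := (1 + t2 w c).+1.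
exists (fun m d => Seq (p1 m d) (While (NonZero d)
    (Seq (Do A (Dec d)) (p2 (d :: m) d.+1)))),
  (fun w c => t1 w c + (1 + \sum_(0 <= i < n w c) cost w (c, i))).
split.
  have pc : pbd cost.
    apply: (@pbd_le _ _ _ (fun w c => 1 + (1 + t2 w c))) => //.
    by do ?[exact: pbd_const|assumption|apply: pbd_add|apply: pbd_mul].
  by do ?[exact: pbd_const|assumption|exact: (pbd_sum pc pn)|apply: pbd_add].
move=> w m d g o sm am Z; apply: evle_seq; first exact: c1.
set c := get k m g; set N := n w c.
pose st i := State 0 (upd g d i) (flatten [seq f w c j | j <- iota i (N - i)] ++ o).
have -> : State 0 (upd g d N) o = st N by rewrite /st subnn.
apply: evle_eq (@evle_count A B w d _ st (fun i => (cost w (c, i)).-1) N _ _) _ _ => //.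
- by move=> i _; rewrite /= /upd eqxx.
- move=> i le; apply: evle_seq; first exact: evle_do.
  rewrite /=; set g' := upd _ d _.
  have Z' r : d.+1 <= r -> g' r = 0.
    by move=> h; rewrite /g' /upd; do ?case: eqP => ?; try lia; apply: Z; lia.
  have sm' : size (d :: m) = k.+1 by rewrite /= sm.
  have am' : all (ltn^~ d.+1) (d :: m) by rewrite /= ltnSn (all_lt am).
  set o' := _ ++ o; have := h2 w _ d.+1 g' o' sm' am' Z'.
  have -> : get k.+1 (d :: m) g' = (c, i).
    by rewrite /= /g' !(get_upd _ _ sm am) //= /upd !eqxx.
  move=> H; apply: evle_eq H _ (leqnn _).
  rewrite /st /o'; have -> : N - i = (N - i.+1).+1 by lia.
  by rewrite /= -catA; congr State; rewrite /g'; updt Z.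
- by rewrite /st subn0; congr State; updt Z.
Qed.

Lemma P_if k (b : seq A -> ctx k -> bool) (f1 f2 : seq A -> ctx k -> seq B) :
  E (fun w c => b w c : nat) -> P f1 -> P f2 ->
  P (fun w c => if b w c then f1 w c else f2 w c).
Proof.
move=> [pn [p [t [pt c]]]] [p1 [t1 [pt1 h1]]] [p2 [t2 [pt2 h2]]].
exists (fun m d => Seq (p m d) (If (NonZero d) (Seq (clear_reg A B d) (p1 m d)) (p2 m d))),
  (fun w c => t w c + (1 + (3 + t1 w c + t2 w c))).
split; first by do ?[exact: pbd_const|assumption|apply: pbd_add].
move=> w m d g o sm am Z; apply: evle_seq; first exact: c.
apply: evle_if; rewrite /= /upd eqxx.
case: (b w _) => /=.
  have H := evle_clear w d 0 (fun x => if x == d then 1 else g x) o.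
  have e : upd (fun x => if x == d then 1 else g x) d 0 = g by updt Z.
  rewrite e eqxx in H.
  by apply: evle_eq (evle_seq H (h1 w m d g o sm am Z)) erefl _; lia.
have -> : (fun x => if x == d then 0 else g x) = g by updt Z.
by apply: evle_eq (h2 w m d g o sm am Z) erefl _; lia.
Qed.

Theorem P_poly_time (f : seq A -> seq B) : @P 0 (fun w _ => f w) -> poly_time f.
Proof.
move=> [p [t [[a [e ht]] h]]].
(* The factor [2 ^ e] converts a power of [(size w).+1] into one of [size w], the additive constant
   covers the empty word, and 2 counts the steps added by the compilation. *)
exists (cmachine (p [::] 0)), (a * 2 ^ e + 2), e => w.
have [n le H] := h w [::] 0 (fun=> 0) [::] erefl erefl (fun _ _ => erefl).
exists n.+2; last by have := ev_machine H; rewrite /= cats0.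
have {}le := leq_trans le (ht w tt); rewrite /sz /= addn0 in le.
suff le2 : (size w).+1 ^ e <= 2 ^ e * size w ^ e + 2 ^ e.
  have := leq_mul (leqnn a) le2; nia.
case: (size w) => [|l]; first by rewrite exp1n; have := expn_gt0 2 e; lia.
rewrite -expnMn; apply: leq_trans (leq_addr _ _).
by case: e {ht le} => // e; rewrite leq_exp2r //; lia.
Qed.
End Exprs.

End Computable.

Import Computable.

(** * Arithmetic and bounded quantifiers in the class [E] *)

Module ComputableArithmetic.

Local Open Scope nat_scope.

Section Closure.
Variables (A B : finType).
Implicit Types (w : seq A).
Notation E := (@E A B _).

Lemma E_succ k (f : seq A -> ctx k -> nat) : E f -> E (fun w c => (f w c).+1).
Proof. by move=> h; apply: E_ext (E_add h (E_one _ _ _)) => w c; rewrite addn1. Qed.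

Lemma E_zero k : E (fun w (c : ctx k) => 0).
Proof. exact: E_ext (E_sub (E_one _ _ _) (E_one _ _ _)). Qed.

Lemma E_const k n : E (fun w (c : ctx k) => n).
Proof. by elim: n => [|n]; [exact: E_zero|exact: E_succ]. Qed.

Lemma E_mul k (f g : seq A -> ctx k -> nat) : E f -> E g -> E (fun w c => f w c * g w c).
Proof.
move=> hf hg; apply: E_ext (@E_sum A B k f (fun w c _ => g w c) hf (E_weak hg)) => w c.
by rewrite sum_nat_const_nat subn0.
Qed.

Lemma E_expn k (f : seq A -> ctx k -> nat) e : E f -> E (fun w c => f w c ^ e).
Proof.
move=> hf; elim: e => [|e IH]; first exact: E_const.
by apply: E_ext (E_mul hf IH) => w c; rewrite expnS.
Qed.

Lemma E_leq k (f g : seq A -> ctx k -> nat) : E f -> E g ->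
  E (fun w c => f w c <= g w c : nat).
Proof.
move=> hf hg; apply: E_ext (E_sub (E_one _ _ _) (E_sub hf hg)) => w c.
by case: leqP => h; lia.
Qed.

Lemma E_neg k (b : seq A -> ctx k -> bool) : E (fun w c => b w c : nat) ->
  E (fun w c => ~~ b w c : nat).
Proof. by move=> h; apply: E_ext (E_sub (E_one _ _ _) h) => w c; case: (b w c). Qed.

Lemma E_and k (b b' : seq A -> ctx k -> bool) : E (fun w c => b w c : nat) ->
  E (fun w c => b' w c : nat) -> E (fun w c => b w c && b' w c : nat).
Proof. by move=> h h'; apply: E_ext (E_mul h h') => w c; rewrite mulnb. Qed.

Lemma E_or k (b b' : seq A -> ctx k -> bool) : E (fun w c => b w c : nat) ->
  E (fun w c => b' w c : nat) -> E (fun w c => b w c || b' w c : nat).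
Proof.
move=> h h'; apply: E_ext (E_neg (E_and (E_neg h) (E_neg h'))) => w c.
by rewrite -negb_or negbK.
Qed.

Lemma E_imp k (b b' : seq A -> ctx k -> bool) : E (fun w c => b w c : nat) ->
  E (fun w c => b' w c : nat) -> E (fun w c => b w c ==> b' w c : nat).
Proof. by move=> h h'; apply: E_ext (E_or (E_neg h) h') => w c; rewrite implybE. Qed.

Lemma E_eqn k (f g : seq A -> ctx k -> nat) : E f -> E g ->
  E (fun w c => f w c == g w c : nat).
Proof.
move=> hf hg; apply: E_ext (E_and (E_leq hf hg) (E_leq hg hf)) => w c.
by rewrite -eqn_leq.
Qed.

Lemma E_addb k (b b' : seq A -> ctx k -> bool) : E (fun w c => b w c : nat) ->
  E (fun w c => b' w c : nat) -> E (fun w c => b w c (+) b' w c : nat).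
Proof.
by move=> h h'; apply: E_ext (E_neg (E_eqn h h')) => w c; case: (b w c); case: (b' w c).
Qed.

Lemma E_if k (b : seq A -> ctx k -> bool) (f g : seq A -> ctx k -> nat) :
  E (fun w c => b w c : nat) -> E f -> E g -> E (fun w c => if b w c then f w c else g w c).
Proof.
move=> h hf hg; apply: E_ext (E_add (E_mul h hf) (E_mul (E_neg h) hg)) => w c.
by case: (b w c); rewrite /= ?mul1n ?mul0n ?addn0.
Qed.

Lemma E_ifb k (b f g : seq A -> ctx k -> bool) :
  E (fun w c => b w c : nat) -> E (fun w c => f w c : nat) -> E (fun w c => g w c : nat) ->
  E (fun w c => (if b w c then f w c else g w c) : nat).
Proof. by move=> h hf hg; apply: E_ext (E_if h hf hg) => w c; case: (b w c). Qed.

Lemma E_all k (n : seq A -> ctx k -> nat) (b : seq A -> ctx k -> nat -> bool) :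
  E n -> @Computable.E A B k.+1 (fun w c => b w c.1 c.2 : nat) ->
  E (fun w c => all (b w c) (iota 0 (n w c)) : nat).
Proof.
move=> hn hb.
apply: E_ext (E_eqn (@E_sum A B k n (fun w c i => ~~ b w c i : nat) hn (E_neg hb))
  (E_zero _)) => w c.
rewrite sum_nat_seq_eq0 /index_iota subn0 /= ; congr nat_of_bool.
by apply: eq_all => i; case: (b w c i).
Qed.

Lemma E_has k (n : seq A -> ctx k -> nat) (b : seq A -> ctx k -> nat -> bool) :
  E n -> @Computable.E A B k.+1 (fun w c => b w c.1 c.2 : nat) ->
  E (fun w c => has (b w c) (iota 0 (n w c)) : nat).
Proof.
move=> hn hb; apply: E_ext (E_neg (@E_all k n (fun w c i => ~~ b w c i) hn (E_neg hb))).
by move=> w c; rewrite -has_predC; congr nat_of_bool; apply: eq_has => i /=; rewrite negbK.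
Qed.

(** Half of [f], rounded down, is the number of [i < f] with [2 * i + 2 <= f], a bounded sum of
    truth values. *)
Lemma E_half k (f : seq A -> ctx k -> nat) : E f -> E (fun w c => (f w c)./2).
Proof.
move=> hf.
pose g w (c : ctx k) i : nat := (i + i).+2 <= f w c.
have hg : @Computable.E A B k.+1 (fun w c => g w c.1 c.2).
  apply: E_leq; last exact: E_weak.
  by apply: E_succ; apply: E_succ; apply: E_add; exact: E_var0.
apply: E_ext (@E_sum A B k f g hf hg) => w c; rewrite /g.
suff H m : \sum_(0 <= i < m) ((i + i).+2 <= f w c : nat) = minn m (f w c)./2.
  by rewrite H; lia.
by elim: m => [|m IH]; [rewrite big_geq; lia|rewrite big_nat_recr //= IH; case: leqP; lia].
Qed.

Lemma E_minn k (f g : seq A -> ctx k -> nat) : E f -> E g -> E (fun w c => minn (f w c) (g w c)).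
Proof.
by move=> hf hg; apply: E_ext (E_sub hf (E_sub hf hg)) => w c; lia.
Qed.

End Closure.

Lemma E_weak2 (A B : finType) k (f : seq A -> ctx k -> nat) : E B f -> @E A B k.+2 (fun w c => f w c.1.1).
Proof. by move=> h; exact: (E_weak (E_weak h)). Qed.
Lemma E_weak3 (A B : finType) k (f : seq A -> ctx k -> nat) : E B f -> @E A B k.+3 (fun w c => f w c.1.1.1).
Proof. by move=> h; exact: (E_weak (E_weak2 h)). Qed.
Lemma E_var1 A B k : @E A B k.+2 (fun w c => c.1.2).
Proof. exact: (E_weak (E_var0 _ _ _)). Qed.
Lemma E_var2 A B k : @E A B k.+3 (fun w c => c.1.1.2).
Proof. exact: (E_weak (E_var1 _ _ _)). Qed.
Lemma E_var3 A B k : @E A B k.+4 (fun w c => c.1.1.1.2).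
Proof. exact: (E_weak (E_var2 _ _ _)). Qed.
Lemma E_var4 A B k : @E A B k.+1.+4 (fun w c => c.1.1.1.1.2).
Proof. exact: (E_weak (E_var3 _ _ _)). Qed.
Lemma E_var5 A B k : @E A B k.+2.+4 (fun w c => c.1.1.1.1.1.2).
Proof. exact: (E_weak (E_var4 _ _ _)). Qed.
Lemma E_var6 A B k : @E A B k.+3.+4 (fun w c => c.1.1.1.1.1.1.2).
Proof. exact: (E_weak (E_var5 _ _ _)). Qed.
Create HintDb E.
#[export] Hint Resolve E_var0 E_var1 E_var2 E_var3 E_var4 E_var5 E_var6 E_one E_zero
  E_const E_len E_sym E_add E_sub E_mul E_succ E_expn E_leq E_neg E_and E_or E_imp E_eqn
  E_addb E_if E_ifb E_all E_has E_half E_minn E_sum : E.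
#[export] Hint Resolve E_weak E_weak2 E_weak3 | 50 : E.

End ComputableArithmetic.

Import ComputableArithmetic.

(** * Expectations and supermartingales on paths *)

Module PathMeasures.

Local Open Scope classical_set_scope.
Local Open Scope ring_scope.

Section Atoms.
Context (d : measure_display) (T : measurableType d) (R : realType) (P : probability T R).

Lemma prob_fin (A : set T) : measurable A -> P A = (fine (P A))%:E.
Proof. by move=> mA; rewrite fineK // fin_num_measure. Qed.

Variables (I : finType) (X : I -> set T).
Hypothesis mX : forall i, measurable (X i).

(** These are the atoms of the finite Boolean algebra generated by the sets [X i]. *)
Definition atom_set (J : {set I}) : set T :=
  [set w | forall i, (i \in J) = (w \in X i)].

Lemma measurable_atom J : measurable (atom_set J).
Proof.
rewrite (_ : atom_set J = \bigcap_i (if i \in J then X i else ~` X i)).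
  apply: fin_bigcap_measurable; first exact: finite_finset.
  by move=> i _; case: ifP => _ //; exact: measurableC.
apply/seteqP; split=> w /= h i; first move=> _.
  case: ifP => ij; move: (h i); rewrite ij => /esym; first exact: set_mem.
  by move=> e Xw; rewrite mem_set in e.
have := h i Logic.I; case: ifP => _ /=; first by move=> ?; rewrite mem_set.
by move=> ?; rewrite memNset.
Qed.

Lemma trivIset_atom (D : set {set I}) : trivIset D atom_set.
Proof.
move=> J K _ _ [w [hJ hK]]; apply/setP => i; by rewrite hJ hK.
Qed.

Lemma prob_atoms (Y : set T) : measurable Y ->
  fine (P Y) = \sum_(J : {set I}) fine (P (Y `&` atom_set J)).
Proof.
move=> mY; apply: EFin_inj; rewrite -prob_fin // -sumEFin.
have mYJ J : measurable (Y `&` atom_set J) by apply: measurableI => //; exact: measurable_atom.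
under eq_bigr do rewrite -prob_fin //.
rewrite fsbig_seq ?index_enum_uniq // -measure_fin_bigcup //; last first.
  by apply: trivIset_setIl; exact: trivIset_atom.
congr (P _); apply/seteqP; split=> w; last by move=> [J _ []].
move=> Yw; exists [set i | w \in X i]%SET; first exact: mem_index_enum.
by split=> // i; rewrite inE.
Qed.

(** Monotonicity of the expectation of a simple function, obtained without integrals: on each
    non-empty atom the sum is a constant that is at most 0, and empty atoms have probability 0. *)
Lemma sum_prob_le0 (r : I -> R) :
  (forall w, \sum_i r i * (w \in X i)%:R <= 0) -> \sum_i r i * fine (P (X i)) <= 0.
Proof.
move=> h.
have -> : \sum_i r i * fine (P (X i)) =
    \sum_(J : {set I}) fine (P (atom_set J)) * \sum_i r i * (i \in J)%:R.
  under eq_bigr do rewrite prob_atoms // big_distrr /=.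
  rewrite exchange_big /=; apply: eq_bigr => J _; rewrite big_distrr /=.
  apply: eq_bigr => i _; rewrite mulrCA; congr (_ * _).
  case iJ : (i \in J); rewrite ?mulr1 ?mulr0.
    congr (fine (P _)); apply/seteqP; split=> w; first by case.
    by move=> wJ; split=> //; move: (wJ i); rewrite iJ => /esym; exact: set_mem.
  rewrite (_ : _ `&` _ = set0) ?measure0 //; apply/seteqP; split=> w // [Xw wJ].
  by move: (wJ i); rewrite iJ mem_set.
apply: sumr_le0 => J _.
have [[w wJ]|ne] := pselect (atom_set J !=set0).
  apply: mulr_ge0_le0; first by rewrite fine_ge0.
  by under eq_bigr => i _ do rewrite (wJ i); exact: h.
rewrite (_ : atom_set J = set0) ?measure0 ?mul0r //.
by apply/seteqP; split=> // w wJ; apply: ne; exists w.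
Qed.

End Atoms.

Section Paths.
Context (R : realType) (S Act : finType) (M : mdp S Act) (sigma : scheduler R M) (s : S).
Notation hist := (history S Act).
Notation P := (path_measure sigma s).

Definition ext (h : hist) a t : hist := (h.1, rcons h.2 (a, t)).

Definition one (h : hist) (F : Act -> S -> R) : R :=
  \sum_a \sum_t sigma h a * ratr (trans M (last_state h) a t) * F a t.

Fixpoint expect n (h : hist) (F : hist -> R) : R :=
  if n is n'.+1 then one h (fun a t => expect n' (ext h a t) F) else F h.

Lemma finite_path_ext h a t :
  finite_path M (ext h a t) = finite_path M h && (0 < trans M (last_state h) a t).
Proof. exact: finite_path_rcons. Qed.

Lemma one_le h (F F' : Act -> S -> R) : finite_path M h ->
  (forall a t, finite_path M (ext h a t) -> F a t <= F' a t) -> one h F <= one h F'.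
Proof.
move=> hp FF; apply: ler_sum => a _; apply: ler_sum => t _.
have [p0|p0] := boolP (0 < trans M (last_state h) a t).
  apply: ler_wpM2l; last by apply: FF; rewrite finite_path_ext hp.
  by apply: mulr_ge0; [exact: sched_ge0|rewrite ler0q trans_ge0].
have -> : trans M (last_state h) a t = 0.
  by apply: le_anti; rewrite trans_ge0 andbT leNgt.
by rewrite rmorph0 mulr0 !mul0r.
Qed.

Lemma one_cst h c : finite_path M h -> one h (fun _ _ => c) = c.
Proof.
move=> hp; rewrite /one; under eq_bigr do rewrite -big_distrl.
by rewrite -big_distrl /= step_sum1 // mul1r.
Qed.

Lemma one_scale h c F : one h (fun a t => c * F a t) = c * one h F.
Proof.
rewrite /one big_distrr; apply: eq_bigr => a _; rewrite big_distrr.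
by apply: eq_bigr => t _ /=; rewrite mulrCA.
Qed.

Lemma expect_le n h (F F' : hist -> R) : finite_path M h ->
  (forall h', finite_path M h' -> h'.1 = h.1 -> size h'.2 = (size h.2 + n)%N -> F h' <= F' h') ->
  expect n h F <= expect n h F'.
Proof.
elim: n h => [|n IH] h hp FF /=; first by apply: FF => //; rewrite addn0.
apply: one_le => // a t hp'; apply: IH => // h' p1 p2 p3; apply: FF => //.
by rewrite p3 size_rcons addSnnS.
Qed.

Lemma expect_eq n h (F F' : hist -> R) : finite_path M h ->
  (forall h', h'.1 = h.1 -> size h'.2 = (size h.2 + n)%N -> F h' = F' h') ->
  expect n h F = expect n h F'.
Proof. by move=> hp FF; apply: le_anti; rewrite !expect_le // => h' _ e1 e2; rewrite FF. Qed.

Lemma expect_super (Phi : hist -> R) n h :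
  (forall h, finite_path M h -> one h (fun a t => Phi (ext h a t)) <= Phi h) ->
  finite_path M h -> expect n h Phi <= Phi h.
Proof.
move=> H; elim: n h => [|n IH] h hp //=.
apply: le_trans (H h hp); apply: one_le => // a t hp'; exact: IH.
Qed.

Lemma expect_sum n h (I : finType) (c : I -> R) (F : I -> hist -> R) :
  expect n h (fun h => \sum_i c i * F i h) = \sum_i c i * expect n h (F i).
Proof.
elim: n h => [|n IH] h //=; rewrite /one.
rewrite [RHS](eq_bigr (fun i => \sum_a \sum_t c i * (sigma h a *
    ratr (trans M (last_state h) a t) * expect n (ext h a t) (F i)))); last first.
  by move=> i _; rewrite big_distrr; apply: eq_bigr => a _; rewrite big_distrr.
rewrite [RHS]exchange_big; apply: eq_bigr => a _ /=; rewrite [RHS]exchange_big.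
apply: eq_bigr => t _ /=; rewrite IH big_distrr; apply: eq_bigr => i _.
by rewrite /= mulrCA.
Qed.

Lemma weight_expect n h A : weight sigma n h A = expect n h (fun h => (extend M h \in A)%:R).
Proof.
elim: n h => [|n IH] h //=; apply: eq_bigr => a _; apply: eq_bigr => t _.
by rewrite IH.
Qed.

(** [path_measure] is picked by choice. Through uniqueness it is replaced by the explicit extension,
    whose values on determined sets are the finite sums [weight]. *)
Lemma induced_extension : induced sigma s (extension sigma s).
Proof.
move=> w n; transitivity (premeasure sigma s (cylinder w n)).
  by apply: extensionE; exists n; exact: determined_cylinder.
rewrite (premeasureE _ _ (@determined_cylinder _ _ _ w n)) /cylinder_prob; congr EFin.
have [e|ne] := eqVneq (w 0%N).1 s.
  by rewrite mul1r -e -[(_, _)]/(prefix_of w 0) (weight_cylinder _ n 0).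
rewrite mul0r weight_cylinder_out // => -[e].
by rewrite e eqxx in ne.
Qed.

Lemma determined_measurable n (A : set (omega M)) : determined_at n A ->
  measurable (A : set (infinite_paths M)).
Proof.
move=> dA.
pose seq_of (t : n.+1.-tuple (S * Act)) : omega M := fun i => nth (thead t) t i.
rewrite (_ : A = \bigcup_(t in [set t | A (seq_of t)]) cylinder (seq_of t) n).
  apply: fin_bigcup_measurable; first exact: finite_finset.
  move=> t _; apply: (@sub_sigma_algebra _ setT (cylinders M)).
  by exists (seq_of t), n.
apply/seteqP; split=> w /=.
  move=> wT; pose t := mktuple (fun i : 'I_n.+1 => w i).
  have tE i : (i <= n)%N -> seq_of t i = w i.
    by move=> im; rewrite /seq_of -[i]/(val (Ordinal (im : (i < n.+1)%N)))
      -tnth_nth tnth_mktuple.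
  have e : prefix_of w n = prefix_of (seq_of t) n.
    rewrite /prefix_of tE //; congr pair; apply/eq_in_map => i.
    by rewrite mem_iota add0n => /andP[_ im]; rewrite !tE // ltnW.
  by exists t => //=; exact: dA e wT.
by move=> [t /= tA e]; apply: dA tA; rewrite e.
Qed.

Lemma prob_determined n (p : pred hist) :
  fine (P [set w | p (prefix_of w n)]) = expect n (s, [::]) (fun h => (p h)%:R).
Proof.
set A : set (omega M) := [set w | _].
have dA : determined_at n A by move=> w w' e; rewrite /A /= e.
have -> : P A = extension sigma s A.
  apply: (induced_unique (path_measureP sigma s) induced_extension).
  exact: determined_measurable dA.
rewrite extensionE; last by exists n.
rewrite (premeasureE _ _ dA) /= weight_expect; apply: expect_eq => // h _ /= sh.
have e : prefix_of (extend M h) n = h by rewrite -{1}[n]add0n -sh extendK.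
by congr (nat_of_bool _)%:R; apply/idP/idP; rewrite inE /A /= e.
Qed.

Definition hist_of n (x : S * n.-tuple (Act * S)) : hist := (x.1, val x.2).

Definition hist_set n (x : S * n.-tuple (Act * S)) : set (infinite_paths M) :=
  [set w | prefix_of w n == hist_of x].

(** Turns an expectation into a combination of probabilities of events, the form in which
    [sum_prob_le0] can use it. *)
Lemma expect_hist n (F : hist -> R) :
  expect n (s, [::]) F = \sum_x F (hist_of x) * fine (P (@hist_set n x)).
Proof.
rewrite (eq_bigr (fun x => F (hist_of x) *
    expect n (s, [::]) (fun h => (h == hist_of x)%:R))); last first.
  by move=> x _; rewrite -(prob_determined n (fun h => h == hist_of x)).
rewrite -expect_sum; apply: expect_eq => // h _ /= sh.
have sh' : size h.2 == n by rewrite sh.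
rewrite (bigD1 (h.1, Tuple sh')) //= big1 ?addr0.
  by rewrite /hist_of /= -surjective_pairing eqxx mulr1.
move=> x ne; case: eqP => [e|_]; rewrite ?mulr0 //.
case/eqP: ne; case: x e => x1 x2; rewrite /hist_of /= => e.
by subst h; congr pair; exact: val_inj.
Qed.


Notation pre := (@prefix_of S Act M).

Lemma sum_hist n (F : hist -> R) (w : infinite_paths M) :
  \sum_x F (hist_of x) * (w \in @hist_set n x)%:R = F (pre w n).
Proof.
have sh : size (pre w n).2 == n by rewrite size_mkseq.
rewrite (bigD1 ((pre w n).1, Tuple sh)) //= big1 ?addr0.
  by rewrite mem_set ?mulr1 //= /hist_set /= /hist_of /= eqxx.
move=> x ne; rewrite memNset ?mulr0 // /hist_set /= => /eqP e.
case/eqP: ne; case: x e => x1 x2; rewrite /hist_of => -[<- e2].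
by congr pair; apply: val_inj.
Qed.

Lemma measurable_hist n x : measurable (@hist_set n x).
Proof.
by apply: (@determined_measurable n) => w w' e; rewrite /hist_set /= e.
Qed.

(** Fatou's lemma for indicators: the tail intersections increase to the union, and each is
    contained in one [E n]. *)
Lemma prob_liminf (E : (set (infinite_paths M))^nat) (e : R) :
  (forall j, measurable (E j)) -> (forall j, fine (P (E j)) <= e) ->
  measurable (\bigcup_n \bigcap_(j in [set j | (n <= j)%N]) E j) /\
  (P (\bigcup_n \bigcap_(j in [set j | (n <= j)%N]) E j) <= e%:E)%E.
Proof.
move=> mE bE; pose F n := \bigcap_(j in [set j | (n <= j)%N]) E j.
have mF n : measurable (F n) by apply: bigcap_measurable => //; exists n => /=.
have mU : measurable (\bigcup_n F n) by exact: bigcupT_measurable.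
split=> //.
have nd : {homo F : n m / (n <= m)%N >-> (n <= m)%O}.
  move=> n m nm; apply/subsetPset => w h j /= mj; apply: h => /=; exact: leq_trans mj.
have cv := nondecreasing_cvg_mu (mu := P) mF mU nd.
rewrite -(cvg_lim _ cv) //; apply: lime_le; first by apply/cvg_ex; exists (P (\bigcup_n F n)).
near=> n; apply: (@le_trans _ _ (P (E n))).
  by apply: le_measure; rewrite ?inE // => w /(_ n); apply => /=.
by rewrite (prob_fin P (mE n)) lee_fin.
Unshelve. all: by end_near. Qed.

(** If all [B n] had probability above [e], the limit inferior of their complements would have
    probability at most [1 - e] by Fatou's lemma; but it has full measure. *)
Lemma prob_limsup (B : (set (infinite_paths M))^nat) (e : R) : 0 < e ->
  (forall j, measurable (B j)) ->
  P.-negligible [set w | forall n, exists2 j, (n <= j)%N & B j w] ->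
  exists n, fine (P (B n)) <= e.
Proof.
move=> e0 mB neg; apply: contrapT => /forallNP H.
pose E n := ~` B n.
have mE n : measurable (E n) by exact: measurableC.
have bE n : fine (P (E n)) <= 1 - e.
  rewrite /E probability_setC // (prob_fin P (mB n)) /= lerB // ltW //.
  by rewrite ltNge; apply/negP; exact: H.
have [mU] := prob_liminf mE bE; set U := \bigcup_n _ in mU *.
have -> : P U = 1%:E; last by rewrite lee_fin; lra.
have := probability_setC P mU.
have -> : P (~` U) = 0%E.
  apply/negligibleP; first exact: measurableC.
  apply: negligibleS neg => w nU n; apply: contrapT => H'; apply: nU.
  exists n => // j /= nj; rewrite /E /= => Bj; apply: H'; by exists j.
rewrite (prob_fin P mU) /= => -[] /eqP; rewrite eq_sym subr_eq0 => /eqP <- //.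
Qed.

Section Recurrence.
Variables (G : hist -> Act -> bool) (D : hist -> Act -> S -> bool) (c : R).
Hypothesis c1 : 1 < c.
Hypothesis Hc : forall h, finite_path M h ->
  one h (fun a t => (~~ D h a t)%:R * (if G h a then c else 1)) <= 1.

Let factor k (h : hist) a t : R :=
  if (size h.2 < k)%N then 1 else (~~ D h a t)%:R * (if G h a then c else 1).

Fixpoint product_from k (h : hist) (l : seq (Act * S)) : R :=
  if l is (a, t) :: l' then factor k h a t * product_from k (ext h a t) l' else 1.

Let Z k (h : hist) := product_from k (h.1, [::]) h.2.

Lemma Z_ext k h a t : Z k (ext h a t) = Z k h * factor k h a t.
Proof.
rewrite /Z /ext /=; case: h => x p /=.
suff H q : product_from k (x, q) (rcons p (a, t)) =
    product_from k (x, q) p * factor k (x, q ++ p) a t by exact: H.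
elim: p q => [|[b u] p IH] q /=; first by rewrite cats0 mulr1 mul1r.
by rewrite IH mulrA cat_rcons.
Qed.

Lemma factor_ge0 k h a t : 0 <= factor k h a t.
Proof.
rewrite /factor; case: ifP => _ //; apply: mulr_ge0; first by rewrite ler0n.
by case: ifP => _ //; apply: ltW; exact: lt_trans ltr01 c1.
Qed.

Lemma Z_ge0 k h : 0 <= Z k h.
Proof.
rewrite /Z; move: (h.1, _) => h'; elim: h.2 h' => [|[a t] p IH] h' //=.
by apply: mulr_ge0 => //; exact: factor_ge0.
Qed.

Lemma prefix_ext (w : omega M) n : pre w n.+1 = ext (pre w n) (w n).2 (w n.+1).1.
Proof. by rewrite /prefix_of mkseqS. Qed.

(** A conditional Borel-Cantelli argument. The product [Z k] of the factors after time [k] is a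
    non-negative supermartingale by [Hc]; a [D] step sets it to 0, any other [G] step multiplies it
    by [c]. On a path with infinitely many [G] steps and no [D] step after [k] it eventually stays
    above each [c ^+ m], and by Markov's inequality this has probability at most [c ^- m]. *)
Lemma recurrence : P.-negligible [set w : infinite_paths M |
  (forall n, exists2 m, (n <= m)%N & G (pre w m) (w m).2) /\
  exists k, forall m, (k <= m)%N -> ~~ D (pre w m) (w m).2 (w m.+1).1].
Proof.
have c0 : 0 < c by exact: lt_trans ltr01 c1.
pose E k m n := [set w : infinite_paths M | c ^+ m <= Z k (pre w n)].
have mE k m n : measurable (E k m n).
  by apply: (@determined_measurable n) => w w' e; rewrite /E /= e.
have bE k m n : fine (P (E k m n)) <= c ^- m.
  rewrite (prob_determined n (fun h => c ^+ m <= Z k h)).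
  apply: (@le_trans _ _ (expect n (s, [::]) (fun h => c ^- m * Z k h))).
    apply: expect_le => // h _ _ _; case: (boolP (c ^+ m <= Z k h)) => H /=.
      by rewrite mulrC ler_pdivlMr ?exprn_gt0 // mul1r.
    by rewrite mulr_ge0 ?Z_ge0 // invr_ge0 exprn_ge0 // ltW.
  apply: (@le_trans _ _ (c ^- m * Z k (s, [::]))); last by rewrite /Z /= mulr1.
  apply: (@expect_super (fun h => c ^- m * Z k h)) => // h hp.
  rewrite one_scale ler_wpM2l ?invr_ge0 ?exprn_ge0 // ?(ltW c0) //.
  rewrite (_ : (fun a t => _) = (fun a t => Z k h * factor k h a t)); last first.
    by apply: funext => a; apply: funext => t; exact: Z_ext.
  rewrite one_scale ler_piMr ?Z_ge0 // /factor.
  by case: (size h.2 < k)%N; [rewrite one_cst|exact: Hc].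
apply: (@negligibleS _ _ _ _ (\bigcup_k [set w : infinite_paths M |
  (forall n, exists2 m, (n <= m)%N & G (pre w m) (w m).2) /\
  forall m, (k <= m)%N -> ~~ D (pre w m) (w m).2 (w m.+1).1])).
  by move=> w [hG [k hD]]; exists k.
apply: negligible_bigcup => k.
pose U m := \bigcup_n \bigcap_(j in [set j | (n <= j)%N]) E k m j.
have UP m := prob_liminf (mE k m) (bE k m).
have mI : measurable (\bigcap_m U m) by apply: bigcapT_measurable => m; have [] := UP m.
exists (\bigcap_m U m); split=> //.
  apply/eqP; rewrite eq_le measure_ge0 andbT; apply/lee_addgt0Pr => e e0; rewrite add0e.
  have cv : c^-1 ^+ n @[n --> \oo] --> (0 : R).
    by apply: cvg_expr; rewrite ger0_norm ?invr_ge0 ?(ltW c0) // invf_lt1.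
  have [m cm] : exists m, c^-1 ^+ m <= e.
    have /cvgrPdist_le /(_ e e0) [m _ Hm] := cv; exists m.
    have := Hm m (leqnn m); rewrite /= sub0r normrN; apply: le_trans; exact: ler_norm.
  apply: (@le_trans _ _ (P (U m))).
    by apply: le_measure; rewrite ?inE //; [have [] := UP m | move=> w; apply].
  by have [_ /le_trans] := UP m; apply; rewrite lee_fin -exprVn.
move=> w [hG hD] m _.
have mono i j : (k <= i)%N -> (i <= j)%N -> Z k (pre w i) <= Z k (pre w j).
  move=> ki /subnKC <-; elim: (j - i)%N => [|l IH]; first by rewrite addn0.
  apply: (le_trans IH); rewrite addnS prefix_ext Z_ext ler_peMr ?Z_ge0 //.
  rewrite /factor size_mkseq ltnNge (leq_trans ki (leq_addr _ _)) /= hD ?mul1r.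
    by case: ifP => _ //; exact: ltW.
  exact: leq_trans ki (leq_addr _ _).
have Zk : Z k (pre w k) = 1.
  suff H i : (i <= k)%N -> Z k (pre w i) = 1 by exact: H.
  elim: i => [|i IH] ik; first by rewrite /Z.
  by rewrite prefix_ext Z_ext IH ?(ltnW ik) // mul1r /factor size_mkseq ik.
suff [n kn Zn] : exists2 n, (k <= n)%N & c ^+ m <= Z k (pre w n).
  by exists n => // j /= nj; exact: le_trans Zn (mono _ _ kn nj).
elim: m => [|m [n kn Zn]]; first by exists k; rewrite ?Zk ?expr0.
have [i ni Gi] := hG n; exists i.+1; first exact: leq_trans kn (leqW ni).
rewrite prefix_ext Z_ext exprSr /factor size_mkseq ltnNge (leq_trans kn ni) /= Gi.
rewrite hD ?(leq_trans kn ni) // mul1r ler_wpM2r ?(ltW c0) //.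
exact: le_trans Zn (mono _ _ kn ni).
Qed.

End Recurrence.

(** [Phi] is a bounded supermartingale that eventually dominates the payoff of almost every path. At
    time [n] the payoff exceeds [Phi] only on [B n], and then by at most [K]; since almost every
    path leaves the sets [B n] for good, some of them have arbitrarily small probability. *)
Lemma expectation_le (I : finType) (X : I -> set (infinite_paths M)) (q : I -> R)
    (Phi : hist -> R) (C : R) :
  (forall i, measurable (X i)) ->
  (forall h, finite_path M h -> one h (fun a t => Phi (ext h a t)) <= Phi h) ->
  (forall h, `|Phi h| <= C) ->
  P.-negligible [set w | ~ exists N, forall n, (N <= n)%N ->
     \sum_i q i * (w \in X i)%:R <= Phi (pre w n)] ->
  \sum_i q i * fine (P (X i)) <= Phi (s, [::]).
Proof.
move=> mX super bPhi neg.
pose f (w : infinite_paths M) := \sum_i q i * (w \in X i)%:R.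
pose K := \sum_i `|q i| + C.
have C0 : 0 <= C by exact: le_trans (normr_ge0 _) (bPhi (s, [::])).
have K0 : 0 <= K by rewrite addr_ge0 // sumr_ge0.
have fK w : f w <= \sum_i `|q i|.
  apply: ler_sum => i _; case: (w \in X i); rewrite ?mulr1 ?mulr0 //; exact: ler_norm.
pose B n : set (infinite_paths M) := [set w | Phi (pre w n) < f w].
have mB n : measurable (B n).
  rewrite (_ : B n = \bigcup_(y in [set y : {set I} * (S * n.-tuple (Act * S)) |
      Phi (hist_of y.2) < \sum_i q i * (i \in y.1)%:R])
      (atom_set X y.1 `&` hist_set y.2)).
    apply: fin_bigcup_measurable; first exact: finite_finset.
    move=> y _; apply: measurableI; first exact: measurable_atom.
    exact: measurable_hist.
  apply/seteqP; split=> w.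
    rewrite /B /= => lt; have sh : size (pre w n).2 == n by rewrite size_mkseq.
    exists ([set i | w \in X i]%SET, ((pre w n).1, Tuple sh)) => /=.
      rewrite -[hist_of _]/(pre w n); apply: (lt_le_trans lt).
      by rewrite /f; under [leRHS]eq_bigr do rewrite inE.
    split; first by move=> i; rewrite inE.
    exact: eqxx.
  move=> [[J x] /= lt [wJ /eqP wx]]; rewrite /B /= wx.
  by apply: (lt_le_trans lt); rewrite /f; under eq_bigr do rewrite wJ.
have main n : \sum_i q i * fine (P (X i)) <= Phi (s, [::]) + K * fine (P (B n)).
  apply: (@le_trans _ _ (expect n (s, [::]) Phi + K * fine (P (B n)))); last first.
    by rewrite lerD2r; exact: expect_super.
  (* Payoff events, histories of length [n] and the event [B n] form one family, so that a pointwise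
     inequality between the three sums becomes one of probabilities. *)
  pose T : finType := (I + (S * n.-tuple (Act * S)) + 'I_1)%type.
  pose Y (y : T) := match y with inl (inl i) => X i | inl (inr x) => hist_set x
    | inr _ => B n end.
  pose r (y : T) := match y with inl (inl i) => q i | inl (inr x) => - Phi (hist_of x)
    | inr _ => - K end.
  have mY y : measurable (Y y).
    by case: y => [[i|x]|u] //=; exact: measurable_hist.
  have := @sum_prob_le0 _ _ _ P T Y mY r.
  rewrite !big_sumType /= big_ord1 -/(f _) expect_hist => H.
  rewrite -subr_le0 opprD addrA -mulNr -sumrN.
  under [X in _ + X + _]eq_bigr do rewrite -mulNr.
  apply: H => w; rewrite !big_sumType /= big_ord1 /=.
  under [X in _ + X + _]eq_bigr do rewrite mulNr.
  rewrite sumrN sum_hist -/(f w).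
  have [Bw|nB] := boolP (w \in B n).
    have := bPhi (pre w n); rewrite ler_norml => /andP[h1 h2].
    by have := fK w; rewrite mulr1 /K; lra.
  rewrite mulr0 addr0 subr_le0 leNgt; apply/negP => lt.
  by move: nB; rewrite mem_set.
apply/ler_addgt0Pr => e e0.
have K1 : 0 < K + 1 by lra.
have negB : P.-negligible [set w | forall n, exists2 j, (n <= j)%N & B j w].
  apply: negligibleS neg => w /= H [N HN].
  by have [j Nj] := H N; rewrite /B /= ltNge HN.
have [n Pn] := prob_limsup (divr_gt0 e0 K1) mB negB.
apply: le_trans (main n) _; rewrite lerD2l.
apply: (@le_trans _ _ (K * (e / (K + 1)))); first exact: ler_wpM2l.
by rewrite mulrA ler_pdivrMr // mulrC ler_wpM2l //; [exact: ltW|lra].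
Qed.

End Paths.

End PathMeasures.

Import PathMeasures.

(** * Cook-Levin clauses for the run of a verifier *)

Module Tableau.

Local Open Scope nat_scope.

Lemma Forall_cat (T : Type) (P : T -> Prop) s1 s2 :
  List.Forall P (s1 ++ s2) <-> List.Forall P s1 /\ List.Forall P s2.
Proof. exact: List.Forall_app. Qed.

Lemma Forall_enum (T : finType) (U : Type) (P : U -> Prop) (f : T -> U) :
  List.Forall P [seq f i | i <- enum T] <-> forall i, P (f i).
Proof.
rewrite List.Forall_forall; split=> [h i|h u].
  apply: h; rewrite List.in_map_iff; exists i; split=> //.
  have : i \in enum T by rewrite mem_enum.
  by elim: (enum T) => //= x s IH; rewrite inE => /orP[/eqP ->|/IH]; [left|right].
by rewrite List.in_map_iff => -[i [<- _]].
Qed.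

Section Tableau.
Variables (A : finType) (M : machine (A + bool)%type bool) (Tf mf : seq A -> nat).
Let K := (extra_tapes M).+1.
Notation G := (option ((A + bool) + bool + aux M)%type).

(* A fact [(t, p, y)] speaks about time [t]: the control state ([QF], with [p = 0]), the position
   [p] of a head ([HF]), the content of cell [p] ([CF]) or the scanned symbol ([SF], with [p = 0])
   of a tape. Cell [0] of the tableau is [Tf w] cells left of the initial head position. *)
Definition kind : finType := (control M + 'I_K * option (G * bool))%type.
Definition fact := (nat * nat * kind)%type.
Definition QF q : kind := inl q.
Definition HF i : kind := inr (i, None).
Definition CF i (c : G) : kind := inr (i, Some (c, true)).
Definition SF i (c : G) : kind := inr (i, Some (c, false)).

(** A halting configuration repeats itself, so acceptance can be read off at the single time
    [Tf w]. *)
Definition act1 (q : control M) (f : {ffun 'I_K -> G}) :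
    control M * ('I_K -> G * direction) :=
  if halting q then (q, fun i => (f i, Stay)) else delta q f.

Definition scan (C : configuration M) : {ffun 'I_K -> G} := [ffun i => (C.2 i).1.2].

Lemma stepE (C : configuration M) :
  step C = ((act1 C.1 (scan C)).1,
            fun i => write_move (C.2 i) ((act1 C.1 (scan C)).2 i)).
Proof.
rewrite /step /act1; case: ifP => _; last by rewrite -/(scan C); case: (delta _ _).
case: C => q t /=; congr pair; apply: boolp.funext => i; rewrite ffunE /=.
by case: (t i) => [[]].
Qed.

Definition mv h d := match d with MoveLeft => h.-1 | Stay => h | MoveRight => h.+1 end.

(** A [tape] is relative to its head; the absolute head position is carried along to give the cells
    addresses that do not move. *)
Definition wstep (C : configuration M * ('I_K -> nat)) :=
  (step C.1, fun i => mv (C.2 i) ((act1 C.1.1 (scan C.1)).2 i).2).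

Definition wrun T z t := iter t wstep (initial M z, fun=> T).

Lemma wrun1 T z t : (wrun T z t).1 = iter t (@step _ _ M) (initial M z).
Proof. by elim: t => //= t ->. Qed.

Lemma wrun_bound T z t i : t <= T -> T - t <= (wrun T z t).2 i <= T + t.
Proof.
elim: t => [|t IH] tT; first by rewrite /=; lia.
have {IH} := IH (ltnW tT); rewrite /=; case: (_.2 i).2 => /=; lia.
Qed.

Definition look (u : tape (A + bool)%type bool (aux M)) h p : G :=
  if p == h then u.1.2 else
  if h < p then nth None u.2 (p - h).-1 else nth None u.1.1 (h - p).-1.

Lemma look_at u h : look u h h = u.1.2.
Proof. by rewrite /look eqxx. Qed.

Lemma look_gt u h k : look u h (h + k.+1) = nth None u.2 k.
Proof. by rewrite /look ifN ?ifT; [congr nth| |]; lia. Qed.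

Lemma look_lt u p k : look u (p + k.+1) p = nth None u.1.1 k.
Proof. by rewrite /look ifN ?ifN; [congr nth| |]; lia. Qed.

Lemma look_move u h p c d : 0 < h ->
  look (write_move u (c, d)) (mv h d) p = if p == h then c else look u h p.
Proof.
case: u => [[l x] r] h0; have [lt|gt|->] := ltngtP p h.
- have [k e] : exists k, h = p + k.+1 by exists (h - p).-1; lia.
  subst h; rewrite look_lt; case: d => /=.
  + case: k h0 lt => [|k] h0 lt; first by rewrite addn1 look_at /= nth0.
    by rewrite addnS /= look_lt /= nth_behead.
  + by rewrite look_lt.
  + by rewrite -addnS look_lt.
- have [k e] : exists k, p = h + k.+1 by exists (p - h).-1; lia.
  subst p; rewrite look_gt; case: d => /=.
  + by rewrite (_ : h + k.+1 = h.-1 + k.+2) ?look_gt //; lia.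
  + by rewrite look_gt.
  + case: k gt => [|k] gt; first by rewrite addn1 look_at /= nth0.
    by rewrite -addSnnS look_gt /= nth_behead.
- case: d => /=.
  + case: h h0 => // h _ /=.
    by have := look_gt (behead l, head None l, c :: r) h 0; rewrite addn1.
  + by rewrite look_at.
  + by rewrite -addn1 look_lt.
Qed.

(* Rules are clauses (premises, conclusions) over a time and two positions; a conclusion that would
   not make sense for the given arguments is replaced by a fact that holds anyway. *)
Definition atom := seq A -> ctx 3 -> fact.
Definition rule := (seq atom * seq atom)%type.
Implicit Types (w : seq A) (c : ctx 3).

(** Starting in cell [Tf w], a head stays between [0] and [Tf w * 2]; the last cell is the right
    neighbour of a head at that bound, which is inspected at the end. *)
Definition Wf w := (Tf w * 2).+2.
Definition at_ (tf pf : seq A -> ctx 3 -> nat) (y : kind) : atom := fun w c => (tf w c, pf w c, y).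
Definition zero_ w c := 0.
Definition time_ w c := c.1.1.2.
Definition timeS w c := c.1.1.2.+1.
Definition pos_ w c := c.1.2.
Definition posS w c := c.1.2.+1.
Definition posP w c := c.1.2.-1.
Definition pos2 w c := c.2.
Definition last_ w c := Tf w.

Definition blank : kind := CF ord0 None.
Definition xcell a : kind := CF ord0 (Some (inl (inl (inl a)))).
Definition ycell b : kind := CF ord0 (Some (inl (inl (inr b)))).
Definition outcell b : kind := CF ord_max (Some (inl (inr b))).

Definition startA : atom := at_ zero_ zero_ (QF (start M)).
Definition inX w c := (Tf w <= c.1.2) && (c.1.2 < Tf w + size w).
Definition inY w c := (Tf w + size w <= c.1.2) && (c.1.2 < Tf w + size w + mf w).
Definition ifA (b : seq A -> ctx 3 -> bool) (f g : atom) : atom :=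
  fun w c => if b w c then f w c else g w c.
Definition xatom a : atom :=
  ifA (fun w c => (Tf w <= c.1.2) && (onth w (c.1.2 - Tf w) == Some a))
    (at_ zero_ pos_ (xcell a)) startA.
Definition yblank : atom := ifA inX startA (at_ zero_ pos_ blank).
Definition yatom b : atom := ifA inY (at_ zero_ pos_ (ycell b)) yblank.
(** Blanks spread to the right behind the input, so the guessed cells form a word followed only by
    blanks. Elsewhere and at the last cell the rule becomes a tautology. *)
Definition pnext w c := if (Tf w + size w <= c.1.2) && (c.1.2.+1 < Wf w) then c.1.2.+1 else c.1.2.
Definition tkeep w c := if c.1.2 == c.2 then c.1.1.2 else c.1.1.2.+1.
Definition pmove d := match d with MoveLeft => posP | Stay => pos_ | MoveRight => posS end.

Definition base (qf : control M * {ffun 'I_K -> G}) : seq atom :=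
  at_ time_ zero_ (QF qf.1) :: [seq at_ time_ zero_ (SF i (qf.2 i)) | i <- enum 'I_K].

Definition accepting (x : G) := x == Some (inl (inr true)).

(** No rule forbids a second content of a cell or a second control state. A valuation may make
    further facts true, but it contains all facts of some run, and the last two groups refute it
    unless that run ends with the output [[:: true]]: the scanned cell must hold [true] and its
    right neighbour no output symbol. *)
Definition rules : seq rule :=
  [:: ([::], [:: startA])] ++
  [seq ([::], [:: at_ zero_ last_ (HF i)]) : rule | i <- enum 'I_K] ++
  [seq ([::], [:: if i == ord0 then startA else at_ zero_ pos_ (CF i None)]) : rule
    | i <- enum 'I_K] ++
  [seq ([::], [:: xatom a]) : rule | a <- enum A] ++
  [:: ([::], [:: yatom true; yatom false; yblank])] ++
  [:: ([:: at_ zero_ pos_ blank], [:: at_ zero_ pnext blank])] ++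
  [seq ([:: at_ time_ pos_ (HF ic.1); at_ time_ pos_ (CF ic.1 ic.2)],
        [:: at_ time_ zero_ (SF ic.1 ic.2)]) : rule | ic <- enum {: 'I_K * G}] ++
  [seq ([:: at_ time_ pos2 (HF ic.1); at_ time_ pos_ (CF ic.1 ic.2)],
        [:: at_ tkeep pos_ (CF ic.1 ic.2)]) : rule | ic <- enum {: 'I_K * G}] ++
  [seq (base qf, [:: at_ timeS zero_ (QF (act1 qf.1 qf.2).1)]) : rule
    | qf <- enum {: control M * {ffun 'I_K -> G}}] ++
  [seq (at_ time_ pos_ (HF qf.2) :: base qf.1,
        [:: at_ timeS pos_ (CF qf.2 ((act1 qf.1.1 qf.1.2).2 qf.2).1)]) : rule
    | qf <- enum {: control M * {ffun 'I_K -> G} * 'I_K}] ++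
  [seq (at_ time_ pos_ (HF qf.2) :: base qf.1,
        [:: at_ timeS (pmove ((act1 qf.1.1 qf.1.2).2 qf.2).2) (HF qf.2)]) : rule
    | qf <- enum {: control M * {ffun 'I_K -> G} * 'I_K}] ++
  [seq ([:: at_ last_ pos_ (HF ord_max); at_ last_ pos_ (CF ord_max x)],
        if accepting x then [:: at_ last_ pos_ (CF ord_max x)] else [::]) : rule
    | x <- enum {: G}] ++
  [seq ([:: at_ last_ pos_ (HF ord_max); at_ last_ posS (outcell b)], [::]) : rule
    | b <- enum {: bool}].

Definition holds w (g : fact -> bool) (r : rule) :=
  forall t p p', t < Tf w -> p < Wf w -> p' < Wf w ->
    all (fun f : atom => g (f w (tt, t, p, p'))) r.1 ->
    has (fun f : atom => g (f w (tt, t, p, p'))) r.2.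

Lemma rulesP (P : rule -> Prop) : List.Forall P rules <->
  ((P ([::], [:: startA]) /\
    (forall i, P ([::], [:: at_ zero_ last_ (HF i)])) /\
    (forall i, P ([::], [:: if i == ord0 then startA else at_ zero_ pos_ (CF i None)])) /\
    (forall a, P ([::], [:: xatom a])) /\
    P ([::], [:: yatom true; yatom false; yblank]) /\
    P ([:: at_ zero_ pos_ blank], [:: at_ zero_ pnext blank])) /\
   ((forall ic, P ([:: at_ time_ pos_ (HF ic.1); at_ time_ pos_ (CF ic.1 ic.2)],
        [:: at_ time_ zero_ (SF ic.1 ic.2)])) /\
    (forall ic, P ([:: at_ time_ pos2 (HF ic.1); at_ time_ pos_ (CF ic.1 ic.2)],
        [:: at_ tkeep pos_ (CF ic.1 ic.2)])) /\
    (forall qf, P (base qf, [:: at_ timeS zero_ (QF (act1 qf.1 qf.2).1)])) /\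
    (forall qf, P (at_ time_ pos_ (HF qf.2) :: base qf.1,
        [:: at_ timeS pos_ (CF qf.2 ((act1 qf.1.1 qf.1.2).2 qf.2).1)])) /\
    (forall qf, P (at_ time_ pos_ (HF qf.2) :: base qf.1,
        [:: at_ timeS (pmove ((act1 qf.1.1 qf.1.2).2 qf.2).2) (HF qf.2)]))) /\
   ((forall x, P ([:: at_ last_ pos_ (HF ord_max); at_ last_ pos_ (CF ord_max x)],
        if accepting x then [:: at_ last_ pos_ (CF ord_max x)] else [::])) /\
    (forall b, P ([:: at_ last_ pos_ (HF ord_max); at_ last_ posS (outcell b)], [::])))).
Proof.
rewrite /rules !Forall_cat !Forall_enum.
have F1 r : List.Forall P [:: r] <-> P r.
  by split=> [h|h]; [inversion h|constructor=> //; constructor].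
rewrite !F1; tauto.
Qed.

Definition full w (y : seq bool) : seq (A + bool) := [seq inl a | a <- w] ++ [seq inr b | b <- y].

Lemma look_initial (z : seq (A + bool)) T i p :
  look ((initial M z).2 i) T p =
  if (i == ord0) && (T <= p) then omap (fun a => inl (inl a)) (onth z (p - T)) else None.
Proof.
have [lt|gt|->] := ltngtP p T; last 2 first.
- have [k e] : exists k, p = T + k.+1 by exists (p - T).-1; lia.
  subst p; rewrite look_gt addKn /initial /=; case: eqP => //= _; last by rewrite nth_nil.
  case: z => [|a z] /=; first by rewrite nth_nil.
  by elim: z k {gt} => [|b z IH] [|k] //=; rewrite IH.
- by rewrite look_at subnn /initial /=; case: eqP => //= _; case: (z).
rewrite andbF; have [k e] : exists k, T = p + k.+1 by exists (T - p).-1; lia.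
by subst T; rewrite look_lt /initial /=; case: eqP => //= _; rewrite nth_nil.
Qed.

Section Fixed.
Variable w : seq A.
Hypothesis wT : size w + mf w <= Tf w.
Hypothesis T0 : 0 < Tf w.

Definition truth z (f : fact) : bool :=
  let: (t, p, k) := f in
  let: (C, h) := wrun (Tf w) z t in
  match k with
  | inl q => C.1 == q
  | inr (i, None) => p == h i
  | inr (i, Some (c, true)) => look (C.2 i) (h i) p == c
  | inr (i, Some (c, false)) => (C.2 i).1.2 == c :> G
  end.

Arguments truth : simpl never.

Lemma truth0 z p i x : truth z (0, p, CF i x) =
  ((if (i == ord0) && (Tf w <= p) then omap (fun a => inl (inl a)) (onth z (p - Tf w))
    else None) == x).
Proof. by rewrite -look_initial. Qed.

Lemma truth_start z c : truth z (startA w c).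
Proof. exact: eqxx. Qed.

Lemma output_true (C : configuration M) :
  output C = [:: true] <->
  (C.2 ord_max).1.2 = Some (inl (inr true)) /\
  forall b, nth None (C.2 ord_max).2 0 <> Some (inl (inr b)).
Proof.
rewrite /output; case: (C.2 ord_max) => [[l x] r] /=.
case: x => [[[a|b]|u]|] //=; try by split=> // -[].
split=> [[-> h]|[[->] h]].
  by split=> // b'; case: r h => //= x r; case: x => [[[]|]|].
by case: r h => //= x r; case: x => [[[]|]|] // b' h; have := h b'.
Qed.

Lemma base_truth z t p p' qf :
  all (fun f : atom => truth z (f w (tt, t, p, p'))) (base qf) ->
  qf.1 = (wrun (Tf w) z t).1.1 /\ qf.2 = scan (wrun (Tf w) z t).1.
Proof.
rewrite /= all_map => /andP[H1 /allP H2]; move: H1; rewrite /truth /=.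
case E : (wrun (Tf w) z t) => [C h] /= /eqP <-; split=> //.
apply/ffunP => i; rewrite ffunE; symmetry; apply/eqP.
by have := H2 i (mem_enum _ i); rewrite /= /truth /= E.
Qed.

Lemma onth_full y j : onth (full w y) j =
  if j < size w then omap inl (onth w j) else omap inr (onth y (j - size w)).
Proof. by rewrite /full onth_cat size_map !onth_map. Qed.

Lemma complete_tableau y : size y <= mf w ->
  output (iter (Tf w) (@step _ _ M) (initial M (full w y))) = [:: true] ->
  List.Forall (holds w (truth (full w y))) rules.
Proof.
move=> ym; rewrite -(wrun1 (Tf w)) => /output_true[o1 o2]; apply/rulesP.
set z := full w y in o1 o2 *; set T := Tf w in o1 o2 *.
have look0 i p : look ((initial M z).2 i) T p = if (i == ord0) && (T <= p)
    then omap (fun a => inl (inl a)) (onth z (p - T)) else None by exact: look_initial.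
do 2 split; [| split; [|split; [|split; [|split]]]| | ].
- by move=> t p p' _ _ _ _ /=; rewrite truth_start.
- by move=> i t p p' _ _ _ _ /=; rewrite /truth /= eqxx.
- move=> i t p p' _ _ _ _ /=; case: eqP => [_|/eqP ne]; first by rewrite truth_start.
  by rewrite /at_ truth0 (negbTE ne) eqxx.
- move=> a t p p' _ _ _ _ /=; rewrite /xatom /ifA /=; case: ifP; rewrite ?truth_start //.
  move=> /andP[le /eqP e]; rewrite /at_ truth0 eqxx le /= onth_full e /= ifT ?eqxx //.
  by rewrite -onthTE e.
- move=> t p p' _ _ _ _ /=; rewrite /yatom /yblank /ifA /inY /inX /= -/T.
  have [/andP[l1 l2]|nY] := ifP; last first.
    case: ifP => nX; first by rewrite truth_start.
    rewrite /at_ truth0 eqxx /pos_ /= -/T; case: (leqP T p) => //= Tp; rewrite ?eqxx //.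
    rewrite onth_full ifN ?onth_default //=; rewrite Tp /= in nX; [|by lia].
    by move: nY nX; lia.
  rewrite ifN; last by lia.
  rewrite /at_ !truth0 eqxx /pos_ /= -/T (_ : T <= p) /=; last by lia.
  rewrite onth_full ifN; last by lia.
  by case: (onth y _) => [[]|] //=; rewrite !eqxx ?orbT.
- move=> t p p' _ _ _ /=; rewrite /at_ !truth0 /pos_ /pnext /= orbF andbT -/T.
  case: (boolP ((T + size w <= p) && (p.+1 < Wf w))) => [/andP[l1 l2]|_] //.
  have [-> ->] : (T <= p) = true /\ (T <= p.+1) = true by split; lia.
  have [e1 e2] : (p - T < size w) = false /\ (p.+1 - T < size w) = false by split; lia.
  rewrite !onth_full e1 e2.
  case e : (onth y (p - T - size w)) => [b|] // _; rewrite onth_default //.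
  by have := onthTE y (p - T - size w); rewrite e /=; lia.
- split; [|split; [|split; [|split]]].
  + move=> [i c] t p p' lt _ _ /=; rewrite /truth /=; case: (wrun _ _ t) => C h /=.
    by move=> /and3P[/eqP -> + _]; rewrite look_at orbF.
  + move=> [i c] t p p' lt _ _; rewrite /= /truth /= /tkeep /=.
    have := wrun_bound z i (ltnW lt); rewrite -/T.
    case: eqP => [->|ne]; first by case: (wrun _ _ t) => C h _ /= /and3P[_ -> _].
    rewrite /=; case: (wrun _ _ t) => C h /= hb /and3P[/eqP e /eqP <- _].
    rewrite stepE /=; case: ((act1 C.1 (scan C)).2 i) => x d /=; rewrite look_move; last by lia.
    by rewrite -e /pos_ /= (introF eqP ne) eqxx.
  + move=> qf t p p' lt _ _ /base_truth[-> ->] /=; rewrite /truth /=.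
    by case: (wrun _ _ t) => C h /=; rewrite stepE eqxx.
  + move=> [qf i] t p p' lt _ _ /= /andP[] + /base_truth[-> ->]; rewrite /truth /=.
    have := wrun_bound z i (ltnW lt); rewrite -/T.
    case: (wrun _ _ t) => C h /= hb /eqP ->; rewrite stepE /=.
    by case: ((act1 C.1 (scan C)).2 i) => x d; rewrite look_move ?eqxx //; lia.
  + move=> [qf i] t p p' lt _ _ /= /andP[] + /base_truth[-> ->]; rewrite /truth /=.
    case: (wrun _ _ t) => C h /= /eqP <-; rewrite orbF.
    by case: ((act1 C.1 (scan C)).2 i).2; exact: eqxx.
- split.
  + move=> x t p p' lt _ _ /= /and3P[H1 H2 _].
    have ac : accepting x.
      move: H1 H2; rewrite /truth /= /last_ -/T.
      case: (wrun _ _ T) o1 o2 => C h /= o1 o2 /eqP ->.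
      by rewrite look_at o1 => /eqP <-; rewrite /accepting.
    by rewrite ac /= H2.
  + move=> b t p p' lt _ _ /=; rewrite /truth /= /last_ /pos_ /posS /= -/T.
    case: (wrun _ _ T) o1 o2 => C h /= o1 o2 /and3P[/eqP ->].
    by rewrite -[(h ord_max).+1]addn1 look_gt => /eqP /o2.
Qed.

(** The certificate is read off up to the first blank behind the input; the rules then force all
    facts of the run on it, by induction on time. *)
Lemma sound_tableau g : List.Forall (holds w g) rules ->
  exists2 y, size y <= mf w &
    output (iter (Tf w) (@step _ _ M) (initial M (full w y))) = [:: true].
Proof.
move=> /rulesP[[r1 [r2 [r3 [r4 [r5 r6]]]]] [[r7 [r8 [r9 [r10 r11]]]] [r12 r13]]].
set T := Tf w; set n := size w; have W0 : 0 < Wf w by [].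
pose bl j := g (0, T + n + j, blank).
pose J := find bl (iota 0 (mf w)).
have Jm : J <= mf w by rewrite -[X in _ <= X](size_iota 0) find_size.
(* A cell may be marked with both symbols; then [true] is taken, and the facts of the corresponding
   run still hold. *)
pose y := [seq g (0, T + n + j, ycell true) | j <- iota 0 J].
have sy : size y = J by rewrite size_map size_iota.
exists y; first by rewrite sy.
rewrite -(wrun1 T); set z := full w y.
have gs : g (0, 0, QF (start M)) by have := r1 0 0 0 T0 W0 W0 isT; rewrite /= orbF.
have notbl i : i < J -> ~~ bl i.
  move=> lt; have := before_find 0 lt; rewrite nth_iota ?add0n => [->//|].
  exact: leq_trans Jm.
have y5 p : p < Wf w -> ~~ ((T <= p) && (p < T + n)) -> 
    [|| ((T + n <= p) && (p < T + n + mf w)) && g (0, p, ycell true),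
        ((T + n <= p) && (p < T + n + mf w)) && g (0, p, ycell false) | g (0, p, blank)].
  move=> pW nX; have := r5 0 p 0 T0 pW W0 isT.
  rewrite /= /yatom /yblank /ifA /inY /inX /= -/T -/n (negbTE nX) orbF.
  by case: ifP => _ //= /orP[->|/orP[]->]; rewrite ?orbT.
(* If no blank occurs among the [mf w] guessed cells, the guess rule forces one right behind them,
   since no symbol is allowed there. *)
have isbl i : J <= i -> T + n + i < Wf w -> bl i.
  elim: i => [|i IH] Ji iW.
    have := y5 (T + n + 0) iW; rewrite -/(bl 0) => H.
    have [J0|J0] := posnP (mf w).
      by move: (H ltac:(lia)); rewrite J0; case/or3P => // /andP[]; lia.
    have : has bl (iota 0 (mf w)) by rewrite has_find size_iota -/J; lia.
    move=> /(nth_find 0); rewrite -/J nth_iota; last by lia.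
    by rewrite add0n (_ : J = 0) //; lia.
  have [Ji'|Ji'] := leqP J i.
    have iW' : T + n + i < Wf w by lia.
    have := r6 0 (T + n + i) 0 T0 iW' W0.
    rewrite /= /at_ /zero_ /pos_ /pnext /= -/T -/n ifT; last by lia.
    by rewrite andbT orbF -addnS; apply; exact: IH.
  have Ji2 : J = i.+1 by lia.
  have [Jm'|Jm'] := leqP (mf w) J.
    have := y5 (T + n + i.+1) iW ltac:(lia); case/or3P => // /andP[]; lia.
  have : has bl (iota 0 (mf w)) by rewrite has_find size_iota -/J; lia.
  by move=> /(nth_find 0); rewrite -/J nth_iota // add0n Ji2.
have g0 i p : p < Wf w -> g (0, p, CF i (look ((initial M z).2 i) T p)).
  move=> pW; rewrite look_initial; case: (eqVneq i ord0) => [->|ne] /=; last first.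
    by have := r3 i 0 p 0 T0 pW W0 isT; rewrite /= (negbTE ne) orbF.
  case: (leqP T p) => Tp; last first.
    by have := y5 p pW ltac:(lia); case/or3P => // /andP[]; lia.
  rewrite onth_full -/n; case: ifP => jn.
    have := onthTE w (p - T); rewrite jn; case e : (onth w _) => [a|] //= _.
    have := r4 a 0 p 0 T0 pW W0 isT.
    by rewrite /= /xatom /ifA /= -/T Tp e eqxx orbF.
  have [j e] : exists j, p = T + n + j by exists (p - T - n); lia.
  subst p; rewrite (_ : T + n + j - T - size w = j); last by rewrite /n; lia.
  have [jJ|Jj] := ltnP j J; last by rewrite onth_default ?sy //; exact: isbl.
  rewrite /y onth_map onthE (nth_map 0) ?size_iota // nth_iota // add0n /=.
  have := y5 _ pW ltac:(lia); rewrite -/(bl j) (negbTE (notbl _ jJ)) orbF.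
  by case e : (g (_, _, ycell true)); rewrite /= ?andbF ?andbT //= => /andP[].
have inv t : t <= T -> [/\ g (t, 0, QF (wrun T z t).1.1),
    forall i, g (t, (wrun T z t).2 i, HF i) &
    forall i p, p < Wf w -> g (t, p, CF i (look ((wrun T z t).1.2 i) ((wrun T z t).2 i) p))].
  elim: t => [|t IH] tT.
    split=> //= i; have := r2 i 0 0 0 T0 W0 W0 isT; rewrite /= orbF; exact.
  have [gq gh gc] := IH (ltnW tT); have hb i := wrun_bound z i (ltnW tT : t <= T).
  rewrite [wrun T z t.+1]/(wstep (wrun T z t)).
  case: (wrun T z t) gq gh gc hb => C h /= gq gh gc hb.
  have hW i : h i < Wf w by have := hb i; rewrite /Wf -/T; lia.
  have gS i : g (t, 0, SF i (scan C i)).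
    have := r7 (i, scan C i) t (h i) 0 tT (hW i) W0; rewrite /= andbT orbF ffunE; apply.
    by apply/andP; split; [exact: gh|have := gc i (h i) (hW i); rewrite look_at].
  have gbase p p' : all (fun f : atom => g (f w (tt, t, p, p'))) (base (C.1, scan C)).
    by rewrite /= gq all_map; apply/allP => i _; exact: gS.
  rewrite stepE /=; split.
  - by have := r9 (C.1, scan C) t 0 0 tT W0 W0 (gbase _ _); rewrite /= orbF.
  - move=> i; have := r11 (C.1, scan C, i) t (h i) 0 tT (hW i) W0.
    rewrite [all _ _]/= (gh i) => /(_ (gbase _ _)); rewrite /= orbF /at_ /timeS /=.
    by case: (_.2 i).2.
  - move=> i p pW.
    have := r10 (C.1, scan C, i) t (h i) 0 tT (hW i) W0.
    rewrite [all _ _]/= (gh i) => /(_ (gbase _ _)); rewrite /= orbF /at_ /timeS /pos_ /=.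
    case: (_.2 i) => c d gw; rewrite look_move; last by have := hb i; lia.
    case: eqP => [->//|ne].
    have := r8 (i, look (C.2 i) (h i) p) t p (h i) tT pW (hW i).
    rewrite /= /at_ /tkeep /time_ /pos2 /pos_ /= (introF eqP ne) (gh i) (gc i p pW) orbF; exact.
have [_ gh gc] := inv T (leqnn _); have hb := wrun_bound z ord_max (leqnn T).
case: (wrun T z T) gh gc hb => C h /= gh gc hb.
have hW : h ord_max < Wf w by rewrite /Wf -/T; lia.
apply/output_true; split.
  have := r12 ((C.2 ord_max).1.2) 0 (h ord_max) 0 T0 hW W0.
  rewrite /= /at_ /last_ /pos_ /= -/T gh /=.
  have := gc ord_max _ hW; rewrite look_at => -> /(_ isT).
  by case: ifP => [/eqP|].
move=> b e; have := r13 b 0 (h ord_max) 0 T0 hW W0.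
rewrite /= /at_ /last_ /pos_ /posS /= -/T gh /= => H; suff : false by []; apply: H.
rewrite /outcell andbT -e; have := gc ord_max (h ord_max + 1).
by rewrite look_gt addn1; apply; rewrite /Wf -/T; lia.
Qed.

End Fixed.
End Tableau.

End Tableau.

Import Tableau.

(** * The complete deterministic process *)

Module ChoiceProcess.

Local Open Scope classical_set_scope.
Local Open Scope ring_scope.

Section Choose.
Variables (n : nat) (n0 : (0 < n)%N).

Definition choose_trans (s a t : 'I_n) : rat := (t == a)%:R.

Lemma choose_sum (s a : 'I_n) : \sum_t choose_trans s a t = 1.
Proof.
by rewrite (bigD1 a) //= big1 ?addr0 /choose_trans ?eqxx // => t /negbTE ->.
Qed.

Definition choose_mdp : mdp 'I_n 'I_n.
Proof.
apply: (@MDP _ _ choose_trans).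
- by move=> s a t; rewrite ler0n.
- by move=> s a t; rewrite /choose_trans; case: (_ == _).
- by exists (Ordinal n0).
- by move=> s; exists s; rewrite choose_sum.
- by move=> s a; rewrite choose_sum eqxx.
Defined.

Variable (R : realType).
Variables (us : seq 'I_n) (us0 : us != [::]).

Definition round_robin i : 'I_n := nth (Ordinal n0) us (i %% size us).

Definition rr_sched : scheduler R choose_mdp.
Proof.
apply: (@Scheduler R _ _ choose_mdp (fun h a => (a == round_robin (size h.2))%:R)).
- by move=> h _ a; rewrite ler0n.
- move=> h _; rewrite (bigD1 (round_robin (size h.2))) //= eqxx big1 ?addr0 //.
  by move=> a /negbTE ->.
- by move=> h _ a; rewrite /enabled choose_sum eqxx.
Defined.

Variable s0 : 'I_n.

Definition rr_path : omega choose_mdp :=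
  fun i => (if i is j.+1 then round_robin j else s0, round_robin i).

(** Scheduler and process are deterministic, so a single path carries the measure; uniqueness of the
    induced measure then gives all probabilities. *)
Lemma rr_induced : induced rr_sched s0 (dirac (rr_path : infinite_paths choose_mdp)).
Proof.
move=> w n'.
transitivity (((rr_path : infinite_paths choose_mdp) \in cylinder w n')%:R%:E : \bar R).
  exact: diracE.
congr EFin; rewrite /cylinder_prob.
elim: n' => [|m IH].
  rewrite big_ord0 mulr1; congr (nat_of_bool _)%:R; apply/idP/eqP.
    by rewrite inE /cylinder /= => -[].
  by rewrite inE /cylinder /prefix_of /= => ->.
rewrite big_ord_recr /= mulrA -IH size_mkseq /choose_trans.
have -> : (rr_path \in cylinder w m.+1) = (rr_path \in cylinder w m) &&
    (((w m).2 == round_robin m) && ((w m.+1).1 == (w m).2)).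
  apply/idP/idP; rewrite !inE /cylinder /= !prefix_ext /ext.
    move=> [e1 /rcons_inj[e2 e3 e4]]; rewrite -e3 -e4 /= !eqxx !andbT.
    by apply/mem_set; rewrite /= /prefix_of /= e1 e2.
  move=> /andP[/set_mem /= e1 /andP[/eqP e2 /eqP e3]].
  by case: e1 => /= -> ->; rewrite e3 e2.
by rewrite -!mulnb !natrM rmorph_nat -?mulrA.
Qed.

Lemma rr_Pr (T : {set 'I_n}) :
  Pr rr_sched s0 (infinitely_often choose_mdp T) = (has (mem T) us)%:R.
Proof.
rewrite /Pr (induced_unique (path_measureP rr_sched s0) rr_induced); last first.
  exact: measurable_infinitely_often.
transitivity (fine (((rr_path : infinite_paths choose_mdp) \in
    infinitely_often choose_mdp T)%:R%:E : \bar R)).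
  by congr (fine _); exact: diracE.
rewrite /=.
congr (nat_of_bool _)%:R; apply/idP/idP.
  rewrite inE => /(_ 1%N)[[|m] // _ /=] mT; apply/hasP; exists (round_robin m) => //.
  by rewrite mem_nth // ltn_mod lt0n size_eq0.
move=> /hasP[u uus /= uT]; rewrite inE => k.
exists (k * size us + index u us).+1.
  by apply: leqW; apply: leq_trans (leq_addr _ _); rewrite leq_pmulr // lt0n size_eq0.
by rewrite /= /round_robin modnMDl modn_small ?index_mem // nth_index.
Qed.

End Choose.

Section ChooseInstance.
Variables (n : nat) (n0 : (0 < n)%N) (ts : seq (int * seq nat)) (ts0 : (0 < size ts)%N) (b : nat).

Definition term i := nth (0, [::]) ts i.

Definition choose_instance : relbuechi_instance.
Proof.
refine (@RelBuechiInstance n n (choose_mdp n0) (size ts) 1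
  (fun i => (term i).1%:~R) (fun=> Ordinal n0) (fun=> ord0) _
  (fun i => [set s : 'I_n | val s \in (term i).2]%SET) GreaterEq b%:R).
by move=> j; exists (Ordinal ts0); rewrite (ord1 j).
Defined.

Definition payoff (U : pred nat) : int :=
  \sum_(i < size ts) (term i).1 * (has U (term i).2)%:R.

Lemma iv_visit (S Act : finType) (M : mdp S Act) (w : infinite_paths M) (T : {set S}) :
  w \in infinitely_often M T = [exists t in T, w \in infinitely_often M [set t]%SET].
Proof.
apply/idP/exists_inP => [|[t tT]]; rewrite !inE; last first.
  by move=> H k; have [m km] := H k; exists m => //; move: q; rewrite inE => /eqP ->.
move=> H; apply: contrapT => N.
have /choice[f fP] : forall t, exists k, t \in T -> forall m, (k <= m)%N -> (w m).1 != t.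
  move=> t; case: (boolP (t \in T)) => tT; last by exists 0%N.
  apply: contrapT => /forallNP N'; apply: N; exists t => //; rewrite inE => k.
  apply: contrapT => N''; apply: (N' k) => _ m km; apply/eqP => e; apply: N''.
  by exists m => //; rewrite e inE.
have [m km mT] := H (\max_t f t).
have := fP _ mT m (leq_trans (leq_bigmax _) km).
by rewrite eqxx.
Qed.

(** If no non-empty set of recurring states pays [b], then by integrality each path pays at most
    [b - 1], and so does the expectation, the constant [b - 1] being a supermartingale. Conversely,
    a set is realized by visiting its states in turn. *)
Lemma choose_holds (R : realType) :
  (forall i j, j \in (term i).2 -> (j < n)%N) ->
  (relbuechi_holds R choose_instance <->
   exists2 U : pred nat, (exists u, (u < n)%N && U u) & b%:Z <= payoff U).
Proof.
move=> tn; split.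
- move=> [sigma]; rewrite /compare /= => H; apply: contrapT => N.
  pose P := path_measure (sigma ord0) (Ordinal n0).
  pose X (i : 'I_(size ts)) := infinitely_often (choose_mdp n0)
    [set s : 'I_n | val s \in (term i).2]%SET.
  have mX i : measurable (X i) by exact: measurable_infinitely_often.
  have key (w : infinite_paths (choose_mdp n0)) :
      \sum_(i < size ts) ((term i).1%:~R : R) * (w \in X i)%:R <= (b%:Z - 1)%:~R.
    pose U u := [exists s : 'I_n, (val s == u) && (w \in infinitely_often (choose_mdp n0) [set s]%SET)].
    have XU i : (w \in X i) = has U (term i).2.
      rewrite iv_visit; apply/exists_inP/hasP.
        move=> [t tT wt]; exists (val t); first by move: tT; rewrite inE.
        by apply/existsP; exists t; rewrite eqxx.
      move=> [u uT /existsP[t /andP[/eqP tu wt]]]; exists t => //.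
      by rewrite inE tu.
    have -> : \sum_(i < size ts) ((term i).1%:~R : R) * (w \in X i)%:R = (payoff U)%:~R.
      rewrite /payoff rmorph_sum /=; apply: eq_bigr => i _.
      by rewrite XU intrM; case: (has U _).
    rewrite ler_int; have [//|lt] := leP (payoff U) (b%:Z - 1); exfalso; apply: N.
    exists U; last by lia.
    have := iv_visit w [set: 'I_n]%SET.
    have -> : w \in infinitely_often (choose_mdp n0) [set: 'I_n]%SET.
      by rewrite inE => k; exists k; rewrite ?inE.
    move=> /esym/exists_inP[t _ wt]; exists (val t); rewrite ltn_ord.
    by apply/existsP; exists t; rewrite eqxx.
  have := @expectation_le R _ _ _ (sigma ord0) (Ordinal n0) _ X
    (fun i => (term i).1%:~R) (fun=> (b%:Z - 1)%:~R) _ mX.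
  move=> /(_ `|(b%:Z - 1)%:~R|) /(_ _ (fun=> lexx _)) /(_ _)-E.
  have : (\sum_(i < size ts) ((term i).1%:~R : R) * fine (P (X i))) <= (b%:Z - 1)%:~R.
    apply: E; first by move=> h hp; rewrite one_cst.
    rewrite (_ : mkset _ = set0); first exact: negligible_set0.
    by apply/seteqP; split=> // w /= nN; apply: nN; exists 0%N => k _; exact: key.
  move: H; rewrite /Pr; under eq_bigr do rewrite ratr_int; rewrite ratr_nat => H H'.
  by have := le_trans H H'; rewrite -[b%:R]/(b%:Z%:~R) ler_int; lia.
- move=> [U [u /andP[un Uu]] bU].
  pose us := [seq s <- enum 'I_n | U (val s)].
  have us0 : us != [::].
    suff : Ordinal un \in us by case: (us).
    by rewrite mem_filter Uu mem_enum.
  exists (fun=> rr_sched n0 R us); rewrite /compare /=.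
  under eq_bigr do rewrite (rr_Pr n0 R us0) ratr_int.
  rewrite ratr_nat -[b%:R]/(b%:Z%:~R).
  have -> : \sum_(i < size ts) ((term i).1%:~R : R) *
      (has (mem [set s : 'I_n | val s \in (term i).2]%SET) us)%:R = (payoff U)%:~R.
    rewrite /payoff rmorph_sum /=; apply: eq_bigr => i _; rewrite intrM.
    rewrite (_ : ((has U (term i).2)%:R)%:~R = (has U (term i).2)%:R :> R); last by case: (has U _).
    congr (_ * (nat_of_bool _)%:R); apply/hasP/hasP.
      move=> [s]; rewrite mem_filter => /andP[Us _]; rewrite /= inE => sT.
      by exists (val s).
    move=> [v vT Uv]; exists (Ordinal (tn i v vT)); last by rewrite /= inE.
    by rewrite mem_filter Uv mem_enum.
  by rewrite ler_int.
Qed.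

End ChooseInstance.

End ChoiceProcess.

Import ChoiceProcess.

(** * The reduction and its running time *)

Module Hardness.

Local Open Scope nat_scope.

Section Satisfiability.
Variables (nv : nat) (cl : seq (seq nat)).

Definition sat_terms : seq (int * seq nat) :=
  flatten [seq [:: (Posz 2, [:: v.*2; v.*2.+1]); ((- 1)%R, [:: v.*2]); ((- 1)%R, [:: v.*2.+1])]
          | v <- iota 0 nv] ++ [seq (Posz 1, c) | c <- cl].

(* The literal [l] is the variable [l./2], negated when [l] is even. *)
Definition lit_true (a : nat -> bool) l := a l./2 == odd l.

Lemma payoffE ts U : payoff ts U = (\sum_(t <- ts) t.1 * (has U t.2)%:R)%R.
Proof. by rewrite (big_nth (0%R, [::])) big_mkord. Qed.

Local Open Scope ring_scope.

Lemma sum_le_size (T : eqType) (s : seq T) (F : T -> int) : {in s, forall x, F x <= 1} ->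
  \sum_(x <- s) F x <= (size s)%:Z /\
  ((size s)%:Z <= \sum_(x <- s) F x -> {in s, forall x, F x = 1}).
Proof.
elim: s => [|x s IH] Fs; first by rewrite big_nil.
have [] := IH (fun y ys => Fs y (mem_behead (s := x :: s) ys)) => IH1 IH2.
have Fx := Fs x (mem_head _ _); rewrite big_cons /= intS; split; first by lra.
move=> le y; rewrite inE => /orP[/eqP ->|ys]; first by lra.
by apply: IH2 => //; lra.
Qed.

Lemma sat_payoff : (0 < nv)%N -> {in cl, forall c, {in c, forall l, l < nv.*2}%N} ->
  (exists2 U : pred nat, (exists u, (u < nv.*2)%N && U u) &
     (nv + size cl)%:Z <= payoff sat_terms U) <->
  exists a, all (has (lit_true a)) cl.
Proof.
move=> nv0 clv.
pose FV (U : pred nat) v : int :=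
  2 * (U v.*2 || U v.*2.+1)%:R - (U v.*2)%:R - (U v.*2.+1)%:R.
pose FC (U : pred nat) c : int := (has U c)%:R.
have pE U : payoff sat_terms U = \sum_(v <- iota 0 nv) FV U v + \sum_(c <- cl) FC U c.
  rewrite payoffE big_cat big_flatten /= !big_map; congr (_ + _).
    apply: eq_bigr => v _; rewrite !big_cons big_nil /= !orbF /FV.
    by case: (U v.*2); case: (U v.*2.+1).
  by apply: eq_bigr => c _; rewrite mul1r.
have FV1 U v : FV U v <= 1 by rewrite /FV; case: (U v.*2); case: (U v.*2.+1).
have FC1 U c : FC U c <= 1 by rewrite /FC; case: (has U c).
split=> [[U _]|[a sat]].
  rewrite pE; have [v1 v2] := sum_le_size (s := iota 0 nv) (fun v _ => FV1 U v).
  have [c1 c2] := sum_le_size (s := cl) (fun c _ => FC1 U c).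
  rewrite size_iota in v1 v2 *; rewrite PoszD => le.
  have {}v2 := v2 ltac:(lra); have {}c2 := c2 ltac:(lra).
  exists (fun v => U v.*2.+1); apply/allP => c cc; have := c2 c cc.
  rewrite /FC; case e : (has U c) => // _; have /hasP[l lc Ul] := e.
  apply/hasP; exists l => //; rewrite /lit_true.
  have lv : l./2 \in iota 0 nv by rewrite mem_iota; have := clv c cc l lc; lia.
  have := v2 _ lv; rewrite /FV; move: Ul; rewrite -{1}(odd_double_half l).
  case: (odd l); rewrite ?add1n ?add0n => -> //.
  by case: (U _.+1).
(* One of the two literals of variable 0 is true, so the set of recurring states is not empty. *)
exists (lit_true a).
  by case e : (a 0%N); [exists 1%N|exists 0%N]; rewrite /lit_true /= e eqxx andbT; lia.
rewrite pE (eq_bigr (fun=> 1)) => [|v _]; last first.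
  rewrite /FV /lit_true /= doubleK uphalf_double odd_double /=.
  by case: (a v).
rewrite big_const_seq count_predT size_iota iter_addr_0 PoszD natz lerD2l.
rewrite (eq_big_seq (fun=> 1)) => [|c cc]; last by rewrite /FC (allP sat).
by rewrite big_const_seq count_predT iter_addr_0 natz.
Qed.

End Satisfiability.

Section Entries.
Variables (n : nat) (n0 : 0 < n) (ts : seq (int * seq nat)) (ts0 : 0 < size ts) (b : nat).

(** The entries [1; 0; 0] are the denominator of the integer coefficient, the source state and the
    scheduler. *)
Definition term_entries n (t : int * seq nat) : seq nat :=
  [:: nat_of_bool (t.1 < 0)%R; absz t.1; 1; 0; 0] ++
  [seq nat_of_bool (s \in t.2) | s <- iota 0 n].

Lemma map_enum_ord (U : Type) m (F : nat -> U) :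
  [seq F (val i) | i <- enum 'I_m] = [seq F i | i <- iota 0 m].
Proof. by rewrite -val_enum_ord -map_comp. Qed.

Lemma rat_entries_int (z : int) : rat_entries z%:~R = [:: nat_of_bool (z < 0)%R; absz z; 1].
Proof. by rewrite /rat_entries numq_int denq_int ltrz0. Qed.

Lemma choose_entries : relbuechi_entries (choose_instance n0 ts0 b) =
  [:: n; n] ++ flatten [seq flatten [seq flatten [seq [:: 0; nat_of_bool (t == a); 1]
     | t <- iota 0 n] | a <- iota 0 n] | s <- iota 0 n] ++ [:: size ts; 1] ++
  flatten [seq term_entries n t | t <- ts] ++ [:: 1; 0; b; 1].
Proof.
rewrite /relbuechi_entries /mdp_entries /=; congr [:: _, _ & _]; congr cat.
  rewrite -map_enum_ord; congr flatten; apply: eq_map => s; rewrite -map_enum_ord.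
  congr flatten; apply: eq_map => a; rewrite -map_enum_ord; congr flatten.
  by apply: eq_map => t; rewrite /choose_trans val_eqE; case: (t == a).
congr [:: _, _ & _]; congr cat.
  have -> : [seq term_entries n t | t <- ts] =
      [seq term_entries n (term ts (val i)) | i <- enum 'I_(size ts)].
    rewrite (map_enum_ord _ (fun i => term_entries n (term ts i))).
    by rewrite -{1}(mkseq_nth (0%R, [::]) ts) /mkseq -map_comp.
  congr flatten; apply: eq_map => i; rewrite /term_entries /= numq_int denq_int ltrz0.
  rewrite -map_enum_ord; do 5 congr cons; apply: eq_map => s.
  by rewrite inE.
by rewrite -[(b%:R)%R]/((Posz b)%:~R)%R rat_entries_int.
Qed.

End Entries.

Lemma encode_cat u s1 s2 : encode u (s1 ++ s2) = encode u s1 ++ encode u s2.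
Proof. by rewrite /encode map_cat flatten_cat. Qed.

Lemma encode_flatten u ss : encode u (flatten ss) = flatten [seq encode u s | s <- ss].
Proof. by elim: ss => //= s ss <-; rewrite encode_cat. Qed.

Lemma size_flatten_iota (T : Type) n (F : nat -> seq T) k : (forall i, size (F i) = k) ->
  size (flatten [seq F i | i <- iota 0 n]) = n * k.
Proof.
move=> h; rewrite size_flatten /shape -map_comp (eq_map (g := fun=> k)) //.
by elim: n 0 => //= n IHn i; rewrite IHn mulSn.
Qed.

Lemma flatten_map_flatten (T U : Type) (F : T -> seq U) ss :
  flatten [seq F x | x <- flatten ss] = flatten [seq flatten [seq F x | x <- s] | s <- ss].
Proof. by elim: ss => //= s ss <-; rewrite map_cat flatten_cat. Qed.

Section Printing.
Variable A : finType.
Notation E := (@E A (option bool) _).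

Definition Pe k (l : seq A -> ctx k -> seq nat) :=
  @P A (option bool) k (fun w c => encode unary (l w c)).

Lemma Pe_cat k (l1 l2 : seq A -> ctx k -> seq nat) : Pe l1 -> Pe l2 ->
  Pe (fun w c => l1 w c ++ l2 w c).
Proof. by move=> h1 h2; apply: P_ext (P_cat h1 h2) => w c; rewrite encode_cat. Qed.

Lemma Pe_nil k : Pe (fun w (c : ctx k) => [::]).
Proof. exact: P_nil. Qed.

Lemma Pe_cons k (f : seq A -> ctx k -> nat) l : E f -> Pe l -> Pe (fun w c => f w c :: l w c).
Proof.
move=> hf hl.
have h1 : @P A (option bool) k.+1 (fun w c => (fun _ _ _ => [:: Some true]) w c.1 c.2).
  exact: P_emit.
apply: P_ext (P_cat (P_cat (@P_for A _ k f (fun _ _ _ => [:: Some true]) hf h1)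
  (P_emit A k None)) hl) => w c.
rewrite -[f w c :: _]cat1s encode_cat; congr cat.
rewrite /encode /= cats0 /unary -cats1 map_nseq; congr cat.
by elim: (f w c) 0 => //= n IH i; rewrite IH.
Qed.

Lemma Pe_for k (n : seq A -> ctx k -> nat) (l : seq A -> ctx k -> nat -> seq nat) :
  E n -> @Pe k.+1 (fun w c => l w c.1 c.2) ->
  Pe (fun w c => flatten [seq l w c i | i <- iota 0 (n w c)]).
Proof.
move=> hn hl; apply: P_ext (@P_for A (option bool) k n _ hn hl) => w c.
by rewrite encode_flatten -map_comp.
Qed.

Lemma Pe_forc k (n : seq A -> ctx k -> nat) (l : seq A -> ctx k.+1 -> seq nat) :
  E n -> Pe l -> Pe (fun w c => flatten [seq l w (c, i) | i <- iota 0 (n w c)]).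
Proof.
move=> hn hl; apply: (@Pe_for k n (fun w c i => l w (c, i))) => //.
Qed.

Lemma Pe_seq k (T : Type) (l : T -> seq A -> ctx k -> seq nat) (s : seq T) :
  List.Forall (fun x => Pe (l x)) s -> Pe (fun w c => flatten [seq l x w c | x <- s]).
Proof.
elim: s => [|x s IH] H; first exact: Pe_nil.
by inversion H; apply: Pe_cat => //; exact: IH.
Qed.

End Printing.

Section Reduction.
Variables (A : finType) (M : machine (A + bool)%type bool) (Tf mf : seq A -> nat).
Hypothesis hT : forall k, @E A (option bool) k (fun w _ => Tf w).
Hypothesis hm : forall k, @E A (option bool) k (fun w _ => mf w).
Hypothesis T0 : forall w, 0 < Tf w.
Hypothesis wT : forall w, size w + mf w <= Tf w.

Lemma WfE w : Wf Tf w = (Tf w * 2).+2.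
Proof. by []. Qed.
Local Opaque kind Wf.

Notation E3 := (@E A (option bool) 3).
Notation kind := (@kind A M).

Definition num w (f : fact M) := (f.1.1 * (Wf Tf w).+1 + f.1.2) * #|kind| + enum_rank f.2.
Definition nvars w := (Tf w).+1 * (Wf Tf w).+1 * #|kind|.

Definition inrange w (f : fact M) := (f.1.1 <= Tf w) && (f.1.2 <= Wf Tf w).

Lemma kind0 : 0 < #|kind|.
Proof. by apply/card_gt0P; exists (QF (start M)). Qed.

Lemma num_lt w f : inrange w f -> num w f < nvars w.
Proof.
move=> /andP[h1 h2]; rewrite /num /nvars; have := ltn_ord (enum_rank f.2).
set r := nat_of_ord _ => hr.
have h : f.1.1 * (Wf Tf w).+1 + f.1.2 < (Tf w).+1 * (Wf Tf w).+1 by nia.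
by move: h hr; move: (_ + f.1.2) ((Tf w).+1 * _) #|_| => x y z; nia.
Qed.

Definition decode w v : fact M :=
  (v %/ #|kind| %/ (Wf Tf w).+1, (v %/ #|kind|) %% (Wf Tf w).+1,
   nth (QF (start M)) (enum kind) (v %% #|kind|)).

Lemma decodeK w f : inrange w f -> decode w (num w f) = f.
Proof.
case: f => [[t p] y] /andP[h1 h2]; rewrite /decode /num /=.
have hr : enum_rank y < #|kind| := ltn_ord _.
rewrite divnMDl ?kind0 // (divn_small hr) addn0.
rewrite divnMDl // (divn_small (m := p)) // addn0 !modnMDl (modn_small hr) modn_small //.
by rewrite nth_enum_rank.
Qed.

Definition lits w c (r : rule M) : seq nat :=
  [seq (num w (f w c)).*2 | f : atom M <- r.1] ++ [seq (num w (f w c)).*2.+1 | f : atom M <- r.2].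

Lemma lits_true a w c (r : rule M) :
  has (lit_true a) (lits w c r) <->
  (all (fun f : atom M => a (num w (f w c))) r.1 -> has (fun f : atom M => a (num w (f w c))) r.2).
Proof.
rewrite /lits has_cat !has_map.
rewrite (eq_has (a2 := predC (fun f : atom M => a (num w (f w c))))); last first.
  by move=> f; rewrite /= /lit_true doubleK odd_double eqbF_neg.
rewrite has_predC [X in _ || X](eq_has (a2 := fun f : atom M => a (num w (f w c)))); last first.
  by move=> f; rewrite /= /lit_true /= uphalf_double odd_double eqb_id.
by case: (all _ _) => /=; split=> //; apply.
Qed.

Definition clauses w : seq (seq nat) :=
  flatten [seq flatten [seq flatten [seq [seq lits w (tt, t, p, p') r
    | p' <- iota 0 (Wf Tf w)] | p <- iota 0 (Wf Tf w)] | t <- iota 0 (Tf w)]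
    | r <- rules M Tf mf].

Lemma all_flatten_map (T U : Type) (Q : pred U) (F : T -> seq U) s :
  all Q (flatten [seq F x | x <- s]) = all (fun x => all Q (F x)) s.
Proof. by elim: s => //= x s IH; rewrite all_cat IH. Qed.

Lemma all_clauses w (Q : pred (seq nat)) : all Q (clauses w) <->
  List.Forall (fun r => forall t p p', t < Tf w -> p < Wf Tf w -> p' < Wf Tf w ->
    Q (lits w (tt, t, p, p') r)) (rules M Tf mf).
Proof.
rewrite /clauses; elim: (rules M Tf mf) => [|r s IH]; first by split.
rewrite /= all_cat; split.
  move=> /andP[H /IH Hs]; constructor=> // t p p' ht hp hp'.
  move: H; rewrite all_flatten_map => /allP /(_ t); rewrite mem_iota => /(_ ht) /=.
  rewrite all_flatten_map => /allP /(_ p); rewrite mem_iota => /(_ hp) /=.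
  by rewrite all_map => /allP /(_ p'); rewrite mem_iota => /(_ hp').
move=> H; inversion H as [|x l H1 H2]; subst; apply/andP; split; last by apply/IH.
rewrite all_flatten_map; apply/allP => t; rewrite mem_iota => /= ht.
rewrite all_flatten_map; apply/allP => p; rewrite mem_iota => /= hp.
by rewrite all_map; apply/allP => p'; rewrite mem_iota => /= hp'; exact: H1.
Qed.

Lemma size_clauses w :
  size (clauses w) = size (rules M Tf mf) * (Tf w * (Wf Tf w * Wf Tf w)).
Proof.
rewrite /clauses; elim: (rules M Tf mf) => [|r s IH] //=.
rewrite size_cat IH mulSn; congr addn.
by apply: (@size_flatten_iota _ _ (fun t => _)) => t; rewrite size_allpairs !size_iota.
Qed.

Definition atom_ok (f : atom M) := E3 (fun w c => num w (f w c)) /\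
  forall w t p p', t < Tf w -> p < Wf Tf w -> p' < Wf Tf w -> inrange w (f w (tt, t, p, p')).

Lemma rules_ok : List.Forall (fun r => List.Forall atom_ok r.1 /\ List.Forall atom_ok r.2)
  (rules M Tf mf).
Proof.
have hW k : @E A (option bool) k (fun w _ => Wf Tf w).
  by apply: (E_ext (fun w c => esym (WfE w))); have := hT k; auto 10 with E.
have ok_at tf pf y : E3 tf -> E3 pf ->
    (forall w t p p', t < Tf w -> p < Wf Tf w -> p' < Wf Tf w ->
      tf w (tt, t, p, p') <= Tf w /\ pf w (tt, t, p, p') <= Wf Tf w) ->
    atom_ok (at_ tf pf y).
  move=> h1 h2 h3; split; first by rewrite /num /at_ /=; have := hW 3; auto 10 with E.
  by move=> w t p p' a b c; rewrite /inrange /=; have [-> ->] := h3 w t p p' a b c.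
have ok_if (b : seq A -> ctx 3 -> bool) f g : E3 (fun w c => b w c : nat) -> atom_ok f -> atom_ok g -> atom_ok (ifA b f g).
  move=> hb [f1 f2] [g1 g2]; split.
    by apply: E_ext (E_if hb f1 g1) => w c; rewrite /ifA; case: (b w c).
  by move=> w t p p' h1 h2 h3; rewrite /ifA; case: (b w _); [exact: f2|exact: g2].
have TW w : Tf w <= Wf Tf w by rewrite WfE; lia.
have eT := hT 3; have eW := hW 3; have em := hm 3.
have bs qf : List.Forall atom_ok (base (M := M) qf).
  rewrite /base; constructor.
    by apply: ok_at; rewrite /time_ /zero_; [auto with E|auto with E|move=> w t p p' ? ? ? /=; have ? := TW w; split; lia].
  apply/Forall_enum => i; apply: ok_at; rewrite /time_ /zero_; [auto with E|auto with E|move=> w t p p' ? ? ? /=; have ? := TW w; split; lia].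
have ok0 : atom_ok (startA M).
  by apply: ok_at; rewrite /zero_; [auto with E|auto with E|move=> w t p p' ? ? ? /=; have ? := TW w; split; lia].
have okp y : atom_ok (at_ (@zero_ A) (@pos_ A) y).
  by apply: ok_at; rewrite /zero_ /pos_ /=; [auto with E|auto with E|move=> w t p p' ? ? ? /=; have ? := TW w; split; lia].
have oky : atom_ok (yblank M Tf).
  by apply: ok_if => //; rewrite /inX; auto 20 with E.
have okyb b : atom_ok (yatom M Tf mf b).
  by apply: ok_if => //; rewrite /inY; auto 20 with E.
have F1 f : atom_ok f -> List.Forall atom_ok [:: f] by move=> h; constructor.
have F0 : List.Forall atom_ok [::] by constructor.
have atd tf pf y : E3 tf -> E3 pf ->
    (forall w t p p', t < Tf w -> p < Wf Tf w -> p' < Wf Tf w ->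
      tf w (tt, t, p, p') <= Tf w /\ pf w (tt, t, p, p') <= Wf Tf w) ->
    atom_ok (at_ tf pf y) by exact: ok_at.
apply/rulesP; split; [split; [|split; [|split; [|split; [|split]]]]|split].
- by split=> //; exact: F1.
- move=> i; split=> //=; apply: F1; apply: ok_at; rewrite /zero_ /last_; auto with E; move=> w t p p' ? ? ? /=; have ? := TW w; split; lia.
- by move=> i; split=> //=; apply: F1; case: eqP => _.
- move=> a; split=> //=; apply: F1; apply: ok_if => //.
  by auto 20 with E.
- by split=> //=; constructor=> //; constructor=> //; exact: F1.
- split=> //=; apply: F1 => //; apply: ok_at; rewrite /zero_ /pnext; auto 20 with E.
  by move=> w t p p' h1 h2 h3 /=; case: ifP; lia.
- split; [|split; [|split; [|split]]].
  + move=> [i x]; split=> /=; [constructor; last apply: F1|apply: F1];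
      apply: ok_at; rewrite /time_ /pos_ /zero_ /=; auto with E; move=> w t p p' ? ? ? /=; have ? := TW w; split; lia.
  + move=> [i x]; split=> /=; [constructor; last apply: F1|apply: F1];
      apply: ok_at; rewrite /time_ /pos_ /pos2 /tkeep /=; auto 20 with E; try (move=> w t p p' ? ? ? /=; have ? := TW w; split; lia).
    by move=> w t p p' h1 h2 h3 /=; case: ifP; lia.
  + move=> qf; split=> //=; apply: F1; apply: ok_at; rewrite /timeS /zero_ /=; auto with E; move=> w t p p' ? ? ? /=; have ? := TW w; split; lia.
  + move=> [qf i]; split=> /=; [constructor=> //|apply: F1]; apply: ok_at;
      rewrite /timeS /time_ /pos_ /=; auto with E; move=> w t p p' ? ? ? /=; have ? := TW w; split; lia.
  + move=> [qf i]; split=> /=; [constructor=> //|apply: F1]; apply: ok_at;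
      rewrite /timeS /time_ /=; auto with E; try (move=> w t p p' ? ? ?; have ? := TW w; rewrite /pos_ /=; split; lia).
      by case: ((act1 _ _).2 i).2; rewrite /pmove /posP /pos_ /posS; auto with E;
        apply: E_ext (E_sub (E_var1 _ _ _) (E_one _ _ _)) => w c; rewrite subn1.
    by case: ((act1 _ _).2 i).2; move=> w t p p' ? ? ?; rewrite /pmove /posP /pos_ /posS /=; split; lia.
- split.
  + move=> x; split=> /=; first by (constructor; last apply: F1);
      apply: ok_at; rewrite /last_ /pos_ /=; auto with E; move=> w t p p' ? ? ? /=; have ? := TW w; split; lia.
    by case: ifP => _ //; apply: F1; apply: ok_at; rewrite /last_ /pos_ /=; auto with E; move=> w t p p' ? ? ? /=; have ? := TW w; split; lia.
  + move=> x; split=> //=; constructor; last apply: F1;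
      apply: ok_at; rewrite /last_ /pos_ /posS /=; auto with E; move=> w t p p' ? ? ? /=; have ? := TW w; split; lia.
Qed.


Lemma lits_lt w : {in clauses w, forall c, {in c, forall l, l < (nvars w).*2}}.
Proof.
suff H : all (all (fun l => l < (nvars w).*2)) (clauses w).
  by move=> c cc l lc; exact: (allP (allP H c cc)).
apply/all_clauses; apply: List.Forall_impl rules_ok => r [r1 r2] t p p' ht hp hp'.
have Hs (s : seq (atom M)) : List.Forall atom_ok s ->
    all (fun f : atom M => num w (f w (tt, t, p, p')) < nvars w) s.
  by elim=> //= f {}s [_ fr] _ ->; rewrite num_lt //; exact: fr.
rewrite /lits all_cat !all_map; apply/andP; split.
  by apply: sub_all (Hs _ r1) => f /=; rewrite ltn_double.
by apply: sub_all (Hs _ r2) => f /=; rewrite ltn_Sdouble.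
Qed.

Lemma Forall_eq_all (T : Type) (f g : pred T) s : List.Forall (fun x => f x = g x) s ->
  all f s = all g s /\ has f s = has g s.
Proof. by elim=> //= x l -> _ [-> ->]. Qed.

Lemma clauses_sat w : (exists a, all (has (lit_true a)) (clauses w)) <->
  exists2 y, size y <= mf w &
    output (iter (Tf w) (@step _ _ M) (initial M (full w y))) = [:: true].
Proof.
split=> [[a /all_clauses H]|[y ym out]].
  apply: (@sound_tableau A M Tf mf w (wT w) (T0 w) (fun f => a (num w f))).
  apply: List.Forall_impl H => r H t p p' ht hp hp'.
  by have /lits_true := H t p p' ht hp hp'.
have H := complete_tableau (wT w) (T0 w) ym out.
exists (fun v => truth Tf w (full w y) (decode w v)); apply/all_clauses.
apply: List.Forall_impl (List.Forall_and H rules_ok) => r [{}H [r1 r2]] t p p' ht hp hp'.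
have tE (f : atom M) : atom_ok f ->
    truth Tf w (full w y) (decode w (num w (f w (tt, t, p, p')))) =
    truth Tf w (full w y) (f w (tt, t, p, p')).
  by move=> [_ fr]; rewrite decodeK //; exact: fr.
have aE (s : seq (atom M)) : List.Forall atom_ok s ->
    all (fun f : atom M => truth Tf w (full w y) (decode w (num w (f w (tt, t, p, p'))))) s =
    all (fun f : atom M => truth Tf w (full w y) (f w (tt, t, p, p'))) s /\
    has (fun f : atom M => truth Tf w (full w y) (decode w (num w (f w (tt, t, p, p'))))) s =
    has (fun f : atom M => truth Tf w (full w y) (f w (tt, t, p, p'))) s.
  by move=> H'; apply: Forall_eq_all; apply: List.Forall_impl H' => f /tE.
apply/lits_true; have [-> _] := aE _ r1; have [_ ->] := aE _ r2.
exact: H.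
Qed.

Definition red_terms w := sat_terms (nvars w) (clauses w).
Definition red_bound w := nvars w + size (clauses w).

Lemma nvars0 w : 0 < nvars w.
Proof. by rewrite /nvars !muln_gt0 kind0. Qed.

Lemma red_states0 w : 0 < (nvars w).*2.
Proof. by rewrite double_gt0 nvars0. Qed.

Lemma size_red_terms w : size (red_terms w) = nvars w * 3 + size (clauses w).
Proof.
rewrite /red_terms /sat_terms size_cat size_map; congr addn.
exact: size_flatten_iota.
Qed.

Lemma red_terms0 w : 0 < size (red_terms w).
Proof. by rewrite size_red_terms; have := nvars0 w; lia. Qed.

Definition red_instance w := choose_instance (red_states0 w) (red_terms0 w) (red_bound w).

Lemma red_term_lt w i j : j \in (term (red_terms w) i).2 -> j < (nvars w).*2.
Proof.
rewrite /term; have [lt|ge] := ltnP i (size (red_terms w)); last by rewrite nth_default.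
have := mem_nth (0%R, [::]) lt; set t := nth _ _ _; rewrite /red_terms /sat_terms mem_cat.
move=> /orP[/flatten_mapP[v]|/mapP[c cc -> /=]]; last exact: lits_lt.
by rewrite mem_iota !inE => vn /or3P[]/eqP -> /=; rewrite !inE; lia.
Qed.

Lemma red_holds (R : realType) w : relbuechi_holds R (red_instance w) <->
  exists2 y, size y <= mf w &
    output (iter (Tf w) (@step _ _ M) (initial M (full w y))) = [:: true].
Proof.
rewrite -clauses_sat (@choose_holds _ _ _ _ _ R (@red_term_lt w)).
exact: (sat_payoff (nvars0 w) (@lits_lt w)).
Qed.

Lemma E_Wf k : @E A (option bool) k (fun w _ => Wf Tf w).
Proof. by apply: (E_ext (fun w c => esym (WfE w))); have := hT k; auto 10 with E. Qed.

Lemma E_nvars k : @E A (option bool) k (fun w _ => nvars w).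
Proof. by rewrite /nvars; have := E_Wf k; have := hT k; auto 10 with E. Qed.

Lemma Pe_target k (fs : seq (seq A -> ctx k -> nat)) :
  List.Forall (@E A (option bool) k) fs ->
  Pe (fun w c => [seq nat_of_bool (s \in [seq f w c | f <- fs]) | s <- iota 0 (nvars w).*2]).
Proof.
move=> Hfs; pose l w (c : ctx k) s := [:: nat_of_bool (s \in [seq f w c | f <- fs])].
have H : @Pe A k.+1 (fun w c => l w c.1 c.2).
  apply: Pe_cons; last exact: Pe_nil.
  elim: fs Hfs {l} => [|f fs IH] Hfs; first exact: E_zero.
  inversion Hfs; subst.
  by apply: E_or; [apply: E_eqn; [auto with E|exact: E_weak]|exact: IH].
have hn : @E A (option bool) k (fun w _ => (nvars w).*2).
  by apply: (E_ext (fun w c => addnn _)); have := E_nvars k; auto with E.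
apply: P_ext (Pe_for hn H) => w c; congr encode; rewrite /l.
by elim: (iota _ _) => //= s s' <-.
Qed.

Lemma Pe_term k (fs : seq (seq A -> ctx k -> nat)) (z : int) :
  List.Forall (@E A (option bool) k) fs ->
  Pe (fun w c => term_entries (nvars w).*2 (z, [seq f w c | f <- fs])).
Proof.
move=> H; rewrite /term_entries /=.
by do 5 (apply: Pe_cons; first exact: E_const); exact: Pe_target.
Qed.

Definition clause_entries r w (c : ctx 3) := term_entries (nvars w).*2 (Posz 1, lits w c r).

Lemma Pe_clause r : List.Forall atom_ok r.1 /\ List.Forall atom_ok r.2 ->
  Pe (clause_entries r).
Proof.
move=> [r1 r2].
pose fs := [seq (fun w c => (num w (f w c)).*2) | f : atom M <- r.1] ++
           [seq (fun w c => (num w (f w c)).*2.+1) | f : atom M <- r.2].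
have H : List.Forall E3 fs.
  apply/Forall_cat; split.
    elim: r.1 r1 => [|f l IH] H; first by constructor.
    inversion H as [|x y [hf _] H2]; subst; constructor; last exact: IH.
    by apply: (E_ext (fun w c => addnn _)); exact: E_add.
  elim: r.2 r2 => [|f l IH] H; first by constructor.
  inversion H as [|x y [hf _] H2]; subst; constructor; last exact: IH.
  by apply: E_succ; apply: (E_ext (fun w c => addnn _)); exact: E_add.
apply: P_ext (Pe_term (Posz 1) H) => w c; congr encode; congr term_entries; congr pair.
by rewrite /fs /lits map_cat -!map_comp.
Qed.

(** The machine is fixed, so the list of rules is unrolled in the program text; only times,
    positions, variables and states are loop variables. *)
Lemma red_poly_time : poly_time (fun w => encode unary (relbuechi_entries (red_instance w))).
Proof.
apply: P_poly_time.
have hn k : @E A (option bool) k (fun w _ => (nvars w).*2).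
  by apply: (E_ext (fun w c => addnn _)); have := E_nvars k; auto with E.
have hs k : @E A (option bool) k (fun w _ => size (clauses w)).
  apply: (E_ext (fun w c => esym (size_clauses w))).
  by have := hT k; have := E_Wf k; auto 20 with E.
have Fa1 k f : @E A (option bool) k f -> List.Forall (@E A (option bool) k) [:: f].
  by move=> h; constructor.
have hl : @Pe A 0 (fun w c => flatten [seq term_entries (nvars w).*2 t | t <- red_terms w]).
  pose l1 w (c : ctx 1) := term_entries (nvars w).*2 (Posz 2, [:: c.2.*2; c.2.*2.+1]) ++
        (term_entries (nvars w).*2 ((-1)%R, [:: c.2.*2]) ++
         (term_entries (nvars w).*2 ((-1)%R, [:: c.2.*2.+1]) ++ [::])).
  have h1 : Pe l1.
    have e1 : @E A (option bool) 1 (fun w c => c.2.*2).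
      by apply: (E_ext (fun w c => addnn _)); auto with E.
    have e2 : @E A (option bool) 1 (fun w c => c.2.*2.+1) by exact: E_succ.
    apply: Pe_cat; first by apply: (@Pe_term 1 [:: _; _]); constructor=> //; exact: Fa1.
    apply: Pe_cat; first by apply: (@Pe_term 1 [:: _]); exact: Fa1.
    by apply: Pe_cat; [apply: (@Pe_term 1 [:: _]); exact: Fa1|exact: Pe_nil].
  pose f2 r w c := flatten [seq clause_entries r w (c, p) | p <- iota 0 (Wf Tf w)].
  pose f1 r w c := flatten [seq f2 r w (c, p) | p <- iota 0 (Wf Tf w)].
  pose f0 r w c := flatten [seq f1 r w (c, p) | p <- iota 0 (Tf w)].
  have h2 : @Pe A 0 (fun w c => flatten [seq f0 r w c | r <- rules M Tf mf]).
    apply: Pe_seq; apply: List.Forall_impl rules_ok => r ok.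
    apply: Pe_forc; first exact: hT.
    apply: Pe_forc; first exact: E_Wf.
    by apply: Pe_forc; [exact: E_Wf|exact: Pe_clause].
  apply: P_ext (Pe_cat (Pe_forc (E_nvars 0) h1) h2) => w c; congr encode.
  rewrite /red_terms /sat_terms map_cat flatten_cat; congr cat.
    by rewrite flatten_map_flatten -map_comp.
  rewrite -map_comp /clauses flatten_map_flatten -map_comp; congr flatten.
  apply: eq_map => r /=; rewrite /f0 flatten_map_flatten -map_comp; congr flatten.
  apply: eq_map => t /=; rewrite /f1 flatten_map_flatten -map_comp; congr flatten.
  by apply: eq_map => p /=; rewrite /f2 -map_comp; case: c.
have hk k : @Pe A k (fun w c => [:: size (red_terms w); 1]).
  apply: Pe_cons; last by apply: Pe_cons; [exact: E_const|exact: Pe_nil].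
  apply: (E_ext (fun w c => esym (size_red_terms w))).
  by have := hs k; have := E_nvars k; auto with E.
have hb : @Pe A 0 (fun w c => [:: 1; 0; red_bound w; 1]).
  do 2 (apply: Pe_cons; first exact: E_const).
  apply: Pe_cons; first by rewrite /red_bound; have := hs 0; have := E_nvars 0; auto with E.
  by apply: Pe_cons; [exact: E_const|exact: Pe_nil].
have h3 : @Pe A 3 (fun w c => [:: 0; nat_of_bool (c.2 == c.1.2); 1]).
  apply: Pe_cons; first exact: E_const.
  by apply: Pe_cons; [auto with E|apply: Pe_cons; [exact: E_const|exact: Pe_nil]].
apply: P_ext (Pe_cat (Pe_cons (hn 0) (Pe_cons (hn 0) (@Pe_nil A 0)))
  (Pe_cat (Pe_forc (hn 0) (Pe_forc (hn 1) (Pe_forc (hn 2) h3)))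
  (Pe_cat (hk 0) (Pe_cat hl hb)))) => w c.
by rewrite choose_entries.
Qed.

End Reduction.

Section Injectivity.

Lemma unary_inj : injective unary.
Proof. by move=> n m /(congr1 size); rewrite !size_nseq. Qed.

Lemma encode_inj u : injective u -> injective (encode u).
Proof.
move=> uI; have sI (a a' : seq bool) r r' :
    [seq Some b | b <- a] ++ None :: r = [seq Some b | b <- a'] ++ None :: r' -> a = a' /\ r = r'.
  elim: a a' => [|b a IH] [|b' a'] //=; first by move=> [->].
  by move=> [-> /IH[-> ->]].
elim=> [|n s IH] [|n' s'] //=; rewrite /encode /=.
- by move=> /(congr1 size); rewrite size_cat size_rcons.
- by move=> /(congr1 size); rewrite size_cat size_rcons.
by rewrite !cat_rcons => /sI[/uI -> /IH ->].
Qed.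

(** Blocks of equal length can be compared one by one; the remainders [r] and [r'] let the argument
    continue along a concatenation. *)
Lemma flatten_map_inj (T : eqType) (U : Type) (F G : T -> seq U) s r r' :
  {in s, forall x, size (F x) = size (G x)} ->
  flatten [seq F x | x <- s] ++ r = flatten [seq G x | x <- s] ++ r' ->
  {in s, forall x, F x = G x} /\ r = r'.
Proof.
elim: s => [|x s IH] sz /=; first by [].
rewrite -!catA => e; have sx := sz x (mem_head _ _).
have e1 : F x = G x by have := congr1 (take (size (F x))) e; rewrite take_size_cat // sx take_size_cat.
move: e; rewrite e1 => /(congr1 (drop (size (G x)))); rewrite !drop_size_cat //.
move=> /IH[|h ->]; first by move=> y ys; apply: sz; rewrite inE ys orbT.
by split=> // y; rewrite inE => /orP[/eqP ->|/h].
Qed.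

Lemma rat_entries_inj : injective rat_entries.
Proof.
move=> x y [e1 e2 e3].
have h (z : rat) : z = ((if (z < 0)%R then -1 else 1) * (absz (numq z))%:R / (absz (denq z))%:R)%R.
  rewrite -{1}[z]divq_num_den; congr (_ / _)%R; last first.
    by rewrite -[LHS]/((denq z)%:~R)%R -{1}(gez0_abs (ltW (denq_gt0 z))).
  rewrite -numq_lt0; case: ltP => h; rewrite ?mul1r ?mulN1r.
    by rewrite -[in LHS](opprK (numq z)) rmorphN /= -{1}(ltz0_abs h).
  by rewrite -{1}(gez0_abs h).
rewrite (h x) (h y) e2 e3; congr (_ * _ / _)%R.
by case: (x < 0)%R e1; case: (y < 0)%R.
Qed.

Lemma mdp_eq (S Act : finType) (M M' : mdp S Act) :
  (forall s a t, trans M s a t = trans M' s a t) -> M = M'.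
Proof.
case: M M' => t1 a1 b1 c1 d1 e1 [t2 a2 b2 c2 d2 e2] /= e.
have {}e : t1 = t2 by apply: funext => s; apply: funext => a; apply: funext => x.
by subst t2; congr MDP; exact: Prop_irrelevance.
Qed.

Lemma comparison_entries_inj c c' r r' :
  comparison_entries c ++ rat_entries r = comparison_entries c' ++ rat_entries r' ->
  c = c' /\ r = r'.
Proof.
have h (x : rat) s : rat_entries x ++ s = [:: nat_of_bool (x < 0)%R, absz (numq x), absz (denq x) & s] by [].
case: c c' => [||e p|e p] [||e' p'|e' p'] //= [].
- by move=> *; split=> //; apply: rat_entries_inj; rewrite /rat_entries; congr [:: _; _; _].
- by move=> *; split=> //; apply: rat_entries_inj; rewrite /rat_entries; congr [:: _; _; _].
- move=> h1 h2 h3 *; have ee : e = e' by apply: rat_entries_inj; rewrite /rat_entries h1 h2 h3.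
  subst e'; rewrite (eq_irrelevance p p'); split=> //.
  by apply: rat_entries_inj; rewrite /rat_entries; congr [:: _; _; _].
- move=> h1 h2 h3 *; have ee : e = e' by apply: rat_entries_inj; rewrite /rat_entries h1 h2 h3.
  subst e'; rewrite (eq_irrelevance p p'); split=> //.
  by apply: rat_entries_inj; rewrite /rat_entries; congr [:: _; _; _].
Qed.

Lemma size_flatten_const (T : Type) (U : Type) (F G : T -> seq U) (s : seq T) :
  (forall x, size (F x) = size (G x)) ->
  size (flatten [seq F x | x <- s]) = size (flatten [seq G x | x <- s]).
Proof. by move=> h; elim: s => //= x s IH; rewrite !size_cat h IH. Qed.

(** A word is in the language if some instance encoded by it holds. For the reduction this has to be
    the constructed instance, so the entries must determine the instance; its proof components agree
    by proof irrelevance. *)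
Lemma relbuechi_entries_inj : injective relbuechi_entries.
Proof.
case=> n1 a1 M1 m1 k1 q1 s1 i1 j1 t1 c1 b1 [n2 a2 M2 m2 k2 q2 s2 i2 j2 t2 c2 b2].
rewrite /relbuechi_entries /mdp_entries /= => -[en ea]; subst n2 a2.
move=> /flatten_map_inj[|eM].
  by move=> s _; apply: size_flatten_const => a; exact: size_flatten_const.
have {}eM : M1 = M2.
  apply: mdp_eq => s a t.
  have := eM s (mem_enum _ s) => /(congr1 (cat^~ [::])) /flatten_map_inj[].
    by move=> a' _; exact: size_flatten_const.
  move=> /(_ a (mem_enum _ a)) /(congr1 (cat^~ [::])) /flatten_map_inj[] //.
  by move=> /(_ t (mem_enum _ t)) /rat_entries_inj.
move=> [em ek]; subst m2 k2 M2.
move=> /flatten_map_inj[|et /comparison_entries_inj[-> ->]].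
  by move=> i _; rewrite /= !size_map.
have et' i : [/\ q1 i = q2 i, s1 i = s2 i, i1 i = i2 i & t1 i = t2 i].
  have [h1 h2 h3 h4 h5 h6] := et i (mem_enum _ i).
  split; try exact: val_inj.
    by apply: rat_entries_inj; rewrite /rat_entries h1 h2 h3.
  have /eq_in_map h := h6; apply/setP => s.
  by have := h s (mem_enum _ s); case: (s \in t1 i); case: (s \in t2 i).
have -> : q1 = q2 by apply: funext => i; have [] := et' i.
have -> : s1 = s2 by apply: funext => i; have [] := et' i.
have -> : t1 = t2 by apply: funext => i; have [] := et' i.
have ei : i1 = i2 by apply: funext => i; have [] := et' i.
by subst i2; congr RelBuechiInstance; exact: Prop_irrelevance.
Qed.

End Injectivity.

Theorem strongly_NP_hard_RelBuechi (R : realType) : strongly_NP_hard (RelBuechi R).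
Proof.
move=> A L [V [c [d [[f [M [c' [d' Mf]]] Vf] LV]]]].
pose mf (w : seq A) := c * size w ^ d + c.
(* The machine reads the input and the certificate, so its time bound is taken at [size w + mf w];
   the last summand makes [Tf] positive and at least the length of the word on the tape. *)
pose Tf (w : seq A) := c' * (size w + mf w) ^ d' + c' + (size w + mf w).+1.
have hm k : @E A (option bool) k (fun w _ => mf w).
  by rewrite /mf; auto 20 with E.
have hT k : @E A (option bool) k (fun w _ => Tf w).
  by rewrite /Tf; have := hm k; auto 20 with E.
have T0 w : 0 < Tf w by rewrite /Tf; lia.
have wT w : size w + mf w <= Tf w by rewrite /Tf; lia.
exists (fun w => encode unary (relbuechi_entries (red_instance M Tf mf w))).
  exact: red_poly_time.
move=> w; have outE y : size y <= mf w ->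
    output (iter (Tf w) (@step _ _ M) (initial M (full w y))) = f (full w y).
  move=> ym; have [t tb [hl <-]] := Mf (full w y); congr output.
  have tT : t <= Tf w.
    apply: leq_trans tb _; rewrite /Tf /full size_cat !size_map.
    apply: leq_trans (leq_addr _ _); rewrite leq_add2r leq_mul //.
    by case: (d') => // e; rewrite leq_exp2r // leq_add2l.
  rewrite -(subnK tT) iterD; elim: (Tf w - t) => //= n ->.
  by rewrite /step hl.
have -> : L w <-> relbuechi_holds R (red_instance M Tf mf w).
  rewrite red_holds // LV; split=> -[y ym].
    by move=> /Vf e; exists y => //; rewrite outE.
  by rewrite outE // => e; exists y => //; apply/Vf.
split=> [h|[I /(encode_inj unary_inj) /relbuechi_entries_inj -> //]].
by exists (red_instance M Tf mf w).
Qed.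

End Hardness.

Import Hardness.

(** * End components and bounds on the payoff *)

Module Payoffs.

Local Open Scope classical_set_scope.
Local Open Scope ring_scope.

Definition io (p : nat -> bool) := forall n, exists2 m, (n <= m)%N & p m.

Lemma eventually_io (X : finType) (z : nat -> X) :
  exists N, forall n, (N <= n)%N -> io (fun m => z m == z n).
Proof.
have /choice[f fP] : forall x, exists k, ~ io (fun m => z m == x) ->
    forall m, (k <= m)%N -> z m != x.
  move=> x; have [h|/existsNP[k kP]] := pselect (io (fun m => z m == x)).
    by exists 0%N.
  by exists k => _ m km; apply/negP => e; apply: kP; exists m.
exists (\max_x f x) => n le; apply: contrapT => N.
have := fP _ N n (leq_trans (leq_bigmax (z n)) le).
by rewrite eqxx.
Qed.

Lemma io_sub (p p' : nat -> bool) : (forall m, p m -> p' m) -> io p -> io p'.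
Proof. by move=> h H n; have [m nm /h pm] := H n; exists m. Qed.

Lemma io_exists (X : finType) (p : X -> nat -> bool) :
  io (fun m => [exists x, p x m]) -> exists x, io (p x).
Proof.
move=> H; apply: contrapT => /forallNP N.
have /choice[f fP] : forall x, exists k, forall m, (k <= m)%N -> ~~ p x m.
  move=> x; have /existsNP[k kP] := N x; exists k => m km.
  by apply/negP => pm; apply: kP; exists m.
have [m le /existsP[x px]] := H (\max_x f x).
by have := fP x m (leq_trans (leq_bigmax x) le); rewrite px.
Qed.

Section AlmostSure.
Context (R : realType) (S Act : finType) (M : mdp S Act) (sigma : scheduler R M) (s : S).
Notation hist := (history S Act).
Notation P := (path_measure sigma s).
Notation pre := (@prefix_of S Act M).
Notation one := (one sigma).

Lemma negligible_exists (I : finType) (F : I -> set (infinite_paths M)) :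
  (forall i, P.-negligible (F i)) -> P.-negligible [set w | exists i, F i w].
Proof.
move=> H; pose F' n := if unpickle n is Some i then F i else set0.
apply: (@negligibleS _ _ _ _ (\bigcup_n F' n)).
  by move=> w [i Fi]; exists (pickle i) => //; rewrite /F' pickleK.
apply: negligible_bigcup => n; rewrite /F'; case: (unpickle n) => [i|] //.
exact: negligible_set0.
Qed.

Section Always.
Variable g : hist -> Act -> S -> bool.

Fixpoint steps_from (h : hist) (l : seq (Act * S)) : bool :=
  if l is (a, t) :: l' then g h a t && steps_from (ext h a t) l' else true.

Let steps (h : hist) := steps_from (h.1, [::]) h.2.

Lemma steps_ext h a t : steps (ext h a t) = steps h && g h a t.
Proof.
rewrite /steps /ext /=; case: h => x p /=.
suff H q : steps_from (x, q) (rcons p (a, t)) =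
    steps_from (x, q) p && g (x, q ++ p) a t by exact: H.
elim: p q => [|[b u] p IH] q /=; first by rewrite cats0 andbT.
by rewrite IH andbA cat_rcons.
Qed.

(** The indicator that some earlier step violated [g] is a supermartingale with initial value 0. *)
Lemma always : (forall h, finite_path M h -> one h (fun a t => (~~ g h a t)%:R) <= 0) ->
  P.-negligible [set w : infinite_paths M | exists n, ~~ g (pre w n) (w n).2 (w n.+1).1].
Proof.
move=> H.
apply: (@negligibleS _ _ _ _ (\bigcup_n [set w : infinite_paths M | ~~ steps (pre w n)])).
  by move=> w [n gn]; exists n.+1 => //=; rewrite prefix_ext steps_ext negb_and gn orbT.
apply: negligible_bigcup => n.
have mA : measurable ([set w : infinite_paths M | ~~ steps (pre w n)]).
  by apply: (@determined_measurable _ _ M n) => w w' e; rewrite /= e.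
suff e : P [set w : infinite_paths M | ~~ steps (pre w n)] = 0 by exact/negligibleP.
rewrite (prob_fin P mA) (prob_determined _ _ n (fun h => ~~ steps h)).
congr EFin; apply: le_anti; apply/andP; split; last first.
  rewrite -(prob_determined _ _ n (fun h => ~~ steps h)); exact: fine_ge0.
apply: (@le_trans _ _ ((~~ steps (s, [::]))%:R : R)); last by [].
apply: (@expect_super _ _ _ _ sigma (fun h => (~~ steps h)%:R)) => // h hp.
rewrite (_ : (fun a t => _) = (fun a t => (~~ (steps h && g h a t))%:R)); last first.
  by apply: funext => a; apply: funext => t; rewrite steps_ext.
case: (steps h) => /=; first exact: H.
by rewrite one_cst.
Qed.

End Always.

Lemma always_pos : P.-negligible [set w : infinite_paths M | exists n,
  ~~ ((0 < sigma (pre w n) (w n).2) && (0 < trans M (w n).1 (w n).2 (w n.+1).1))].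
Proof.
pose g (h : hist) a t := (0 < sigma h a) && (0 < trans M (last_state h) a t).
apply: negligibleS (@always g _).
  by move=> w [n H]; exists n; rewrite /g last_state_prefix.
move=> h hp; apply: sumr_le0 => a _; apply: sumr_le0 => t _; rewrite /g negb_and.
have [|s0] := boolP (0 < sigma h a); last first.
  have -> : sigma h a = 0 by apply: le_anti; rewrite leNgt s0 (sched_ge0 _ hp).
  by rewrite !mul0r.
have [|t0] /= := boolP (0 < trans M (last_state h) a t); first by rewrite mulr0.
have -> : trans M (last_state h) a t = 0 by apply: le_anti; rewrite leNgt t0 trans_ge0.
by rewrite rmorph0 mulr0 mul0r.
Qed.

Lemma one_le_pos h (F : Act -> S -> R) (c : R) : finite_path M h ->
  (forall a, enabled M (last_state h) a -> 0 < sigma h a ->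
     \sum_t ratr (trans M (last_state h) a t) * F a t <= c) -> one h F <= c.
Proof.
move=> hp H; rewrite -[c]mul1r -(sched_sum1 sigma hp) big_distrl /=; apply: ler_sum => a _.
under eq_bigr do rewrite -mulrA; rewrite -big_distrr /=.
have [s0|s0] := boolP (0 < sigma h a); last first.
  have -> : sigma h a = 0 by apply: le_anti; rewrite leNgt s0 (sched_ge0 _ hp).
  by rewrite !mul0r.
apply: ler_wpM2l; first exact: ltW.
apply: H => //; apply: contraLR s0 => nen.
by rewrite (sched_enabled sigma hp nen) ltxx.
Qed.

Lemma sum_trans1 t a : enabled M t a -> \sum_x ratr (trans M t a x) = 1 :> R.
Proof. by move=> en; rewrite -rmorph_sum (eqP en) rmorph1. Qed.

(** The factor [(1 - p)^-1] exactly compensates the probability [1 - p] of a miss in one trial; for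
    [p = 1] a miss has probability 0 and any factor above 1 will do. *)
Definition boost (p : R) : R := if p == 1 then 2 else (1 - p)^-1.

Lemma boost_gt1 p : 0 < p -> p <= 1 -> 1 < boost p.
Proof.
move=> p0 p1; rewrite /boost; case: eqP => [_|/eqP ne]; first lra.
have : 0 < 1 - p by rewrite subr_gt0 lt_neqAle ne.
by move=> q0; rewrite invf_gt1 //; lra.
Qed.

Lemma boost_le1 p : p <= 1 -> (1 - p) * boost p <= 1.
Proof.
move=> p1; rewrite /boost; case: eqP => [->|/eqP ne]; first by rewrite subrr mul0r.
by rewrite mulfV // subr_eq0 eq_sym.
Qed.

(** This is [recurrence] with a trial at each use of [(t, a)] and success on entering [t']. *)
Lemma recurrent_successor t a t' : 0 < trans M t a t' ->
  P.-negligible [set w : infinite_paths M | io (fun m => w m == (t, a)) /\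
    ~ io (fun m => (w m).1 == t')].
Proof.
move=> p0; pose p : R := ratr (trans M t a t').
have p0' : 0 < p by rewrite ltr0q.
have p1' : p <= 1 by rewrite -[1](ratr_nat _ 1) ler_rat trans_le1.
pose G (h : hist) b := (last_state h == t) && (b == a).
pose D (h : hist) (b : Act) x := x == t' :> S.
apply: negligibleS (@recurrence _ _ _ _ sigma s G D (boost p) (boost_gt1 p0' p1') _).
  move=> w [H1 H2]; split.
    move=> n; have [m nm /eqP wm] := H1 n; exists m => //.
    by rewrite /G last_state_prefix wm !eqxx.
  have /existsNP[k kP] := H2; exists k => m km; apply/negP => /eqP e; apply: kP.
  by exists m.+1; [exact: leqW|rewrite e].
move=> h hp; apply: one_le_pos => // b en _; rewrite /D /G.
have sum1 := sum_trans1 en.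
case: ifP => [/andP[/eqP lt /eqP ba]|_]; last first.
  rewrite -[leRHS]sum1; apply: ler_sum => x _; rewrite mulr1.
  by rewrite ler_piMr ?ler0q ?trans_ge0 //; case: (x == t').
subst b; rewrite lt in sum1 *.
under eq_bigr do rewrite mulrA; rewrite -big_distrl /=.
suff -> : \sum_x ratr (trans M t a x) * (x != t')%:R = 1 - p by exact: boost_le1.
have -> : 1 - p = \sum_x ratr (trans M t a x) - p by rewrite sum1.
rewrite (bigD1 t') //= [X in _ = X - _](bigD1 t') //= eqxx mulr0 add0r.
rewrite addrAC subrr add0r; apply: eq_bigr => x ->; exact: mulr1.
Qed.

Definition regular (w : infinite_paths M) :=
  (forall n, (0 < sigma (pre w n) (w n).2) && (0 < trans M (w n).1 (w n).2 (w n.+1).1)) /\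
  (forall t a t', 0 < trans M t a t' -> io (fun m => w m == (t, a)) ->
     io (fun m => (w m).1 == t')).

Lemma ae_regular : P.-negligible [set w | ~ regular w].
Proof.
pose F (x : S * Act * S) := [set w : infinite_paths M |
  [/\ 0 < trans M x.1.1 x.1.2 x.2, io (fun m => w m == x.1) & ~ io (fun m => (w m).1 == x.2)]].
have nF : P.-negligible [set w | exists x, F x w].
  apply: negligible_exists => -[[t a] t'].
  have [p0|p0] := boolP (0 < trans M t a t').
    apply: negligibleS (recurrent_successor p0) => w [_ h1 h2]; split=> //.
  rewrite (_ : F _ = set0); first exact: negligible_set0.
  by apply/seteqP; split=> // w [/=]; rewrite (negbTE p0).
apply: negligibleS (negligibleU always_pos nF) => w nr.
apply: contrapT => /not_orP[n1 n2]; apply: nr; split.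
  by move=> n; apply: contrapT => /negP H; apply: n1; exists n.
move=> t a t' p0 H; apply: contrapT => H2; apply: n2.
by exists (t, a, t').
Qed.

End AlmostSure.

Section EndComponents.
Context (S Act : finType) (M : mdp S Act).

Definition Bst (B : {set S * Act}) : {set S} := [set t | [exists a, (t, a) \in B]].

Definition Bstep (B : {set S * Act}) : rel S :=
  fun t t' => [exists a, ((t, a) \in B) && (0 < trans M t a t')].

(** Strong connectivity is expressed through the base point [u], in both directions, which is the
    form that rank functions certify. *)
Definition ec (B : {set S * Act}) (u : S) : bool :=
  [&& u \in Bst B,
      [forall x in B, enabled M x.1 x.2 &&
         [forall t', (0 < trans M x.1 x.2 t') ==> (t' \in Bst B)]] &
      [forall t in Bst B, connect (Bstep B) t u && connect (Bstep B) u t]].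

Definition inf_pairs (w : nat -> S * Act) : {set S * Act} := [set x | `[< io (fun m => w m == x) >]].

Lemma inf_pairsP w x : reflect (io (fun m => w m == x)) (x \in inf_pairs w).
Proof. by rewrite inE; exact: asboolP. Qed.

Lemma Bst_inf w t : reflect (io (fun m => (w m).1 == t)) (t \in Bst (inf_pairs w)).
Proof.
apply: (iffP idP); rewrite inE.
  move=> /existsP[a /inf_pairsP]; apply: io_sub => m /eqP -> /=; exact: eqxx.
move=> H; apply/existsP.
have [|a Ha] := @io_exists Act (fun a m => w m == (t, a)).
  apply: io_sub H => m /eqP e; apply/existsP; exists (w m).2.
  by rewrite -e -surjective_pairing.
by exists a; apply/inf_pairsP.
Qed.

(** From some time on only recurring pairs are used, so the tail of the path itself connects any two
    recurring states. *)
Lemma ec_inf (w : nat -> S * Act) u :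
  (forall n, 0 < trans M (w n).1 (w n).2 (w n.+1).1) ->
  (forall t a t', 0 < trans M t a t' -> io (fun m => w m == (t, a)) ->
     io (fun m => (w m).1 == t')) ->
  u \in Bst (inf_pairs w) -> ec (inf_pairs w) u.
Proof.
move=> pos rec uB; rewrite /ec uB /=; apply/andP; split.
  apply/forall_inP => -[t a] /inf_pairsP H /=; apply/andP; split.
    have [m _ /eqP wm] := H 0%N; have := pos m; rewrite wm /= => p0.
    rewrite /enabled; apply/negPn/negP => ne.
    have := trans_01 ne; rewrite (bigD1 (w m.+1).1) //= => e.
    have : 0 <= \sum_(i | i != (w m.+1).1) trans M t a i.
      by apply: sumr_ge0 => i _; exact: trans_ge0.
    by move: p0 e; lra.
  by apply/forallP => t'; apply/implyP => p0; apply/Bst_inf; exact: rec H.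
have [N HN] := eventually_io w.
have path_conn n k : (N <= n)%N -> connect (Bstep (inf_pairs w)) (w n).1 (w (n + k)%N).1.
  move=> Nn; elim: k => [|k IH]; first by rewrite addn0.
  apply: connect_trans IH _; rewrite addnS; apply: connect1; apply/existsP.
  exists (w (n + k)%N).2; rewrite -surjective_pairing pos andbT.
  by apply/inf_pairsP; apply: HN; exact: leq_trans Nn (leq_addr _ _).
have conn t t' : t \in Bst (inf_pairs w) -> t' \in Bst (inf_pairs w) ->
    connect (Bstep (inf_pairs w)) t t'.
  move=> /Bst_inf Ht /Bst_inf Ht'; have [n Nn /eqP <-] := Ht N.
  by have [m nm /eqP <-] := Ht' n; rewrite -(subnKC nm); exact: path_conn.
by apply/forall_inP => t tB; rewrite !conn.
Qed.

End EndComponents.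

Section Values.
Context (R : realType) (S Act : finType) (M : mdp S Act).
Variables (I : finType) (q : I -> rat) (T : I -> {set S}).

Definition hit (U T : {set S}) : bool := [exists t in T, t \in U].

(* A negative coefficient is turned into a reward for not visiting its target. *)
Definition pay (U : {set S}) : rat := \sum_i `|q i| * (hit U (T i) (+) (q i < 0))%:R.

Definition neg_weight : rat := \sum_i (if q i < 0 then `|q i| else 0).

Definition value (sigma : scheduler R M) (s : S) : R :=
  \sum_i ratr (q i) * Pr sigma s (infinitely_often M (T i)).

Lemma pay_ge0 U : 0 <= pay U.
Proof. by apply: sumr_ge0 => i _; apply: mulr_ge0; rewrite ?ler0n. Qed.

Lemma payE U : pay U = \sum_i q i * (hit U (T i))%:R + neg_weight.
Proof.
rewrite /pay /neg_weight -big_split /=; apply: eq_bigr => i _.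
have [q0|q0] := ltP (q i) 0; [rewrite ltr0_norm //|rewrite ger0_norm //];
  case: (hit U (T i)) => /=; rewrite ?mulr1 ?mulr0 ?addr0 ?add0r ?subrr //.
Qed.

Lemma io_hit (w : infinite_paths M) i :
  (w \in infinitely_often M (T i)) = hit (Bst (inf_pairs w)) (T i).
Proof.
apply/idP/exists_inP => [|[t tT /Bst_inf H]]; rewrite inE; last first.
  by move=> n; have [m nm /eqP e] := H n; exists m => //; rewrite e.
move=> H; have [|t Ht] := @io_exists S (fun t m => (t \in T i) && ((w m).1 == t)).
  by move=> n; have [m nm mT] := H n; exists m => //; apply/existsP; exists (w m).1; rewrite mT /=.
exists t; last by apply/Bst_inf; apply: io_sub Ht => m /andP[].
by have [m _ /andP[]] := Ht 0%N.
Qed.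

Lemma payoff_inf (w : infinite_paths M) :
  \sum_i (ratr (q i) : R) * (w \in infinitely_often M (T i))%:R =
  ratr (pay (Bst (inf_pairs w)) - neg_weight).
Proof.
rewrite payE addrK rmorph_sum; apply: eq_bigr => i _.
by rewrite io_hit rmorphM rmorph_nat.
Qed.

Lemma last_state_ext (h : history S Act) a t : last_state (ext h a t) = t.
Proof. by rewrite /last_state /ext /= map_rcons last_rcons. Qed.

Theorem upper_bound (v : S -> rat) :
  (forall s a, enabled M s a -> \sum_t trans M s a t * v t <= v s) ->
  (forall B u, ec M B u -> pay (Bst B) <= v u) ->
  forall (sigma : scheduler R M) s, value sigma s + ratr neg_weight <= ratr (v s).
Proof.
move=> sup maj sigma s; rewrite -lerBrDr -rmorphB.
pose Phi (h : history S Act) : R := ratr (v (last_state h) - neg_weight).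
apply: (@expectation_le R S Act M sigma s I (fun i => infinitely_often M (T i))
  (fun i => ratr (q i)) Phi (ratr (\sum_s `|v s| + `|neg_weight|))).
- by move=> i; exact: measurable_infinitely_often.
- move=> h hp; apply: one_le_pos => // a en _; rewrite /Phi.
  under eq_bigr do rewrite last_state_ext -rmorphM.
  rewrite -rmorph_sum ler_rat.
  under eq_bigr do rewrite mulrBr.
  by rewrite sumrB -big_distrl /= (eqP en) mul1r lerD2r; exact: sup.
- move=> h; rewrite /Phi -ratr_norm ler_rat (le_trans (ler_normB _ _)) // lerD2r.
  rewrite (bigD1 (last_state h)) //= lerDl; apply: sumr_ge0 => *; exact: normr_ge0.
(* From [N] on every visited state recurs, hence lies in the end component of the path, whose payoff
   is dominated by [v] there. *)
apply: negligibleS (ae_regular sigma s) => w /= nN reg; apply: nN.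
have [N HN] := eventually_io w; exists N => n Nn.
rewrite payoff_inf /Phi last_state_prefix ler_rat lerD2r; apply: maj.
have [pos rec] := reg; apply: ec_inf => //.
  by move=> m; have /andP[] := pos m.
by apply/Bst_inf; apply: io_sub (HN n Nn) => m /eqP ->.
Qed.

Section Lower.
Variables (pi : S -> option Act) (B : S -> {set S * Act}) (x : S -> rat) (rk : S -> nat).

Definition stop_value u : rat := if ec M (B u) u then pay (Bst (B u)) else 0.

Hypothesis pi_en : forall s a, pi s = Some a -> enabled M s a.
Hypothesis x_step : forall s a, pi s = Some a -> x s <= \sum_t trans M s a t * x t.
Hypothesis x_stop : forall s, pi s = None -> x s <= stop_value s.
Hypothesis rk_dec : forall s a, pi s = Some a ->
  exists2 t, 0 < trans M s a t & (rk t < rk s)%N.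

(* The first stopping state of the history, whose end component is then followed. *)
Definition mode (h : history S Act) : option S :=
  ohead [seq t <- h.1 :: [seq y.2 | y <- h.2] | pi t == None].

Lemma mode_ext h a t : mode (ext h a t) =
  if mode h is Some u then Some u else if pi t == None then Some t else None.
Proof.
rewrite /mode [(ext h a t).1]/= [(ext h a t).2]/= map_rcons -rcons_cons filter_rcons.
by case: (pi t == None); case: [seq t0 <- h.1 :: [seq y.2 | y <- h.2] | pi t0 == None].
Qed.

Lemma mode_none h : mode h = None -> exists a, pi (last_state h) = Some a.
Proof.
rewrite /mode /last_state => e.
have : last_state h \notin [seq t <- h.1 :: [seq y.2 | y <- h.2] | pi t == None].
  by move: e; case: [seq t0 <- h.1 :: [seq y.2 | y <- h.2] | pi t0 == None].
rewrite mem_filter mem_last andbT /last_state.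
by case: (pi _) => // a _; exists a.
Qed.

Definition en_set t : {set Act} := finset (enabled M t).

(** All actions of the component are played with equal probability, so that each recurs. The default
    keeps the scheduler defined elsewhere; a path that follows an end component does not meet it. *)
Definition acts u t : {set Act} :=
  let E := en_set t :&: finset (fun a => (t, a) \in B u) in if E == finset.set0 then en_set t else E.

Definition allowed h : {set Act} :=
  if mode h is Some u then acts u (last_state h)
  else if pi (last_state h) is Some a then finset.set1 a else en_set (last_state h).

Lemma en_set0 t : en_set t != finset.set0.
Proof. by have [a en] := actions_enabled M t; apply/finset.set0Pn; exists a; rewrite inE. Qed.

Lemma acts_sub u t : acts u t \subset en_set t.
Proof. by rewrite /acts; case: ifP => _ //; apply/fintype.subsetP => a; rewrite !inE => /andP[]. Qed.

Lemma allowed_sub h : allowed h \subset en_set (last_state h).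
Proof.
rewrite /allowed; case: (mode h) => [u|]; first exact: acts_sub.
by case e : (pi _) => [a|] //; rewrite finset.sub1set inE; exact: pi_en.
Qed.

Lemma allowed0 h : (0 < #|allowed h|)%N.
Proof.
rewrite finset.card_gt0 /allowed; case: (mode h) => [u|].
  by rewrite /acts; case: ifP => [_|->] //; exact: en_set0.
case: (pi _) => [a|]; last exact: en_set0.
by apply/finset.set0Pn; exists a; rewrite inE.
Qed.

Definition lower_sched : scheduler R M.
Proof.
apply: (@Scheduler R _ _ M (fun h a => (a \in allowed h)%:R / #|allowed h|%:R)).
- by move=> h _ a; rewrite divr_ge0 ?ler0n.
- move=> h _; rewrite -big_distrl /= -natr_sum -big_mkcond sum1_card divff //.
  by rewrite pnatr_eq0 -lt0n allowed0.
- move=> h _ a nen; rewrite (_ : a \in allowed h = false) ?mul0r //.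
  by apply: contraNF nen => /(fintype.subsetP (allowed_sub h)); rewrite inE.
Defined.

Lemma lower_pos h a : (0 < lower_sched h a) = (a \in allowed h).
Proof.
rewrite /=; case: (a \in allowed h); last by rewrite mul0r ltxx.
by rewrite mul1r invr_gt0 ltr0n allowed0.
Qed.

Variable s : S.
Notation P := (path_measure lower_sched s).
Notation pre := (@prefix_of S Act M).

(** Each visit to [t] in mode [u] is a trial that selects [a0] with probability
    [1 / #|acts u t|]. *)
Lemma recurrent_action u t a0 : a0 \in acts u t ->
  P.-negligible [set w : infinite_paths M |
    io (fun m => (mode (pre w m) == Some u) && ((w m).1 == t)) /\
    ~ io (fun m => w m == (t, a0))].
Proof.
move=> a0A; set A := acts u t in a0A.
have A0 : (0 < #|A|)%N by apply/card_gt0P; exists a0.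
pose p : R := #|A|%:R^-1.
have p0 : 0 < p by rewrite invr_gt0 ltr0n.
have p1 : p <= 1 by rewrite invf_le1 ?ltr0n // ler1n.
pose G (h : history S Act) (b : Act) := (mode h == Some u) && (last_state h == t).
pose D (h : history S Act) (b : Act) (y : S) := (last_state h == t) && (b == a0).
apply: negligibleS (@recurrence _ _ _ _ lower_sched s G D (boost p) (boost_gt1 p0 p1) _).
  move=> w [H1 H2]; split.
    by move=> n; have [m nm /andP[h1 h2]] := H1 n; exists m => //; rewrite /G h1 last_state_prefix.
  have /existsNP[k kP] := H2; exists k => m km; rewrite /D last_state_prefix.
  apply/negP => /andP[/eqP e1 /eqP e2]; apply: kP; exists m => //.
  by rewrite -e1 -e2 -surjective_pairing.
move=> h hp; rewrite /D /G.
have [/andP[/eqP hm /eqP ht]|_] := boolP (_ && _); last first.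
  apply: one_le_pos => // a en _; rewrite -[leRHS](sum_trans1 _ en); apply: ler_sum => y _.
  rewrite mulr1 ler_piMr ?ler0q ?trans_ge0 //; by case: (~~ _).
have al : allowed h = A by rewrite /allowed hm ht.
rewrite ht eqxx /=.
have -> : one lower_sched h (fun a (_ : S) => (a != a0)%:R * boost p) =
    boost p * \sum_a lower_sched h a * (a != a0)%:R.
  rewrite /one big_distrr; apply: eq_bigr => a _ /=; rewrite ht.
  rewrite -big_distrl -big_distrr /=.
  have [aA|aA] := boolP (a \in allowed h); last by rewrite !mul0r mulr0.
  have /(fintype.subsetP (allowed_sub h)) := aA; rewrite inE ht => en.
  by rewrite sum_trans1 // mulr1 [RHS]mulrC mulrA.
rewrite (_ : \sum_a _ = 1 - p); first by rewrite mulrC; exact: boost_le1.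
have -> : 1 - p = \sum_a lower_sched h a - p by rewrite sched_sum1.
rewrite (bigD1 a0) //= [X in _ = X - _](bigD1 a0) //=.
rewrite eqxx mulr0 add0r al a0A mul1r addrAC subrr add0r.
by apply: eq_bigr => a ->; rewrite mulr1.
Qed.

Definition fair (w : infinite_paths M) := forall u t a, a \in acts u t ->
  io (fun m => (mode (pre w m) == Some u) && ((w m).1 == t)) -> io (fun m => w m == (t, a)).

Lemma ae_fair : P.-negligible [set w | ~ fair w].
Proof.
pose F (y : S * S * Act) := [set w : infinite_paths M | [/\ y.2 \in acts y.1.1 y.1.2,
  io (fun m => (mode (pre w m) == Some y.1.1) && ((w m).1 == y.1.2)) &
  ~ io (fun m => w m == (y.1.2, y.2))]].
apply: (@negligibleS _ _ _ _ [set w | exists y, F y w]).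
  move=> w nf; apply: contrapT => N; apply: nf => u t a aA H; apply: contrapT => H'.
  by apply: N; exists (u, t, a).
apply: negligible_exists => -[[u t] a].
have [aA|aA] := boolP (a \in acts u t).
  by apply: negligibleS (recurrent_action aA) => w [_ h1 h2].
rewrite (_ : F _ = set0); first exact: negligible_set0.
by apply/seteqP; split=> // w [/=]; rewrite (negbTE aA).
Qed.

Section OnPath.
Variable w : infinite_paths M.
Hypothesis reg : regular lower_sched w.
Hypothesis fw : fair w.

Lemma path_allowed n : (w n).2 \in allowed (pre w n).
Proof. by have [/(_ n) /andP[+ _] _] := reg; rewrite lower_pos. Qed.

Lemma path_pos n : 0 < trans M (w n).1 (w n).2 (w n.+1).1.
Proof. by have [/(_ n) /andP[]] := reg. Qed.

Lemma inf_nonempty : exists t, t \in Bst (inf_pairs w).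
Proof.
have [N HN] := eventually_io w; exists (w N).1; apply/Bst_inf.
by apply: io_sub (HN N (leqnn _)) => m /eqP ->.
Qed.

(** Without a stop, a recurring state of minimal rank would have a successor of smaller rank, which
    recurs as well. *)
Lemma eventually_stops : exists n, mode (pre w n) != None.
Proof.
apply: contrapT => /forallNP N.
have mN n : mode (pre w n) = None by apply/eqP/negPn/negP; exact: N.
have step n : pi (w n).1 = Some (w n).2.
  have := path_allowed n; rewrite /allowed mN last_state_prefix.
  have [a e] := mode_none (mN n); rewrite last_state_prefix in e; rewrite e.
  by rewrite inE => /eqP ->.
have [t0 t0B] := inf_nonempty.
case: (arg_minnP rk t0B) => t tB tmin.
have : t \in Bst (inf_pairs w) by []; rewrite inE => /existsP[a /inf_pairsP H].
have pit : pi t = Some a by have [m _ /eqP e] := H 0%N; have := step m; rewrite e.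
have [t' p0 lt] := rk_dec pit.
have : t' \in Bst (inf_pairs w) by apply/Bst_inf; have [_ rec] := reg; exact: rec H.
by move=> /tmin; rewrite leqNgt lt.
Qed.

Lemma mode_stable n m u : (n <= m)%N -> mode (pre w n) = Some u -> mode (pre w m) = Some u.
Proof.
move=> /subnKC <- e; elim: (m - n)%N => [|k IH]; first by rewrite addn0.
by rewrite addnS prefix_ext mode_ext IH.
Qed.

Lemma mode_inv n u : mode (pre w n) = Some u -> ec M (B u) u -> (w n).1 \in Bst (B u).
Proof.
move=> + ecu; elim: n => [|n IH].
  rewrite /mode /=; case: (pi _ == None) => //= -[->].
  by case/and3P: ecu.
rewrite prefix_ext mode_ext; case e : (mode (pre w n)) IH => [u'|] IH.
  move=> [eu]; subst u'; have tB := IH erefl.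
  have := path_allowed n; rewrite /allowed e /acts last_state_prefix.
  case: eqP => [E0|_].
    have := tB; rewrite inE => /existsP[a aB]; have : a \in en_set (w n).1 :&: finset (fun a => ((w n).1, a) \in B u).
      case/and3P: ecu => _ /forall_inP /(_ _ aB) /andP[en _] _.
      by rewrite !inE en.
    by rewrite E0 inE.
  rewrite !inE -surjective_pairing => /andP[_ wB].
  case/and3P: ecu => _ /forall_inP /(_ _ wB) /andP[_ /forallP /(_ (w n.+1).1)] + _.
  by rewrite path_pos /= inE.
by case: (pi _ == None) => // -[->]; case/and3P: ecu.
Qed.

(** The recurring states stay within the component and, by fairness, are closed under its steps;
    strong connectivity leaves only the whole component. *)
Lemma inf_component n u : mode (pre w n) = Some u -> ec M (B u) u ->
  Bst (inf_pairs w) = Bst (B u).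
Proof.
move=> mu ecu; apply/setP => t.
have sub t' : t' \in Bst (inf_pairs w) -> t' \in Bst (B u).
  move=> /Bst_inf H; have [m nm /eqP <-] := H n.
  exact: mode_inv (mode_stable nm mu) ecu.
have clo t1 t2 : t1 \in Bst (inf_pairs w) -> Bstep M (B u) t1 t2 -> t2 \in Bst (inf_pairs w).
  move=> t1I /existsP[a /andP[aB p0]]; apply/Bst_inf; have [_ rec] := reg; apply: (rec _ _ _ p0).
  have en : enabled M t1 a by case/and3P: ecu => _ /forall_inP /(_ _ aB) /andP[].
  have aE : a \in en_set t1 :&: finset (fun a => (t1, a) \in B u) by rewrite !inE en.
  have aA : a \in acts u t1.
    by rewrite /acts; case: eqP aE => // ->; rewrite inE.
  apply: (fw aA); have /Bst_inf H := t1I => k; have [m km wm] := H (maxn k n).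
  exists m; first exact: leq_trans (leq_maxl _ _) km.
  by rewrite wm andbT (mode_stable (leq_trans (leq_maxr _ _) km) mu).
have cl t1 t2 : t1 \in Bst (inf_pairs w) -> connect (Bstep M (B u)) t1 t2 ->
    t2 \in Bst (inf_pairs w).
  move=> + /connectP[l pl ->] => {t2}; elim: l t1 pl => [|y l IH] t1 //= /andP[h1 h2] t1I.
  exact: IH h2 (clo _ _ t1I h1).
apply/idP/idP; first exact: sub.
move=> tB; have [t0 t0I] := inf_nonempty; have /and3P[_ _ /forall_inP co] := ecu.
have /andP[c1 _] := co _ (sub _ t0I); have /andP[_ c2] := co _ tB.
exact: cl (cl _ _ t0I c1) c2.
Qed.

End OnPath.

(** This is [expectation_le] for the negated payoff. The process [z] is the value of the current
    state until the first stop and from then on the reward of the stopping state, so [- z] is a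
    supermartingale. *)
Theorem lower_bound : ratr (x s) <= value lower_sched s + ratr neg_weight.
Proof.
pose z (h : history S Act) := if mode h is Some u then stop_value u else x (last_state h).
pose Phi (h : history S Act) : R := ratr (neg_weight - z h).
suff H : \sum_i - ratr (q i) * fine (P (infinitely_often M (T i))) <= Phi (s, [::]).
  have H2 : ratr (x s) <= ratr (z (s, [::])) :> R.
    by rewrite ler_rat /z /mode /=; case: eqP => [/x_stop|].
  move: H; rewrite /Phi rmorphB /=; under eq_bigr do rewrite mulNr.
  by rewrite sumrN /value /Pr; lra.
apply: (@expectation_le R S Act M lower_sched s I (fun i => infinitely_often M (T i))
  (fun i => - ratr (q i)) Phi (ratr (`|neg_weight| + (\sum_s `|x s| + \sum_s `|stop_value s|)))).
- by move=> i; exact: measurable_infinitely_often.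
- move=> h hp; apply: one_le_pos => // a en; rewrite lower_pos => al; rewrite /Phi.
  under eq_bigr do rewrite -rmorphM; rewrite -rmorph_sum ler_rat.
  under eq_bigr do rewrite mulrBr.
  rewrite sumrB -big_distrl /= (eqP en) mul1r lerD2l lerN2.
  case e : (mode h) => [u|].
    rewrite /z e; under eq_bigr do rewrite mode_ext e.
    by rewrite -big_distrl /= (eqP en) mul1r.
  have [b eb] := mode_none e.
  have ab : a = b by move: al; rewrite /allowed e eb inE => /eqP.
  subst b; rewrite {1}/z e; apply: le_trans (x_step eb) _; apply: ler_sum => t _.
  apply: ler_wpM2l; first exact: trans_ge0.
  rewrite /z mode_ext e last_state_ext; case: eqP => [/x_stop //|_]; exact: lexx.
- move=> h; rewrite /Phi -ratr_norm ler_rat (le_trans (ler_normB _ _)) // lerD2l /z.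
  case: (mode h) => [u|].
    rewrite [X in _ <= _ + X](bigD1 u) //= addrCA lerDl addr_ge0 //; apply: sumr_ge0 => *; exact: normr_ge0.
  rewrite (bigD1 (last_state h)) //= -addrA lerDl addr_ge0 //; apply: sumr_ge0 => *; exact: normr_ge0.
apply: negligibleS (negligibleU (ae_regular lower_sched s) ae_fair) => w /= nN.
apply: contrapT => /not_orP[/contrapT reg /contrapT fw]; apply: nN.
have [n mn] := eventually_stops reg.
case mu : (mode (pre w n)) mn => [u|] // _; exists n => m nm.
under eq_bigr do rewrite mulNr.
rewrite sumrN payoff_inf /Phi /z (mode_stable nm mu) -rmorphN ler_rat opprB lerD2l lerN2.
(* If [B u] is not an end component, nothing is known about the path, but the reward is 0 and the
   shifted payoff is non-negative. *)
rewrite /stop_value; case: ifP => ecu; last exact: pay_ge0.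
by rewrite (inf_component reg fw mu ecu).
Qed.

End Lower.

End Values.

End Payoffs.

Import Payoffs.

(** * Optimal stopping on a finite decision process *)

Module OptimalStopping.

Local Open Scope ring_scope.

(** The rank is the length of a shortest path to [Z]; a path without repetitions shows that it is
    below [#|S|]. States that cannot reach [Z] get rank 0. *)
Lemma rank_exists (S : finType) (r : rel S) (Z : pred S) :
  exists rk : S -> nat, (forall s, rk s < #|S|)%N /\
    forall s t, Z t -> connect r s t -> ~~ Z s -> exists2 t', r s t' & (rk t' < rk s)%N.
Proof.
pose reach s k := [exists p : k.-tuple S, path r s p && Z (last s p)].
pose ok s := has (reach s) (iota 0 #|S|).
pose rk s := if ok s then find (reach s) (iota 0 #|S|) else 0%N.
have okP s t : Z t -> connect r s t -> ok s.
  move=> Zt /connectP[p /shortenP[p' pp' up' _]] e; subst t.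
  apply/hasP; exists (size p').
    rewrite mem_iota add0n /= -[(size p').+1]/(size (s :: p')).
    by rewrite -(card_uniqP up') max_card.
  by apply/existsP; exists (in_tuple p'); rewrite /= pp'.
have rkP s : ok s -> reach s (rk s) /\ forall k, reach s k -> (rk s <= k)%N.
  move=> os; rewrite /rk os; have := os; rewrite /ok has_find size_iota => lt; split.
    by have := nth_find 0%N os; rewrite nth_iota.
  move=> k rk_k; rewrite leqNgt; apply/negP => klt.
  have := before_find 0%N klt; rewrite nth_iota ?add0n ?rk_k //.
  exact: ltn_trans klt lt.
exists rk; split=> [s|s t Zt co nZ].
  rewrite /rk; case: ifP => [|_]; first by rewrite /ok has_find size_iota.
  by apply/card_gt0P; exists s.
have os := okP _ _ Zt co; have [/existsP[p /andP[pp Zp]] _] := rkP _ os.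
case: p pp Zp => -[|t' p] /= ep; first by rewrite (negbTE nZ).
move=> /andP[rt pp] Zp; exists t' => //.
have co' : connect r t' (last t' p) by apply/connectP; exists p.
have [_ min] := rkP _ (okP _ _ Zp co').
rewrite -(eqP ep) /= ltnS; apply: min; apply/existsP; exists (in_tuple p).
by rewrite /= pp.
Qed.

Section Stopping.
Context (n : nat) (Act : finType) (M : mdp 'I_n Act).
Notation S := 'I_n.
Implicit Types (pi : {ffun S -> option Act}) (y : S -> rat).

Definition closed_under pi (C : {set S}) : bool :=
  [forall s in C, if pi s is Some a then [forall t, (0 < trans M s a t) ==> (t \in C)]
                  else false].

(** The second condition excludes a non-empty closed set without stopping states, which on a finite
    process says that a stop is reached almost surely from every state. *)
Definition proper pi : bool :=
  [forall s, if pi s is Some a then enabled M s a else true] &&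
  [forall C : {set S}, closed_under pi C ==> (C == finset.set0)].

Lemma proper_enabled pi s a : proper pi -> pi s = Some a -> enabled M s a.
Proof. by move=> /andP[/forallP /(_ s) + _] e; rewrite e. Qed.

Lemma proper_closed pi (C : {set S}) s : proper pi -> closed_under pi C -> s \notin C.
Proof. by move=> /andP[_ /forallP /(_ C) /implyP h] /h /eqP ->; rewrite finset.in_set0. Qed.

Lemma avg_max s a y m : enabled M s a ->
  (forall t, 0 < trans M s a t -> y t <= m) -> m <= \sum_t trans M s a t * y t ->
  forall t, 0 < trans M s a t -> y t = m.
Proof.
move=> en le ge t p0.
have H x : 0 <= trans M s a x * (m - y x).
  have [/le h|p] := boolP (0 < trans M s a x).
    by rewrite mulr_ge0 ?trans_ge0 // subr_ge0.
  have -> : trans M s a x = 0 by apply: le_anti; rewrite trans_ge0 leNgt p.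
  by rewrite mul0r.
have e : \sum_x trans M s a x * (m - y x) = m - \sum_x trans M s a x * y x.
  by under eq_bigr do rewrite mulrBr; rewrite sumrB -big_distrl /= (eqP en) mul1r.
have := le t p0; have := H t; move: e; rewrite (bigD1 t) //=.
have : 0 <= \sum_(i | i != t) trans M s a i * (m - y i) by apply: sumr_ge0.
move=> h1 h2 h3 h4; have : trans M s a t * (m - y t) = 0 by lra.
by move=> /eqP; rewrite mulf_eq0 (gt_eqF p0) /= subr_eq0 => /eqP.
Qed.

(** The states where [y] attains a positive maximum would form a closed set: an average that is not
    below the maximum attains it in every successor. *)
Lemma max_principle pi y : proper pi ->
  (forall s a, pi s = Some a -> y s <= \sum_t trans M s a t * y t) ->
  (forall s, pi s = None -> y s <= 0) -> forall s, y s <= 0.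
Proof.
move=> pr step stop s0; rewrite leNgt; apply/negP => y0.
have [m _ mmax] := @Order.TotalTheory.arg_maxP _ _ _ s0 predT y isT.
have ym : 0 < y m by apply: lt_le_trans y0 _; exact: mmax.
have : m \notin (finset (fun s => y s == y m) : {set S}).
  apply: (proper_closed m pr); apply/forall_inP => s; rewrite inE => /eqP ys.
  case e : (pi s) => [a|]; last by have := stop _ e; rewrite ys leNgt ym.
  apply/forallP => t; apply/implyP => p0; rewrite inE; apply/eqP.
  apply: avg_max p0; first exact: proper_enabled e.
    by move=> x _; exact: mmax.
  by rewrite -ys; exact: step.
by rewrite inE eqxx.
Qed.

(** The states from which no stop is reachable form a closed set, so there are none. *)
Lemma proper_rank pi : proper pi -> exists rk : S -> nat, (forall s, rk s < n)%N /\
  forall s a, pi s = Some a -> exists2 t, 0 < trans M s a t & (rk t < rk s)%N.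
Proof.
move=> pr; pose r s t := if pi s is Some a then 0 < trans M s a t else false.
have [rk [rkn rkP]] := rank_exists r (fun s => pi s == None).
exists rk; split=> [s|s a e]; first by have := rkn s; rewrite card_ord.
pose C : {set S} := finset (fun s => ~~ [exists t, (pi t == None) && connect r s t]).
have : s \notin C.
  apply: proper_closed pr _; apply/forall_inP => s'; rewrite inE => nC.
  case e' : (pi s') => [b|].
    apply/forallP => t; apply/implyP => p0; rewrite inE; apply: contra nC.
    move=> /existsP[t' /andP[Zt' co]]; apply/existsP; exists t'; rewrite Zt' /=.
    by apply: connect_trans co; apply: connect1; rewrite /r e'.
  by case/existsP: nC; exists s'; rewrite e' eqxx connect0.
rewrite inE negbK => /existsP[t /andP[Zt co]].
have [|t' rt lt] := rkP s t Zt co; first by rewrite e.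
by exists t' => //; move: rt; rewrite /r e.
Qed.

Variables (D : nat) (Et : S -> Act -> S -> nat) (Gd : S -> nat).
Hypothesis D0 : (0 < D)%N.
Hypothesis EtE : forall s a t, (Et s a t)%:R = D%:R * trans M s a t.

Let Dq : (D%:R : rat) != 0.
Proof. by rewrite pnatr_eq0 -lt0n. Qed.

Lemma Et_le s a t : (Et s a t <= D)%N.
Proof. by rewrite -(ler_nat rat) EtE ler_piMr ?ler0n // trans_le1. Qed.

(** [D] times the identity minus the transition matrix in the moving rows, the identity in the
    stopping rows; with integer entries, Cramer's rule yields quotients of integers. *)
Definition policy_mx pi : 'M[int]_n := \matrix_(i, j)
  if pi i is Some a then (i == j)%:R * D%:Z - (Et i a j)%:Z else (i == j)%:R.

Definition stop_col pi : 'cV[int]_n := \col_i if pi i is Some a then 0 else (Gd i)%:Z.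

Lemma sum_policy pi s y : \sum_t (policy_mx pi s t)%:~R * y t =
  if pi s is Some a then D%:R * (y s - \sum_t trans M s a t * y t) else y s.
Proof.
have delta (c : rat) : \sum_t (s == t)%:R * c * y t = c * y s.
  rewrite (bigD1 s) //= eqxx mul1r big1 ?addr0 // => t ne.
  by rewrite eq_sym (negbTE ne) !mul0r.
case e : (pi s) => [a|].
  rewrite mulrBr -(delta D%:R) big_distrr -sumrB; apply: eq_bigr => t _ /=.
  rewrite mxE e rmorphB rmorphM /= mulrBl mulrA -EtE.
  by congr (_ * _ * _ - _); case: (s == t).
rewrite -[RHS]mul1r -(delta 1); apply: eq_bigr => t _.
by rewrite mxE e mulr1; congr (_ * _); case: (s == t).
Qed.

(** A kernel vector is harmonic in the moving states and 0 in the stopping ones; the maximum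
    principle for it and for its negative makes it 0. *)
Lemma policy_det pi : proper pi -> \det (policy_mx pi) != 0.
Proof.
move=> pr; apply/negP => /eqP d0.
have : \det (map_mx (fun z : int => z%:~R : rat) (policy_mx pi)^T) = 0.
  by rewrite det_map_mx det_tr d0.
move=> /eqP/det0P[v v0 ev].
have eq0 s : \sum_t (policy_mx pi s t)%:~R * v 0 t = 0.
  have := congr1 (fun B : 'rV__ => B 0 s) ev; rewrite /= !mxE => e0.
  by rewrite -[RHS]e0; apply: eq_bigr => t _; rewrite !mxE mulrC.
have harm (c : rat) s : c * v 0 s <= 0.
  have pol s' := eq0 s'; move: s.
  apply: (max_principle pr) => [s a e|s e].
    have := pol s; rewrite sum_policy e => /eqP.
    rewrite mulf_eq0 (negbTE Dq) /= subr_eq0 => /eqP ->.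
    by rewrite big_distrr /=; apply: ler_sum => t _; rewrite mulrCA.
  by have := pol s; rewrite sum_policy e => ->; rewrite mulr0.
case/eqP: v0; apply/rowP => s; rewrite mxE; apply: le_anti.
by have := harm 1 s; have := harm (-1) s; rewrite mul1r mulN1r oppr_le0 => -> ->.
Qed.

(** Cramer's rule via the adjugate; the last division by [D] undoes the scaling of the rewards
    [Gd]. *)
Definition policy_value pi (s : S) : rat :=
  ((\adj (policy_mx pi) *m stop_col pi) s 0)%:~R / (\det (policy_mx pi))%:~R / D%:R.

Lemma policy_valueE pi s : proper pi ->
  \sum_t (policy_mx pi s t)%:~R * policy_value pi t = (stop_col pi s 0)%:~R / D%:R.
Proof.
move=> pr; under eq_bigr do rewrite /policy_value !mulrA.
rewrite -!big_distrl /=; congr (_ / _).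
have d0 : (\det (policy_mx pi))%:~R != 0 :> rat by rewrite intr_eq0 policy_det.
apply: (canLR (mulfK d0)).
have := congr1 (fun B : 'cV[int]__ => B s 0) (mulmxA (policy_mx pi) (\adj (policy_mx pi)) (stop_col pi)).
rewrite /= mul_mx_adj mul_scalar_mx !mxE => /(congr1 (fun z : int => z%:~R : rat)).
rewrite rmorph_sum rmorphM /= mulrC => <-.
by apply: eq_bigr => t _; rewrite rmorphM.
Qed.

Lemma policy_value_step pi s a : proper pi -> pi s = Some a ->
  policy_value pi s = \sum_t trans M s a t * policy_value pi t.
Proof.
move=> pr e; have := policy_valueE s pr; rewrite sum_policy e mxE e mul0r => /eqP.
by rewrite mulf_eq0 (negbTE Dq) /= subr_eq0 => /eqP.
Qed.

Lemma policy_value_stop pi s : proper pi -> pi s = None ->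
  policy_value pi s = (Gd s)%:R / D%:R.
Proof. by move=> pr e; have := policy_valueE s pr; rewrite sum_policy e mxE e. Qed.

Lemma policy_value_ge0 pi s : proper pi -> 0 <= policy_value pi s.
Proof.
move=> pr; rewrite -oppr_le0; move: s; apply: (max_principle pr) => s.
  move=> a e; rewrite (policy_value_step pr e) -sumrN.
  by apply: ler_sum => t _; rewrite mulrN.
by move=> e; rewrite policy_value_stop // oppr_le0 divr_ge0 ?ler0n.
Qed.

Lemma policy_value_le pi s : proper pi -> policy_value pi s <= (\max_t Gd t)%:R / D%:R.
Proof.
move=> pr; rewrite -subr_le0.
move: s; apply: (max_principle pr (y := fun s => policy_value pi s - _)) => s.
  move=> a e; rewrite {1}(policy_value_step pr e); under [leRHS]eq_bigr do rewrite mulrBr.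
  by rewrite sumrB lerD2l lerN2 -big_distrl /= (eqP (proper_enabled pr e)) mul1r.
move=> e; rewrite policy_value_stop // subr_le0 ler_pM2r ?invr_gt0 ?ltr0n //.
by rewrite ler_nat; exact: leq_bigmax.
Qed.

(** In Leibniz' formula every matrix entry is at most [D] in absolute value: a diagonal entry of a
    moving row is [D] minus a number between 0 and [D], and in a stopping row [1 <= D] applies. *)
Lemma det_policy_le pi : (absz (\det (policy_mx pi)) <= n`! * D ^ n)%N.
Proof.
rewrite -lez_nat abszE /determinant; apply: le_trans (ler_norm_sum _ _ _) _.
apply: (@le_trans _ _ (\sum_(s : 'S_n) (D ^ n)%N%:Z)); last first.
  by rewrite sumr_const card_Sn -mulr_natl natz PoszM.
apply: ler_sum => s _; rewrite normrM normrX normrN1 expr1n mul1r normr_prod.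
have -> : (D ^ n)%N%:Z = \prod_(i < n) D%:Z.
  by rewrite prodr_const card_ord -!natz natrX.
apply: ler_prod => i _; rewrite normr_ge0 /= mxE.
case: (pi i) => [a|].
  have := Et_le i a (s i); case: (_ == _); rewrite ?mul1r ?mul0r ?sub0r => le.
    by rewrite ger0_norm ?subr_ge0 ?lez_nat // gerBl lez_nat.
  by rewrite normrN /= lez_nat.
by case: (_ == _); rewrite ?normr1 ?normr0 // lez_nat.
Qed.

Lemma proper_stop : proper [ffun=> None].
Proof.
apply/andP; split; first by apply/forallP => s; rewrite ffunE.
apply/forallP => C; apply/implyP => /forall_inP H; apply/eqP/setP => s.
by rewrite finset.in_set0; apply/negP => /H; rewrite ffunE.
Qed.

Lemma proper_upd_stop pi s0 : proper pi ->
  proper [ffun s => if s == s0 then None else pi s].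
Proof.
move=> pr; apply/andP; split.
  by apply/forallP => s; rewrite ffunE; case: eqP => // _; have /andP[/forallP /(_ s)] := pr.
apply/forallP => C; apply/implyP => cC; apply/eqP/setP => s; rewrite finset.in_set0.
apply/negbTE; apply: (proper_closed s pr); apply/forall_inP => t tC.
by have /forall_inP /(_ t tC) := cC; rewrite ffunE; case: eqP.
Qed.

(** On a non-empty set closed under the new policy the old values attain a maximum, but not in [s0]:
    the improving action leads from [s0] into the set, with an average above the value of [s0]. So
    the maximizers would be closed under the old policy. *)
Lemma proper_upd_act pi s0 a0 : proper pi -> enabled M s0 a0 ->
  policy_value pi s0 < \sum_t trans M s0 a0 t * policy_value pi t ->
  proper [ffun s => if s == s0 then Some a0 else pi s].
Proof.
move=> pr en lt; apply/andP; split.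
  apply/forallP => s; rewrite ffunE; case: eqP => [-> //|_].
  by have /andP[/forallP /(_ s)] := pr.
apply/forallP => C; apply/implyP => /forall_inP cC; apply/negPn/negP => /finset.set0Pn[s1 s1C].
have [m mC mmax] := @Order.TotalTheory.arg_maxP _ _ _ s1 (mem C) (policy_value pi) s1C.
have succ t a : (if t == s0 then Some a0 else pi t) = Some a -> t \in C ->
    forall t', 0 < trans M t a t' -> t' \in C.
  by move=> e /cC; rewrite ffunE e => /forallP h t'; apply/implyP.
have ms0 : policy_value pi s0 < policy_value pi m \/ s0 \notin C.
  have [s0C|] := boolP (s0 \in C); [left|by right].
  rewrite lt_neqAle (mmax s0 s0C : policy_value pi s0 <= policy_value pi m) andbT; apply/negP => /eqP e.
  move: lt; rewrite ltNge => /negP; apply; rewrite e.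
  rewrite -[leRHS]mul1r -(eqP en) big_distrl /=; apply: ler_sum => t _.
  have [p0|p0] := boolP (0 < trans M s0 a0 t).
    by apply: ler_wpM2l; rewrite ?trans_ge0 //; apply: mmax; apply: (succ s0) p0; rewrite ?eqxx.
  have -> : trans M s0 a0 t = 0 by apply: le_anti; rewrite trans_ge0 leNgt p0.
  by rewrite !mul0r.
pose C' : {set S} := finset (fun s => (s \in C) && (policy_value pi s == policy_value pi m)).
have : m \notin C'; last by rewrite inE eqxx (mC : m \in C).
apply: (proper_closed m pr); apply/forall_inP => s; rewrite inE => /andP[sC /eqP sm].
have ss0 : s != s0.
  apply/negP => /eqP e; subst s; case: ms0 => [|]; first by rewrite sm ltxx.
  by rewrite sC.
have := cC _ sC; rewrite ffunE (negbTE ss0); case e : (pi s) => [a|] // _.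
apply/forallP => t; apply/implyP => p0; rewrite inE.
have inC t' : 0 < trans M s a t' -> t' \in C by apply: succ; rewrite ?(negbTE ss0).
rewrite inC //=; apply/eqP; apply: avg_max p0; first exact: proper_enabled e.
  by move=> x /inC; exact: mmax.
by rewrite -sm (policy_value_step pr e).
Qed.

(* A policy whose values have maximal sum admits no profitable one-state change. *)
Theorem optimal_policy : exists2 pi, proper pi &
  (forall s, (Gd s)%:R / D%:R <= policy_value pi s) /\
  (forall s a, enabled M s a ->
     \sum_t trans M s a t * policy_value pi t <= policy_value pi s).
Proof.
have [pi pr pmax] := @Order.TotalTheory.arg_maxP _ _ _ _ proper
  (fun pi => \sum_s policy_value pi s) proper_stop.
have improve pi' s0 : proper pi' -> policy_value pi s0 < policy_value pi' s0 ->
    (forall s, policy_value pi s <= policy_value pi' s) -> False.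
  move=> pr' lt le; have := pmax _ pr'; rewrite /= leNgt => /negP; apply.
  by rewrite (bigD1 s0) //= [ltRHS](bigD1 s0) //= ltr_leD //; apply: ler_sum.
exists pi => //; split=> [s0|s0 a0 en]; rewrite leNgt; apply/negP => lt.
  pose pi' := [ffun s => if s == s0 then None else pi s].
  have pr' : proper pi' by exact: proper_upd_stop.
  have v0 : policy_value pi' s0 = (Gd s0)%:R / D%:R.
    by apply: policy_value_stop => //; rewrite ffunE eqxx.
  apply: (improve pi' s0) => //; first by rewrite v0.
  move=> s; rewrite -subr_le0; move: s.
  apply: (max_principle pr' (y := fun s => policy_value pi s - policy_value pi' s)) => s.
    move=> a; rewrite ffunE; case: eqP => // /eqP ne e.
    have e' : pi' s = Some a by rewrite ffunE (negbTE ne).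
    rewrite (policy_value_step pr e) (policy_value_step pr' e') -sumrB.
    by apply: ler_sum => t _; rewrite mulrBr.
  rewrite ffunE; case: eqP => [-> _|/eqP ne e]; first by rewrite v0 subr_le0 ltW.
  have e' : pi' s = None by rewrite ffunE (negbTE ne).
  by rewrite !policy_value_stop // subrr.
pose pi' := [ffun s => if s == s0 then Some a0 else pi s].
have pr' : proper pi' by exact: proper_upd_act.
have e0 : pi' s0 = Some a0 by rewrite ffunE eqxx.
have le s : policy_value pi s <= policy_value pi' s.
  rewrite -subr_le0; move: s.
  apply: (max_principle pr' (y := fun s => policy_value pi s - policy_value pi' s)) => s.
    move=> a e'; rewrite (policy_value_step pr' e'); under [leRHS]eq_bigr do rewrite mulrBr.
    rewrite sumrB lerD2r; move: e'; rewrite ffunE; case: eqP => [-> [<-]|_ e]; first exact: ltW.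
    by rewrite (policy_value_step pr e).
  rewrite ffunE; case: eqP => // /eqP ne e.
  have e' : pi' s = None by rewrite ffunE (negbTE ne).
  by rewrite !policy_value_stop // subrr.
apply: (improve pi' s0) => //; apply: lt_le_trans lt _.
by rewrite (policy_value_step pr' e0); apply: ler_sum => t _; rewrite ler_wpM2l ?trans_ge0.
Qed.

(** Values are non-negative, so the numerator and the determinant never have opposite signs, and
    absolute values preserve their quotient. *)
Definition policy_num pi s := absz ((\adj (policy_mx pi) *m stop_col pi) s 0).
Definition policy_den pi := absz (\det (policy_mx pi)).

Lemma policy_den_gt0 pi : proper pi -> (0 < policy_den pi)%N.
Proof. by move=> pr; rewrite absz_gt0 policy_det. Qed.

Lemma policy_numE pi s : proper pi ->
  (policy_num pi s)%:R = policy_value pi s * (policy_den pi)%:R * D%:R.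
Proof.
move=> pr; have d0 := policy_den_gt0 pr.
have e : (policy_num pi s)%:R / (policy_den pi)%:R / D%:R = policy_value pi s.
  rewrite -[RHS]ger0_norm ?policy_value_ge0 // /policy_value !normrM !normfV !normr_nat.
  by rewrite -!intr_norm -!abszE.
by rewrite -e mulrAC divfK // divfK // pnatr_eq0 -lt0n.
Qed.

Lemma policy_num_le pi s : proper pi -> (policy_num pi s <= policy_den pi * \max_t Gd t)%N.
Proof.
move=> pr; rewrite -(ler_nat rat) policy_numE // mulrAC natrM mulrC ler_wpM2l ?ler0n //.
by rewrite -ler_pdivlMr ?ltr0n //; exact: policy_value_le.
Qed.

End Stopping.

End OptimalStopping.

Import OptimalStopping.

(** * Gluing and mixing schedulers *)

Module Mixtures.

Local Open Scope classical_set_scope.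
Local Open Scope ring_scope.

Section ProbabilityOfMeasure.
Context (d : measure_display) (T : measurableType d) (R : realType).
Variable m : {measure set T -> \bar R}.
Hypothesis mT : m setT = 1%E.

Definition total_one (B : set T) : \bar R := m B.

HB.instance Definition _ := isMeasure.Build _ _ _ total_one
  (measure0 m) (measure_ge0 m) (@measure_semi_sigma_additive _ _ _ m).
HB.instance Definition _ := Measure_isProbability.Build _ _ _ total_one mT.

Lemma probability_of_measure : exists Q : probability T R, forall B, Q B = m B.
Proof. by exists total_one. Qed.

End ProbabilityOfMeasure.

Section Schedulers.
Context (R : realType) (S Act : finType) (M : mdp S Act).
Notation hist := (history S Act).
Notation pre := (@prefix_of S Act M).

Section Glue.
Variable sg : S -> scheduler R M.

Definition glue : scheduler R M.
Proof.
apply: (@Scheduler R _ _ M (fun h => sg h.1 h)).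
- by move=> h hp a; exact: sched_ge0.
- by move=> h hp; exact: sched_sum1.
- by move=> h hp a; exact: sched_enabled.
Defined.

Lemma Pr_glue s A : measurable A -> Pr glue s A = Pr (sg s) s A.
Proof.
move=> mA; congr fine; apply: (@induced_unique _ _ _ _ (sg s) s) mA; last exact: path_measureP.
move=> w n; rewrite path_measureP /cylinder_prob; congr EFin.
have [e|ne] := eqVneq (w 0%N).1 s; last by rewrite !mul0r.
by congr (_ * _); apply: eq_bigr => i _ /=; rewrite e.
Qed.

End Glue.

Fixpoint weight_from (sigma : scheduler R M) (h : hist) (l : seq (Act * S)) : R :=
  if l is (a, t) :: l' then sigma h a * weight_from sigma (ext h a t) l' else 1.

(** The factor of a cylinder probability that comes from the scheduler; the factor of the process is
    common to all schedulers. *)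
Definition hweight sigma (h : hist) := weight_from sigma (h.1, [::]) h.2.

Lemma hweight_ext sigma h a t : hweight sigma (ext h a t) = hweight sigma h * sigma h a.
Proof.
rewrite /hweight /ext /=; case: h => x p /=.
suff H q : weight_from sigma (x, q) (rcons p (a, t)) =
    weight_from sigma (x, q) p * sigma (x, q ++ p) a by exact: H.
elim: p q => [|[b u] p IH] q /=; first by rewrite cats0 mulr1 mul1r.
by rewrite IH mulrA cat_rcons.
Qed.

Lemma finite_path_ext (h : hist) a t :
  finite_path M (ext h a t) = finite_path M h && (0 < trans M (last_state h) a t).
Proof. exact: finite_path_rcons. Qed.

Lemma hist_ind (P : hist -> Prop) : (forall s, P (s, [::])) ->
  (forall h a t, P h -> P (ext h a t)) -> forall h, P h.
Proof.
move=> P0 PS [s p]; elim/last_ind: p => [|p [a t] IH]; first exact: P0.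
exact: (PS (s, p)).
Qed.

Lemma hweight_ge0 sigma h : finite_path M h -> 0 <= hweight sigma h.
Proof.
elim/hist_ind: h => [s _|h a t IH]; first exact: ler01.
rewrite finite_path_ext hweight_ext => /andP[hp _]; rewrite mulr_ge0 ?IH //.
exact: sched_ge0.
Qed.

Lemma cylinder_prob_weight sigma s w n : cylinder_prob sigma s w n =
  ((w 0%N).1 == s)%:R * hweight sigma (pre w n) *
  \prod_(i < n) ratr (trans M (w i).1 (w i).2 (w i.+1).1).
Proof.
rewrite /cylinder_prob -mulrA; congr (_ * _); elim: n => [|n IH].
  by rewrite !big_ord0 mulr1.
by rewrite !big_ord_recr /= IH prefix_ext hweight_ext mulrACA.
Qed.

Lemma trans_prod0 (w : omega M) n : ~~ finite_path M (pre w n) ->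
  \prod_(i < n) (ratr (trans M (w i).1 (w i).2 (w i.+1).1) : R) = 0.
Proof.
elim: n => [|n IH] //; rewrite prefix_ext finite_path_ext last_state_prefix negb_and big_ord_recr /=.
case/orP => [/IH ->|p0]; first by rewrite mul0r.
have -> : trans M (w n).1 (w n).2 (w n.+1).1 = 0 by apply: le_anti; rewrite trans_ge0 leNgt p0.
by rewrite rmorph0 mulr0.
Qed.

Section Mixture.
Variables (sigma tau : scheduler R M) (lam : R).
Hypothesis lam01 : 0 <= lam <= 1.

Let mw h := lam * hweight sigma h + (1 - lam) * hweight tau h.

Let mw_parts h : finite_path M h ->
  0 <= lam * hweight sigma h /\ 0 <= (1 - lam) * hweight tau h.
Proof.
case/andP: lam01 => l0 l1 hp.
by split; rewrite mulr_ge0 ?subr_ge0 ?hweight_ge0.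
Qed.

(** As in Kuhn's theorem, an initial coin toss with bias [lam] is replaced by its conditional
    distribution given the history. Where [mw] vanishes the history has weight 0 and [sigma] serves
    as default. *)
Definition mixture : scheduler R M.
Proof.
apply: (@Scheduler R _ _ M (fun h a => if mw h == 0 then sigma h a else
  (lam * hweight sigma h * sigma h a + (1 - lam) * hweight tau h * tau h a) / mw h)).
- move=> h hp a; case: eqP => _; first exact: sched_ge0.
  have [p1 p2] := mw_parts hp.
  by rewrite divr_ge0 ?addr_ge0 // mulr_ge0 // sched_ge0.
- move=> h hp; have [e|ne] := eqVneq (mw h) 0; first exact: sched_sum1.
  by rewrite -big_distrl /= big_split /= -!big_distrr /= !sched_sum1 // !mulr1 divff.
- move=> h hp a nen; case: eqP => _; first exact: sched_enabled.
  by rewrite !(sched_enabled _ hp nen) !mulr0 addr0 mul0r.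
Defined.

Lemma mixture_weight h : finite_path M h -> hweight mixture h = mw h.
Proof.
elim/hist_ind: h => [s _|h a t IH].
  by rewrite /mw /hweight /= !mulr1 addrC subrK.
rewrite finite_path_ext /mw !hweight_ext => /andP[hp _].
rewrite IH // /=; case: eqP => [e|/eqP ne].
  have [p1 p2] := mw_parts hp; rewrite e mul0r !mulrA.
  have -> : lam * hweight sigma h = 0 by move: e; rewrite /mw; lra.
  have -> : (1 - lam) * hweight tau h = 0 by move: e; rewrite /mw; lra.
  by rewrite !mul0r addr0.
by rewrite mulrCA divff // mulr1 !mulrA.
Qed.

Lemma Pr_mixture s A : measurable A ->
  Pr mixture s A = lam * Pr sigma s A + (1 - lam) * Pr tau s A.
Proof.
move=> mA; case/andP: lam01 => l0; rewrite -subr_ge0 => l1.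
pose m : {measure set (infinite_paths M) -> \bar R} :=
  measure_add (mscale (NngNum l0) (path_measure sigma s)) (mscale (NngNum l1) (path_measure tau s)).
have mE B : m B = (lam%:E * path_measure sigma s B + (1 - lam)%:E * path_measure tau s B)%E.
  exact: measure_addE.
have mT : m setT = 1%E.
  by rewrite mE !probability_setT !mule1 -EFinD addrC subrK.
have [Q QE] := probability_of_measure mT.
have iQ : induced mixture s Q.
  move=> w n; rewrite QE mE !path_measureP -!EFinM -EFinD !cylinder_prob_weight; congr EFin.
  have [hp|/trans_prod0 ->] := boolP (finite_path M (pre w n)); last by rewrite !mulr0 addr0.
  by rewrite mixture_weight // /mw; ring.
rewrite /Pr (induced_unique (path_measureP mixture s) iQ mA) QE mE.
have fP (P : probability (infinite_paths M) R) : P A = (fine (P A))%:E.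
  by rewrite fineK // fin_num_measure.
by rewrite (fP (path_measure sigma s)) (fP (path_measure tau s)) -!EFinM -EFinD.
Qed.

End Mixture.

End Schedulers.

End Mixtures.

Import Mixtures.

(** * Certificates for lower bounds on the optimal value *)

Module Certificates.

Lemma all_ord n (f : pred nat) : all f (iota 0 n) = [forall i : 'I_n, f i].
Proof.
apply/allP/forallP => [h i|h i]; first by apply: h; rewrite mem_iota /=.
by rewrite mem_iota /= => lt; exact: (h (Ordinal lt)).
Qed.

Lemma has_ord n (f : pred nat) : has f (iota 0 n) = [exists i : 'I_n, f i].
Proof.
apply/hasP/existsP => [[i]|[i fi]]; last by exists (i : nat); rewrite ?mem_iota /=.
by rewrite mem_iota /= => lt fi; exists (Ordinal lt).
Qed.

Section NatCert.
Variables (n a ns : nat) (tgt : nat -> nat -> bool).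
Variables (pol rk : nat -> nat -> nat) (Bm : nat -> nat -> nat -> nat -> bool).
Variables (rf rb : nat -> nat -> nat -> nat).
Variables (enp : nat -> nat -> bool) (posp : nat -> nat -> nat -> bool).
Variables (stepp : nat -> nat -> nat -> bool) (zerop payp : nat -> nat -> bool).

(** The checks use natural numbers and abstract tests, so that they can be instantiated both with
    arithmetic tests and with the columnwise ones of the verifier. *)
Definition nat_st g u t := has (Bm g u t) (iota 0 a).

Definition nat_step g u t t' := has (fun b => Bm g u t b && posp t b t') (iota 0 a).

Definition nat_hit g u i := has (fun t => tgt i t && nat_st g u t) (iota 0 n).

(** Reachability is certified by ranks: [rf] decreases along some step towards [u], [rb] along some
    step traversed backwards. *)
Definition nat_ec g u :=
  nat_st g u u &&
  all (fun t =>
    all (fun b => Bm g u t b ==> enp t b &&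
      all (fun t' => posp t b t' ==> nat_st g u t') (iota 0 n)) (iota 0 a) &&
    (nat_st g u t ==> (t == u) ||
      has (fun t' => nat_step g u t t' && (rf g u t' < rf g u t)) (iota 0 n) &&
      has (fun t' => nat_step g u t' t && (rb g u t' < rb g u t)) (iota 0 n))) (iota 0 n).

(** A group [g = k * n + s] stands for scheduler [k] started in [s]; a value of [pol] that is not an
    action means stopping. *)
Definition state_ok g t :=
  if pol g t < a then
    [&& enp t (pol g t), stepp g t (pol g t) &
      has (fun t' => posp t (pol g t) t' && (rk g t' < rk g t)) (iota 0 n)]
  else zerop g t || nat_ec g t && payp g t.

Definition states_ok :=
  all (fun k => all (fun s => all (state_ok (k * n + s)) (iota 0 n)) (iota 0 n)) (iota 0 ns).

End NatCert.

Lemma rank_connect (S : finType) (r : rel S) (P : pred S) (u : S) (rk : S -> nat) :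
  (forall t, P t -> t = u \/ exists2 t', r t t' & P t' /\ rk t' < rk t) ->
  forall t, P t -> connect r t u.
Proof.
move=> H t; have [k le] := ubnP (rk t); elim: k t le => // k IH t; rewrite ltnS => le Pt.
have [->|[t' rt [Pt' lt]]] := H t Pt; first exact: connect0.
apply: connect_trans (connect1 rt) _; apply: IH Pt'.
exact: leq_trans lt le.
Qed.

Section Components.
Context (n a : nat) (M : mdp 'I_n 'I_a).
Notation S := 'I_n.
Notation Act := 'I_a.
Variables (enp : nat -> nat -> bool) (posp : nat -> nat -> nat -> bool).
Hypothesis enE : forall (s : S) (b : Act), enp s b = enabled M s b.
Hypothesis posE : forall (s : S) (b : Act) (t : S), posp s b t = (0 < trans M s b t)%R.
Variables (Bm : nat -> nat -> nat -> nat -> bool) (rf rb : nat -> nat -> nat -> nat).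

Definition Bset g (u : S) : {set S * Act} := finset (fun x : S * Act => Bm g u x.1 x.2).

Lemma nat_stE g (u t : S) : nat_st a Bm g u t = (t \in Bst (Bset g u)).
Proof. by rewrite /nat_st has_ord inE; apply: eq_existsb => b; rewrite inE. Qed.

Lemma nat_stepE g (u t t' : S) : nat_step a Bm posp g u t t' = Bstep M (Bset g u) t t'.
Proof. by rewrite /nat_step has_ord; apply: eq_existsb => b; rewrite inE posE. Qed.

Lemma nat_hitE (tgt : nat -> nat -> bool) (T : {set S}) g (u : S) i : (forall t : S, tgt i t = (t \in T)) ->
  nat_hit n a tgt Bm g u i = hit (Bst (Bset g u)) T.
Proof.
by move=> e; rewrite /nat_hit has_ord; apply: eq_existsb => t; rewrite nat_stE e.
Qed.

Lemma nat_ec_sound g (u : S) : nat_ec n a Bm rf rb enp posp g u -> ec M (Bset g u) u.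
Proof.
move=> /andP[uB]; rewrite all_ord => /forallP H; rewrite nat_stE in uB.
have clo x : x \in Bset g u -> enabled M x.1 x.2 /\
    forall t', (0 < trans M x.1 x.2 t')%R -> t' \in Bst (Bset g u).
  move=> xB; have /andP[+ _] := H x.1; rewrite all_ord => /forallP /(_ x.2).
  rewrite inE in xB; rewrite xB /= => /andP[en]; rewrite enE in en; split=> // t' p0.
  by move: b; rewrite all_ord => /forallP /(_ t'); rewrite posE p0 nat_stE.
have stc t t' : Bstep M (Bset g u) t t' -> (t \in Bst (Bset g u)) && (t' \in Bst (Bset g u)).
  move=> /existsP[b /andP[bB p0]]; have [_ /(_ _ p0) ->] := clo _ bB.
  by rewrite andbT inE; apply/existsP; exists b.
have conn t : t \in Bst (Bset g u) -> t = u \/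
  (exists2 t', Bstep M (Bset g u) t t' & (t' \in Bst (Bset g u)) /\ rf g u t' < rf g u t) /\
  (exists2 t', Bstep M (Bset g u) t' t & (t' \in Bst (Bset g u)) /\ rb g u t' < rb g u t).
  move=> tB; have /andP[_] := H t; rewrite nat_stE tB /=; case: (t =P u) => [->|_]; first by left.
  rewrite (_ : ((t : nat) == u) = (t == u)) //; case: eqP => [->|_] /=; first by left.
  rewrite !has_ord => /andP[/existsP[t1 /andP[st1 lt1]] /existsP[t2 /andP[st2 lt2]]].
  rewrite nat_stepE in st1; rewrite nat_stepE in st2.
  have /andP[_ ?] := stc _ _ st1; have /andP[? _] := stc _ _ st2.
  by right; split; [exists t1|exists t2].
rewrite /ec uB /=; apply/andP; split.
  apply/forall_inP => x /clo[-> h] /=; apply/forallP => t'; apply/implyP; exact: h.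
apply/forall_inP => t tB; apply/andP; split.
  apply: (@rank_connect _ _ (mem (Bst (Bset g u))) u (rf g u)) tB => t' /conn[->|[[t1 h1 h2] _]].
    by left.
  by right; exists t1.
suff : connect (fun x y => Bstep M (Bset g u) y x) t u by rewrite connect_rev.
apply: (@rank_connect _ _ (mem (Bst (Bset g u))) u (rb g u)) tB => t' /conn[->|[_ [t1 h1 h2]]].
  by left.
by right; exists t1.
Qed.

Lemma nat_ec_complete g (u : S) : ec M (Bset g u) u ->
  (forall t t' : S, t != u -> connect (Bstep M (Bset g u)) t u ->
     exists2 t' : S, Bstep M (Bset g u) t t' & rf g u t' < rf g u t) ->
  (forall t t' : S, t != u -> connect (Bstep M (Bset g u)) u t ->
     exists2 t' : S, Bstep M (Bset g u) t' t & rb g u t' < rb g u t) ->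
  nat_ec n a Bm rf rb enp posp g u.
Proof.
move=> /and3P[uB /forall_inP clo /forall_inP co] Hf Hb; rewrite /nat_ec nat_stE uB /=.
rewrite all_ord; apply/forallP => t; apply/andP; split.
  rewrite all_ord; apply/forallP => b; apply/implyP => tb.
  have xB : (t, b) \in Bset g u by rewrite inE.
  have /andP[/= en /forallP h] := clo _ xB; rewrite enE en /= all_ord.
  by apply/forallP => t'; rewrite posE nat_stE; exact: h.
rewrite nat_stE; apply/implyP => /co/andP[c1 c2].
rewrite (_ : ((t : nat) == u) = (t == u)) //; case: eqVneq => //= ne; rewrite !has_ord.
have [t1 s1 l1] := Hf _ t ne c1; have [t2 s2 l2] := Hb _ t ne c2.
by apply/andP; split; apply/existsP; [exists t1|exists t2]; rewrite nat_stepE ?s1 ?s2.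
Qed.

End Components.

Arguments Bset {n} a.

Local Open Scope ring_scope.

Section BestComponent.
Context (S Act : finType) (M : mdp S Act) (I : finType) (q : I -> rat) (T : I -> {set S}).

Definition best_ec (u : S) : {set S * Act} :=
  odflt finset.set0 [pick B | ec M B u &&
    [forall B', ec M B' u ==> (pay q T (Bst B') <= pay q T (Bst B))]].

Lemma best_ec_max (B : {set S * Act}) u : ec M B u -> pay q T (Bst B) <= stop_value M q T best_ec u.
Proof.
move=> eB; rewrite /stop_value /best_ec; case: pickP => [B' /andP[eB' /forallP /(_ B)]|nB] /=.
  by rewrite eB' eB.
have [B' eB' mB'] := @Order.TotalTheory.arg_maxP _ _ _ B (fun B => ec M B u)
  (fun B => pay q T (Bst B)) eB.
have := nB B'; rewrite eB' /= => /negP[]; apply/forallP => B''; apply/implyP.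
exact: mB'.
Qed.

Lemma stop_value_ge0 B u : 0 <= stop_value M q T B u.
Proof. by rewrite /stop_value; case: ifP => // _; exact: pay_ge0. Qed.

End BestComponent.

Section Link.
Context (R : realType) (J : relbuechi_instance) (sg : bool).
Notation n := (nstates J).
Notation a := (nactions J).
Notation m := (nterms J).
Notation ns := (nscheds J).
Notation M := (model J).
Variables (D : nat) (Et : nat -> nat -> nat -> nat) (C : nat -> nat) (ng : nat -> bool).
Variables (src sch : nat -> nat) (tgt : nat -> nat -> bool).
Hypothesis D0 : (0 < D)%N.
Hypothesis EtE : forall (s : 'I_n) (b : 'I_a) (t : 'I_n), (Et s b t)%:R = D%:R * trans M s b t.
Hypothesis CE : forall i : 'I_m, (C i)%:R = D%:R * `|coef i|.
Hypothesis ngE : forall i : 'I_m, coef i != 0 -> ng i = (coef i < 0) (+) sg.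
Hypothesis srcE : forall i : 'I_m, src i = source i.
Hypothesis schE : forall i : 'I_m, sch i = sched_index i.
Hypothesis tgtE : forall (i : 'I_m) (t : 'I_n), tgt i t = (t \in target i).

Let D0' : 0 < D%:R :> rat. Proof. by rewrite ltr0n. Qed.

Definition nat_pay Bm g u : nat := (\sum_(0 <= i < m)
  (sch i * n + src i == g) * C i * (nat_hit n a tgt Bm g u i (+) ng i))%N.

Definition enabled_test t b := (\sum_(0 <= t' < n) Et t b t' == D)%N.
Definition step_test (X : nat -> nat -> nat) g t b := (D * X g t <= \sum_(0 <= t' < n) Et t b t' * X g t')%N.
Definition pay_test Bm Z (X : nat -> nat -> nat) g t := (X g t <= Z * nat_pay Bm g t)%N.

Definition cert_ok pol rk Bm rf rb Z (X : nat -> nat -> nat) :=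
  states_ok n a ns pol rk Bm rf rb enabled_test (fun t b t' => 0 < Et t b t')%N
    (step_test X) (fun g t => X g t == 0%N) (pay_test Bm Z X).

Definition signed_coef (i : 'I_m) : rat := (-1) ^+ sg * coef i.

Definition group_coef (k : 'I_ns) (s : 'I_n) (i : 'I_m) : rat :=
  if (sched_index i == k) && (source i == s) then signed_coef i else 0.

Definition total (sigma : 'I_ns -> scheduler R M) : R := \sum_i
  ratr (signed_coef i) * Pr (sigma (sched_index i)) (source i) (infinitely_often M (target i)).

Definition cert_sum (X : nat -> nat -> nat) : nat :=
  (\sum_(0 <= k < ns) \sum_(0 <= s < n) X (k * n + s)%N s)%N.

Definition cert_neg : nat := (\sum_(0 <= i < m) C i * ng i)%N.

Lemma enabledE (s : 'I_n) (b : 'I_a) : enabled_test s b = enabled M s b.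
Proof.
rewrite /enabled_test /enabled big_mkord -(eqr_nat rat) natr_sum.
under eq_bigr do rewrite EtE; rewrite -big_distrr /= -[X in _ == X]mulr1.
by rewrite (inj_eq (mulfI _)) // gt_eqF.
Qed.

Lemma positiveE (s : 'I_n) (b : 'I_a) (t : 'I_n) : (0 < Et s b t)%N = (0 < trans M s b t).
Proof. by rewrite -(ltr_nat rat) EtE pmulr_rgt0. Qed.

Lemma group_index (k k' s s' : nat) : (s < n)%N -> (s' < n)%N ->
  (k * n + s == k' * n + s')%N = (k == k') && (s == s').
Proof.
move=> sn sn'; have n0 : (0 < n)%N by exact: leq_ltn_trans sn.
apply/eqP/andP => [e|[/eqP -> /eqP ->] //].
have := congr1 (divn^~ n) e; have := congr1 (modn^~ n) e => /=.
by rewrite !modnMDl !divnMDl // !modn_small // !divn_small // !addn0 => -> ->.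
Qed.

(** Each term belongs to the one group given by its scheduler and its source, so groups can be
    optimized separately. *)
Lemma regroup (V : nmodType) (F : 'I_ns -> 'I_n -> 'I_m -> V) :
  \sum_k \sum_s \sum_i (if (sched_index i == k) && (source i == s) then F k s i else 0) =
  \sum_i F (sched_index i) (source i) i.
Proof.
rewrite pair_big /= exchange_big /=; apply: eq_bigr => i _.
rewrite (bigD1 (sched_index i, source i)) //= !eqxx big1 ?addr0 // => -[k s] /=.
by rewrite xpair_eqE eq_sym [_ == s]eq_sym => /negbTE ->.
Qed.

Lemma signed_norm i : `|signed_coef i| = `|coef i|.
Proof. by rewrite normrM normrX normrN1 expr1n mul1r. Qed.

(** A zero coefficient is left out because negation flips its sign bit but not the coefficient; it
    carries weight 0. *)
Lemma signed_neg i : coef i != 0 -> ng i = (signed_coef i < 0).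
Proof.
move=> c0; rewrite ngE // /signed_coef; case: sg; rewrite ?expr1 ?expr0 ?mul1r ?addbF //.
by rewrite mulN1r oppr_lt0 addbT -leNgt le_eqVlt eq_sym (negbTE c0).
Qed.

Lemma group_pay Bm (k : 'I_ns) (s u : 'I_n) :
  (nat_pay Bm (k * n + s)%N u)%:R =
  D%:R * pay (group_coef k s) (@target J) (Bst (Bset a Bm (k * n + s)%N u)).
Proof.
rewrite /nat_pay big_mkord natr_sum /pay big_distrr; apply: eq_bigr => i _ /=.
rewrite schE srcE group_index // (@nat_hitE _ a Bm tgt (target i)); last exact: tgtE.
rewrite /group_coef -!val_eqE /=.
case: andP => [_|_]; last by rewrite normr0 !mul0r mulr0.
rewrite mul1n signed_norm natrM CE -mulrA; congr (_ * _).
have [->|c0] := eqVneq (coef i) 0; first by rewrite normr0 !mul0r.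
by rewrite signed_neg.
Qed.

Lemma total_neg : \sum_k \sum_s neg_weight (group_coef k s) = cert_neg%:R / D%:R.
Proof.
pose F (k : 'I_ns) (s : 'I_n) i := if signed_coef i < 0 then `|signed_coef i| else 0.
transitivity (\sum_i F (sched_index i) (source i) i).
  rewrite -regroup; apply: eq_bigr => k _; apply: eq_bigr => s _; apply: eq_bigr => i _.
  by rewrite /group_coef; case: (_ && _); rewrite ?ltxx.
apply: (canRL (mulfK _)); first exact: lt0r_neq0.
rewrite /cert_neg big_mkord natr_sum big_distrl; apply: eq_bigr => i _ /=.
rewrite /F natrM CE signed_norm; have [c0|c0] := eqVneq (coef i) 0.
  by rewrite c0 normr0 mulr0 !mul0r; case: ifP => _; rewrite mul0r.
by rewrite signed_neg //; case: ifP => _; rewrite ?mulr1 ?mulr0 ?mul0r // mulrC.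
Qed.

Lemma total_value (sigma : 'I_ns -> scheduler R M) :
  \sum_k \sum_s value (group_coef k s) (@target J) (sigma k) s = total sigma.
Proof.
rewrite /total -(regroup (fun k s i => ratr (signed_coef i) * Pr (sigma k) s (infinitely_often M (target i)))).
apply: eq_bigr => k _; apply: eq_bigr => s _; apply: eq_bigr => i _.
by rewrite /group_coef; case: ifP => // _; rewrite rmorph0 mul0r.
Qed.

Lemma cert_sumE X : (cert_sum X)%:R = \sum_(k < ns) \sum_(s < n) (X (k * n + s)%N s)%:R :> rat.
Proof.
rewrite /cert_sum big_mkord natr_sum; apply: eq_bigr => k _.
by rewrite big_mkord natr_sum.
Qed.

(** Each group gets its own scheduler from [lower_bound]; [glue] reassembles them, since the groups
    of one scheduler differ in the source state. *)
Theorem cert_sound pol rk Bm rf rb Z X : (0 < Z)%N -> cert_ok pol rk Bm rf rb Z X ->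
  exists sigma, ratr ((cert_sum X)%:R / (D * Z)%:R) <= total sigma + ratr (cert_neg%:R / D%:R).
Proof.
move=> Z0 ok.
have DZ : 0 < (D * Z)%:R :> rat by rewrite ltr0n muln_gt0 D0.
have okP (k : 'I_ns) (s t : 'I_n) : state_ok n a pol rk Bm rf rb enabled_test
    (fun t b t' => 0 < Et t b t')%N (step_test X) (fun g t => X g t == 0%N) (pay_test Bm Z X)
    (k * n + s)%N t.
  move: ok; rewrite /cert_ok /states_ok all_ord => /forallP /(_ k).
  by rewrite all_ord => /forallP /(_ s); rewrite all_ord => /forallP /(_ t).
have H (k : 'I_ns) (s : 'I_n) : exists sigma : scheduler R M,
    ratr ((X (k * n + s)%N s)%:R / (D * Z)%:R) <=
    value (group_coef k s) (@target J) sigma s + ratr (neg_weight (group_coef k s)).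
  pose g := (k * n + s)%N.
  pose pi (t : 'I_n) : option 'I_a := insub (pol g t).
  have piP t b : pi t = Some b -> pol g t = b :> nat.
    by rewrite /pi; case: insubP => // b' _ <- [->].
  have step t b : pi t = Some b -> [/\ enabled M t b,
      (D * X g t <= \sum_(t' < n) Et t b t' * X g t')%N &
      exists2 t', 0 < trans M t b t' & (rk g t' < rk g t)%N].
    move=> /piP e; have := okP k s t; rewrite /state_ok -/g e ltn_ord enabledE.
    move=> /and3P[en]; rewrite /step_test big_mkord => st.
    rewrite has_ord => /existsP[t' /andP[p0 lt]]; split=> //; exists t' => //.
    by rewrite -positiveE.
  have en t b (h : pi t = Some b) : enabled M t b by have [] := step t b h.
  pose x (t : 'I_n) : rat := (X g t)%:R / (D * Z)%:R.
  exists (@lower_sched R _ _ M pi (Bset a Bm g) en).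
  apply: (@lower_bound R _ _ M _ (group_coef k s) (@target J) pi (Bset a Bm g) x (rk g) en).
  - move=> t b /step[_ st _]; rewrite /x; under eq_bigr do rewrite mulrA.
    rewrite -big_distrl /= ler_pM2r ?invr_gt0 // -(ler_pM2l D0') big_distrr /=.
    under eq_bigr do rewrite mulrA -EtE -natrM.
    by rewrite -natr_sum -natrM ler_nat.
  - move=> t e; have := okP k s t; rewrite /state_ok -/g ifF; last first.
      by move: e; rewrite /pi; case: insubP => // /negbTE.
    case/orP => [/eqP z|/andP[/(nat_ec_sound enabledE positiveE) ecu]].
      by rewrite /x z mul0r stop_value_ge0.
    rewrite /pay_test /stop_value ecu /x => le.
    rewrite ler_pdivrMr // natrM mulrA [_ * D%:R]mulrC -group_pay -natrM ler_nat mulnC.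
    exact: le.
  - by move=> t b /step[].
have /choice[sig sigP] : forall ks : 'I_ns * 'I_n, exists sigma : scheduler R M,
    ratr ((X (ks.1 * n + ks.2)%N ks.2)%:R / (D * Z)%:R) <=
    value (group_coef ks.1 ks.2) (@target J) sigma ks.2 + ratr (neg_weight (group_coef ks.1 ks.2)).
  by move=> [k s]; exact: H.
exists (fun k => glue (fun s => sig (k, s))).
rewrite -total_value -total_neg cert_sumE big_distrl !rmorph_sum -big_split /=.
apply: ler_sum => k _; rewrite big_distrl !rmorph_sum -big_split /=; apply: ler_sum => s _.
apply: le_trans (sigP (k, s)) _; rewrite lerD2r le_eqVlt; apply/orP; left; apply/eqP.
apply: eq_bigr => i _; rewrite Pr_glue //; exact: measurable_infinitely_often.
Qed.

Definition group_of (g : nat) : option ('I_ns * 'I_n) :=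
  [pick x : 'I_ns * 'I_n | x.1 * n + x.2 == g]%N.

Lemma group_ofE (k : 'I_ns) (s : 'I_n) : group_of (k * n + s)%N = Some (k, s).
Proof.
rewrite /group_of; case: pickP => [[k' s']|/(_ (k, s))] /=; last by rewrite eqxx.
by rewrite group_index // => /andP[/eqP/val_inj -> /eqP/val_inj ->].
Qed.

Definition at_group A (d : A) (F : 'I_ns * 'I_n -> 'I_n -> A) (g t : nat) : A :=
  if group_of g is Some ks then if insub t is Some t' then F ks t' else d else d.

Lemma at_groupE A (d : A) F (k : 'I_ns) (s t : 'I_n) :
  at_group d F (k * n + s)%N t = F (k, s) t.
Proof. by rewrite /at_group group_ofE valK. Qed.

Lemma at_group_support A (d : A) F g t : at_group d F g t <> d -> (g < ns * n)%N /\ (t < n)%N.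
Proof.
rewrite /at_group /group_of; case: pickP => [[k s] /= /eqP <-|//]; case: insubP => // t' tn _ _.
split=> //; apply: (@leq_trans (k.+1 * n)%N); first by rewrite mulSn addnC ltn_add2r.
by rewrite leq_mul2r ltn_ord orbT.
Qed.

Lemma at_group_ind A (d : A) F (Q : A -> Prop) :
  Q d -> (forall ks t, Q (F ks t)) -> forall g t, Q (at_group d F g t).
Proof.
move=> Qd QF g t; rewrite /at_group; case: (group_of g) => // ks.
by case: (insub t).
Qed.

(** The certificate will be a finite table that reads as 0 or false outside its range; the data must
    agree with this. *)
Definition supported (pol rk : nat -> nat -> nat) (Bm : nat -> nat -> nat -> nat -> bool)
    (rf rb : nat -> nat -> nat -> nat) (X : nat -> nat -> nat) :=
  (forall g t, [|| pol g t != 0, rk g t != 0 | X g t != 0]%N -> (g < ns * n)%N /\ (t < n)%N) /\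
  (forall g u t, (rf g u t != 0)%N || (rb g u t != 0)%N -> [/\ g < ns * n, u < n & t < n]%N) /\
  (forall g u t b, Bm g u t b -> [/\ g < ns * n, u < n, t < n & b < a]%N).

Theorem cert_complete : exists pol rk Bm rf rb Z X,
  supported pol rk Bm rf rb X /\
  [/\ (0 < Z <= (n`! * D ^ n) ^ (ns * n))%N,
      forall g t, (X g t <= Z * \sum_(0 <= i < m) C i)%N,
      forall g t, (pol g t <= a)%N && (rk g t <= n)%N,
      forall g u t, (rf g u t <= n)%N && (rb g u t <= n)%N &
      cert_ok pol rk Bm rf rb Z X] /\
  forall sigma, total sigma + ratr (cert_neg%:R / D%:R) <= ratr ((cert_sum X)%:R / (D * Z)%:R).
Proof.
pose best (ks : 'I_ns * 'I_n) := best_ec M (group_coef ks.1 ks.2) (@target J).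
pose gpay (ks : 'I_ns * 'I_n) (u : 'I_n) : nat := (\sum_(i < m)
  ((sched_index i == ks.1) && (source i == ks.2)) * C i *
  (hit (Bst (best ks u)) (target i) (+) ng i))%N.
pose Gd ks u := if ec M (best ks u) u then gpay ks u else 0%N.
have GdE ks u : (Gd ks u)%:R / D%:R = stop_value M (group_coef ks.1 ks.2) (@target J) (best ks) u.
  rewrite /Gd /stop_value; case: ifP => _; last by rewrite mul0r.
  apply: (canLR (mulfK _)); first exact: lt0r_neq0.
  rewrite /gpay natr_sum /pay big_distrl; apply: eq_bigr => i _ /=.
  rewrite /group_coef; case: andP => [_|_]; last by rewrite normr0 !mul0r.
  rewrite mul1n signed_norm natrM CE [RHS]mulrC -mulrA; congr (_ * _).
  have [->|c0] := eqVneq (coef i) 0; first by rewrite normr0 !mul0r.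
  by rewrite signed_neg.
pose Eo (s : 'I_n) (b : 'I_a) (t : 'I_n) := Et s b t.
have /choice[pi piP] : forall ks, exists pi, proper M pi /\
    (forall s, (Gd ks s)%:R / D%:R <= policy_value D Eo (Gd ks) pi s) /\
    (forall s a, enabled M s a -> \sum_t trans M s a t * policy_value D Eo (Gd ks) pi t <=
        policy_value D Eo (Gd ks) pi s).
  by move=> ks; have [pi pr H] := optimal_policy (Gd ks) D0 EtE; exists pi.
have pr ks : proper M (pi ks) by have [] := piP ks.
have /choice[rk0 rk0P] := fun ks => proper_rank (pr ks).
have /choice[rf0 rf0P] := fun x : ('I_ns * 'I_n) * 'I_n =>
  rank_exists (Bstep M (best x.1 x.2)) (pred1 x.2).
have /choice[rb0 rb0P] := fun x : ('I_ns * 'I_n) * 'I_n =>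
  rank_exists (fun t t' => Bstep M (best x.1 x.2) t' t) (pred1 x.2).
pose Zg ks := policy_den D Eo (pi ks).
pose Xg ks := policy_num D Eo (Gd ks) (pi ks).
have Zg0 ks : (0 < Zg ks)%N by exact: (policy_den_gt0 D0 EtE (pr ks)).
(* The product of the denominators serves all groups at once, and its bit length is at most the sum
   of theirs. *)
pose Z := (\prod_ks Zg ks)%N.
have ZgZ ks : (Zg ks * (Z %/ Zg ks) = Z)%N by rewrite mulnC divnK // /Z (bigD1 ks) // dvdn_mulr.
have Z0 : (0 < Z)%N by rewrite prodn_gt0.
pose pol := at_group 0%N (fun ks t => if pi ks t is Some b then b : nat else a).
pose rk := at_group 0%N rk0.
pose Bm g u t b := at_group false (fun ks u => [exists x in best ks u, (x.1 == t :> nat) && (x.2 == b :> nat)]) g u.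
pose rf g u t := at_group 0%N (fun ks u => oapp (rf0 (ks, u)) 0%N (insub t)) g u.
pose rb g u t := at_group 0%N (fun ks u => oapp (rb0 (ks, u)) 0%N (insub t)) g u.
pose X := at_group 0%N (fun ks t => Xg ks t * (Z %/ Zg ks))%N.
have XE (k : 'I_ns) (s t : 'I_n) :
    (X (k * n + s)%N t)%:R = policy_value D Eo (Gd (k, s)) (pi (k, s)) t * (D * Z)%:R.
  rewrite /X at_groupE natrM /Xg (policy_numE (Gd _) D0 EtE _ (pr _)) natrM.
  have -> : Z%:R = (Zg (k, s))%:R * (Z %/ Zg (k, s))%:R :> rat by rewrite -natrM ZgZ.
  by rewrite /Zg; ring.
have BsetE (k : 'I_ns) (s u : 'I_n) : Bset a Bm (k * n + s)%N u = best (k, s) u.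
  apply/setP => -[t b]; rewrite inE /Bm at_groupE /=.
  apply/exists_inP/idP => [[[t' b'] h /andP[/eqP/val_inj <- /eqP/val_inj <-]] //|h].
  by exists (t, b); rewrite //= !eqxx.
have nat_payE (k : 'I_ns) (s u : 'I_n) : ec M (best (k, s) u) u ->
    nat_pay Bm (k * n + s)%N u = Gd (k, s) u.
  move=> ecu; apply/eqP; rewrite -(eqr_nat rat) group_pay BsetE.
  by rewrite -[X in _ == X](divfK (lt0r_neq0 D0')) GdE /stop_value ecu mulrC.
have ord_n (t : 'I_n) : (0 < n)%N by exact: leq_ltn_trans (ltn_ord t).
exists pol, rk, Bm, rf, rb, Z, X; split.
  split; [|split].
  - by move=> g t /or3P[] /eqP h; exact: (at_group_support h).
  - move=> g u t /orP[] /eqP h; have [gn un] := at_group_support h; split=> //;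
      rewrite ltnNge; apply/negP => tn; apply: h; apply: (at_group_ind (Q := fun z => z = 0%N)) => // ks u';
      by rewrite insubN // -leqNgt.
  - move=> g u t b h; have h' : Bm g u t b <> false by rewrite h.
    have [gn un] := at_group_support h'.
    have : (t < n)%N && (b < a)%N; last by case/andP.
    move: h; apply: (at_group_ind (Q := fun z : bool => z -> (t < n)%N && (b < a)%N)) => // ks u'.
    by move=> /exists_inP[x _ /andP[/eqP <- /eqP <-]]; rewrite !ltn_ord.
split.
  split.
  - rewrite Z0 /=; apply: (@leq_trans (\prod_(ks : 'I_ns * 'I_n) (n`! * D ^ n))%N).
      by apply: leq_prod => ks _; exact: (det_policy_le D0 EtE (pi ks)).
    by rewrite prod_nat_const card_prod !card_ord.
  - move=> g t; apply: (at_group_ind (Q := fun z => (z <= Z * \sum_(0 <= i < m) C i)%N)) => // ks t'.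
    have -> : (Z * \sum_(0 <= i < m) C i = Zg ks * (\sum_(0 <= i < m) C i) * (Z %/ Zg ks))%N.
      by rewrite [RHS]mulnAC ZgZ.
    rewrite leq_mul2r; apply/orP; right.
    apply: leq_trans (policy_num_le (Gd ks) D0 EtE t' (pr ks)) _.
    rewrite leq_mul2l; apply/orP; right; apply/bigmax_leqP => u _.
    rewrite /Gd; case: ifP => // _; rewrite big_mkord; apply: leq_sum => i _.
    by case: (_ && _); case: (_ (+) _); rewrite ?mul1n ?muln1 ?muln0 ?mul0n.
  - move=> g t; apply/andP; split; [apply: (at_group_ind (Q := fun z => z <= a)%N) => // ks t'|].
      by case: (pi ks t') => // b; exact: ltnW.
    by apply: (at_group_ind (Q := fun z => z <= n)%N) => // ks t'; have [/(_ t')/ltnW] := rk0P ks.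
  - move=> g u t; apply/andP; split; apply: (at_group_ind (Q := fun z => z <= n)%N) => // ks u'.
      by case: (insub t) => //= t'; have [/(_ t')/ltnW] := rf0P (ks, u'); rewrite card_ord.
    by case: (insub t) => //= t'; have [/(_ t')/ltnW] := rb0P (ks, u'); rewrite card_ord.
  rewrite /cert_ok /states_ok all_ord; apply/forallP => k; rewrite all_ord; apply/forallP => s.
  rewrite all_ord; apply/forallP => t; rewrite /state_ok /pol at_groupE.
  case e : (pi (k, s) t) => [b|].
    rewrite ltn_ord enabledE (proper_enabled (pr _) e) /=; apply/andP; split.
      rewrite /step_test big_mkord -(ler_nat rat) natrM natr_sum XE.
      rewrite (policy_value_step (Gd (k, s)) D0 EtE (pr _) e) mulrA big_distrr /= big_distrl /=.
      by apply: ler_sum => t' _; rewrite [(Et _ _ _ * _)%:R]natrM XE EtE !mulrA.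
    have [_ /(_ _ _ e)[t' p0 lt]] := rk0P (k, s).
    by rewrite has_ord; apply/existsP; exists t'; rewrite positiveE p0 /rk !at_groupE.
  rewrite ltnn.
  have Xt : X (k * n + s)%N t = (Gd (k, s) t * Z)%N.
    apply/eqP; rewrite -(eqr_nat rat) XE (policy_value_stop (Gd (k, s)) D0 EtE (pr _) e).
    by rewrite !natrM mulrA divfK // lt0r_neq0.
  case ecu : (ec M (best (k, s) t) t); last by rewrite Xt /Gd ecu mul0n eqxx.
  apply/orP; right; apply/andP; split; last first.
    by rewrite /pay_test Xt nat_payE // mulnC.
  apply: (nat_ec_complete enabledE positiveE); rewrite BsetE //.
    move=> t1 _ ne co; have [_ /(_ t1 t)] := rf0P ((k, s), t).
    rewrite /= eqxx => /(_ isT co ne)[t2 st lt]; exists t2 => //.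
    by rewrite /rf !at_groupE !valK.
  move=> t1 _ ne co; have [_ /(_ t1 t)] := rb0P ((k, s), t).
  rewrite /= connect_rev eqxx => /(_ isT co ne)[t2 st lt]; exists t2 => //.
  by rewrite /rb !at_groupE !valK.
move=> sigma; rewrite -total_value -total_neg cert_sumE big_distrl !rmorph_sum -big_split /=.
apply: ler_sum => k _; rewrite big_distrl !rmorph_sum -big_split /=; apply: ler_sum => s _.
rewrite XE mulfK; last by rewrite pnatr_eq0 -lt0n muln_gt0 D0.
have [_ [maj sup]] := piP (k, s).
apply: upper_bound => // B u ecB; apply: le_trans (maj u); rewrite GdE.
exact: best_ec_max.
Qed.

Definition attains (strict : bool) (b : rat) : Prop := exists sigma,
  if strict then ratr b < total sigma else ratr b <= total sigma.

(** The comparison after clearing the denominator [D * Z], with the negative part of the bound moved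
    to the other side to stay in the natural numbers; adding [strict] turns a strict comparison into
    a weak one. *)
Definition final_test (strict : bool) (P1 P2 Z : nat) (X : nat -> nat -> nat) : bool :=
  (Z * (P1 + cert_neg) + strict <= cert_sum X + Z * P2)%N.

Lemma final_testE strict P1 P2 Z X : (0 < Z)%N -> final_test strict P1 P2 Z X =
  let b : rat := (P1%:R - P2%:R) / D%:R + cert_neg%:R / D%:R in
  let x : rat := (cert_sum X)%:R / (D * Z)%:R in if strict then b < x else b <= x.
Proof.
move=> Z0 /=; have Z0' : 0 < Z%:R :> rat by rewrite ltr0n.
have DZ : 0 < (D * Z)%:R :> rat by rewrite ltr0n muln_gt0 D0.
rewrite -(ltr_pM2r DZ) -(ler_pM2r DZ) divfK ?lt0r_neq0 //.
have -> : ((P1%:R - P2%:R) / D%:R + cert_neg%:R / D%:R) * (D * Z)%:R =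
    (Z * (P1 + cert_neg))%:R - (Z * P2)%:R :> rat.
  by rewrite !natrM natrD; field; rewrite lt0r_neq0.
rewrite lerBlDr ltrBlDr -!natrD ler_nat ltr_nat /final_test.
by case: strict; rewrite ?addn0 // addn1.
Qed.

Theorem attains_cert strict P1 P2 b : b * D%:R = P1%:R - P2%:R -> attains strict b ->
  exists pol rk Bm rf rb Z X,
  supported pol rk Bm rf rb X /\
  [/\ (0 < Z <= (n`! * D ^ n) ^ (ns * n))%N,
      forall g t, (X g t <= Z * \sum_(0 <= i < m) C i)%N,
      forall g t, (pol g t <= a)%N && (rk g t <= n)%N,
      forall g u t, (rf g u t <= n)%N && (rb g u t <= n)%N &
      cert_ok pol rk Bm rf rb Z X && final_test strict P1 P2 Z X].
Proof.
move=> bE [sigma H].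
have [pol [rk [Bm [rf [rb [Z [X [sup [[h1 h2 h3 h4 h5] up]]]]]]]]] := cert_complete.
exists pol, rk, Bm, rf, rb, Z, X; split=> //; split=> //; rewrite h5 /=.
rewrite final_testE; last by case/andP: h1.
rewrite -bE mulfK ?lt0r_neq0 //=; have := up sigma.
by case: strict H => H U; rewrite -(ltr_rat R, ler_rat R) rmorphD /=; lra.
Qed.

Theorem cert_attains strict P1 P2 b pol rk Bm rf rb Z X : b * D%:R = P1%:R - P2%:R ->
  (0 < Z)%N -> cert_ok pol rk Bm rf rb Z X -> final_test strict P1 P2 Z X -> attains strict b.
Proof.
move=> bE Z0 ok; rewrite final_testE // -bE mulfK ?lt0r_neq0 //= => fin.
have [sigma lo] := cert_sound Z0 ok; exists sigma.
by case: strict fin; rewrite -(ltr_rat R, ler_rat R) rmorphD /= => fin; lra.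
Qed.

End Link.

Definition cmp_code (c : comparison) : nat :=
  match c with Greater => 0 | GreaterEq => 1 | Approx _ _ => 2 | NotApprox _ _ => 3 end.

Definition cmp_eps (c : comparison) : rat :=
  match c with Approx e _ => e | NotApprox e _ => e | _ => 0 end.

Definition cmp_strict (c : nat) : bool := (c == 0%N) || (c == 3%N).

Section Comparisons.
Context (R : realType) (J : relbuechi_instance).
Notation code := (cmp_code (cmp J)).

(** With [sg] the problem is negated. For [NotApprox] one of the two values must exceed its bound by
    more than [eps]; for [Approx] each must reach its bound up to [eps], by schedulers that may
    differ. *)
Definition goal_bound (sg : bool) : rat :=
  (-1) ^+ sg * bound J + (code == 3%N)%:R * cmp_eps (cmp J) - (code == 2%N)%:R * cmp_eps (cmp J).

Definition goal (sg : bool) : Prop := attains R J sg (cmp_strict code) (goal_bound sg).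

Lemma total_opp (sigma : 'I_(nscheds J) -> scheduler R (model J)) :
  total true sigma = - total false sigma.
Proof.
rewrite /total -sumrN; apply: eq_bigr => i _.
by rewrite /signed_coef expr1 expr0 mul1r mulN1r rmorphN mulNr.
Qed.

Lemma holds_goal : relbuechi_holds R J <->
  if code == 2%N then goal false /\ goal true
  else if code == 3%N then goal false \/ goal true else goal false.
Proof.
have totalE (sigma : 'I_(nscheds J) -> scheduler R (model J)) : \sum_i ratr (coef i) *
    Pr (sigma (sched_index i)) (source i) (infinitely_often (model J) (target i)) = total false sigma.
  by apply: eq_bigr => i _; rewrite /signed_coef expr0 mul1r.
rewrite /relbuechi_holds /goal /goal_bound /attains; case: (cmp J) => [||e e0|e e0] /=.
- by split=> -[sigma H]; exists sigma; move: H; rewrite totalE ?expr0 ?mul1r ?mul0r ?addr0 ?subr0.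
- by split=> -[sigma H]; exists sigma; move: H; rewrite totalE ?expr0 ?mul1r ?mul0r ?addr0 ?subr0.
- have e0' : 0 <= ratr e :> R by rewrite ler0q.
  rewrite ?expr0 ?expr1 ?mulN1r ?mul1r ?mul0r ?addr0 ?mul1r; split=> [[sigma]|[[s1 H1] [s2 H2]]].
    rewrite totalE ler_norml => /andP[h1 h2].
    by split; exists sigma; rewrite ?total_opp !rmorphB /= ?rmorphN /=; lra.
  move: H1 H2; rewrite total_opp !rmorphB /= rmorphN /=.
  set t1 := total false s1; set t2 := total false s2 => H1 H2.
  (* If [t1] or [t2] is already close enough, it is taken; otherwise the bound lies strictly between
     them and the interpolation hits it exactly. *)
  have [lam l01 ll] : exists2 lam : R, 0 <= lam <= 1 &
      `|lam * t1 + (1 - lam) * t2 - ratr (bound J)| <= ratr e.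
    have [h1|h1] := leP t1 (ratr (bound J) + ratr e).
      by exists 1; [lra|rewrite ler_norml; lra].
    have [h2|h2] := leP (ratr (bound J) - ratr e) t2.
      by exists 0; [lra|rewrite ler_norml; lra].
    have d0 : 0 < t1 - t2 by lra.
    exists ((ratr (bound J) - t2) / (t1 - t2)).
      by rewrite divr_ge0 ?ler_pdivrMr //; lra.
    rewrite (_ : _ - _ = 0) ?normr0 //.
    by field; rewrite lt0r_neq0.
  exists (fun k => mixture (s1 k) (s2 k) l01).
  rewrite (totalE (fun k => mixture (s1 k) (s2 k) l01)).
  suff -> : total false (fun k => mixture (s1 k) (s2 k) l01) = lam * t1 + (1 - lam) * t2 by [].
  rewrite /total !big_distrr -big_split; apply: eq_bigr => i _ /=.
  by rewrite Pr_mixture; [ring|exact: measurable_infinitely_often].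
- rewrite ?expr0 ?expr1 ?mulN1r ?mul1r ?mul0r ?subr0 ?mul1r; split=> [[sigma]|[[sigma]|[sigma]]].
  + rewrite totalE ltNge ler_norml negb_and -!ltNge => /orP[h|h]; [right|left]; exists sigma;
    by rewrite ?total_opp !rmorphD /= ?rmorphN /=; lra.
  + rewrite rmorphD /= => h; exists sigma; rewrite totalE ltNge ler_norml negb_and -!ltNge.
    by apply/orP; right; lra.
  + rewrite total_opp rmorphD rmorphN /= => h; exists sigma.
    rewrite totalE ltNge ler_norml negb_and -!ltNge.
    by apply/orP; left; lra.
Qed.

End Comparisons.

End Certificates.

Import Certificates.

(** * Arithmetic on columns of binary numbers *)

Module Columns.

Local Open Scope nat_scope.

(** Columns are arbitrary natural numbers, not bits: sums and products are formed columnwise without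
    carries and stay small enough for counters. *)
Definition colval K (f : nat -> nat) := \sum_(0 <= k < K) f k * 2 ^ k.

Definition conv (f g : nat -> nat) k := \sum_(0 <= i < k.+1) f i * g (k - i).

(* [e - M] is the rounded-down quotient of the difference of the first [i] columns by [2 ^ i]. *)
Definition lecols K (f g : nat -> nat) : bool :=
  let M := \sum_(0 <= k < K) f k in
  M <= iteri K (fun i e => (e + M + g i - f i)./2) M.

Definition eqcols K f g := lecols K f g && lecols K g f.

(** The offset [M] is at least every column of [f], so the subtraction never truncates although the
    true carry [e - M] may be negative; the sign of the final carry decides. *)
Lemma lecolsE K f g : lecols K f g = (colval K f <= colval K g).
Proof.
rewrite /lecols; set M := \sum_(_ <= _ < _) _.
have fM i : i < K -> f i <= M.
  by move=> lt; rewrite /M big_mkord (bigD1 (Ordinal lt)) //= leq_addr.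
have inv j : j <= K -> let e := iteri j (fun i e => (e + M + g i - f i)./2) M in
    e * 2 ^ j + colval j f <= M * 2 ^ j + colval j g < e.+1 * 2 ^ j + colval j f.
  elim: j => [|j IH] lt; first by rewrite /colval !big_geq //= !muln1 !addn0 leqnn ltnSn.
  have := IH (ltnW lt); have := fM j lt; rewrite /colval !big_nat_recr //= -/(colval j f) -/(colval j g).
  set e := iteri _ _ _; have := odd_double_half (e + M + g j - f j).
  set e' := _./2; set o := odd _; rewrite expnS; move: (2 ^ j) (colval j f) (colval j g) => P F G.
  move=> eq fj /= /andP[h1 h2].
  have key : f j + (o + e'.*2) = e + M + g j by lia.
  have kP : f j * P + (o * P + e' * (2 * P)) = e * P + M * P + g j * P.
    by rewrite -!mulnDl -key mulnA muln2 -!mulnDl.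
  have oP : o * P <= P by case: (o); rewrite ?mul1n ?mul0n.
  rewrite [e.+1 * _]mulSn in h2; rewrite [e'.+1 * _]mulSn [M * (2 * P)]mulnCA; move: h1 h2 kP oP.
  move: (e * P) (M * P) (f j * P) (g j * P) (o * P) (e' * (2 * P)) => ? ? ? ? ? ?.
  by move=> *; apply/andP; split; lia.
have /andP[h1 h2] := inv K (leqnn K); move: h1 h2 => /=.
set e := iteri _ _ _ => h1 h2; have P0 : 0 < 2 ^ K by rewrite expn_gt0.
apply/idP/idP => h; first by have := leq_mul2r (2 ^ K) M e; rewrite h orbT => ?; nia.
rewrite leqNgt; apply/negP => lt.
have X : e.+1 * 2 ^ K <= M * 2 ^ K by rewrite leq_mul2r lt orbT.
by have := leq_trans h2 (leq_add X h); rewrite ltnn.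
Qed.

Lemma eqcolsE K f g : eqcols K f g = (colval K f == colval K g).
Proof. by rewrite /eqcols !lecolsE eqn_leq. Qed.

Lemma colval_ext K L f : L <= K -> (forall k, L <= k -> f k = 0) -> colval K f = colval L f.
Proof.
move=> LK f0; rewrite /colval (@big_cat_nat _ _ _ L 0 K) //= [X in _ + X]big1_seq ?addn0 //.
by move=> k /andP[_]; rewrite mem_index_iota => /andP[Lk _]; rewrite f0.
Qed.

(** [conv] multiplies polynomials, and [L + L] columns hold the whole product. *)
Lemma colval_conv K L f g : L + L <= K -> (forall k, L <= k -> f k = 0) ->
  (forall k, L <= k -> g k = 0) -> colval K (conv f g) = colval L f * colval L g.
Proof.
move=> LK f0 g0.
have c0 k : L + L <= k -> conv f g k = 0.
  move=> lk; rewrite /conv big1_seq // => i /andP[_]; rewrite mem_index_iota => /andP[_ ik].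
  have [/f0 -> //|lt] := leqP L i; rewrite g0 ?muln0 //; lia.
rewrite (colval_ext LK c0) {LK c0 K} /colval big_distrl /=.
under [RHS]eq_bigr do rewrite big_distrr /=.
have shift i : \sum_(0 <= j < L) f i * 2 ^ i * (g j * 2 ^ j) =
    \sum_(0 <= k < L + L) if i <= k then f i * g (k - i) * 2 ^ k else 0.
  have [li|il] := leqP L i.
    by rewrite !big1_seq // => k _; rewrite f0 //; case: ifP.
  rewrite [RHS](@big_cat_nat _ _ _ i) //=; last lia.
  rewrite [X in X + _]big1_seq ?add0n; last first.
    by move=> k /andP[_]; rewrite mem_index_iota => /andP[_ ki]; rewrite leqNgt ki.
  have sh (G : nat -> nat) : \sum_(i <= k < L + L) G k = \sum_(0 <= k < L + L - i) G (k + i).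
    by rewrite -{1}[i]add0n big_addn.
  rewrite sh [RHS](@big_cat_nat _ _ _ L) //=; last lia.
  rewrite [X in _ + X]big1_seq ?addn0; last first.
    move=> k /andP[_]; rewrite mem_index_iota => /andP[lk _].
    by rewrite leq_addl addnK g0 // muln0.
  apply: eq_bigr => j _; rewrite leq_addl addnK expnD; nia.
under [RHS]eq_bigr do rewrite shift.
rewrite exchange_big_nat /=; apply: eq_big_nat => k /andP[_ lk].
rewrite /conv big_distrl /= (big_nat_widen _ _ (L + L)) // big_mkcond /=.
rewrite [LHS](_ : _ = \sum_(0 <= i < L + L) if i <= k then f i * g (k - i) * 2 ^ k else 0); last first.
  by apply: eq_bigr => i _; rewrite ltnS.
rewrite (@big_cat_nat _ _ _ L) //=; last lia.
rewrite [X in _ + X]big1_seq ?addn0 // => i /andP[_]; rewrite mem_index_iota => /andP[li _].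
by rewrite f0 //; case: ifP.
Qed.

Lemma colval_add K f g : colval K (fun k => f k + g k) = colval K f + colval K g.
Proof. by rewrite /colval -big_split /=; apply: eq_bigr => k _; rewrite mulnDl. Qed.

Lemma colval_sum K n (F : nat -> nat -> nat) :
  colval K (fun k => \sum_(0 <= i < n) F i k) = \sum_(0 <= i < n) colval K (F i).
Proof. by rewrite /colval exchange_big_nat; apply: eq_bigr => k _; rewrite big_distrl. Qed.

Lemma colval_scale K c f : colval K (fun k => c * f k) = c * colval K f.
Proof. by rewrite /colval big_distrr /=; apply: eq_bigr => k _; rewrite mulnA. Qed.

Lemma colval_unit K : 0 < K -> colval K (fun k => k == 0 : nat) = 1.
Proof.
move=> K0; rewrite (@colval_ext K 1) // /colval ?big_nat1 // => k; by case: k.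
Qed.

Lemma colval_gt0 K f : (0 < colval K f) = has (fun k => 0 < f k) (iota 0 K).
Proof.
rewrite /colval lt0n sum_nat_seq_eq0 -has_predC /index_iota subn0.
by apply: eq_has => k /=; rewrite muln_eq0 expn_eq0 orbF lt0n.
Qed.

Definition bits_of (n k : nat) : nat := odd (n %/ 2 ^ k).

Lemma colval_bits K n : n < 2 ^ K -> colval K (bits_of n) = n.
Proof.
have H : colval K (bits_of n) = n %% 2 ^ K.
  elim: K => [|K IH]; first by rewrite /colval big_geq ?modn1.
  rewrite /colval big_nat_recr //= -/(colval K _) IH /bits_of -modn2.
  have e := divn_eq n (2 ^ K); have e2 := divn_eq (n %/ 2 ^ K) 2.
  have en : n = (n %/ 2 ^ K) %/ 2 * (2 * 2 ^ K) + ((n %/ 2 ^ K) %% 2 * 2 ^ K + n %% 2 ^ K).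
    by rewrite {1}e {1}e2 mulnDl -!mulnA addnA.
  rewrite expnS [in RHS]en modnMDl [RHS]modn_small; first by rewrite addnC.
  have : n %% 2 ^ K < 2 ^ K by rewrite ltn_mod expn_gt0.
  have : (n %/ 2 ^ K) %% 2 <= 1 by rewrite -ltnS ltn_mod.
  by move: ((n %/ 2 ^ K) %% 2) (n %% 2 ^ K) (2 ^ K) => x y z; nia.
by move=> lt; rewrite H modn_small.
Qed.

Section EColumns.
Variables (A B : finType).
Notation E := (@E A B _).

Lemma E_lecols k (K : seq A -> ctx k -> nat) (f g : seq A -> ctx k -> nat -> nat) :
  E K -> @Computable.E A B k.+1 (fun w c => f w c.1 c.2) -> @Computable.E A B k.+1 (fun w c => g w c.1 c.2) ->
  E (fun w c => lecols (K w c) (f w c) (g w c) : nat).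
Proof.
move=> hK hf hg; rewrite /lecols.
have hM : E (fun w c => \sum_(0 <= i < K w c) f w c i) by auto with E.
have hG : E (fun w c => \sum_(0 <= i < K w c) g w c i) by auto with E.
apply: E_leq => //.
apply: (@E_iteri A B k K _ (fun w c i e => (e + \sum_(0 <= i < K w c) f w c i + g w c i - f w c i)./2)
  (fun w c => \sum_(0 <= i < K w c) f w c i + \sum_(0 <= i < K w c) g w c i)) => //.
- have h1 := E_weak hf; have h2 := E_weak hg; have h3 := E_weak2 hM.
  apply: E_half; apply: E_sub => //; apply: E_add => //; apply: E_add => //; exact: E_var0.
- exact: E_pbd (E_add hM hG).
move=> w c j; elim: j => [|j IH] le /=; first exact: leq_addr.
have : g w c j <= \sum_(0 <= i < K w c) g w c i.
  by rewrite big_mkord (bigD1 (Ordinal le)) //= leq_addr.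
have := IH (ltnW le); set e := iteri _ _ _; move: (\sum_(_ <= _ < _) _) (\sum_(_ <= _ < _) _).
by move=> X Y; lia.
Qed.

Lemma E_eqcols k (K : seq A -> ctx k -> nat) (f g : seq A -> ctx k -> nat -> nat) :
  E K -> @Computable.E A B k.+1 (fun w c => f w c.1 c.2) -> @Computable.E A B k.+1 (fun w c => g w c.1 c.2) ->
  E (fun w c => eqcols (K w c) (f w c) (g w c) : nat).
Proof. by move=> hK hf hg; apply: E_and; apply: E_lecols. Qed.

End EColumns.

#[export] Hint Resolve E_lecols E_eqcols : E.

End Columns.

Import Columns.

(** * The checks of the verifier *)

Module Verifier.

Local Open Scope nat_scope.

(* What the verifier sees: [sm j] is the [j]-th number of the instance cut off at the word
   length, [bt j k] its [k]-th bit, and [cb] the table of the certificate. *)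
Record view := View {
  sm : nat -> nat;
  bt : nat -> nat -> bool;
  cb : nat -> nat -> nat -> nat -> nat -> bool;
  rad : nat;
  nent : nat }.

Section Checks.
Variable v : view.

(* Positions of the numbers in [relbuechi_entries]: [tro s b t] is the first entry of a transition
   probability, [blk i] that of the [i]-th term. *)
Definition vn := sm v 0.
Definition va := sm v 1.
Definition base2 := 2 + 3 * (vn * va * vn).
Definition tro s b t := 2 + 3 * ((s * va + b) * vn + t).
Definition vm := sm v base2.
Definition vns := sm v base2.+1.
Definition blk i := base2 + 2 + i * (5 + vn).
Definition base3 := base2 + 2 + vm * (5 + vn).
Definition vcode := sm v base3.
Definition epso := base3 + 1.
Definition bndo := if vcode < 2 then base3 + 1 else base3 + 4.
Definition vsrc i := sm v (blk i + 3).
Definition vsch i := sm v (blk i + 4).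
Definition vtgt i t := sm v (blk i + 5 + t) == 1.

Definition ebit j k : nat := bt v j k.
(* Large numbers of the certificate are rows of bits, small ones are written in unary. *)
Definition cbig tag i1 i2 k : nat := (k < rad v) && cb v tag i1 i2 0 k.
Definition crow tag i1 i2 i3 := \sum_(0 <= k < rad v) cb v tag i1 i2 i3 k.
(** Wide enough for a product of two rows. *)
Definition ncols := 2 * rad v.
Definition dbit := cbig 0 0 0.
Definition rbit o := cbig 1 o 0.

Definition nz (f : nat -> nat) := has (fun k => 0 < f k) (iota 0 (rad v)).

(** A fraction is stored in lowest terms, with the sign bit clear for 0. Coprimality is witnessed by
    a Bezout identity whose coefficients have the tags 2 and 3, and the row [rbit o] must be [D]
    times the absolute value. *)
Definition rat_ok o :=
  [&& sm v o <= 1, (sm v o == 1) ==> nz (ebit (o + 1)), nz (ebit (o + 2)),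
      eqcols ncols (fun k => conv (cbig 3 o 0) (ebit (o + 2)) k)
        (fun k => conv (cbig 2 o 0) (ebit (o + 1)) k + (k == 0)) &
      eqcols ncols (fun k => conv (rbit o) (ebit (o + 2)) k) (fun k => conv dbit (ebit (o + 1)) k)].

Definition term_ok i :=
  [&& vsrc i < vn, vsch i < vns & all (fun t => sm v (blk i + 5 + t) <= 1) (iota 0 vn)].

(** Numbers are seen only up to a cut-off, so each must be shown to lie below it: the number of
    entries bounds the sizes, and [vns <= vm] the number of schedulers. *)
Definition fmt_ok :=
  [&& 0 < vn, 0 < va, nent v == bndo + 3, vns <= vm, vcode <= 3,
      all term_ok (iota 0 vm) &
      all (fun j => has (fun i => vsch i == j) (iota 0 vm)) (iota 0 vns)].

Definition trans_rat_ok s b t := rat_ok (tro s b t) && (sm v (tro s b t) == 0).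

Definition rats_ok :=
  [&& all (fun s => all (fun b => all (trans_rat_ok s b) (iota 0 vn)) (iota 0 va)) (iota 0 vn),
      all (fun i => rat_ok (blk i)) (iota 0 vm),
      (1 < vcode) ==> rat_ok epso && (sm v epso == 0), rat_ok bndo & nz dbit].

Definition tr_en s b :=
  eqcols ncols (fun k => \sum_(0 <= t < vn) rbit (tro s b t) k) (fun k => dbit k).

Definition tr_pos s b t := nz (rbit (tro s b t)).

Definition tr_ok :=
  all (fun s => has (tr_en s) (iota 0 va) &&
    all (fun b => tr_en s b || all (fun t => ~~ tr_pos s b t) (iota 0 vn)) (iota 0 va)) (iota 0 vn).

Section Signed.
Variable sg : nat.

(** The tags 4 to 10 hold the certificate for the given coefficients, 14 to 20 the one for their
    negatives. *)
Definition zbit := cbig (4 + 10 * sg) 0 0.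
Definition xbit g t := cbig (5 + 10 * sg) g t.
Definition cpol g t := crow (6 + 10 * sg) g t 0.
Definition crk g t := crow (7 + 10 * sg) g t 0.
Definition cBm g u t b := cb v (8 + 10 * sg) g u t b.
Definition crf g u t := crow (9 + 10 * sg) g u t.
Definition crb g u t := crow (10 + 10 * sg) g u t.
Definition vng i := (sm v (blk i) == 1) (+) (sg == 1).

Definition payc g u k := \sum_(0 <= i < vm)
  (vsch i * vn + vsrc i == g) * (nat_hit vn va vtgt cBm g u i (+) vng i) * rbit (blk i) k.

Definition step_ok g t b :=
  lecols ncols (fun k => conv dbit (xbit g t) k)
    (fun k => \sum_(0 <= t' < vn) conv (rbit (tro t b t')) (xbit g t') k).

Definition zero_ok g t := ~~ nz (xbit g t).

Definition pay_ok g t := lecols ncols (fun k => xbit g t k) (fun k => conv zbit (payc g t) k).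

Definition vst := nat_st va cBm.
Definition vstep := nat_step va cBm tr_pos.
Definition vec := nat_ec vn va cBm crf crb tr_en tr_pos.
Definition vstate_ok := state_ok vn va cpol crk cBm crf crb tr_en tr_pos step_ok zero_ok pay_ok.

Definition vstates_ok :=
  states_ok vn va vns cpol crk cBm crf crb tr_en tr_pos step_ok zero_ok pay_ok.

Definition bnd_neg := (sm v bndo == 1) (+) (sg == 1).
Definition negc k := \sum_(0 <= i < vm) vng i * rbit (blk i) k.
Definition p1c k := ~~ bnd_neg * rbit bndo k + (vcode == 3) * rbit epso k.
Definition p2c k := bnd_neg * rbit bndo k + (vcode == 2) * rbit epso k.

Definition final_ok :=
  lecols ncols
    (fun k => conv zbit (fun j => p1c j + negc j) k
              + ((vcode == 0) || (vcode == 3)) * (k == 0))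
    (fun k => \sum_(0 <= l < vns) \sum_(0 <= s < vn) xbit (l * vn + s) s k + conv zbit p2c k).

Definition signed_ok := [&& nz zbit, vstates_ok & final_ok].

End Signed.

Definition core :=
  [&& fmt_ok, rats_ok, tr_ok &
      if vcode == 2 then signed_ok 0 && signed_ok 1
      else if vcode == 3 then signed_ok 0 || signed_ok 1 else signed_ok 0].

End Checks.

Definition letter : finType := (option bool + bool)%type.
Implicit Types w : seq letter.

Definition is_sep w i := onth w i == Some (inl None : letter).
Definition is_one w i := onth w i == Some (inl (Some true) : letter).
Definition is_inp w i := [|| is_sep w i, is_one w i | onth w i == Some (inl (Some false) : letter)].
Definition inp_len w := \sum_(0 <= i < size w) is_inp w i.
Definition seps w i := \sum_(0 <= k < i) is_sep w k.
(** The positions with fewer than [j] separators before them form an initial segment, whose length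
    is where entry [j] begins. *)
Definition entry_start w j := \sum_(0 <= i < size w) (seps w i < j).
Definition entry_len w j := entry_start w j.+1 - (entry_start w j).+1.
Definition entry_bit w j k := (k < entry_len w j) && is_one w (entry_start w j + k).
(** Horner's scheme from the most significant bit, cut off in every step to stay polynomially
    bounded; since [2 * x + b] is at least [x], cutting off early does not change the cut-off
    result. *)
Definition entry_val w j := iteri (entry_len w j)
  (fun k acc => minn (size w).+1 (2 * acc + entry_bit w j (entry_len w j - k.+1))) 0.
(** The side of the certificate table. It exceeds the tags, the group numbers of size at most
    [n ^ 2], and the bit length [2 * n ^ 4 + 3 * n] allowed for the largest certificate numbers. *)
Definition radix n := (n + 30) ^ 5.
Definition table_pos N tag i1 i2 i3 i4 := (((tag * N + i1) * N + i2) * N + i3) * N + i4.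
Definition cert_bit w tag i1 i2 i3 i4 :=
  let N := radix (inp_len w) in [&& i1 < N, i2 < N, i3 < N & i4 < N] &&
  (onth w (inp_len w + table_pos (radix (inp_len w)) tag i1 i2 i3 i4) == Some (inr true : letter)).

Definition wview w :=
  View (entry_val w) (entry_bit w) (cert_bit w) (radix (inp_len w)) (seps w (size w)).

Definition parse_ok w :=
  [&& 0 < inp_len w, is_sep w (inp_len w).-1 &
      all (fun j => (entry_len w j == 0) || entry_bit w j (entry_len w j).-1) (iota 0 (seps w (size w)))].

Definition verify w := parse_ok w && core (wview w).

(** * Polynomial-time computability of the checks *)

Notation EE := (@E letter bool _).

Section ELemmas.
Variable k : nat.
Implicit Types f g h e d : seq letter -> ctx k -> nat.

Lemma E_pred f : EE f -> EE (fun w (c : ctx k) => (f w c).-1).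
Proof. by move=> h; apply: E_ext (E_sub h (E_one _ _ _)) => w c; rewrite subn1. Qed.
Lemma E_is_sep f : EE f -> EE (fun w (c : ctx k) => is_sep w (f w c) : nat).
Proof. rewrite /is_sep; auto 40 with E. Qed.
Lemma E_is_one f : EE f -> EE (fun w (c : ctx k) => is_one w (f w c) : nat).
Proof. rewrite /is_one; auto 40 with E. Qed.

End ELemmas.

#[export] Hint Resolve E_pred E_is_sep E_is_one : E.

Section ELemmas.
Variable k : nat.
Implicit Types f g h e d : seq letter -> ctx k -> nat.

Lemma E_is_inp f : EE f -> EE (fun w (c : ctx k) => is_inp w (f w c) : nat).
Proof. rewrite /is_inp; auto 40 with E. Qed.

End ELemmas.

#[export] Hint Resolve E_is_inp : E.

Section ELemmas.
Variable k : nat.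
Implicit Types f g h e d : seq letter -> ctx k -> nat.

Lemma E_inp_len  : EE (fun w (c : ctx k) => inp_len w).
Proof. rewrite /inp_len; auto 40 with E. Qed.
Lemma E_seps f : EE f -> EE (fun w (c : ctx k) => seps w (f w c)).
Proof. rewrite /seps; auto 40 with E. Qed.

End ELemmas.

#[export] Hint Resolve E_inp_len E_seps : E.

Section ELemmas.
Variable k : nat.
Implicit Types f g h e d : seq letter -> ctx k -> nat.

Lemma E_entry_start f : EE f -> EE (fun w (c : ctx k) => entry_start w (f w c)).
Proof. rewrite /entry_start; auto 40 with E. Qed.

End ELemmas.

#[export] Hint Resolve E_entry_start : E.

Section ELemmas.
Variable k : nat.
Implicit Types f g h e d : seq letter -> ctx k -> nat.

Lemma E_entry_len f : EE f -> EE (fun w (c : ctx k) => entry_len w (f w c)).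
Proof. rewrite /entry_len; auto 40 with E. Qed.

End ELemmas.

#[export] Hint Resolve E_entry_len : E.

Section ELemmas.
Variable k : nat.
Implicit Types f g h e d : seq letter -> ctx k -> nat.

Lemma E_entry_bit f g : EE f -> EE g -> EE (fun w (c : ctx k) => entry_bit w (f w c) (g w c) : nat).
Proof. rewrite /entry_bit; auto 40 with E. Qed.

End ELemmas.

#[export] Hint Resolve E_entry_bit : E.

Section ELemmas.
Variable k : nat.
Implicit Types f g h e d : seq letter -> ctx k -> nat.

Lemma E_radix f : EE f -> EE (fun w (c : ctx k) => radix (f w c)).
Proof. rewrite /radix; auto 40 with E. Qed.

End ELemmas.

#[export] Hint Resolve E_radix : E.

Section ELemmas.
Variable k : nat.
Implicit Types f g h e d : seq letter -> ctx k -> nat.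

Lemma E_entry_val f : EE f -> EE (fun w (c : ctx k) => entry_val w (f w c)).
Proof. 
move=> hf; apply: (@E_iteri letter bool k (fun w c => entry_len w (f w c)) (fun w c => 0)
  (fun w c j acc => minn (size w).+1 (2 * acc + entry_bit w (f w c) (entry_len w (f w c) - j.+1)))
  (fun w c => (size w).+1)); try by auto 20 with E.
- by apply: (@E_pbd letter bool); auto with E.
- by move=> w c [|j] //= _; exact: geq_minl.
 Qed.
Lemma E_cert_bit f g h e d : EE f -> EE g -> EE h -> EE e -> EE d -> EE (fun w (c : ctx k) => cert_bit w (f w c) (g w c) (h w c) (e w c) (d w c) : nat).
Proof. rewrite /cert_bit /table_pos; auto 40 with E. Qed.

End ELemmas.

#[export] Hint Resolve E_entry_val E_cert_bit : E.

Section ELemmas.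
Variable k : nat.
Implicit Types f g h e d : seq letter -> ctx k -> nat.

Lemma E_sm f : EE f -> EE (fun w (c : ctx k) => sm (wview w) (f w c)).
Proof. exact: E_entry_val. Qed.
Lemma E_bt f g : EE f -> EE g -> EE (fun w (c : ctx k) => bt (wview w) (f w c) (g w c) : nat).
Proof. exact: E_entry_bit. Qed.
Lemma E_cb f g h e d : EE f -> EE g -> EE h -> EE e -> EE d -> EE (fun w (c : ctx k) => cb (wview w) (f w c) (g w c) (h w c) (e w c) (d w c) : nat).
Proof. exact: E_cert_bit. Qed.
Lemma E_rad  : EE (fun w (c : ctx k) => rad (wview w)).
Proof. by apply: E_radix; exact: E_inp_len. Qed.
Lemma E_nent  : EE (fun w (c : ctx k) => nent (wview w)).
Proof. by apply: E_seps; exact: E_len. Qed.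

End ELemmas.

#[export] Hint Resolve E_sm E_bt E_cb E_rad E_nent : E.

Section ELemmas.
Variable k : nat.
Implicit Types f g h e d : seq letter -> ctx k -> nat.

Lemma E_vn  : EE (fun w (c : ctx k) => vn (wview w)).
Proof. rewrite /vn; auto 40 with E. Qed.
Lemma E_va  : EE (fun w (c : ctx k) => va (wview w)).
Proof. rewrite /va; auto 40 with E. Qed.

End ELemmas.

#[export] Hint Resolve E_vn E_va : E.

Section ELemmas.
Variable k : nat.
Implicit Types f g h e d : seq letter -> ctx k -> nat.

Lemma E_base2  : EE (fun w (c : ctx k) => base2 (wview w)).
Proof. rewrite /base2; auto 40 with E. Qed.
Lemma E_tro f g h : EE f -> EE g -> EE h -> EE (fun w (c : ctx k) => tro (wview w) (f w c) (g w c) (h w c)).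
Proof. rewrite /tro; auto 40 with E. Qed.

End ELemmas.

#[export] Hint Resolve E_base2 E_tro : E.

Section ELemmas.
Variable k : nat.
Implicit Types f g h e d : seq letter -> ctx k -> nat.

Lemma E_vm  : EE (fun w (c : ctx k) => vm (wview w)).
Proof. rewrite /vm; auto 40 with E. Qed.
Lemma E_vns  : EE (fun w (c : ctx k) => vns (wview w)).
Proof. rewrite /vns; auto 40 with E. Qed.
Lemma E_blk f : EE f -> EE (fun w (c : ctx k) => blk (wview w) (f w c)).
Proof. rewrite /blk; auto 40 with E. Qed.

End ELemmas.

#[export] Hint Resolve E_vm E_vns E_blk : E.

Section ELemmas.
Variable k : nat.
Implicit Types f g h e d : seq letter -> ctx k -> nat.

Lemma E_base3  : EE (fun w (c : ctx k) => base3 (wview w)).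
Proof. rewrite /base3; auto 40 with E. Qed.
Lemma E_vsrc f : EE f -> EE (fun w (c : ctx k) => vsrc (wview w) (f w c)).
Proof. rewrite /vsrc; auto 40 with E. Qed.
Lemma E_vsch f : EE f -> EE (fun w (c : ctx k) => vsch (wview w) (f w c)).
Proof. rewrite /vsch; auto 40 with E. Qed.
Lemma E_vtgt f g : EE f -> EE g -> EE (fun w (c : ctx k) => vtgt (wview w) (f w c) (g w c) : nat).
Proof. rewrite /vtgt; auto 40 with E. Qed.

End ELemmas.

#[export] Hint Resolve E_base3 E_vsrc E_vsch E_vtgt : E.

Section ELemmas.
Variable k : nat.
Implicit Types f g h e d : seq letter -> ctx k -> nat.

Lemma E_vcode  : EE (fun w (c : ctx k) => vcode (wview w)).
Proof. rewrite /vcode; auto 40 with E. Qed.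
Lemma E_epso  : EE (fun w (c : ctx k) => epso (wview w)).
Proof. rewrite /epso; auto 40 with E. Qed.
Lemma E_ebit f g : EE f -> EE g -> EE (fun w (c : ctx k) => ebit (wview w) (f w c) (g w c)).
Proof. rewrite /ebit; auto 40 with E. Qed.
Lemma E_cbig f g h e : EE f -> EE g -> EE h -> EE e -> EE (fun w (c : ctx k) => cbig (wview w) (f w c) (g w c) (h w c) (e w c)).
Proof. rewrite /cbig; auto 40 with E. Qed.
Lemma E_crow f g h e : EE f -> EE g -> EE h -> EE e -> EE (fun w (c : ctx k) => crow (wview w) (f w c) (g w c) (h w c) (e w c)).
Proof. rewrite /crow; auto 40 with E. Qed.
Lemma E_ncols  : EE (fun w (c : ctx k) => ncols (wview w)).
Proof. rewrite /ncols; auto 40 with E. Qed.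

End ELemmas.

#[export] Hint Resolve E_vcode E_epso E_ebit E_cbig E_crow E_ncols : E.

Section ELemmas.
Variable k : nat.
Implicit Types f g h e d : seq letter -> ctx k -> nat.

Lemma E_bndo  : EE (fun w (c : ctx k) => bndo (wview w)).
Proof. rewrite /bndo; auto 40 with E. Qed.
Lemma E_dbit f : EE f -> EE (fun w (c : ctx k) => dbit (wview w) (f w c)).
Proof. rewrite /dbit; auto 40 with E. Qed.
Lemma E_rbit f g : EE f -> EE g -> EE (fun w (c : ctx k) => rbit (wview w) (f w c) (g w c)).
Proof. rewrite /rbit; auto 40 with E. Qed.

End ELemmas.

#[export] Hint Resolve E_bndo E_dbit E_rbit : E.

Section ELemmas.
Variable k : nat.
Implicit Types f g h e d : seq letter -> ctx k -> nat.

Lemma E_rat_ok f : EE f -> EE (fun w (c : ctx k) => rat_ok (wview w) (f w c) : nat).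
Proof. rewrite /rat_ok /nz /conv; auto 40 with E. Qed.
Lemma E_term_ok f : EE f -> EE (fun w (c : ctx k) => term_ok (wview w) (f w c) : nat).
Proof. rewrite /term_ok; auto 40 with E. Qed.
Lemma E_tr_en f g : EE f -> EE g -> EE (fun w (c : ctx k) => tr_en (wview w) (f w c) (g w c) : nat).
Proof. rewrite /tr_en; auto 40 with E. Qed.
Lemma E_tr_pos f g h : EE f -> EE g -> EE h -> EE (fun w (c : ctx k) => tr_pos (wview w) (f w c) (g w c) (h w c) : nat).
Proof. rewrite /tr_pos /nz; auto 40 with E. Qed.

End ELemmas.

#[export] Hint Resolve E_rat_ok E_term_ok E_tr_en E_tr_pos : E.

Section ELemmas.
Variable k : nat.
Implicit Types f g h e d : seq letter -> ctx k -> nat.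

Lemma E_fmt_ok  : EE (fun w (c : ctx k) => fmt_ok (wview w) : nat).
Proof. rewrite /fmt_ok; auto 40 with E. Qed.
Lemma E_trans_rat_ok f g h : EE f -> EE g -> EE h -> EE (fun w (c : ctx k) => trans_rat_ok (wview w) (f w c) (g w c) (h w c) : nat).
Proof. rewrite /trans_rat_ok; auto 40 with E. Qed.
Lemma E_tr_ok  : EE (fun w (c : ctx k) => tr_ok (wview w) : nat).
Proof. rewrite /tr_ok; auto 40 with E. Qed.
Lemma E_zbit f g : EE f -> EE g -> EE (fun w (c : ctx k) => zbit (wview w) (f w c) (g w c)).
Proof. rewrite /zbit; auto 40 with E. Qed.
Lemma E_xbit f g h e : EE f -> EE g -> EE h -> EE e -> EE (fun w (c : ctx k) => xbit (wview w) (f w c) (g w c) (h w c) (e w c)).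
Proof. rewrite /xbit; auto 40 with E. Qed.
Lemma E_cpol f g h : EE f -> EE g -> EE h -> EE (fun w (c : ctx k) => cpol (wview w) (f w c) (g w c) (h w c)).
Proof. rewrite /cpol; auto 40 with E. Qed.
Lemma E_crk f g h : EE f -> EE g -> EE h -> EE (fun w (c : ctx k) => crk (wview w) (f w c) (g w c) (h w c)).
Proof. rewrite /crk; auto 40 with E. Qed.
Lemma E_cBm f g h e d : EE f -> EE g -> EE h -> EE e -> EE d -> EE (fun w (c : ctx k) => cBm (wview w) (f w c) (g w c) (h w c) (e w c) (d w c) : nat).
Proof. rewrite /cBm; auto 40 with E. Qed.
Lemma E_crf f g h e : EE f -> EE g -> EE h -> EE e -> EE (fun w (c : ctx k) => crf (wview w) (f w c) (g w c) (h w c) (e w c)).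
Proof. rewrite /crf; auto 40 with E. Qed.
Lemma E_crb f g h e : EE f -> EE g -> EE h -> EE e -> EE (fun w (c : ctx k) => crb (wview w) (f w c) (g w c) (h w c) (e w c)).
Proof. rewrite /crb; auto 40 with E. Qed.
Lemma E_vng f g : EE f -> EE g -> EE (fun w (c : ctx k) => vng (wview w) (f w c) (g w c) : nat).
Proof. rewrite /vng; auto 40 with E. Qed.

End ELemmas.

#[export] Hint Resolve E_fmt_ok E_trans_rat_ok E_tr_ok E_zbit E_xbit E_cpol E_crk E_cBm E_crf E_crb E_vng : E.

Section ELemmas.
Variable k : nat.
Implicit Types f g h e d : seq letter -> ctx k -> nat.

Lemma E_rats_ok  : EE (fun w (c : ctx k) => rats_ok (wview w) : nat).
Proof. rewrite /rats_ok /nz; auto 40 with E. Qed.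
Lemma E_vst f g h e : EE f -> EE g -> EE h -> EE e -> EE (fun w (c : ctx k) => vst (wview w) (f w c) (g w c) (h w c) (e w c) : nat).
Proof. rewrite /vst /nat_st; auto 40 with E. Qed.
Lemma E_vstep f g h e d : EE f -> EE g -> EE h -> EE e -> EE d -> EE (fun w (c : ctx k) => vstep (wview w) (f w c) (g w c) (h w c) (e w c) (d w c) : nat).
Proof. rewrite /vstep /nat_step; auto 40 with E. Qed.

End ELemmas.

#[export] Hint Resolve E_rats_ok E_vst E_vstep : E.

Section ELemmas.
Variable k : nat.
Implicit Types f g h e d : seq letter -> ctx k -> nat.

Lemma E_vhit f g h e : EE f -> EE g -> EE h -> EE e -> EE (fun w (c : ctx k) => nat_hit (vn (wview w)) (va (wview w)) (vtgt (wview w)) (cBm (wview w) (f w c)) (g w c) (h w c) (e w c) : nat).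
Proof. 
by move=> hf hg hh he; apply: (@E_has _ _ _ _ (fun w c t => vtgt (wview w) (e w c) t && vst (wview w) (f w c) (g w c) (h w c) t)); auto 40 with E.
 Qed.

End ELemmas.

#[export] Hint Resolve E_vhit : E.

Section ELemmas.
Variable k : nat.
Implicit Types f g h e d : seq letter -> ctx k -> nat.

Lemma E_payc f g h e : EE f -> EE g -> EE h -> EE e -> EE (fun w (c : ctx k) => payc (wview w) (f w c) (g w c) (h w c) (e w c)).
Proof. rewrite /payc; auto 40 with E. Qed.
Lemma E_step_ok f g h e : EE f -> EE g -> EE h -> EE e -> EE (fun w (c : ctx k) => step_ok (wview w) (f w c) (g w c) (h w c) (e w c) : nat).
Proof. rewrite /step_ok /conv; auto 40 with E. Qed.
Lemma E_zero_ok f g h : EE f -> EE g -> EE h -> EE (fun w (c : ctx k) => zero_ok (wview w) (f w c) (g w c) (h w c) : nat).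
Proof. rewrite /zero_ok /nz; auto 40 with E. Qed.
Lemma E_vec f g h : EE f -> EE g -> EE h -> EE (fun w (c : ctx k) => vec (wview w) (f w c) (g w c) (h w c) : nat).
Proof. 
move=> hf hg hh; rewrite /vec /nat_ec; apply: E_and; first exact: E_vst.
apply: (@E_all _ _ _ _ (fun w c t =>
  all (fun b => cBm (wview w) (f w c) (g w c) (h w c) t b ==> tr_en (wview w) t b &&
    all (fun t' => tr_pos (wview w) t b t' ==> vst (wview w) (f w c) (g w c) (h w c) t') (iota 0 (vn (wview w))))
    (iota 0 (va (wview w))) &&
  (vst (wview w) (f w c) (g w c) (h w c) t ==> (t == h w c) ||
    has (fun t' => vstep (wview w) (f w c) (g w c) (h w c) t t' &&
      (crf (wview w) (f w c) (g w c) (h w c) t' < crf (wview w) (f w c) (g w c) (h w c) t)) (iota 0 (vn (wview w))) &&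
    has (fun t' => vstep (wview w) (f w c) (g w c) (h w c) t' t &&
      (crb (wview w) (f w c) (g w c) (h w c) t' < crb (wview w) (f w c) (g w c) (h w c) t)) (iota 0 (vn (wview w))))));
  auto 40 with E.
 Qed.
Lemma E_bnd_neg f : EE f -> EE (fun w (c : ctx k) => bnd_neg (wview w) (f w c) : nat).
Proof. rewrite /bnd_neg; auto 40 with E. Qed.
Lemma E_negc f g : EE f -> EE g -> EE (fun w (c : ctx k) => negc (wview w) (f w c) (g w c)).
Proof. rewrite /negc; auto 40 with E. Qed.

End ELemmas.

#[export] Hint Resolve E_payc E_step_ok E_zero_ok E_vec E_bnd_neg E_negc : E.

Section ELemmas.
Variable k : nat.
Implicit Types f g h e d : seq letter -> ctx k -> nat.

Lemma E_pay_ok f g h : EE f -> EE g -> EE h -> EE (fun w (c : ctx k) => pay_ok (wview w) (f w c) (g w c) (h w c) : nat).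
Proof. rewrite /pay_ok /conv; auto 40 with E. Qed.
Lemma E_p1c f g : EE f -> EE g -> EE (fun w (c : ctx k) => p1c (wview w) (f w c) (g w c)).
Proof. rewrite /p1c; auto 40 with E. Qed.
Lemma E_p2c f g : EE f -> EE g -> EE (fun w (c : ctx k) => p2c (wview w) (f w c) (g w c)).
Proof. rewrite /p2c; auto 40 with E. Qed.

End ELemmas.

#[export] Hint Resolve E_pay_ok E_p1c E_p2c : E.

Section ELemmas.
Variable k : nat.
Implicit Types f g h e d : seq letter -> ctx k -> nat.

Lemma E_final_ok f : EE f -> EE (fun w (c : ctx k) => final_ok (wview w) (f w c) : nat).
Proof. rewrite /final_ok /conv; auto 40 with E. Qed.
Lemma E_vstate_ok f g h : EE f -> EE g -> EE h -> EE (fun w (c : ctx k) => vstate_ok (wview w) (f w c) (g w c) (h w c) : nat).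
Proof. 
move=> hf hg hh; rewrite /vstate_ok /state_ok; apply: E_ifb; [auto 20 with E| |].
  by apply: E_and; [auto 20 with E|apply: E_and; auto 40 with E].
by apply: E_or; [auto 20 with E|apply: E_and; [exact: E_vec|auto 20 with E]].
 Qed.

End ELemmas.

#[export] Hint Resolve E_final_ok E_vstate_ok : E.

Section ELemmas.
Variable k : nat.
Implicit Types f g h e d : seq letter -> ctx k -> nat.

Lemma E_signed_ok f : EE f -> EE (fun w (c : ctx k) => signed_ok (wview w) (f w c) : nat).
Proof. 
move=> hf; rewrite /signed_ok; apply: E_and; first by rewrite /nz; auto 40 with E.
apply: E_and; last by auto 20 with E.
apply: (@E_all _ _ _ _ (fun w c l => all (fun s => all (vstate_ok (wview w) (f w c) (l * vn (wview w) + s))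
  (iota 0 (vn (wview w)))) (iota 0 (vn (wview w))))); auto 40 with E.
 Qed.

End ELemmas.

#[export] Hint Resolve E_signed_ok : E.

Section ELemmas.
Variable k : nat.
Implicit Types f g h e d : seq letter -> ctx k -> nat.

Lemma E_core  : EE (fun w (c : ctx k) => core (wview w) : nat).
Proof. rewrite /core; auto 40 with E. Qed.

End ELemmas.

#[export] Hint Resolve E_core : E.

Section ELemmas.
Variable k : nat.
Implicit Types f g h e d : seq letter -> ctx k -> nat.

Lemma E_parse_ok  : EE (fun w (c : ctx k) => parse_ok w : nat).
Proof. rewrite /parse_ok; auto 40 with E. Qed.

End ELemmas.

#[export] Hint Resolve E_parse_ok : E.

Lemma poly_time_verify : poly_time (fun w => [:: verify w]).
Proof.
apply: (@P_poly_time letter bool).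
apply: (@P_ext _ _ _ (fun w c => if verify w then [:: true] else [:: false])).
  by move=> w c; case: (verify w).
apply: P_if; [|exact: P_emit|exact: P_emit].
by apply: E_and; [exact: E_parse_ok|exact: E_core].
Qed.

End Verifier.

Import Verifier.

(** * Reading numbers off the word *)

Module Parsing.

Local Open Scope nat_scope.

Definition bits_val (c : seq bool) : nat := foldr (fun (b : bool) acc => b + 2 * acc) 0 c.

Lemma colval_recl K f : colval K.+1 f = f 0 + 2 * colval K (fun k => f k.+1).
Proof.
rewrite /colval big_nat_recl //= muln1 big_distrr; congr (_ + _).
by apply: eq_bigr => k _; rewrite /= expnS mulnCA.
Qed.

Lemma colval_nth K c : size c <= K -> colval K (fun k => nth false c k : nat) = bits_val c.
Proof.
elim: c K => [|b c IH] K.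
  by move=> _; rewrite /colval big1 // => k _; rewrite nth_nil.
by case: K => // K; rewrite ltnS => le; rewrite colval_recl /= IH.
Qed.

Lemma bits_val_lt c : bits_val c < 2 ^ size c.
Proof.
elim: c => //= b c IH; rewrite expnS; move: (2 ^ size c) (bits_val c) IH => P x.
by case: b; lia.
Qed.

Lemma bits_val_odd c i : odd (bits_val c %/ 2 ^ i) = nth false c i.
Proof.
elim: i c => [|i IH] [|b c]; rewrite ?div0n //=.
  by rewrite divn1 oddD oddM /= addbF; case: b.
rewrite expnS -IH divnMA; congr (odd (_ %/ _)).
by rewrite divn2 addnC mul2n; case: b; lia.
Qed.

(** The most significant bit comes last; requiring it to be 1 makes the notation unique, so that a
    parsed word is the encoding of its values. *)
Definition canonical (c : seq bool) := (size c == 0) || nth false c (size c).-1.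

Lemma bits_val_ge c : canonical c -> 0 < size c -> 2 ^ (size c).-1 <= bits_val c.
Proof.
rewrite /canonical lt0n => + c0; rewrite (negbTE c0) /=.
elim: c c0 => //= b [|b' c] IH _; first by case: b.
move=> /(IH isT) /=; rewrite expnS; lia.
Qed.

Lemma binary_bits_val c : canonical c -> binary (bits_val c) = c.
Proof.
move=> cc; rewrite /binary.
have -> : up_log 2 (bits_val c).+1 = size c.
  have [/size0nil -> //|c0] := posnP (size c).
  rewrite -(prednK c0); apply: up_log_eq => //; rewrite (prednK c0) ltnS bits_val_ge //=.
  exact: bits_val_lt.
apply: (@eq_from_nth _ false); rewrite size_map size_iota // => i lt.
by rewrite (nth_map 0) ?size_iota // nth_iota // add0n bits_val_odd.
Qed.

Lemma size_binary n : size (binary n) = up_log 2 n.+1.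
Proof. by rewrite size_map size_iota. Qed.

Lemma binary_lt n : n < 2 ^ size (binary n).
Proof. by rewrite size_binary up_logP. Qed.

Lemma nth_binary n k : nth false (binary n) k = odd (n %/ 2 ^ k).
Proof.
have [lt|ge] := ltnP k (size (binary n)).
  by rewrite (nth_map 0) ?size_iota -?size_binary // nth_iota -?size_binary.
rewrite nth_default // divn_small //; apply: leq_trans (binary_lt n) _.
by rewrite leq_exp2l.
Qed.

Lemma bits_val_binary n : bits_val (binary n) = n.
Proof.
rewrite -(@colval_nth (size (binary n))) // -[RHS](colval_bits (binary_lt n)).
by apply: eq_bigr => k _; rewrite nth_binary.
Qed.

Lemma canonical_binary n : canonical (binary n).
Proof.
rewrite /canonical nth_binary size_binary; case: n => [|n]; first by rewrite up_log1.
have e0 : 0 < up_log 2 n.+2 by rewrite up_log_gt0.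
have /andP[h1 h2] := up_log_bounds (isT : 1 < 2) (isT : 1 < n.+2).
suff -> : n.+1 %/ 2 ^ (up_log 2 n.+2).-1 = 1 by rewrite orbT.
apply/eqP; rewrite eqn_leq -ltnS ltn_divLR ?expn_gt0 // leq_divRL ?expn_gt0 //.
by rewrite -expnS (prednK e0) mul1n h2.
Qed.

Definition chunk_word (cs : seq (seq bool)) : seq (option bool) :=
  flatten [seq rcons [seq Some b | b <- c] None | c <- cs].

Lemma encodeE numeral ns : encode numeral ns = chunk_word [seq numeral n | n <- ns].
Proof. by rewrite /encode /chunk_word -map_comp. Qed.

Lemma chunks_of (x : seq (option bool)) : last None x = None ->
  exists cs, x = chunk_word cs.
Proof.
suff H y : exists c cs, y ++ [:: None] = rcons [seq Some b | b <- c] None ++ chunk_word cs.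
  case/lastP: x => [|y z]; first by exists [::].
  rewrite last_rcons => ->; have [c [cs e]] := H y; exists (c :: cs).
  by rewrite -cats1 e.
elim: y => [|[b|] y [c [cs e]]]; first by exists [::], [::].
  by exists (b :: c), cs; rewrite /= e.
by exists [::], (c :: cs); rewrite /= e.
Qed.

Lemma chunk_cat l1 l2 : chunk_word (l1 ++ l2) = chunk_word l1 ++ chunk_word l2.
Proof. by rewrite /chunk_word map_cat flatten_cat. Qed.

Section RawWords.
Variables (x : seq (option bool)) (y : seq bool).
Notation w := ([seq inl a | a <- x] ++ [seq inr b | b <- y] : seq letter).

Lemma onth_word i : onth w i = if i < size x then omap (inl : option bool -> letter) (onth x i)
  else omap (inr : bool -> letter) (onth y (i - size x)).
Proof. by rewrite onth_cat size_map !onth_map. Qed.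

Lemma is_sepE i : is_sep w i = (onth x i == Some None).
Proof.
rewrite /is_sep onth_word; case: ltnP => h; first by case: (onth x i) => [[b|]|].
by rewrite (onth_default h); case: (onth y _).
Qed.

Lemma is_oneE i : is_one w i = (onth x i == Some (Some true)).
Proof.
rewrite /is_one onth_word; case: ltnP => h; first by case: (onth x i) => [[b|]|].
by rewrite (onth_default h); case: (onth y _).
Qed.

Lemma inp_lenE : inp_len w = size x.
Proof.
rewrite /inp_len (eq_bigr (fun i => (i < size x) : nat)).
  rewrite size_cat !size_map (@big_cat_nat _ _ _ (size x)) //= ?leq_addr //.
  rewrite [X in _ + X]big1_seq; last first.
    by move=> i /andP[_]; rewrite mem_index_iota => /andP[h _]; rewrite ltnNge h.
  rewrite addn0 (eq_big_nat _ _ (F2 := fun=> 1)) => [|i /andP[_ ->] //].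
  by rewrite sum_nat_const_nat subn0 muln1.
move=> i _; rewrite /is_inp is_sepE is_oneE onth_word; congr nat_of_bool.
case: ltnP => h; last by rewrite (onth_default h); case: (onth y _).
have : onth x i by rewrite onthTE.
by case: (onth x i) => [[[]|]|].
Qed.

Lemma sepsE i : seps w i = count (pred1 None) (take i x).
Proof.
elim: i => [|i IH]; first by rewrite take0 /seps big_geq.
rewrite /seps big_nat_recr //= -/(seps w i) IH is_sepE.
have [lt|ge] := ltnP i (size x); last first.
  by rewrite (onth_default ge) (take_oversize ge) (take_oversize (leqW ge)) addn0.
rewrite (take_nth None lt) -cats1 count_cat /= addn0; congr (_ + nat_of_bool _).
have : onth x i by rewrite onthTE.
by rewrite -odflt_onth; case: (onth x i).
Qed.

Lemma seps_mono i i' : i <= i' -> seps w i <= seps w i'.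
Proof. by move=> le; rewrite /seps (big_cat_nat (leq0n i) le) /= leq_addr. Qed.

Lemma size_word : size w = size x + size y.
Proof. by rewrite size_cat !size_map. Qed.

End RawWords.

Section Words.
Variables (cs : seq (seq bool)) (y : seq bool).
Notation x := (chunk_word cs).
Notation w := ([seq inl a | a <- x] ++ [seq inr b | b <- y] : seq letter).

Definition chunk_pos j := size (chunk_word (take j cs)).

Lemma chunk_split j : j < size cs ->
  x = chunk_word (take j cs) ++ rcons [seq Some b | b <- nth [::] cs j] None ++ chunk_word (drop j.+1 cs).
Proof.
move=> lt; rewrite -{1}(cat_take_drop j cs) (drop_nth [::] lt).
by rewrite /chunk_word map_cat flatten_cat.
Qed.

Lemma count_chunks l : count (pred1 None) (chunk_word l) = size l.
Proof.
elim: l => //= c l IH; rewrite /chunk_word /= count_cat -/(chunk_word l) IH -cats1 count_cat /=.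
by rewrite count_map (eq_count (a2 := pred0)) // count_pred0.
Qed.

Lemma chunk_posS j : j < size cs -> chunk_pos j.+1 = chunk_pos j + (size (nth [::] cs j)).+1.
Proof.
move=> lt; rewrite /chunk_pos (take_nth [::] lt) -cats1 /chunk_word map_cat flatten_cat size_cat /=.
by rewrite cats0 size_rcons size_map.
Qed.

Lemma chunk_pos_le j : chunk_pos j <= size x.
Proof.
have := congr1 size (chunk_cat (take j cs) (drop j cs)).
by rewrite cat_take_drop size_cat => ->; exact: leq_addr.
Qed.

Lemma seps_pos j : j <= size cs -> seps w (chunk_pos j) = j.
Proof.
move=> le; rewrite sepsE (_ : x = chunk_word (take j cs) ++ chunk_word (drop j cs)); last first.
  by rewrite -chunk_cat cat_take_drop.
by rewrite take_size_cat // count_chunks size_take_min; apply/minn_idPl.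
Qed.

Lemma seps_last j : j < size cs -> seps w (chunk_pos j.+1).-1 = j.
Proof.
move=> lt; have := seps_pos lt; rewrite chunk_posS // addnS /=.
rewrite {1}/seps big_nat_recr //= -/(seps w _) is_sepE {2}(chunk_split lt).
rewrite onth_cat ltnNge leq_addr /= addKn -cats1 -catA onth_cat size_map ltnn subnn /= ?eqxx.
by rewrite addn1 => -[].
Qed.

Lemma seps_lt i j : j <= size cs -> (seps w i < j) = (i < chunk_pos j).
Proof.
move=> le; have [lt|ge] := ltnP i (chunk_pos j); last first.
  by apply/negbTE; rewrite -leqNgt -{1}(seps_pos le) seps_mono.
case: j le lt => [|j] le lt; first by rewrite /chunk_pos take0 in lt.
have := @seps_mono x y i (chunk_pos j.+1).-1; rewrite seps_last // ltnS; apply.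
by case: (chunk_pos j.+1) lt.
Qed.

Lemma sum_lt_const n p : p <= n -> \sum_(0 <= i < n) (i < p : nat) = p.
Proof.
move=> le; rewrite (@big_cat_nat _ _ _ p) //= [X in _ + X]big1_seq ?addn0; last first.
  by move=> i /andP[_]; rewrite mem_index_iota => /andP[h _]; rewrite ltnNge h.
rewrite (eq_big_nat _ _ (F2 := fun=> 1)) => [|i /andP[_ ->] //].
by rewrite sum_nat_const_nat subn0 muln1.
Qed.

Lemma seps_total : seps w (size w) = size cs.
Proof.
rewrite sepsE take_oversize ?count_chunks //.
by rewrite size_word leq_addr.
Qed.

Lemma entry_startE j : j <= size cs -> entry_start w j = chunk_pos j.
Proof.
move=> le; rewrite /entry_start; under eq_bigr do rewrite seps_lt //.
by rewrite sum_lt_const // size_word (leq_trans (chunk_pos_le j)) // leq_addr.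
Qed.

Lemma entry_start_ge j : size cs <= j -> size x <= entry_start w j.
Proof.
move=> le; rewrite -[leqLHS]/(size (chunk_word cs)) -{1}(take_size cs) -/(chunk_pos (size cs)) -entry_startE //.
rewrite /entry_start; apply: leq_sum => i _; case: ltnP => //= h.
by rewrite (leq_trans h le).
Qed.

Lemma entry_lenE j : j < size cs -> entry_len w j = size (nth [::] cs j).
Proof.
by move=> lt; rewrite /entry_len !entry_startE // ?(ltnW lt) // chunk_posS // addnS subSS addKn.
Qed.

Lemma entry_bitE j k : entry_bit w j k = nth false (nth [::] cs j) k.
Proof.
rewrite /entry_bit is_oneE; have [lt|ge] := ltnP j (size cs); last first.
  rewrite (nth_default _ ge) nth_nil onth_default ?andbF //.
  exact: leq_trans (entry_start_ge ge) (leq_addr _ _).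
rewrite entry_lenE // entry_startE ?(ltnW lt) //.
have [lk|gk] /= := ltnP k (size (nth [::] cs j)); last by rewrite nth_default.
rewrite {1}(chunk_split lt) onth_cat ltnNge leq_addr /= addKn onth_cat size_rcons size_map ltnS (ltnW lk).
rewrite -cats1 onth_cat size_map lk onth_map.
have : onth (nth [::] cs j) k by rewrite onthTE.
by rewrite -(odflt_onth false (nth [::] cs j)); case: (onth _ k) => [[]|].
Qed.

Lemma entry_valE j : entry_val w j = minn (size w).+1 (bits_val (nth [::] cs j)).
Proof.
rewrite /entry_val; set L := entry_len w j; set cap := (size w).+1; set c := nth [::] cs j.
(* After [k] steps the top [k] bits have been read. The zero padding covers an index beyond the last
   entry, where [c] is empty. *)
have H k : k <= L -> iteri k (fun i acc => minn cap (2 * acc + entry_bit w j (L - i.+1))) 0 =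
    minn cap (bits_val (take k (drop (L - k) (c ++ nseq L false)))).
  elim: k => [|k IH] le /=; first by rewrite take0 minn0.
  rewrite IH ?(ltnW le) // entry_bitE -/c.
  have lt : L - k.+1 < size (c ++ nseq L false) by rewrite size_cat size_nseq; lia.
  rewrite (drop_nth false lt) subnSK //= nth_cat.
  have -> : (if L - k.+1 < size c then nth false c (L - k.+1) else nth false (nseq L false) (L - k.+1 - size c))
      = nth false c (L - k.+1).
    by case: ltnP => // h; rewrite nth_nseq if_same nth_default.
  by move: (bits_val _) (nth false c _) => u b; lia.
rewrite H // subnn drop0; congr minn.
have [lt|ge] := ltnP j (size cs).
  by rewrite /L entry_lenE // take_size_cat.
rewrite /c nth_default // cat0s take_nseq //.
by elim: (L) => //= n ->.
Qed.

Lemma cert_bitE tag i1 i2 i3 i4 : cert_bit w tag i1 i2 i3 i4 =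
  [&& i1 < radix (size x), i2 < radix (size x), i3 < radix (size x) & i4 < radix (size x)] &&
  nth false y (table_pos (radix (size x)) tag i1 i2 i3 i4).
Proof.
rewrite /cert_bit inp_lenE; congr (_ && _).
rewrite onth_word ltnNge leq_addr /= addKn -odflt_onth.
by case: (onth y _) => [[]|].
Qed.

Lemma parse_okE : parse_ok w = (0 < size cs) && all canonical cs.
Proof.
rewrite /parse_ok inp_lenE seps_total; case: (posnP (size cs)) => [/size0nil -> //|c0].
have -> : 0 < size x.
  by case: (cs) c0 => // c l _; rewrite /chunk_word /= size_cat size_rcons.
have -> : is_sep w (size x).-1.
  rewrite is_sepE; have lt : (size cs).-1 < size cs by rewrite prednK.
  have -> : x = (chunk_word (take (size cs).-1 cs) ++ [seq Some b | b <- nth [::] cs (size cs).-1])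
      ++ [:: None].
    by rewrite {1}(chunk_split lt) (prednK c0) drop_size cats0 -cats1 catA.
  by rewrite size_cat addn1 /= onth_cat ltnn subnn.
rewrite /=; apply/allP/allP => [H c|H j].
  move=> /(nthP [::])[j lt <-]; have := H j; rewrite mem_iota /= lt => /(_ isT).
  by rewrite entry_lenE // entry_bitE.
rewrite mem_iota /= => lt; rewrite entry_lenE // entry_bitE.
by apply: H; rewrite mem_nth.
Qed.

End Words.

End Parsing.

Import Parsing.

(** * The checks as statements about numbers *)

Module VerifierValues.

Local Open Scope nat_scope.

Definition faithful (v : view) (e : nat -> nat) (cap : nat) :=
  [/\ 0 < rad v, forall j, sm v j = minn cap (e j), forall j, colval (rad v) (ebit v j) = e j &
      forall j k, rad v <= k -> ebit v j k = 0].

Section Values.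
Variable v : view.

Definition Dv := colval (rad v) (dbit v).
Definition Rv o := colval (rad v) (rbit v o).
Definition Zv sg := colval (rad v) (zbit v sg).
Definition Xv sg g t := colval (rad v) (xbit v sg g t).
Definition Uv o := colval (rad v) (cbig v 2 o 0).
Definition Vv o := colval (rad v) (cbig v 3 o 0).
Definition P1v sg := ~~ bnd_neg v sg * Rv (bndo v) + (vcode v == 3) * Rv (epso v).
Definition P2v sg := bnd_neg v sg * Rv (bndo v) + (vcode v == 2) * Rv (epso v).

Lemma cbig0 tag i1 i2 k : rad v <= k -> cbig v tag i1 i2 k = 0.
Proof. by rewrite /cbig leqNgt => /negbTE ->. Qed.

Lemma nzE f : nz v f = (0 < colval (rad v) f).
Proof. by rewrite colval_gt0. Qed.

Lemma wide f : (forall k, rad v <= k -> f k = 0) -> colval (ncols v) f = colval (rad v) f.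
Proof. by move=> f0; apply: colval_ext; rewrite // /ncols mul2n -addnn leq_addr. Qed.

Lemma convE f g : (forall k, rad v <= k -> f k = 0) -> (forall k, rad v <= k -> g k = 0) ->
  colval (ncols v) (conv f g) = colval (rad v) f * colval (rad v) g.
Proof. by move=> f0 g0; apply: colval_conv; rewrite // /ncols mul2n -addnn. Qed.

Lemma tr_enE s b : tr_en v s b = (\sum_(0 <= t < vn v) Rv (tro v s b t) == Dv).
Proof.
rewrite /tr_en eqcolsE (@colval_sum (ncols v) _ (fun t => rbit v (tro v s b t))) wide; last exact: cbig0.
congr (_ == _); apply: eq_bigr => t _; rewrite wide //; exact: cbig0.
Qed.

Lemma tr_posE s b t : tr_pos v s b t = (0 < Rv (tro v s b t)).
Proof. exact: nzE. Qed.

Lemma step_okE sg g t b : step_ok v sg g t b =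
  (Dv * Xv sg g t <= \sum_(0 <= t' < vn v) Rv (tro v t b t') * Xv sg g t').
Proof.
rewrite /step_ok lecolsE convE; [|exact: cbig0|exact: cbig0].
rewrite (@colval_sum (ncols v) _ (fun t' => conv (rbit v (tro v t b t')) (xbit v sg g t'))).
congr (_ <= _); apply: eq_bigr => t' _; rewrite convE //; exact: cbig0.
Qed.

Lemma zero_okE sg g t : zero_ok v sg g t = (Xv sg g t == 0).
Proof. by rewrite /zero_ok nzE lt0n negbK. Qed.

Definition payv sg g u := \sum_(0 <= i < vm v) (vsch v i * vn v + vsrc v i == g) * Rv (blk v i) *
  (nat_hit (vn v) (va v) (vtgt v) (cBm v sg) g u i (+) vng v sg i).

Lemma pay_okE sg g t : pay_ok v sg g t = (Xv sg g t <= Zv sg * payv sg g t).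
Proof.
rewrite /pay_ok lecolsE wide; last exact: cbig0.
rewrite convE; [|exact: cbig0|]; last first.
  by move=> k le; rewrite /payc big1 // => i _; rewrite /rbit cbig0 ?muln0.
rewrite /payc (@colval_sum (rad v) _ (fun i k => _ * rbit v (blk v i) k)).
congr (_ <= _ * _); apply: eq_bigr => i _.
by rewrite (@colval_scale (rad v) _ (rbit v (blk v i))) mulnAC.
Qed.

Definition negv sg := \sum_(0 <= i < vm v) Rv (blk v i) * vng v sg i.
Definition sumv sg := \sum_(0 <= l < vns v) \sum_(0 <= s < vn v) Xv sg (l * vn v + s) s.

Lemma final_okE sg : 0 < rad v -> final_ok v sg =
  (Zv sg * (P1v sg + negv sg) + ((vcode v == 0) || (vcode v == 3)) <= sumv sg + Zv sg * P2v sg).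
Proof.
move=> r0; rewrite /final_ok lecolsE.
rewrite (@colval_add _ (fun k => conv (zbit v sg) (fun j => p1c v sg j + negc v sg j) k)).
rewrite (@colval_add _ _ (conv (zbit v sg) (p2c v sg))).
have r0' o k : rad v <= k -> rbit v o k = 0 by exact: cbig0.
rewrite !convE; try exact: cbig0.
- rewrite colval_scale colval_unit ?muln1; last by rewrite /ncols; lia.
  congr (_ * _ + _ <= _ + _ * _).
  + rewrite (@colval_add _ (p1c v sg) (negc v sg)); congr (_ + _).
      by rewrite /p1c colval_add !colval_scale.
    rewrite /negc (@colval_sum _ _ (fun i k => _ * rbit v (blk v i) k)); apply: eq_bigr => i _.
    by rewrite (@colval_scale _ _ (rbit v (blk v i))) mulnC.
  + rewrite (@colval_sum _ _ (fun l k => \sum_(0 <= s < vn v) xbit v sg (l * vn v + s) s k)).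
    apply: eq_bigr => l _.
    rewrite (@colval_sum _ _ (fun s => xbit v sg (l * vn v + s) s)); apply: eq_bigr => s _.
    by rewrite wide //; exact: cbig0.
  + by rewrite /p2c colval_add !colval_scale.
- by move=> k le; rewrite /p2c !r0' // !muln0.
- by move=> k le; rewrite /p1c /negc !r0' // !muln0 big1 // => i _; rewrite r0' ?muln0.
Qed.

End Values.

Lemma rat_okE v e cap o : faithful v e cap -> rat_ok v o =
  [&& sm v o <= 1, (sm v o == 1) ==> (0 < e (o + 1)), 0 < e (o + 2),
      Vv v o * e (o + 2) == Uv v o * e (o + 1) + 1 & Rv v o * e (o + 2) == Dv v * e (o + 1)].
Proof.
case=> r0 _ eE e0; rewrite /rat_ok !nzE !eE !eqcolsE.
rewrite (@colval_add _ (conv (cbig v 2 o 0) (ebit v (o + 1)))) colval_unit; last by rewrite /ncols; lia.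
by rewrite !convE ?eE //; first [exact: cbig0|exact: e0].
Qed.

Section Linked.
Context (R : realType) (J : relbuechi_instance) (v : view).

(** The interface shared by soundness and completeness: in one direction [J] is built from the view,
    in the other the view from [J]. *)
Record linked : Prop := Linked {
  link_rad : 0 < rad v;
  link_n : vn v = nstates J;
  link_a : va v = nactions J;
  link_m : vm v = nterms J;
  link_ns : vns v = nscheds J;
  link_D : 0 < Dv v;
  link_trans : forall (s : 'I_(nstates J)) (b : 'I_(nactions J)) (t : 'I_(nstates J)), (Rv v (tro v s b t))%:R%R = ((Dv v)%:R * trans (model J) s b t)%R;
  link_coef : forall i : 'I_(nterms J), (Rv v (blk v i))%:R%R = ((Dv v)%:R * `|coef (r := J) i|)%R;
  link_sign : forall i : 'I_(nterms J), (sm v (blk v i) == 1) = (coef (r := J) i < 0)%R;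
  link_source : forall i : 'I_(nterms J), vsrc v i = source (r := J) i;
  link_sched : forall i : 'I_(nterms J), vsch v i = sched_index (r := J) i;
  link_target : forall (i : 'I_(nterms J)) (t : 'I_(nstates J)), vtgt v i t = (t \in target (r := J) i);
  link_code : vcode v = cmp_code (cmp J);
  link_eps : 1 < vcode v -> (Rv v (epso v))%:R%R = ((Dv v)%:R * cmp_eps (cmp J))%R;
  link_bound : (Rv v (bndo v))%:R%R = ((Dv v)%:R * `|bound J|)%R;
  link_bsign : (sm v (bndo v) == 1) = (bound J < 0)%R }.

Hypothesis lk : linked.

Lemma signed_okE (sg : bool) : signed_ok v sg =
  [&& 0 < Zv v sg,
      cert_ok J (Dv v) (fun s b t => Rv v (tro v s b t)) (fun i => Rv v (blk v i)) (vng v sg)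
        (vsrc v) (vsch v) (vtgt v) (cpol v sg) (crk v sg) (cBm v sg) (crf v sg) (crb v sg)
        (Zv v sg) (Xv v sg) &
      final_test J (fun i => Rv v (blk v i)) (vng v sg) (cmp_strict (cmp_code (cmp J)))
        (P1v v sg) (P2v v sg) (Zv v sg) (Xv v sg)].
Proof.
rewrite /signed_ok nzE /vstates_ok /cert_ok final_okE ?(link_rad lk) //.
congr [&& _, _ & _]; last first.
  by rewrite /final_test /cert_neg /cert_sum /negv /sumv (link_m lk) (link_ns lk) (link_n lk) (link_code lk).
have -> : tr_en v = enabled_test J (Dv v) (fun s b t => Rv v (tro v s b t)).
  by apply: funext => s; apply: funext => b; rewrite tr_enE (link_n lk).
have -> : tr_pos v = (fun t b t' => 0 < Rv v (tro v t b t')).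
  by apply: funext => s; apply: funext => b; apply: funext => t; rewrite tr_posE.
have -> : step_ok v sg = step_test J (Dv v) (fun s b t => Rv v (tro v s b t)) (Xv v sg).
  by apply: funext => s; apply: funext => b; apply: funext => t; rewrite step_okE (link_n lk).
have -> : zero_ok v sg = (fun g t => Xv v sg g t == 0).
  by apply: funext => s; apply: funext => b; rewrite zero_okE.
have -> : pay_ok v sg = pay_test J (fun i => Rv v (blk v i)) (vng v sg) (vsrc v) (vsch v) (vtgt v)
    (cBm v sg) (Zv v sg) (Xv v sg).
  apply: funext => g; apply: funext => t.
  by rewrite pay_okE /pay_test /nat_pay /payv (link_m lk) (link_n lk) (link_a lk).
by rewrite (link_n lk) (link_a lk) (link_ns lk).
Qed.

Lemma link_neg (sg : bool) i : coef (r := J) i != 0%R -> vng v sg i = (coef (r := J) i < 0)%R (+) sg.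
Proof. by move=> _; rewrite /vng (link_sign lk); case: sg. Qed.

Lemma link_goal_bound (sg : bool) :
  (goal_bound J sg * (Dv v)%:R = (P1v v sg)%:R - (P2v v sg)%:R)%R.
Proof.
rewrite /goal_bound /P1v /P2v !natrD !natrM (link_bound lk) /bnd_neg (link_bsign lk).
have -> : (((vcode v == 3) : nat)%:R * (Rv v (epso v))%:R =
    ((vcode v == 3) : nat)%:R * ((Dv v)%:R * cmp_eps (cmp J)) :> rat)%R.
  by case: eqP => c; rewrite ?mul0r // (link_eps lk) // c.
have -> : (((vcode v == 2) : nat)%:R * (Rv v (epso v))%:R =
    ((vcode v == 2) : nat)%:R * ((Dv v)%:R * cmp_eps (cmp J)) :> rat)%R.
  by case: eqP => c; rewrite ?mul0r // (link_eps lk) // c.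
rewrite (link_code lk).
have [b0|b0] := ltrP (bound J) 0%R; [rewrite ltr0_norm //|rewrite ger0_norm //];
  by case: sg => /=; rewrite ?expr0 ?expr1; ring.
Qed.

Lemma signed_goal (sg : bool) : signed_ok v sg -> goal R J sg.
Proof.
rewrite signed_okE => /and3P[Z0 ok fin].
apply: (cert_attains R (link_D lk) (link_trans lk) (link_coef lk) (@link_neg sg) (link_source lk)
  (link_sched lk) (link_target lk) (link_goal_bound sg) Z0 ok fin).
Qed.

Lemma signed_holds : (if vcode v == 2 then signed_ok v 0 && signed_ok v 1
    else if vcode v == 3 then signed_ok v 0 || signed_ok v 1 else signed_ok v 0) ->
  relbuechi_holds R J.
Proof.
move=> H; apply/holds_goal; rewrite (link_code lk) in H.
have g0 := @signed_goal false; have g1 := @signed_goal true.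
case: (_ == 2) H => [/andP[/g0 ? /g1 ?] //|].
by case: (_ == 3) => [/orP[/g0|/g1]|/g0]; [left|right|].
Qed.

End Linked.

End VerifierValues.

Import VerifierValues.

(** * From an accepted word to an instance *)

Module Soundness.

Local Open Scope nat_scope.

Section Segments.
Variable e : nat -> nat.

Definition seg o c := [seq e j | j <- iota o c].

Lemma seg_cat o c c' : seg o c ++ seg (o + c) c' = seg o (c + c').
Proof. by rewrite /seg iotaD map_cat. Qed.

Lemma seg_flatten n c o (F : 'I_n -> seq nat) : (forall i : 'I_n, F i = seg (o + i * c) c) ->
  flatten [seq F i | i <- enum 'I_n] = seg o (n * c).
Proof.
move=> FE; rewrite (eq_map FE) (map_comp (fun i => seg (o + i * c) c) val) val_enum_ord {F FE}.
elim: n => [|n IH] //; rewrite -addn1 iotaD map_cat flatten_cat IH /= cats0 add0n seg_cat.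
by rewrite addn1 mulSn addnC.
Qed.

Lemma seg_map n o (f : 'I_n -> nat) : (forall i : 'I_n, f i = e (o + i)) ->
  [seq f i | i <- enum 'I_n] = seg o n.
Proof.
move=> fE; rewrite (eq_map fE) (map_comp (fun i => e (o + i)) val) val_enum_ord.
by rewrite /seg -[in RHS](addn0 o) iotaDl -map_comp.
Qed.

Definition rat_at o : rat := ((-1) ^+ e o * (e (o + 1))%:R / (e (o + 2))%:R)%R.

Lemma rat_at_neg o : e o <= 1 -> (e o == 1 -> 0 < e (o + 1)) -> 0 < e (o + 2) ->
  (rat_at o < 0)%R = (e o == 1).
Proof.
move=> s1 s0 d0; have d0' : (0 < (e (o + 2))%:R^-1 :> rat)%R by rewrite invr_gt0 ltr0n.
rewrite /rat_at pmulr_llt0 //; case: (e o) s1 s0 => [|[|]] // _ s0.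
  by rewrite expr0 mul1r ltNge ler0n.
by rewrite expr1 mulN1r oppr_lt0 ltr0n s0.
Qed.

Lemma rat_at_norm o : `|rat_at o|%R = ((e (o + 1))%:R / (e (o + 2))%:R)%R.
Proof. by rewrite !normrM normrX normrN1 expr1n mul1r normfV !normr_nat. Qed.

Lemma rat_at_entries o : e o <= 1 -> (e o == 1 -> 0 < e (o + 1)) -> 0 < e (o + 2) ->
  coprime (e (o + 1)) (e (o + 2)) -> rat_entries (rat_at o) = seg o 3.
Proof.
move=> s1 s0 d0 co; rewrite /seg /= -(addn2 o) -(addn1 o) /rat_entries rat_at_neg //.
pose z : int := ((-1) ^+ e o * (e (o + 1))%:Z)%R.
have zE : absz z = e (o + 1) by rewrite abszMsign.
have rE : rat_at o = (z%:~R / ((e (o + 2))%:Z)%:~R)%R.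
  by rewrite /rat_at /z rmorphM rmorphXn rmorphN1.
have coz : coprime (absz z) (absz (Posz (e (o + 2)))) by rewrite zE.
have d1 : (Posz (e (o + 2)) == 0%R) = false by apply/negbTE; rewrite -lt0n.
rewrite rE coprimeq_num // coprimeq_den // d1 abszM zE absz_sg d1 mul1n.
by case: (e o) s1 => [|[|]].
Qed.

End Segments.

Section Sound.
Context (R : realType) (v : view) (e : nat -> nat) (cap : nat).
Hypothesis fv : faithful v e cap.
Hypothesis capn : nent v < cap.
Hypothesis cv : core v.

Let smE j : sm v j = minn cap (e j). Proof. by case: fv. Qed.

Lemma exact_val j : sm v j < cap -> e j = sm v j.
Proof. by rewrite smE => h; lia. Qed.

Let fmt : fmt_ok v. Proof. by case/and4P: cv. Qed.
Let n0 : 0 < vn v. Proof. by case/and5P: fmt. Qed.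
Let a0 : 0 < va v. Proof. by case/and5P: fmt. Qed.
Let nentE : nent v = bndo v + 3. Proof. by case/and5P: fmt => _ _ /eqP. Qed.
Let ns_le : vns v <= vm v. Proof. by case/and5P: fmt. Qed.
Let code_le : vcode v <= 3. Proof. by case/and5P: fmt => _ _ _ _ /and3P[]. Qed.

Let base_le : base2 v <= base3 v.
Proof. by rewrite /base3; lia. Qed.

Let bndo_ge : base3 v < bndo v.
Proof. by rewrite /bndo; case: ifP; lia. Qed.

Let n_lt : vn v < cap.
Proof.
apply: leq_ltn_trans capn; rewrite nentE; apply: (@leq_trans (base2 v)); last lia.
by rewrite /base2; nia.
Qed.

Let a_lt : va v < cap.
Proof.
apply: leq_ltn_trans capn; rewrite nentE; apply: (@leq_trans (base2 v)); last lia.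
have : va v <= vn v * va v * vn v by rewrite mulnAC leq_pmull // muln_gt0 n0.
by rewrite /base2; move: (_ * _ * _) => x; lia.
Qed.

Let m_lt : vm v < cap.
Proof.
apply: leq_ltn_trans capn; rewrite nentE; apply: (@leq_trans (base3 v)); last lia.
by rewrite /base3; nia.
Qed.

Let cap3 : 3 < cap.
Proof. by apply: leq_ltn_trans capn; rewrite nentE; lia. Qed.

Let termP i : i < vm v -> [/\ vsrc v i < vn v, vsch v i < vns v &
  forall t, t < vn v -> sm v (blk v i + 5 + t) <= 1].
Proof.
move=> lt; have /and5P[_ _ _ _ /and3P[_ /allP H _]] := fmt.
have := H i; rewrite mem_iota lt => /(_ isT) /and3P[h1 h2 /allP h3]; split=> // t tn.
by apply: h3; rewrite mem_iota.
Qed.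

Lemma rat_okP o : rat_ok v o -> [/\ rat_entries (rat_at e o) = seg e o 3,
  (Rv v o)%:R%R = ((Dv v)%:R * `|rat_at e o|)%R, (sm v o == 1) = (rat_at e o < 0)%R & e o = sm v o].
Proof.
rewrite (rat_okE o fv) => /and5P[s1 s0 d0 /eqP bez /eqP sc].
have eo : e o = sm v o by apply: exact_val; apply: leq_ltn_trans s1 _; lia.
rewrite -eo in s1 s0; have {}s0 : e o == 1 -> 0 < e (o + 1) by exact/implyP.
split=> //; last by rewrite -eo rat_at_neg.
- apply: rat_at_entries => //; rewrite /coprime -dvdn1.
  rewrite -(dvdn_addr (m := Uv v o * e (o + 1))) ?dvdn_mull ?dvdn_gcdl //.
  by rewrite -bez dvdn_mull // dvdn_gcdr.
- rewrite rat_at_norm mulrA -natrM -sc natrM mulfK // pnatr_eq0 -lt0n //.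
Qed.

Let rats : rats_ok v. Proof. by case/and4P: cv. Qed.

Let D0 : 0 < Dv v.
Proof. by case/and5P: rats => _ _ _ _; rewrite nzE. Qed.

Let D0' : (0 < (Dv v)%:R :> rat)%R. Proof. by rewrite ltr0n. Qed.

Let trP (s t : 'I_(vn v)) (b : 'I_(va v)) : rat_ok v (tro v s b t) /\ (0 <= rat_at e (tro v s b t))%R.
Proof.
case/and5P: rats; rewrite all_ord => /forallP /(_ s); rewrite all_ord => /forallP /(_ b).
rewrite all_ord => /forallP /(_ t) /andP[ok /eqP s0] _ _ _ _; split=> //.
by have [_ _ sn _] := rat_okP ok; rewrite leNgt -sn s0.
Qed.

Let tr (s : 'I_(vn v)) (b : 'I_(va v)) (t : 'I_(vn v)) : rat := rat_at e (tro v s b t).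

Let trR (s : 'I_(vn v)) (b : 'I_(va v)) (t : 'I_(vn v)) : (Rv v (tro v s b t))%:R%R = ((Dv v)%:R * tr s b t)%R.
Proof.
have [ok ge] := trP s t b; have [_ -> _ _] := rat_okP ok.
by rewrite ger0_norm.
Qed.

Let trE (s : 'I_(vn v)) (b : 'I_(va v)) : tr_en v s b = (\sum_t tr s b t == 1)%R.
Proof.
rewrite tr_enE big_mkord -(eqr_nat rat) natr_sum; under eq_bigr do rewrite trR.
rewrite -mulr_sumr -[X in (_ == X)%R]mulr1.
by rewrite (inj_eq (mulfI _)) // gt_eqF.
Qed.

Let tr_sum s b : (\sum_t tr s b t = 1)%R \/ forall t, tr s b t = 0%R.
Proof.
case/and4P: cv => _ _; rewrite /tr_ok all_ord => /forallP /(_ s) /andP[_].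
rewrite all_ord => /forallP /(_ b) /orP[|]; first by rewrite trE => /eqP; left.
rewrite all_ord => /forallP H _; right=> t; have := H t; rewrite tr_posE -leqNgt leqn0.
move=> /eqP e0; have := trR s b t; rewrite e0 => /esym/eqP.
by rewrite mulf_eq0 (gt_eqF D0') /= => /eqP.
Qed.

Let tr_ge0 s b t : (0 <= tr s b t)%R. Proof. by have [] := trP s t b. Qed.

Let tr_le1 s b t : (tr s b t <= 1)%R.
Proof.
have [<-|->] := tr_sum s b; last by [].
by rewrite (bigD1 t) //= lerDl; apply: sumr_ge0.
Qed.

Let some_state : exists s : 'I_(vn v), true. Proof. by exists (Ordinal n0). Qed.

Let some_action s : exists b, (\sum_t tr s b t == 1)%R.
Proof.
case/and4P: cv => _ _; rewrite /tr_ok all_ord => /forallP /(_ s) /andP[+ _] _.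
by rewrite has_ord => /existsP[b h]; exists b; rewrite -trE.
Qed.

Let tr_01 s b : (\sum_t tr s b t != 1 -> \sum_t tr s b t = 0)%R.
Proof. by have [->|h] := tr_sum s b; [rewrite eqxx|move=> _; rewrite big1]. Qed.

Let mod : mdp 'I_(vn v) 'I_(va v) := MDP tr_ge0 tr_le1 some_state some_action tr_01.

Let src (i : 'I_(vm v)) : 'I_(vn v).
Proof. by apply: (@Ordinal _ (vsrc v i)); case: (termP (ltn_ord i)). Defined.

Let sch (i : 'I_(vm v)) : 'I_(vns v).
Proof. by apply: (@Ordinal _ (vsch v i)); case: (termP (ltn_ord i)). Defined.

Let sch_surj j : exists i, sch i = j.
Proof.
have /and5P[_ _ _ _ /and3P[_ _]] := fmt; rewrite all_ord => /forallP /(_ j).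
by rewrite has_ord => /existsP[i /eqP h]; exists i; apply: val_inj.
Qed.

Let coefP (i : 'I_(vm v)) : rat_ok v (blk v i).
Proof. by case/and5P: rats => _; rewrite all_ord => /forallP /(_ i). Qed.

Let bndP : rat_ok v (bndo v). Proof. by case/and5P: rats. Qed.

Let codeE : e (base3 v) = vcode v. Proof. by apply: exact_val; exact: leq_ltn_trans code_le cap3. Qed.

Let cmpP : exists c, [/\ cmp_code c = vcode v,
  comparison_entries c = seg e (base3 v) (bndo v - base3 v) &
  1 < vcode v -> (Rv v (epso v))%:R%R = ((Dv v)%:R * cmp_eps c)%R].
Proof.
have epsP : 1 < vcode v -> [/\ (0 <= rat_at e (epso v))%R,
    rat_entries (rat_at e (epso v)) = seg e (epso v) 3 &
    (Rv v (epso v))%:R%R = ((Dv v)%:R * rat_at e (epso v))%R].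
  move=> c1; case/and5P: rats => _ _ /implyP /(_ c1) /andP[/rat_okP[h1 h2 h3 _] /eqP s0] _ _.
  have ge : (0 <= rat_at e (epso v))%R by rewrite leNgt -h3 s0.
  by split=> //; rewrite h2 ger0_norm.
have segS c : seg e (base3 v) c.+1 = vcode v :: seg e (epso v) c by rewrite /seg /= codeE /epso addn1.
rewrite /bndo; case c : (vcode v) epsP => [|[|[|[|k]]]] epsP /=.
- by exists Greater; rewrite addKn segS c.
- by exists GreaterEq; rewrite addKn segS c.
- by have [// |h1 h2 h3] := epsP; exists (Approx h1); rewrite addKn segS c /= h2.
- by have [// |h1 h2 h3] := epsP; exists (NotApprox h1); rewrite addKn segS c /= h2.
- by have := code_le; rewrite c.
Qed.

(** The instance is assembled from the numbers, the checks supplying the proofs that its records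
    require; its entries are then recomputed and found to be the numbers read. *)
Theorem core_sound : exists J, relbuechi_entries J = mkseq e (nent v) /\ relbuechi_holds R J.
Proof.
have [c [cE ceE epsE]] := cmpP.
pose J := @RelBuechiInstance (vn v) (va v) mod (vm v) (vns v) (fun i => rat_at e (blk v i)) src sch
  sch_surj (fun i => finset (fun t : 'I_(vn v) => vtgt v i t)) c (rat_at e (bndo v)).
have lk : linked J v.
  have [_ b2 b3 _] := rat_okP bndP.
  split=> //=; first by case: fv.
  - by move=> i; have [_ h _ _] := rat_okP (coefP i).
  - by move=> i; have [_ _ h _] := rat_okP (coefP i).
  - by move=> i t; rewrite inE.
exists J; split; last by apply: (signed_holds R lk); case/and4P: cv.
rewrite /mkseq nentE -/(seg e 0 (bndo v + 3)) /relbuechi_entries /mdp_entries /=.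
have e0 : e 0 = vn v by exact: exact_val.
have e1 : e 1 = va v by exact: exact_val.
have e2 : e (base2 v) = vm v by exact: exact_val.
have e3 : e (base2 v).+1 = vns v by apply: exact_val; apply: leq_ltn_trans ns_le m_lt.
rewrite (@seg_flatten e (vn v) (va v * (vn v * 3)) 2); last first.
  move=> s; apply: seg_flatten => b.
  rewrite (@seg_flatten e (vn v) 3 (2 + 3 * ((s * va v + b) * vn v))).
    by congr seg; nia.
  move=> t; have [ok _] := trP s t b; have [-> _ _ _] := rat_okP ok.
  by congr seg; rewrite /tro; nia.
rewrite (@seg_flatten e (vm v) (5 + vn v) (base2 v + 2)); last first.
  move=> i; have [h _ _ _] := rat_okP (coefP i).
  rewrite -[LHS]/(rat_entries (rat_at e (blk v i)) ++ [:: vsrc v i; vsch v i] ++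
    [seq nat_of_bool (s \in finset (fun t : 'I_(vn v) => vtgt v i t)) | s <- enum 'I_(vn v)]) h.
  have [s1 s2 s3] := termP (ltn_ord i).
  rewrite (@seg_map e (vn v) (blk v i + 5)); last first.
    move=> t; rewrite inE /vtgt; have := s3 t (ltn_ord t) => le.
    have := exact_val (leq_ltn_trans le (ltnW (ltnW cap3))) => ->.
    by case: (sm v _) le => [|[|]].
  have -> : [:: vsrc v i; vsch v i] = seg e (blk v i + 3) 2.
    rewrite /seg /= -addnS; congr [:: _; _].
      by rewrite (exact_val (j := blk v i + 3)) //; exact: ltn_trans s1 n_lt.
    rewrite (exact_val (j := blk v i + 4)) //; apply: ltn_trans s2 _.
    exact: leq_ltn_trans ns_le m_lt.
  by rewrite catA seg_cat; exact: (seg_cat e (blk v i) 5 (vn v)).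
have [h _ _ _] := rat_okP bndP; rewrite -/(rat_entries (rat_at e (bndo v))) h ceE.
have segE o d o' d' : o' = o + d -> seg e o d ++ seg e o' d' = seg e o (d + d').
  by move=> ->; exact: seg_cat.
set L := vn v * (va v * (vn v * 3)); rewrite -[LHS]/([:: vn v; va v] ++ seg e 2 L ++ [:: vm v; vns v] ++
  seg e (base2 v + 2) (vm v * (5 + vn v)) ++ seg e (base3 v) (bndo v - base3 v) ++ seg e (bndo v) 3).
have -> : [:: vn v; va v] = seg e 0 2 by rewrite /seg /= e0 e1.
have -> : [:: vm v; vns v] = seg e (base2 v) 2 by rewrite /seg /= e2 e3.
have LE : base2 v = 2 + L by rewrite /base2 /L; nia.
do 5 (rewrite segE; last by move: bndo_ge; rewrite /base3 ?LE; lia).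
by congr seg; move: bndo_ge; rewrite /base3 LE; lia.
Qed.

End Sound.

End Soundness.

Import Soundness.

(** * Positions of the entries of an instance *)

Module Layout.

Local Open Scope nat_scope.

Lemma size_flatten_ord n c (F : 'I_n -> seq nat) : (forall i, size (F i) = c) ->
  size (flatten [seq F i | i <- enum 'I_n]) = n * c.
Proof.
move=> sF; rewrite size_flatten sumnE /shape -map_comp big_map.
under eq_bigr do rewrite /= sF.
by rewrite big_const_seq count_predT size_enum_ord iter_addn_0 mulnC.
Qed.

Lemma nth_flatten_ord n c (F : 'I_n -> seq nat) (i : 'I_n) r : (forall i, size (F i) = c) ->
  r < c -> nth 0 (flatten [seq F i | i <- enum 'I_n]) (i * c + r) = nth 0 (F i) r.
Proof.
move=> sF rc.
have H (l : seq 'I_n) k : k < size l ->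
    nth 0 (flatten [seq F i | i <- l]) (k * c + r) = nth 0 (F (nth i l k)) r.
  elim: l k => // j l IH [|k] /= lt; rewrite nth_cat sF.
    by rewrite mul0n add0n rc.
  by rewrite mulSn -addnA ltnNge leq_addr /= addKn IH.
by rewrite H ?size_enum_ord // nth_ord_enum.
Qed.

Section Layout.
Variable J : relbuechi_instance.
Notation n := (nstates J).
Notation a := (nactions J).
Notation m := (nterms J).
Notation e := (nth 0 (relbuechi_entries J)).

Definition jbase2 := 2 + 3 * (n * a * n).
Definition jtro s b t := 2 + 3 * ((s * a + b) * n + t).
Definition jblk i := jbase2 + 2 + i * (5 + n).
Definition jbase3 := jbase2 + 2 + m * (5 + n).
Definition jbndo := if cmp_code (cmp J) < 2 then jbase3 + 1 else jbase3 + 4.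

Let size_tr (s : 'I_n) (b : 'I_a) :
  size (flatten [seq rat_entries (trans (model J) s b t) | t <- enum 'I_n]) = n * 3.
Proof. exact: size_flatten_ord. Qed.

Let size_act (s : 'I_n) : size (flatten [seq flatten [seq rat_entries (trans (model J) s b t)
  | t <- enum 'I_n] | b <- enum 'I_a]) = a * (n * 3).
Proof. by apply: size_flatten_ord => b; exact: size_tr. Qed.

Lemma size_mdp_entries : size (mdp_entries (model J)) = jbase2.
Proof. by rewrite /= (@size_flatten_ord _ (a * (n * 3))) // /jbase2; nia. Qed.

Definition term_entries (i : 'I_m) := rat_entries (coef i) ++ [:: val (source i); val (sched_index i)]
  ++ [seq nat_of_bool (s \in target i) | s <- enum 'I_n].

Let size_term i : size (term_entries i) = 5 + n.
Proof. by rewrite /= size_map size_enum_ord. Qed.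

Let size_terms : size (flatten [seq term_entries i | i <- enum 'I_m]) = m * (5 + n).
Proof. exact: size_flatten_ord. Qed.

Let size_cmp : jbase3 + size (comparison_entries (cmp J)) = jbndo.
Proof. by rewrite /jbndo; case: (cmp J) => //=; rewrite ?addn1. Qed.

Lemma layout_size : size (relbuechi_entries J) = jbndo + 3.
Proof.
rewrite /relbuechi_entries size_cat size_mdp_entries size_cat size_cat size_terms size_cat.
by rewrite -size_cmp /jbase3 [size [:: _; _]]/= [size (rat_entries _)]/= !addnA.
Qed.

Lemma layout_n : e 0 = n. Proof. by []. Qed.
Lemma layout_a : e 1 = a. Proof. by []. Qed.

Lemma layout_trans (s : 'I_n) (b : 'I_a) (t : 'I_n) r : r < 3 ->
  e (jtro s b t + r) = nth 0 (rat_entries (trans (model J) s b t)) r.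
Proof.
move=> r3; have n0 := ltn_ord s; have bl := ltn_ord b; have sl := ltn_ord s; have tl := ltn_ord t.
rewrite /relbuechi_entries nth_cat size_mdp_entries.
have t1 : t * 3 + r < n * 3 by lia.
have t2 : b * (n * 3) + (t * 3 + r) < a * (n * 3) by nia.
have t3 : s * (a * (n * 3)) + (b * (n * 3) + (t * 3 + r)) < n * (a * (n * 3)) by nia.
have E : jtro s b t + r = (s * (a * (n * 3)) + (b * (n * 3) + (t * 3 + r))).+2.
  by rewrite /jtro; nia.
have -> : jtro s b t + r < jbase2 by rewrite E /jbase2; nia.
rewrite E /= (@nth_flatten_ord _ (a * (n * 3))) // (@nth_flatten_ord _ (n * 3)) //.
by rewrite (@nth_flatten_ord _ 3).
Qed.

Let e_shift k : e (jbase2 + k) = nth 0 ([:: m; nscheds J] ++ flatten [seq term_entries i | i <- enum 'I_m]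
  ++ comparison_entries (cmp J) ++ rat_entries (bound J)) k.
Proof. by rewrite /relbuechi_entries nth_cat size_mdp_entries ltnNge leq_addr /= addKn. Qed.

Lemma layout_m : e jbase2 = m. Proof. by rewrite -[jbase2]addn0 e_shift. Qed.
Lemma layout_ns : e jbase2.+1 = nscheds J. Proof. by rewrite -addn1 e_shift. Qed.

Lemma layout_term (i : 'I_m) r : r < 5 + n -> e (jblk i + r) = nth 0 (term_entries i) r.
Proof.
move=> lt; have -> : jblk i + r = jbase2 + (2 + i * (5 + n) + r) by rewrite /jblk !addnA.
rewrite e_shift nth_cat /=.
have -> : 2 + i * (5 + n) + r - 2 = i * (5 + n) + r by lia.
rewrite nth_cat size_terms ifT; last by have := ltn_ord i; nia.
by rewrite (@nth_flatten_ord _ (5 + n)).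
Qed.

Lemma layout_coef (i : 'I_m) r : r < 3 -> e (jblk i + r) = nth 0 (rat_entries (coef i)) r.
Proof. by move=> r3; rewrite layout_term; [case: r r3 => [|[|[|]]]|lia]. Qed.

Lemma layout_source (i : 'I_m) : e (jblk i + 3) = source i.
Proof. by rewrite layout_term //; lia. Qed.

Lemma layout_sched (i : 'I_m) : e (jblk i + 4) = sched_index i.
Proof. by rewrite layout_term //; lia. Qed.

Lemma layout_target (i : 'I_m) (t : 'I_n) : e (jblk i + 5 + t) = (t \in target i).
Proof.
rewrite -addnA layout_term; last by have := ltn_ord t; lia.
rewrite -[LHS]/(nth 0 [seq nat_of_bool (s \in target i) | s <- enum 'I_n] t).
by rewrite (nth_map t) ?size_enum_ord // (nth_ord_enum t t).
Qed.

Let e_shift3 k : e (jbase3 + k) = nth 0 (comparison_entries (cmp J) ++ rat_entries (bound J)) k.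
Proof.
have -> : jbase3 + k = jbase2 + (2 + (m * (5 + n) + k)) by rewrite /jbase3 !addnA.
rewrite e_shift nth_cat /=.
by rewrite addKn nth_cat size_terms ltnNge leq_addr /= addKn.
Qed.

Lemma layout_code : e jbase3 = cmp_code (cmp J).
Proof. by rewrite -[jbase3]addn0 e_shift3; case: (cmp J). Qed.

Lemma layout_eps r : r < 3 -> 1 < cmp_code (cmp J) ->
  e (jbase3 + 1 + r) = nth 0 (rat_entries (cmp_eps (cmp J))) r.
Proof.
by move=> r3; rewrite -addnA e_shift3; case: (cmp J) => //= eps _ _; case: r r3 => [|[|[|]]].
Qed.

Lemma layout_bound r : r < 3 -> e (jbndo + r) = nth 0 (rat_entries (bound J)) r.
Proof.
by move=> r3; rewrite -size_cmp -addnA e_shift3 nth_cat ltnNge leq_addr /= addKn.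
Qed.

Lemma nscheds_le : nscheds J <= m.
Proof.
have /choice[f fP] := @sched_index_surj J.
have : injective f by move=> j j' /(congr1 (@sched_index J)); rewrite !fP.
by move=> /leq_card; rewrite !card_ord.
Qed.

Lemma nstates_gt0 : 0 < n.
Proof. by have [s _] := states_nonempty (model J); exact: leq_ltn_trans (ltn_ord s). Qed.

Lemma nactions_gt0 : 0 < a.
Proof.
have [s _] := states_nonempty (model J); have [b _] := actions_enabled (model J) s.
exact: leq_ltn_trans (ltn_ord b).
Qed.

End Layout.

End Layout.

Import Layout.

(** * From a yes-instance to an accepted certificate *)

Module Completeness.

Local Open Scope nat_scope.

Lemma fact_le_expn n : n`! <= n ^ n.
Proof.
rewrite fact_prod -[X in _ <= X ^ _](card_ord n) -[X in _ <= _ ^ X](card_ord n).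
rewrite card_ord -{3}[n](card_ord n) -prod_nat_const big_add1 /= big_mkord.
by apply: leq_prod => i _; exact: ltn_ord.
Qed.

(** The left side is the bit length of the scaled values: [Z] is at most [2 ^ (2 * L ^ 4)], and the
    total weight of the terms contributes at most [2 ^ (3 * L)]. *)
Lemma radix_big L : 2 * L ^ 4 + 3 * L < radix L.
Proof.
rewrite /radix; set q := L + 30.
have h1 : L ^ 4 <= q ^ 4 by rewrite leq_exp2r // leq_addr.
have q1 : 0 < q ^ 3 by rewrite expn_gt0 /q addn_gt0 orbT.
have h2 : L <= q ^ 4.
  by rewrite expnS; apply: leq_trans (leq_addr 30 L) _; rewrite leq_pmulr.
have h3 : 30 * q ^ 4 <= q ^ 5 by rewrite [q ^ 5]expnS leq_mul2r leq_addl orbT.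
have h4 : 0 < q ^ 4 by rewrite expn_gt0 /q addn_gt0 orbT.
by move: h1 h2 h3 h4; move: (L ^ 4) (q ^ 4) (q ^ 5) => x y z; lia.
Qed.

Lemma radix_sq L : L ^ 2 < radix L /\ 4 * L + 30 < radix L.
Proof.
rewrite /radix; set q := L + 30.
have q30 : 30 <= q by rewrite leq_addl.
have h1 : L ^ 2 <= q ^ 2 by rewrite leq_exp2r // leq_addr.
have h2 : q ^ 2 * 30 <= q ^ 5.
  have -> : q ^ 5 = q ^ 2 * q ^ 3 by rewrite -expnD.
  rewrite leq_mul2l; apply/orP; right.
  by apply: leq_trans q30 _; rewrite -{1}[q]expn1 leq_exp2l //; lia.
have h3 : q * 30 <= q ^ 2 by rewrite -mulnn leq_mul2l q30 orbT.
by move: h1 h2 h3; rewrite /q; move: (L ^ 2) (q ^ 2) (q ^ 5) => x y z; lia.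
Qed.

Record witness := Witness {
  wpol : nat -> nat -> nat;
  wrk : nat -> nat -> nat;
  wB : nat -> nat -> nat -> nat -> bool;
  wrf : nat -> nat -> nat -> nat;
  wrb : nat -> nat -> nat -> nat;
  wZ : nat;
  wX : nat -> nat -> nat }.

Section Complete.
Context (R : realType) (J : relbuechi_instance).
Variables (sm0 : nat -> nat) (bt0 : nat -> nat -> bool) (L cap : nat).
Notation ns := (relbuechi_entries J).
Notation e := (nth 0 ns).
Notation N := (radix L).
Definition vw T := View sm0 bt0 T N (size ns).

Hypothesis fv : forall T, faithful (vw T) e cap.
Hypothesis cap_gt : size ns < cap.
Hypothesis len_le : size ns <= L.
Hypothesis e_lt : forall j, e j < 2 ^ L.

(** The product runs over all entries, not only the denominators: any common multiple of these
    works, and the product is still at most 2 to the length of the word. *)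
Definition common_den := \prod_(0 <= j < size ns) maxn 1 (e j).
Notation D := common_den.
Hypothesis D_le : D <= 2 ^ L.

(** Set to 0 beyond the side [N] of the table, which has no such rows. *)
Definition scaled o := if o < N then D * e (o + 1) %/ e (o + 2) else 0.
Definition bez1 o := if o < N then (egcdn (e (o + 2)) (e (o + 1))).2 else 0.
Definition bez2 o := if o < N then (egcdn (e (o + 2)) (e (o + 1))).1 else 0.

Definition table (W : bool -> witness) tag i1 i2 i3 i4 : bool :=
  [&& i1 < N, i2 < N, i3 < N & i4 < N] && (tag < 30) &&
  let bit z := odd (z %/ 2 ^ i4) in
  let u := W ((tag - 4) %/ 10 == 1) in
  if tag < 4 then nth false [:: bit D; bit (scaled i1); bit (bez1 i1); bit (bez2 i1)] tag
  else nth false [:: bit (wZ u); bit (wX u i1 i2); i4 < wpol u i1 i2; i4 < wrk u i1 i2;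
    wB u i1 i2 i3 i4; i4 < wrf u i1 i2 i3; i4 < wrb u i1 i2 i3] ((tag - 4) %% 10).

Let N0 : 0 < N. Proof. by rewrite /radix expn_gt0 addn_gt0 orbT. Qed.

Lemma table_big W tag i1 i2 z : z < 2 ^ N ->
  (forall k, k < N -> table W tag i1 i2 0 k = odd (z %/ 2 ^ k)) ->
  colval N (cbig (vw (table W)) tag i1 i2) = z.
Proof.
move=> zN H; rewrite -[RHS](colval_bits zN); apply: eq_big_nat => k /andP[_ kN].
by rewrite /cbig /= kN H.
Qed.

Lemma table_row W tag i1 i2 i3 z : z <= N ->
  (forall k, k < N -> table W tag i1 i2 i3 k = (k < z)) ->
  crow (vw (table W)) tag i1 i2 i3 = z.
Proof.
move=> zN H; rewrite -[RHS](@sum_lt_const N z) //; apply: eq_big_nat => k /andP[_ kN].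
by rewrite /= H.
Qed.

Let pow_lt z : z < 2 ^ L -> z < 2 ^ N.
Proof.
move=> h; apply: leq_trans h _; rewrite leq_exp2l //.
by have [_ h] := radix_sq L; lia.
Qed.

Lemma DvE W : Dv (vw (table W)) = D.
Proof.
apply: table_big => [|k kN]; last by rewrite /table N0 kN.
have [_ h] := radix_sq L; apply: (leq_ltn_trans D_le); rewrite ltn_exp2l //; lia.
Qed.

Lemma scaled_lt o : scaled o <= 2 ^ (2 * L).
Proof.
rewrite /scaled; case: ifP => // _; apply: leq_trans (leq_div _ _) _.
by rewrite mul2n -addnn expnD leq_mul // ltnW.
Qed.

Lemma RvE W o : Rv (vw (table W)) o = scaled o.
Proof.
apply: table_big => [|k kN].
  by apply: leq_ltn_trans (scaled_lt o) _; rewrite ltn_exp2l //; have [_ h] := radix_sq L; lia.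
rewrite /table N0 kN /scaled andbT /=; case: (o < N) => //=.
by rewrite div0n.
Qed.

Lemma bezoutP W o : o < N -> 0 < e (o + 2) -> coprime (e (o + 1)) (e (o + 2)) ->
  Vv (vw (table W)) o * e (o + 2) = Uv (vw (table W)) o * e (o + 1) + 1.
Proof.
move=> oN d0 co.
have [z1 z2] : bez1 o < 2 ^ L /\ bez2 o <= 2 ^ L /\
    bez2 o * e (o + 2) = bez1 o * e (o + 1) + 1.
  rewrite /bez1 /bez2 oN; case: egcdnP => // u z eq lt /=.
  have g1 : gcdn (e (o + 2)) (e (o + 1)) = 1 by rewrite gcdnC; exact/eqP.
  rewrite g1 muln1 in lt; rewrite g1 in eq; split; first exact: ltn_trans lt (e_lt _).
  split=> //; have := e_lt (o + 1) => h; apply: leq_trans h.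
  by rewrite -(leq_pmul2r d0) eq mulSn; nia.
case: z2 => z2 eq.
have -> : Vv (vw (table W)) o = bez2 o.
  apply: table_big => [|k kN]; last by rewrite /table oN N0 kN.
  by apply: leq_ltn_trans z2 _; rewrite ltn_exp2l //; have [_ h] := radix_sq L; lia.
have -> : Uv (vw (table W)) o = bez1 o; last exact: eq.
apply: table_big => [|k kN]; [exact: pow_lt|by rewrite /table oN N0 kN].
Qed.

Lemma D_gt0 : 0 < D.
Proof. by rewrite /D big_mkord prodn_gt0 // => i; rewrite leq_max. Qed.

Lemma dvd_den j : j < size ns -> 0 < e j -> e j %| D.
Proof.
move=> lt e0; rewrite /D big_mkord (bigD1 (Ordinal lt)) //=.
by rewrite (maxn_idPr e0) dvdn_mulr.
Qed.

Let small j : e j < cap -> sm0 j = e j.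
Proof. by case: (fv (fun _ _ _ _ _ => false)) => _ /(_ j) /= -> _ _ h; lia. Qed.

Let LN : L < N. Proof. by have [_ h] := radix_sq L; lia. Qed.

Lemma rat_good W o r : o + 2 < size ns -> (forall k, k < 3 -> e (o + k) = nth 0 (rat_entries r) k) ->
  [/\ rat_ok (vw (table W)) o, (Rv (vw (table W)) o)%:R%R = (D%:R * `|r|)%R &
      sm0 o = (r < 0)%R].
Proof.
move=> lt rE; have h0 := rE 0 isT; have h1 := rE 1 isT; have h2 := rE 2 isT.
rewrite addn0 /= in h0; rewrite /= in h1 h2.
have oN : o < N by lia.
have d0 : 0 < e (o + 2) by rewrite h2 absz_gt0 denq_neq0.
have co : coprime (e (o + 1)) (e (o + 2)) by rewrite h1 h2; exact: coprime_num_den.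
have sE : sm0 o = (r < 0)%R.
  rewrite small ?h0 //; apply: leq_trans cap_gt; have : (r < 0)%R <= 1 by case: (r < 0)%R.
  lia.
have sc : scaled o * e (o + 2) = D * e (o + 1).
  by rewrite /scaled oN divnK // dvdn_mulr // dvd_den.
have d1 : ((e (o + 2))%:R != 0 :> rat)%R by rewrite pnatr_eq0 -lt0n.
split=> //.
  rewrite (rat_okE o (fv _)) /= sE d0 RvE DvE sc eqxx bezoutP // eqxx !andbT.
  rewrite h1; case: ltrP => //= r0; rewrite absz_gt0 numq_eq0.
  by rewrite lt_eqF.
rewrite RvE; apply: (mulIf d1); rewrite -natrM sc natrM -mulrA; congr (_ * _)%R.
rewrite h1 h2 -[r in `|r|%R]divq_num_den normrM normfV -!intr_norm -!abszE divfK //.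
by rewrite intr_eq0 -lt0n absz_gt0 denq_neq0.
Qed.

Let sizeE : size ns = jbndo J + 3. Proof. exact: layout_size. Qed.
Let bnd_ge : jbase3 J < jbndo J. Proof. by rewrite /jbndo; case: ifP => _; lia. Qed.
Let b32 : jbase2 J + 2 <= jbase3 J. Proof. exact: leq_addr. Qed.

Let n_le : nstates J <= jbase2 J.
Proof. by have := nactions_gt0 J; have := nstates_gt0 J; rewrite /jbase2; nia. Qed.

Let a_le : nactions J <= jbase2 J.
Proof.
have : nactions J <= nstates J * nactions J * nstates J.
  by rewrite mulnAC leq_pmull // muln_gt0 nstates_gt0.
by rewrite /jbase2; move: (_ * _ * _) => x; lia.
Qed.

Let m_le : nterms J <= jbase3 J. Proof. by rewrite /jbase3; nia. Qed.

Let lt_cap z : z <= jbase3 J -> z < cap.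
Proof. by move=> h; apply: leq_ltn_trans cap_gt; lia. Qed.

Section View.
Variable W : bool -> witness.
Notation v := (vw (table W)).

Lemma vnE : vn v = nstates J.
Proof. by rewrite /vn /= small layout_n // lt_cap //; lia. Qed.
Lemma vaE : va v = nactions J.
Proof. by rewrite /va /= small layout_a // lt_cap //; lia. Qed.
Lemma base2E : base2 v = jbase2 J. Proof. by rewrite /base2 vnE vaE. Qed.
Lemma troE s b t : tro v s b t = jtro J s b t. Proof. by rewrite /tro vnE vaE. Qed.
Lemma vmE : vm v = nterms J.
Proof. by rewrite /vm base2E /= small layout_m // lt_cap. Qed.
Lemma vnsE : vns v = nscheds J.
Proof.
rewrite /vns base2E /= small layout_ns // lt_cap //.
exact: leq_trans (nscheds_le J) m_le.
Qed.
Lemma blkE i : blk v i = jblk J i. Proof. by rewrite /blk base2E vnE. Qed.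
Lemma base3E : base3 v = jbase3 J. Proof. by rewrite /base3 base2E vmE vnE. Qed.
Lemma vcodeE : vcode v = cmp_code (cmp J).
Proof.
rewrite /vcode base3E /= small layout_code // lt_cap //.
by apply: (@leq_trans 3); [case: (cmp J)|rewrite /jbase3 /jbase2; lia].
Qed.
Lemma bndoE : bndo v = jbndo J. Proof. by rewrite /bndo vcodeE base3E. Qed.
Lemma epsoE : epso v = jbase3 J + 1. Proof. by rewrite /epso base3E. Qed.

Let blk_lt (i : 'I_(nterms J)) r : r < 5 + nstates J -> jblk J i + r < jbase3 J.
Proof. by move=> h; have := ltn_ord i; rewrite /jblk /jbase3; nia. Qed.

Lemma trans_good (s : 'I_(nstates J)) (b : 'I_(nactions J)) (t : 'I_(nstates J)) :
  [/\ rat_ok v (tro v s b t), (Rv v (tro v s b t))%:R%R = (D%:R * trans (model J) s b t)%R &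
      sm v (tro v s b t) = 0].
Proof.
have ge := trans_ge0 (model J) s b t.
have [|r r3|h1 h2 h3] := @rat_good W (jtro J s b t) (trans (model J) s b t).
- have : jtro J s b t + 2 < jbase2 J; last by lia.
  by have := ltn_ord s; have := ltn_ord b; have := ltn_ord t; rewrite /jtro /jbase2; nia.
- exact: layout_trans.
- by rewrite troE; split; rewrite ?h2 ?ger0_norm //= h3 ltNge ge.
Qed.

Lemma coef_good (i : 'I_(nterms J)) :
  [/\ rat_ok v (blk v i), (Rv v (blk v i))%:R%R = (D%:R * `|coef i|)%R &
      sm v (blk v i) = (coef i < 0)%R].
Proof.
rewrite blkE; apply: rat_good => [|r r3]; last exact: layout_coef.
by have : jblk J i + 2 < jbase3 J by [apply: blk_lt; lia]; lia.
Qed.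

Lemma bound_good : [/\ rat_ok v (bndo v), (Rv v (bndo v))%:R%R = (D%:R * `|bound J|)%R &
  sm v (bndo v) = (bound J < 0)%R].
Proof.
rewrite bndoE; apply: rat_good => [|r r3]; first by lia.
exact: layout_bound.
Qed.

Lemma eps_good : 1 < vcode v ->
  [/\ rat_ok v (epso v), (Rv v (epso v))%:R%R = (D%:R * cmp_eps (cmp J))%R & sm v (epso v) = 0].
Proof.
rewrite vcodeE => c1; have ge : (0 <= cmp_eps (cmp J))%R by case: (cmp J) c1.
have [|r r3|h1 h2 h3] := @rat_good W (jbase3 J + 1) (cmp_eps (cmp J)).
- by rewrite sizeE /jbndo ifF; [lia|rewrite ltnNge c1].
- exact: layout_eps.
- by rewrite epsoE; split; rewrite ?h2 ?ger0_norm //= h3 ltNge ge.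
Qed.

Lemma vsrcE (i : 'I_(nterms J)) : vsrc v i = source i.
Proof.
rewrite /vsrc blkE /= small layout_source // lt_cap //.
by apply: leq_trans (ltnW (ltn_ord _)) _; lia.
Qed.

Lemma vschE (i : 'I_(nterms J)) : vsch v i = sched_index i.
Proof.
rewrite /vsch blkE /= small layout_sched // lt_cap //.
by apply: leq_trans (ltnW (ltn_ord _)) _; exact: leq_trans (nscheds_le J) m_le.
Qed.

Lemma sm_target (i : 'I_(nterms J)) (t : 'I_(nstates J)) :
  sm v (blk v i + 5 + t) = (t \in target i).
Proof.
rewrite blkE /= small layout_target // lt_cap //.
by apply: (@leq_trans 1); [case: (_ \in _)|lia].
Qed.

Lemma view_linked : linked J v.
Proof.
have [b1 b2 b3] := bound_good.
split; rewrite ?DvE //.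
- exact: vnE.
- exact: vaE.
- exact: vmE.
- exact: vnsE.
- exact: D_gt0.
- by move=> s b t; have [_ ->] := trans_good s b t.
- by move=> i; have [_ ->] := coef_good i.
- by move=> i; have [_ _ ->] := coef_good i; case: (_ < _)%R.
- exact: vsrcE.
- exact: vschE.
- by move=> i t; rewrite /vtgt sm_target; case: (_ \in _).
- exact: vcodeE.
- by move=> c1; have [_ ->] := eps_good c1.
- by rewrite b3; case: (_ < _)%R.
Qed.

Lemma view_fmt : fmt_ok v.
Proof.
rewrite /fmt_ok vnE vaE vmE vnsE nstates_gt0 nactions_gt0 bndoE -sizeE eqxx nscheds_le vcodeE.
do ?[apply/andP; split=> //].
- by case: (cmp J) => *.
- rewrite all_ord; apply/forallP => i.
  rewrite /term_ok vsrcE vschE vnE vnsE !ltn_ord /= all_ord; apply/forallP => t.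
  by rewrite [sm0 _]sm_target; case: (_ \in _).
- rewrite all_ord; apply/forallP => j; rewrite has_ord.
  by have [i ij] := sched_index_surj j; apply/existsP; exists i; rewrite vschE ij.
Qed.

Lemma view_rats : rats_ok v.
Proof.
rewrite /rats_ok vnE vaE vmE nzE [colval _ _](DvE W) D_gt0 andbT; apply/and4P; split.
- rewrite all_ord; apply/forallP => s; rewrite all_ord; apply/forallP => b.
  rewrite all_ord; apply/forallP => t.
  by have [h1 _ h2] := trans_good s b t; rewrite /trans_rat_ok h1 h2.
- by rewrite all_ord; apply/forallP => i; have [] := coef_good i.
- by apply/implyP => /eps_good[h1 _ h2]; rewrite h1 h2.
- by have [] := bound_good.
Qed.

Lemma view_tr : tr_ok v.
Proof.
have lk := view_linked.
have enE (s : 'I_(nstates J)) (b : 'I_(nactions J)) : tr_en v s b = enabled (model J) s b.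
  rewrite -(@enabledE J (Dv v) (fun s b t => Rv v (tro v s b t)) (link_D lk) (link_trans lk)) tr_enE /enabled_test.
  by rewrite (link_n lk).
rewrite /tr_ok vnE vaE all_ord; apply/forallP => s; apply/andP; split.
  rewrite has_ord; have [b en] := actions_enabled (model J) s.
  by apply/existsP; exists b; rewrite enE.
rewrite all_ord; apply/forallP => b; rewrite enE; case: (boolP (enabled _ _ _)) => //= nen.
rewrite all_ord; apply/forallP => t; rewrite tr_posE -leqNgt leqn0 -(eqr_nat rat).
rewrite (link_trans lk) mulf_eq0; apply/orP; right; apply/eqP.
have := trans_01 nen => /psumr_eq0P; apply=> // i _; exact: trans_ge0.
Qed.

End View.

Definition witness0 := Witness (fun _ _ => 0) (fun _ _ => 0) (fun _ _ _ _ => false)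
  (fun _ _ _ => 0) (fun _ _ _ => 0) 0 (fun _ _ => 0).

Theorem core_complete : relbuechi_holds R J -> exists W, core (vw (table W)).
Proof.
move=> H.
(* The common denominator and the scaled entries do not depend on the witness, so the trivial one
   gives a view relative to which the true witness is chosen. *)
pose v0 := vw (table (fun=> witness0)); have lk0 : linked J v0 := view_linked _.
pose good (sg : bool) (u : witness) := [/\ supported J (wpol u) (wrk u) (wB u) (wrf u) (wrb u) (wX u),
  [/\ 0 < wZ u < 2 ^ N, forall g t, wX u g t < 2 ^ N, forall g t, wpol u g t <= N /\ wrk u g t <= N &
   forall g r t, wrf u g r t <= N /\ wrb u g r t <= N],
  cert_ok J (Dv v0) (fun s b t => Rv v0 (tro v0 s b t)) (fun i => Rv v0 (blk v0 i)) (vng v0 sg)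
        (vsrc v0) (vsch v0) (vtgt v0) (wpol u) (wrk u) (wB u) (wrf u) (wrb u) (wZ u) (wX u) &
      final_test J (fun i => Rv v0 (blk v0 i)) (vng v0 sg) (cmp_strict (cmp_code (cmp J)))
        (P1v v0 sg) (P2v v0 sg) (wZ u) (wX u)].
have /choice[W WP] : forall sg, exists u, goal R J sg -> good sg u.
  move=> sg; have [g|ng] := pselect (goal R J sg); last by exists witness0.
  have [pol [rk [B [rf [rb [Z [X [sup [Z1 X1 p1 r1 /andP[ok fin]]]]]]]]]] :=
    @attains_cert R J sg (Dv v0) (fun s b t => Rv v0 (tro v0 s b t)) (fun i => Rv v0 (blk v0 i)) (vng v0 sg)
    (vsrc v0) (vsch v0) (vtgt v0) (link_D lk0) (link_trans lk0) (link_coef lk0) (@link_neg J v0 lk0 sg) (link_source lk0) (link_sched lk0)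
    (link_target lk0) _ _ _ _ (link_goal_bound lk0 sg) g.
  exists (Witness pol rk B rf rb Z X) => _; split=> //=.
  have nL : nstates J <= L by lia.
  have aL : nactions J <= L by lia.
  have mL : nterms J <= L by lia.
  have sL : nscheds J <= L by exact: leq_trans (nscheds_le J) mL.
  have L2 : L < 2 ^ L by exact: ltn_expl.
  (* The factorial of the number of states and the power of [D] are both at most [2 ^ (L * L)], and
     there are at most [L * L] groups. *)
  have Z2 : Z <= 2 ^ (2 * L ^ 4).
    case/andP: Z1 => _ h; apply: leq_trans h _; rewrite DvE.
    apply: (@leq_trans ((2 ^ (L * L) * 2 ^ (L * L)) ^ (L * L))); last first.
      rewrite -expnD -expnM leq_exp2l // addnn -mul2n -mulnA (_ : L ^ 4 = L * L * (L * L)) //.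
      by rewrite !mulnn -expnM.
    have h1 : (nstates J)`! <= 2 ^ (L * L).
      apply: leq_trans (fact_le_expn _) _; apply: (@leq_trans (L ^ nstates J)).
        by case: (nstates J) nL => // k kL; rewrite leq_exp2r.
      have L0 : 0 < L by have := nstates_gt0 J; lia.
      apply: (@leq_trans (L ^ L)); first by rewrite leq_pexp2l.
      by rewrite expnM; case: (L) L0 L2 => // k _ h; rewrite leq_exp2r // ltnW.
    have h2 : D ^ nstates J <= 2 ^ (L * L).
      apply: (@leq_trans ((2 ^ L) ^ nstates J)).
        by case: (nstates J) => // k; rewrite leq_exp2r.
      by rewrite -expnM leq_exp2l // leq_mul2l nL orbT.
    apply: (@leq_trans ((2 ^ (L * L) * 2 ^ (L * L)) ^ (nscheds J * nstates J))).
      case: (nscheds J * nstates J) => // k; rewrite leq_exp2r //; exact: leq_mul.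
    by rewrite leq_pexp2l ?leq_mul // muln_gt0 expn_gt0.
  have Nb := radix_big L.
  have Ls : L * L < N by have [h _] := radix_sq L; rewrite mulnn.
  split.
  - case/andP: Z1 => -> _ /=; apply: leq_ltn_trans Z2 _; rewrite ltn_exp2l //; lia.
  - move=> g' t; apply: leq_ltn_trans (X1 g' t) _.
    (* Each weight is at most [2 ^ (2 * L)], and there are fewer than [2 ^ L] terms. *)
    apply: (@leq_ltn_trans (2 ^ (2 * L ^ 4) * 2 ^ (3 * L))); last first.
      by rewrite -expnD ltn_exp2l.
    apply: leq_mul => //; apply: (@leq_trans (\sum_(0 <= i < nterms J) 2 ^ (2 * L))).
      by apply: leq_sum => i _; rewrite RvE scaled_lt.
    rewrite sum_nat_const_nat subn0 -[3]/(1 + 2) mulnDl mul1n expnD leq_mul2r; apply/orP; right.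
    exact: leq_trans mL (ltnW L2).
  - by move=> g' t; have /andP[h1 h2] := p1 g' t; split; lia.
  - by move=> g' r t; have /andP[h1 h2] := r1 g' r t; split; lia.
exists W; set v := vw (table W); have lk : linked J v := view_linked W.
have signed (sg : bool) : goal R J sg -> signed_ok v sg.
  move=> /WP[[sup1 [sup2 sup3]] [/andP[Z0 Z1] X1 p1 r1] ok fin].
  have Ls : L * L < N by have [h _] := radix_sq L; rewrite mulnn.
  have gN g : g < nscheds J * nstates J -> g < N.
    move=> h; apply: leq_trans h _; apply: leq_trans (ltnW Ls); apply: leq_mul; last by lia.
    by apply: leq_trans (nscheds_le J) _; lia.
  have tN t : t < nstates J -> t < N by move=> h; lia.
  have tagE r : r < 10 -> (r + 4 + 10 * sg - 4) %/ 10 = sg /\ (r + 4 + 10 * sg - 4) %% 10 = r.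
    by move=> r10; case: (sg); lia.
  have rd (r i1 i2 i3 k : nat) : r < 7 -> k < N -> table W (r + 4 + 10 * sg) i1 i2 i3 k =
      [&& i1 < N, i2 < N & i3 < N] && let u := W sg in
      nth false [:: odd (wZ u %/ 2 ^ k); odd (wX u i1 i2 %/ 2 ^ k); k < wpol u i1 i2; k < wrk u i1 i2;
        wB u i1 i2 i3 k; k < wrf u i1 i2 i3; k < wrb u i1 i2 i3] r.
    move=> r7 kN; have [|e1 e2] := tagE r; first by lia.
    have t30 : r + 4 + 10 * sg < 30 by case: (sg); lia.
    rewrite /table kN t30 !andbT e1 e2 (_ : r + 4 + 10 * sg < 4 = false); last by lia.
    by case: (sg).
  have ZE : Zv v sg = wZ (W sg).
    by apply: table_big => // k kN; rewrite (rd 0) // N0.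
  have XE : Xv v sg = wX (W sg).
    apply: funext => g; apply: funext => t; apply: table_big => // k kN.
    rewrite (rd 1) //= N0 andbT; have [_ //|h] := boolP ((g < N) && (t < N)); rewrite /=.
    case: (eqVneq (wX (W sg) g t) 0) => [->|ne]; first by rewrite div0n.
    by have [|h1 h2] := sup1 g t; [rewrite ne !orbT|move: h; rewrite gN ?tN].
  have polE : cpol v sg = wpol (W sg).
    apply: funext => g; apply: funext => t; apply: table_row; first by have [] := p1 g t.
    move=> k kN; rewrite (rd 2) //= N0 andbT; have [_ //|h] := boolP ((g < N) && (t < N)); rewrite /=.
    case: (eqVneq (wpol (W sg) g t) 0) => [->|ne] //.
    by have [|h1 h2] := sup1 g t; [rewrite ne|move: h; rewrite gN ?tN].
  have rkE : crk v sg = wrk (W sg).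
    apply: funext => g; apply: funext => t; apply: table_row; first by have [] := p1 g t.
    move=> k kN; rewrite (rd 3) //= N0 andbT; have [_ //|h] := boolP ((g < N) && (t < N)); rewrite /=.
    case: (eqVneq (wrk (W sg) g t) 0) => [->|ne] //.
    by have [|h1 h2] := sup1 g t; [rewrite ne orbT|move: h; rewrite gN ?tN].
  have BE : cBm v sg = wB (W sg).
    apply: funext => g; apply: funext => r; apply: funext => t; apply: funext => b.
    have [kN|kN] := ltnP b N; last first.
      transitivity false; first by rewrite /cBm /= /table [b < N]ltnNge kN /= !andbF.
      by apply/esym/negP => /sup3[_ _ _ h]; lia.
    rewrite /cBm /= (rd 4) //=; have [_ //|h] := boolP [&& g < N, r < N & t < N]; rewrite /=; apply/esym/negP => /sup3[h1 h2 h3 _].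
    by move: h; rewrite gN ?tN.
  have rfE : crf v sg = wrf (W sg).
    apply: funext => g; apply: funext => r; apply: funext => t; apply: table_row; first by have [] := r1 g r t.
    move=> k kN; rewrite (rd 5) //=; have [_ //|h] := boolP [&& g < N, r < N & t < N]; rewrite /=.
    case: (eqVneq (wrf (W sg) g r t) 0) => [->|ne] //.
    by have [|h1 h2 h3] := sup2 g r t; [rewrite ne|move: h; rewrite gN ?tN].
  have rbE : crb v sg = wrb (W sg).
    apply: funext => g; apply: funext => r; apply: funext => t; apply: table_row; first by have [] := r1 g r t.
    move=> k kN; rewrite (rd 6) //=; have [_ //|h] := boolP [&& g < N, r < N & t < N]; rewrite /=.
    case: (eqVneq (wrb (W sg) g r t) 0) => [->|ne] //.
    by have [|h1 h2 h3] := sup2 g r t; [rewrite ne orbT|move: h; rewrite gN ?tN].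
  have Dvv : Dv v = Dv v0 by rewrite !DvE.
  have Rvv : Rv v = Rv v0 by apply: funext => o; rewrite !RvE.
  rewrite (signed_okE lk) ZE Z0 /= XE polE rkE BE rfE rbE Dvv.
  have -> : P1v v sg = P1v v0 sg by rewrite /P1v Rvv.
  have -> : P2v v sg = P2v v0 sg by rewrite /P2v Rvv.
  by rewrite Rvv; apply/andP.
apply/and4P; split; [exact: view_fmt|exact: view_rats|exact: view_tr|].
have s0 := signed false; have s1 := signed true; rewrite vcodeE.
move: H => /holds_goal; case: (_ == 2) => [[/s0 -> /s1 ->] //|].
by case: (_ == 3) => [[/s0 ->|/s1 ->]|/s0]; rewrite ?orbT.
Qed.

End Complete.

End Completeness.

Import Completeness.

(** * Membership in NP and the theorem *)

Local Open Scope nat_scope.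

Lemma nth_map_binary ns j : nth [::] [seq binary n | n <- ns] j = binary (nth 0 ns j).
Proof.
have [lt|ge] := ltnP j (size ns); first by rewrite (nth_map 0).
by rewrite !nth_default ?size_map.
Qed.

Lemma size_encode_ge ns : size ns <= size (encode binary ns).
Proof. by elim: ns => // n ns IH; rewrite /encode /= size_cat size_rcons -/(encode binary ns); lia. Qed.

(** Every number is below 2 to its bit length, and the separator leaves room for a 0, which counts
    as 1. *)
Lemma prod_encode ns : \prod_(n <- ns) maxn 1 n <= 2 ^ size (encode binary ns).
Proof.
elim: ns => [|n ns IH]; first by rewrite big_nil.
rewrite big_cons /encode /= size_cat expnD leq_mul // size_rcons size_map expnS.
have := binary_lt n; rewrite geq_max => h; apply/andP; split; last by lia.
by rewrite muln_gt0 expn_gt0.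
Qed.

Lemma size_binary_encode ns n : n \in ns -> size (binary n) <= size (encode binary ns).
Proof.
elim: ns => // k ns IH; rewrite inE /encode /= size_cat size_rcons size_map.
by case/orP => [/eqP ->|/IH]; rewrite -?/(encode binary ns); lia.
Qed.

Lemma nth_lt_encode ns j : nth 0 ns j < 2 ^ size (encode binary ns).
Proof.
have [lt|ge] := ltnP j (size ns); last by rewrite nth_default // expn_gt0.
apply: leq_trans (binary_lt _) _; rewrite leq_exp2l //.
by apply: size_binary_encode; rewrite mem_nth.
Qed.

Lemma faithful_view ns cap v : rad v = radix (size (encode binary ns)) ->
  (forall j, sm v j = minn cap (nth 0 ns j)) ->
  (forall j k, bt v j k = nth false (binary (nth 0 ns j)) k) -> faithful v (nth 0 ns) cap.
Proof.
move=> rE smE btE.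
have szN j : size (binary (nth 0 ns j)) <= rad v.
  have : size (encode binary ns) <= rad v by rewrite rE; have [_ h] := radix_sq (size (encode binary ns)); lia.
  apply: leq_trans; have [lt|ge] := ltnP j (size ns); last by rewrite nth_default.
  by apply: size_binary_encode; rewrite mem_nth.
split=> //.
- by rewrite rE /radix expn_gt0 addn_gt0 orbT.
- move=> j; rewrite -[RHS]bits_val_binary -(colval_nth (szN j)).
  by apply: eq_bigr => k _; rewrite /ebit btE.
- by move=> j k le; rewrite /ebit btE nth_default // (leq_trans (szN j)).
Qed.

Lemma poly_shift a d : exists c, forall n, (n + a) ^ d <= c * n ^ d + c.
Proof.
exists (a.+1 ^ d) => -[|n].
  by rewrite add0n; apply: leq_trans (leq_addl _ _); case: d => // d; rewrite leq_exp2r.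
apply: leq_trans (leq_addr _ _); rewrite -expnMn; case: d => // d; rewrite leq_exp2r //; nia.
Qed.

Section Membership.
Variable R : realType.
Notation word x y := ([seq inl a | a <- x] ++ [seq inr b | b <- y] : seq letter).

Lemma verify_sound x y : verify (word x y) ->
  exists2 J : relbuechi_instance, x = encode binary (relbuechi_entries J) & relbuechi_holds R J.
Proof.
case/andP=> ok co.
have [cs xE] : exists cs, x = chunk_word cs.
  apply: chunks_of; case/and3P: ok => _; rewrite inp_lenE is_sepE => h _.
  by rewrite -nth_last -odflt_onth (eqP h).
subst x; have := ok; rewrite parse_okE => /andP[c0 /allP can].
pose ns := [seq bits_val c | c <- cs].
have csE : cs = [seq binary n | n <- ns].
  rewrite /ns -map_comp -[LHS]map_id; apply/eq_in_map => c /can cc.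
  by rewrite /= binary_bits_val.
have xE : chunk_word cs = encode binary ns by rewrite encodeE -csE.
have valE j : nth 0 ns j = bits_val (nth [::] cs j).
  have [lt|ge] := ltnP j (size cs); first by rewrite (nth_map [::]).
  by rewrite !nth_default ?size_map.
have fw : faithful (wview (word (chunk_word cs) y)) (nth 0 ns) (size (word (chunk_word cs) y)).+1.
  apply: faithful_view; first by rewrite /= inp_lenE xE.
    by move=> j; rewrite [LHS]entry_valE valE.
  by move=> j k; rewrite [LHS]entry_bitE csE nth_map_binary.
have [|J [JE holds]] := core_sound R fw _ co.
  rewrite /= seps_total ltnS size_word xE; apply: leq_trans (leq_addr _ _).
  by rewrite -(size_map bits_val cs); exact: size_encode_ge.
exists J => //; rewrite xE JE /= seps_total; congr encode.
by rewrite -(size_map bits_val cs) -/ns; exact/esym/mkseq_nth.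
Qed.

Section Table.
Variables (N : nat) (T : nat -> nat -> nat -> nat -> nat -> bool).

Definition table_word : seq bool := mkseq (fun p =>
  T (p %/ N %/ N %/ N %/ N) (p %/ N %/ N %/ N %% N) (p %/ N %/ N %% N) (p %/ N %% N) (p %% N)) (N ^ 5).

Lemma nth_table_word tag i1 i2 i3 i4 : i1 < N -> i2 < N -> i3 < N -> i4 < N ->
  nth false table_word (table_pos N tag i1 i2 i3 i4) = (tag < N) && T tag i1 i2 i3 i4.
Proof.
move=> h1 h2 h3 h4; have N0 : 0 < N by exact: leq_ltn_trans h1.
have lt : (table_pos N tag i1 i2 i3 i4 < N ^ 5) = (tag < N).
  have S u K i : i < N -> (u * N + i < K * N) = (u < K).
    by move=> iN; rewrite -ltn_divLR // divnMDl // divn_small // addn0.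
  by rewrite /table_pos (_ : N ^ 5 = N * N * N * N * N) ?S // !expnS expn0 muln1 !mulnA.
have [tN|tN] := ltnP tag N; last by rewrite nth_default // size_mkseq leqNgt lt ltnNge tN.
rewrite nth_mkseq ?lt //= /table_pos.
have dv u i : i < N -> (u * N + i) %/ N = u by move=> iN; rewrite divnMDl // divn_small // addn0.
have md u i : i < N -> (u * N + i) %% N = i by move=> iN; rewrite modnMDl modn_small.
by rewrite !(dv _ i4) // !(dv _ i3) // !(dv _ i2) // !(dv _ i1) // !md.
Qed.

End Table.

Lemma verify_complete (J : relbuechi_instance) : relbuechi_holds R J ->
  let x := encode binary (relbuechi_entries J) in
  exists2 y, size y = radix (size x) ^ 5 & verify (word x y).
Proof.
move=> H x; set ns := relbuechi_entries J in x *; set L := size x; set N := radix L.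
(* The certificate has the fixed length [N ^ 5], so the cut-off, one more than the length of the
   whole word, is known before its content. *)
pose cap := (L + N ^ 5).+1.
pose sm0 j := minn cap (nth 0 ns j).
pose bt0 j k := nth false (binary (nth 0 ns j)) k.
have lenL : size ns <= L by exact: size_encode_ge.
have [|||||W co] := @core_complete R J sm0 bt0 L cap _ _ _ _ _ H.
- by move=> T; apply: faithful_view.
- by rewrite ltnS; apply: leq_trans (leq_addr _ _).
- exact: lenL.
- exact: nth_lt_encode.
- by rewrite /common_den -(big_nth 0 predT (maxn 1)); exact: prod_encode.
pose y := table_word N (table J L W).
have szy : size y = N ^ 5 by rewrite size_mkseq.
exists y => //.
have xE : x = chunk_word [seq binary n | n <- ns] by rewrite /x encodeE.
apply/andP; split.
  rewrite xE parse_okE size_map; apply/andP; split; first by rewrite layout_size addn3.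
  by apply/allP => c /mapP[n _ ->]; exact: canonical_binary.
suff -> : wview (word x y) = vw J sm0 bt0 L (table J L W) by [].
rewrite /wview /vw inp_lenE -/L; congr View.
- apply: funext => j; rewrite xE entry_valE nth_map_binary bits_val_binary -xE.
  by rewrite size_word szy.
- by apply: funext => j; apply: funext => k; rewrite xE entry_bitE nth_map_binary.
- apply: funext => tag; apply: funext => i1; apply: funext => i2; apply: funext => i3; apply: funext => i4.
  rewrite xE cert_bitE -xE -/L -/N; have [/and4P[h1 h2 h3 h4]|h] := boolP [&& _, _, _ & _].
    rewrite nth_table_word // /table h1 h2 h3 h4 /=.
    case: ltnP => //= h; suff -> : tag < 30 = false by [].
    by apply/negbTE; rewrite -leqNgt; apply: leq_trans h; have [_ h'] := radix_sq L; rewrite -/N in h'; lia.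
  by rewrite /table (negbTE h).
- by rewrite xE seps_total size_map.
Qed.

Theorem in_NP_RelBuechi : in_NP (language_of binary (RelBuechi R)).
Proof.
(* The table has five indices below [(L + 30) ^ 5], hence [(L + 30) ^ 25] cells. *)
have [c cP] := poly_shift 30 (5 * 5).
exists verify, c, (5 * 5); split.
  exists (fun w => [:: verify w]); first exact: poly_time_verify.
  by move=> w; split=> [->|[]].
move=> x; split=> [[J -> H]|[y _ /verify_sound[J xE H]]]; last by exists J.
have [y sy vy] := verify_complete H; exists y => //.
by rewrite sy /radix -expnM.
Qed.

End Membership.

Theorem theorem6p20 (R : realType) : strongly_NP_complete (RelBuechi R).
Proof. by split; [exact: in_NP_RelBuechi|exact: strongly_NP_hard_RelBuechi]. Qed.
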